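(* Let $s>5/2$. $K^s$ is a Kähler manifold. In fact, letting $g$ denote the metric $\langle \cdot, \cdot \rangle$ on $K^s$, the following hold: (a) $g$ is a smooth metric on $K^s$ and $\nabla$ is a smooth connection compatible with $g$. (b) $\omega$ is a symplectic form on $K^s$ compatible with $\nabla$, i.e. $\omega$ is a smooth nondegenerate closed two-form on $K^s$ such that $\nabla \omega = 0$. (c) $J$ is a complex structure on $K^s$ compatible with $\nabla$, i.e. $J$ is a smooth $(1,1)$-tensor on $K^s$ such that $J^2 = -I$ and $\nabla J = 0$. (d) The symplectic form $\omega$, the metric $g$, and the complex structure $J$ are compatible, i.e. $\omega(U, V) = g(JU, V).$ (e) The metric $g$ is almost Hermitian, i.e. $g(U, V) = g(JU, JV).$ (f) The Nijenhuis tensor $N^J$ defined for vector fields $X, Y$ by $$N^J(X,Y) = [X,Y] + J[JX, Y] + J[X, JY] - [JX, JY]$$ vanishes identically.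
   Context: $S^1=\mathbb{R}/\mathbb{Z}$ is the circle of length one and $S^1_{4\pi}=\mathbb{R}/4\pi\mathbb{Z}$. Subscript $x$ denotes the derivative in $x$. The manifold $K^s$ ($s>5/2$). $H_0^s(S^1;\mathbb{R}) = \{u\in H^s(S^1;\mathbb{R}) : u(0)=0\}$. $\mathrm{Diff}_0^s(S^1)$ is the space of orientation-preserving diffeomorphisms $\varphi$ of $S^1$ of Sobolev class $H^s$ with $\varphi(0)=0$, identified with the open subset $\{\mathrm{id}+h : h\in H^s(S^1;\mathbb{R}),\ h_x>-1,\ h(0)=0\}$ of $\mathrm{id}+H_0^s(S^1;\mathbb{R})$. $H^{s-1}(S^1;S^1_{4\pi})/S^1_{4\pi}$ is the set of $H^{s-1}$ maps $\alpha:S^1\to S^1_{4\pi}$ modulo addition of a constant phase, with classes $[\alpha]$; it is a Banach manifold modeled on the quotient Banach space $H^{s-1}(S^1;\mathbb{R})/\mathbb{R}$ (functions modulo constants). $K^s$ is the semidirect product of $\mathrm{Diff}_0^s(S^1)$ and $H^{s-1}(S^1;S^1_{4\pi})/S^1_{4\pi}$: the product Banach manifold with multiplication $(\varphi,[\alpha])(\psi,[\beta])=(\varphi\circ\psi,[\beta+\alpha\circ\psi])$ and identity $(\mathrm{id},[0])$. $T_{(\varphi,[\alpha])}K^s\simeq H_0^s(S^1;\mathbb{R})\times(H^{s-1}(S^1;\mathbb{R})/\mathbb{R})$. Metric. On the tangent space at $(\varphi,[\alpha])$ put $\pi(U_2)=U_2-\int_{S^1}U_2\varphi_x\,dx$ (so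 at the identity $\pi(\rho)=\rho-\int_{S^1}\rho\,dx$). The right-invariant metric on $K^s$ is $$\langle(U_1,[U_2]),(V_1,[V_2])\rangle_{(\varphi,[\alpha])}=\frac14\int_{S^1}\left(\frac{U_{1x}V_{1x}}{\varphi_x}+\pi(U_2)\pi(V_2)\varphi_x\right)dx.$$ It is a weak Riemannian metric: positive definite, but the induced topology on tangent spaces may be weaker than the given one. Similarly, nondegeneracy of $\omega$ is meant in the weak sense: $\omega(U,V)=0$ for all $V$ implies $U=0$. Connection. $\nabla_XY=DY\cdot X-\Gamma_{(\varphi,[\alpha])}(Y,X)$ (in the local charts, $DY\cdot X$ being the directional derivative), where, for $u=(u_1,[u_2])$, $v=(v_1,[v_2])\in T_{(\mathrm{id},[0])}K^s$, $$\Gamma_{(\mathrm{id},[0])}(u,v)=-\frac12\begin{pmatrix}A^{-1}\partial_x(u_{1x}v_{1x}+\pi(u_2)\pi(v_2))\\ [u_{1x}\pi(v_2)+v_{1x}\pi(u_2)]\end{pmatrix},\qquad \Gamma_{(\varphi,[\alpha])}(u\circ\varphi,v\circ\varphi)=\Gamma_{(\mathrm{id},[0])}(u,v)\circ\varphi,$$ with $A=-\partial_x^2$ and $(A^{-1}f)(x)=-\int_0^x\int_0^yf\,dz\,dy+x\int_{S^1}\int_0^yf\,dz\,dy$ when $\int_{S^1}f\,dx=0$. Compatibility of $\nabla$ with $g$ means $X\,g(Y,Z)=g(\nabla_XY,Z)+g(Y,\nabla_XZ)$ for all vector fields. Tensors. The $(1,1)$-tensor $J$ and the two-form $\omega$ are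 $$J_{(\varphi,[\alpha])}(U_1,[U_2])=\left(-\int_0^x\pi(U_2)\varphi_x\,dy,\ \left[\frac{U_{1x}}{\varphi_x}\right]\right),\qquad \omega_{(\varphi,[\alpha])}((U_1,[U_2]),(V_1,[V_2]))=\frac14\int_{S^1}(U_{2x}V_1-V_{2x}U_1)\,dx.$$ $[X,Y]$ is the Lie bracket of vector fields. *)

(* Defs.v *)
From Stdlib Require Export Reals List ZArith.
From Stdlib Require Import ClassicalEpsilon.
From Coquelicot Require Export Coquelicot.
Export ListNotations.
Open Scope R_scope.

(** * Normed spaces of representatives *)

(** A normed space given by representatives: the vectors are the elements of
    [nmem] taken modulo [neqv].  This form accommodates quotients such as
    "functions modulo constants" (so that Leibniz equality, as required by
    Coquelicot's [NormedModule], is not available), and lets maps be written on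
    the ambient type, membership of the values being part of what is stated. *)
Record nspace : Type := NSpace {
  ncar :> Type;
  nmem : ncar -> Prop;
  neqv : ncar -> ncar -> Prop;
  nzero : ncar;
  nadd : ncar -> ncar -> ncar;
  nscal : R -> ncar -> ncar;
  nnorm : ncar -> R }.

Arguments nmem {_} _.
Arguments neqv {_} _ _.
Arguments nzero {_}.
Arguments nadd {_} _ _.
Arguments nscal {_} _ _.
Arguments nnorm {_} _.

Definition nsub {E : nspace} (u v : E) : E := nadd u (nscal (-1) v).

Infix "==" := neqv (at level 70, no associativity).
Infix "[+]" := nadd (at level 50, left associativity).
Infix "[-]" := nsub (at level 50, left associativity).
Infix "[*]" := nscal (at level 40, left associativity).

Definition Rspace : nspace :=
  NSpace R (fun _ => True) (@eq R) 0 Rplus Rmult Rabs.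

(** * Manifolds with translation charts *)

(** A manifold modeled on [model] whose points are the elements of [pmem]
    modulo [peqv].  Around each point [p] the map [h |-> shift p h], restricted
    to the [h] with [shift p h] in the manifold, is a chart; all changes of
    charts are translations.  Hence every tangent space is canonically [model],
    and derivatives computed in the chart centered at the point under
    consideration are derivatives in any other of these charts. *)
Record tmanifold : Type := TManifold {
  model : nspace;
  point : Type;
  pmem : point -> Prop;
  peqv : point -> point -> Prop;
  shift : point -> model -> point }.

Arguments pmem {_} _.
Arguments peqv {_} _ _.
Arguments shift {_} _ _.

(** [D Y p h] is the directional derivative at [p] in the direction [h]. *)
Definition is_dderiv {M : tmanifold} {F : nspace}
    (Y : point M -> F) (p : point M) (h : model M) (d : F) : Prop :=
  nmem d /\
  forall eps, 0 < eps -> exists delta, 0 < delta /\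
    forall t, t <> 0 -> Rabs t < delta ->
      nnorm (/ t [*] (Y (shift p (t [*] h)) [-] Y p) [-] d) < eps.

Definition D {M : tmanifold} {F : nspace}
    (Y : point M -> F) (p : point M) (h : model M) : F :=
  epsilon (inhabits nzero) (is_dderiv Y p h).

(** ** Bounded multilinear maps and smooth tensor fields *)

(** A multilinear map of [k] arguments is applied to lists of length [k]. *)
Definition args {E : nspace} (k : nat) (l : list E) : Prop :=
  length l = k /\ List.Forall nmem l.

Definition norms {E : nspace} (l : list E) : R :=
  fold_right (fun u a => nnorm u * a) 1 l.

Definition bounded_multilinear {E F : nspace} (k : nat) (L : list E -> F)
    : Prop :=
  (forall l, args k l -> nmem (L l)) /\
  (forall l l', args k l -> args k l' -> List.Forall2 neqv l l' -> L l == L l') /\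
  (forall l1 l2 u v a, args k (l1 ++ u :: l2) -> nmem v ->
     L (l1 ++ (a [*] u [+] v) :: l2) ==
     a [*] L (l1 ++ u :: l2) [+] L (l1 ++ v :: l2)) /\
  (exists C, forall l, args k l -> nnorm (L l) <= C * norms l).

Definition tensor_field (M : tmanifold) (F : nspace) (k : nat)
    (T : point M -> list (model M) -> F) : Prop :=
  (forall p, pmem p -> bounded_multilinear k (T p)) /\
  (forall p q l, pmem p -> pmem q -> peqv p q -> args k l -> T p l == T q l).

(** Continuity and Frechet differentiability of maps into the space of bounded
    [k]-linear maps with the operator norm.  The derivative, a map into bounded
    [k+1]-linear maps, takes the direction of differentiation as its first
    argument. *)
Definition tensor_continuous (M : tmanifold) (F : nspace) (k : nat)
    (T : point M -> list (model M) -> F) : Prop :=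
  forall p, pmem p -> forall eps, 0 < eps -> exists delta, 0 < delta /\
    forall h, nmem h -> nnorm h < delta -> pmem (shift p h) ->
      forall l, args k l -> nnorm (T (shift p h) l [-] T p l) <= eps * norms l.

Definition is_tensor_derive (M : tmanifold) (F : nspace) (k : nat)
    (T T' : point M -> list (model M) -> F) : Prop :=
  forall p, pmem p -> forall eps, 0 < eps -> exists delta, 0 < delta /\
    forall h, nmem h -> nnorm h < delta -> pmem (shift p h) ->
      forall l, args k l ->
        nnorm (T (shift p h) l [-] T p l [-] T' p (h :: l))
        <= eps * nnorm h * norms l.

Fixpoint tensor_Cn (M : tmanifold) (F : nspace) (n k : nat)
    (T : point M -> list (model M) -> F) : Prop :=
  tensor_field M F k T /\ tensor_continuous M F k T /\
  match n with
  | O => True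
  | S m => exists T', is_tensor_derive M F k T T' /\ tensor_Cn M F m (S k) T'
  end.

Definition smooth_tensor (M : tmanifold) (F : nspace) (k : nat)
    (T : point M -> list (model M) -> F) : Prop :=
  forall n, tensor_Cn M F n k T.

Definition smooth0 (M : tmanifold) (F : nspace) (f : point M -> F) : Prop :=
  smooth_tensor M F 0 (fun p _ => f p).

Definition smooth1 (M : tmanifold) (F : nspace)
    (f : point M -> model M -> F) : Prop :=
  smooth_tensor M F 1 (fun p l => f p (nth 0 l nzero)).

Definition smooth2 (M : tmanifold) (F : nspace)
    (f : point M -> model M -> model M -> F) : Prop :=
  smooth_tensor M F 2 (fun p l => f p (nth 0 l nzero) (nth 1 l nzero)).

Definition smooth_function (M : tmanifold) (f : point M -> R) : Prop :=
  smooth0 M Rspace f.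

Definition vfield (M : tmanifold) (X : point M -> model M) : Prop :=
  smooth0 M (model M) X.

(** ** Vector fields, connections, metrics, forms, complex structures *)

(** [deriv X f] is the function usually written [X f]. *)
Definition deriv {M : tmanifold} (X : point M -> model M) (f : point M -> R)
    (p : point M) : R := @D M Rspace f p (X p).

Definition bracket {M : tmanifold} (X Y : point M -> model M) (p : point M)
    : model M := D Y p (X p) [-] D X p (Y p).

Definition covariant {M : tmanifold}
    (Gam : point M -> model M -> model M -> model M)
    (X Y : point M -> model M) (p : point M) : model M :=
  D Y p (X p) [-] Gam p (Y p) (X p).

Definition smooth_connection (M : tmanifold)
    (Gam : point M -> model M -> model M -> model M) : Prop :=
  let nabla := covariant Gam in
  smooth2 M (model M) Gam /\
  (forall X Y, vfield M X -> vfield M Y -> vfield M (nabla X Y)) /\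
  (forall f X X' Y, smooth_function M f ->
     vfield M X -> vfield M X' -> vfield M Y -> forall p, pmem p ->
     nabla (fun q => f q [*] X q [+] X' q) Y p ==
     f p [*] nabla X Y p [+] nabla X' Y p) /\
  (forall f X Y Y', smooth_function M f ->
     vfield M X -> vfield M Y -> vfield M Y' -> forall p, pmem p ->
     nabla X (fun q => f q [*] Y q [+] Y' q) p ==
     f p [*] nabla X Y p [+] deriv X f p [*] Y p [+] nabla X Y' p).

(** A weak Riemannian metric: positive definite, but not required to induce
    the topology of the model space. *)
Definition smooth_metric (M : tmanifold)
    (g : point M -> model M -> model M -> R) : Prop :=
  smooth2 M Rspace g /\
  (forall p u v, pmem p -> nmem u -> nmem v -> g p u v = g p v u) /\
  (forall p u, pmem p -> nmem u -> ~ u == nzero -> 0 < g p u u).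

(** [nabla B = 0] for a tensor field [B] of type (0,2); for a metric this is
    its compatibility with the connection. *)
Definition parallel2 (M : tmanifold)
    (Gam : point M -> model M -> model M -> model M)
    (B : point M -> model M -> model M -> R) : Prop :=
  forall X Y Z, vfield M X -> vfield M Y -> vfield M Z -> forall p, pmem p ->
    deriv X (fun q => B q (Y q) (Z q)) p =
    B p (covariant Gam X Y p) (Z p) + B p (Y p) (covariant Gam X Z p).

(** [nabla J = 0] for a tensor field [J] of type (1,1). *)
Definition parallel11 (M : tmanifold)
    (Gam : point M -> model M -> model M -> model M)
    (J : point M -> model M -> model M) : Prop :=
  forall X Y, vfield M X -> vfield M Y -> forall p, pmem p ->
    covariant Gam X (fun q => J q (Y q)) p == J p (covariant Gam X Y p).

Definition smooth_two_form (M : tmanifold)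
    (om : point M -> model M -> model M -> R) : Prop :=
  smooth2 M Rspace om /\
  (forall p u v, pmem p -> nmem u -> nmem v -> om p u v = - om p v u).

Definition weakly_nondegenerate (M : tmanifold)
    (om : point M -> model M -> model M -> R) : Prop :=
  forall p u, pmem p -> nmem u ->
    (forall v, nmem v -> om p u v = 0) -> u == nzero.

Definition closed_two_form (M : tmanifold)
    (om : point M -> model M -> model M -> R) : Prop :=
  forall X Y Z, vfield M X -> vfield M Y -> vfield M Z -> forall p, pmem p ->
    deriv X (fun q => om q (Y q) (Z q)) p
    + deriv Y (fun q => om q (Z q) (X q)) p
    + deriv Z (fun q => om q (X q) (Y q)) p
    - om p (bracket X Y p) (Z p)
    - om p (bracket Y Z p) (X p)
    - om p (bracket Z X p) (Y p) = 0.

Definition symplectic_form (M : tmanifold)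
    (om : point M -> model M -> model M -> R) : Prop :=
  smooth_two_form M om /\ weakly_nondegenerate M om /\ closed_two_form M om.

Definition complex_structure (M : tmanifold)
    (J : point M -> model M -> model M) : Prop :=
  smooth1 M (model M) J /\
  (forall p u, pmem p -> nmem u -> J p (J p u) == (-1) [*] u).

Definition nijenhuis {M : tmanifold} (J : point M -> model M -> model M)
    (X Y : point M -> model M) (p : point M) : model M :=
  let JX := fun q => J q (X q) in
  let JY := fun q => J q (Y q) in
  bracket X Y p [+] J p (bracket JX Y p) [+] J p (bracket X JY p)
  [-] bracket JX JY p.

Definition integrable (M : tmanifold) (J : point M -> model M -> model M)
    : Prop :=
  forall X Y, vfield M X -> vfield M Y -> forall p, pmem p ->
    nijenhuis J X Y p == nzero.

Definition form_compatible (M : tmanifold)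
    (om g : point M -> model M -> model M -> R)
    (J : point M -> model M -> model M) : Prop :=
  forall p u v, pmem p -> nmem u -> nmem v -> om p u v = g p (J p u) v.

Definition almost_hermitian (M : tmanifold)
    (g : point M -> model M -> model M -> R)
    (J : point M -> model M -> model M) : Prop :=
  forall p u v, pmem p -> nmem u -> nmem v -> g p u v = g p (J p u) (J p v).

Definition kahler_manifold (M : tmanifold)
    (g om : point M -> model M -> model M -> R)
    (J : point M -> model M -> model M) : Prop :=
  smooth_metric M g /\ complex_structure M J /\ integrable M J /\
  almost_hermitian M g J /\ symplectic_form M om /\ form_compatible M om g J.

(** * Sobolev spaces on the circle of length one *)

(** Functions on the circle are 1-periodic functions on [R]. *)
Definition fourier (f : R -> R) (k : Z) : C :=
  (RInt (fun x => f x * cos (2 * PI * IZR k * x)) 0 1,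
   - RInt (fun x => f x * sin (2 * PI * IZR k * x)) 0 1).

Definition sob_weight (r : R) (f : R -> R) (k : Z) : R :=
  Rpower (1 + IZR k ^ 2) r * Cmod (fourier f k) ^ 2.

(** The sum over all integers, [n] and [-n-1] being grouped together. *)
Definition sob_term (r : R) (f : R -> R) (n : nat) : R :=
  sob_weight r f (Z.of_nat n) + sob_weight r f (- Z.of_nat (S n)).

(** [Hs r] is used for [r > 1/2] only, where every class of H^r has a unique
    continuous representative. *)
Definition Hs (r : R) (f : R -> R) : Prop :=
  (forall x, continuous f x) /\ (forall x, f (x + 1) = f x) /\
  ex_series (sob_term r f).

Definition Hs_norm (r : R) (f : R -> R) : R := sqrt (Series (sob_term r f)).

(** The norm of H^r modulo constants: the infimum over the class. *)
Definition Hs_quot_norm (r : R) (f : R -> R) : R :=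
  real (Glb_Rbar (fun y => exists c, y = Hs_norm r (fun x => f x - c))).

(** H_0^s x (H^(s-1) / R). *)
Definition Kmodel (s : R) : nspace :=
  NSpace ((R -> R) * (R -> R))
    (fun u => Hs s (fst u) /\ fst u 0 = 0 /\ Hs (s - 1) (snd u))
    (fun u v => (forall x, fst u x = fst v x) /\
                exists c, forall x, snd u x = snd v x + c)
    (fun _ => 0, fun _ => 0)
    (fun u v => (fun x => fst u x + fst v x, fun x => snd u x + snd v x))
    (fun a u => (fun x => a * fst u x, fun x => a * snd u x))
    (fun u => Hs_norm s (fst u) + Hs_quot_norm (s - 1) (snd u)).

(** * The manifold K^s *)

(** A point is a pair (phi, a) where phi = id + h, and a : R -> R is a lift of
    a map from the circle to R / 4 pi Z; the integer [n] below is the degree of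
    that map.  Two lifts are identified when the maps they induce differ by a
    constant phase of R / 4 pi Z. *)
Definition K (s : R) : tmanifold :=
  TManifold (Kmodel s) ((R -> R) * (R -> R))
    (fun p =>
       Hs s (fun x => fst p x - x) /\
       (forall x, -1 < Derive (fun y => fst p y - y) x) /\
       fst p 0 = 0 /\
       exists n : Z, Hs (s - 1) (fun x => snd p x - 4 * PI * IZR n * x))
    (fun p q =>
       (forall x, fst p x = fst q x) /\
       exists c, forall x, exists k : Z,
         snd p x = snd q x + c + 4 * PI * IZR k)
    (fun p u => (fun x => fst p x + fst u x, fun x => snd p x + snd u x)).

Definition piphi (phi u2 : R -> R) (x : R) : R :=
  u2 x - RInt (fun y => u2 y * Derive phi y) 0 1.

Definition K_metric (s : R) (p : point (K s)) (U V : model (K s)) : R :=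
  let phi := fst p in
  / 4 * RInt (fun x =>
    Derive (fst U) x * Derive (fst V) x / Derive phi x
    + piphi phi (snd U) x * piphi phi (snd V) x * Derive phi x) 0 1.

(** The inverse of A = - d^2/dx^2 on functions of mean zero. *)
Definition Ainv (f : R -> R) (x : R) : R :=
  - RInt (fun y => RInt f 0 y) 0 x + x * RInt (fun y => RInt f 0 y) 0 1.

Definition K_Gamma_id (s : R) (u v : model (K s)) : model (K s) :=
  let pi_id := piphi (fun x => x) in
  (fun x => - / 2 * Ainv (Derive (fun y =>
     Derive (fst u) y * Derive (fst v) y
     + pi_id (snd u) y * pi_id (snd v) y)) x,
   fun x => - / 2 * (Derive (fst u) x * pi_id (snd v) x
                     + Derive (fst v) x * pi_id (snd u) x)).

Definition inverse (phi : R -> R) (y : R) : R :=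
  epsilon (inhabits 0) (fun x => phi x = y).

Definition right_comp (u : (R -> R) * (R -> R)) (phi : R -> R)
    : (R -> R) * (R -> R) :=
  (fun x => fst u (phi x), fun x => snd u (phi x)).

(** Gamma at the identity, transported by right translation. *)
Definition K_Gamma (s : R) (p : point (K s)) (U V : model (K s))
    : model (K s) :=
  let phi := fst p in
  right_comp (K_Gamma_id s (right_comp U (inverse phi))
                           (right_comp V (inverse phi))) phi.

Definition K_J (s : R) (p : point (K s)) (U : model (K s)) : model (K s) :=
  let phi := fst p in
  (fun x => - RInt (fun y => piphi phi (snd U) y * Derive phi y) 0 x,
   fun x => Derive (fst U) x / Derive phi x).

Definition K_omega (s : R) (p : point (K s)) (U V : model (K s)) : R :=
  / 4 * RInt (fun x =>
    Derive (snd U) x * fst V x - Derive (snd V) x * fst U x) 0 1.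

(* Main.v *)
(* Write a tangent vector [(U_1, [U_2])] at [(phi, [alpha])] in the coordinates
   [a = U_1x] (of mean zero) and [b = pi (U_2)] ([b phi_x] of mean zero).  Then
   [J (a, b) = (- b phi_x, a / phi_x)], the metric is the weighted L^2 product, and
   the substitution [y = phi x] removes the composition with the inverse of [phi]
   from the connection, whose components become [(G - phi_x int G) / 2], with
   [G = a a' / phi_x + b b' phi_x], and [- (a b' + a' b) / (2 phi_x)] up to a constant.
   So every tensor is a polynomial in [phi_x], [1 / phi_x], the coordinates and
   their integrals.  It is smooth, because H^(s-1) is an algebra closed under
   reciprocals of positive functions; [nabla g = 0] and
   [(D_X J) Y = Gamma (J Y, X) - J Gamma (Y, X)] are checked pointwise.  The rest is
   formal: [omega = g (J ., .)] is parallel because [g] and [J] are, and since [nabla]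
   is torsion free this gives [d omega = 0] and [N^J = 0]. *)

Require Import Defs.
From Stdlib Require Import Lia Lra Psatz FunctionalExtensionality ClassicalEpsilon Permutation.
From Stdlib Require FinFun.

(** * Finite sums and sums over the integers *)

(** The Sobolev exponent is real and the norms are sums over Fourier coefficients, so embedding,
    algebra property, reciprocals and primitives are all derived from the coefficients of continuous
    functions. Uniqueness of coefficients, uniform convergence of absolutely summable series and
    Bessel's inequality suffice. The bound [5/2 < s] enters twice: [s - 1 > 3/2] for reciprocals,
    and [s - 2 > 1/2] to have a continuous derivative of the second component.

    The obstacle to smoothness is composition: on [H^s] the map sending [(u, phi)] to [u] composed
    with [phi] is only continuous. The connection escapes because every composition cancels after
    the substitution. Derivatives of all orders are then taken formally, on a syntax of expressions
    closed under differentiation, and one quadratic remainder estimate serves every order.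

    Vectors are representatives modulo [==] and [D] is a choice among limits, so calculus is done
    with tensor fields in operator norm and transferred to [D] by uniqueness of limits. *)

Definition lsum {A : Type} (f : A -> R) (l : list A) : R :=
  fold_right (fun a acc => f a + acc) 0 l.

Lemma lsum_cons {A} (f : A -> R) a l : lsum f (a :: l) = f a + lsum f l.
Proof. reflexivity. Qed.

Lemma lsum_app {A} (f : A -> R) l l' : lsum f (l ++ l') = lsum f l + lsum f l'.
Proof.
  induction l as [|a l IH]; simpl; [ring|rewrite IH; ring].
Qed.

Lemma lsum_ext {A} (f g : A -> R) l :
  (forall a, In a l -> f a = g a) -> lsum f l = lsum g l.
Proof.
  induction l as [|a l IH]; intros H; simpl; [reflexivity|].
  rewrite IH by (intros; apply H; now right). rewrite H by now left. reflexivity.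
Qed.

Lemma lsum_plus {A} (f g : A -> R) l :
  lsum (fun a => f a + g a) l = lsum f l + lsum g l.
Proof. induction l as [|a l IH]; simpl; [ring|rewrite IH; ring]. Qed.

Lemma lsum_scal {A} c (f : A -> R) l :
  lsum (fun a => c * f a) l = c * lsum f l.
Proof. induction l as [|a l IH]; simpl; [ring|rewrite IH; ring]. Qed.

Lemma lsum_le {A} (f g : A -> R) l :
  (forall a, In a l -> f a <= g a) -> lsum f l <= lsum g l.
Proof.
  induction l as [|a l IH]; intros H; simpl; [lra|].
  apply Rplus_le_compat; [apply H; now left|apply IH; intros; apply H; now right].
Qed.

Lemma lsum_ge0 {A} (f : A -> R) l : (forall a, 0 <= f a) -> 0 <= lsum f l.
Proof.
  intros H; induction l as [|a l IH]; simpl; [lra|]. specialize (H a); lra.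
Qed.

Lemma lsum_abs {A} (f : A -> R) l : Rabs (lsum f l) <= lsum (fun a => Rabs (f a)) l.
Proof.
  induction l as [|a l IH]; simpl; [rewrite Rabs_R0; lra|].
  eapply Rle_trans; [apply Rabs_triang|lra].
Qed.

Lemma lsum_map {A B} (f : B -> R) (h : A -> B) l :
  lsum f (map h l) = lsum (fun a => f (h a)) l.
Proof. induction l as [|a l IH]; simpl; [reflexivity|now rewrite IH]. Qed.

Lemma lsum_perm {A} (f : A -> R) l l' : Permutation l l' -> lsum f l = lsum f l'.
Proof. induction 1; simpl in *; lra. Qed.

Lemma lsum_incl {A} (f : A -> R) l l' :
  (forall a, 0 <= f a) -> NoDup l -> incl l l' -> lsum f l <= lsum f l'.
Proof.
  intros Hf Hl; revert l'; induction Hl as [|a l Ha Hl IH]; intros l' Hi.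
  - now apply lsum_ge0.
  - destruct (in_split a l') as (l1 & l2 & ->); [apply Hi; now left|].
    rewrite (lsum_perm f (l1 ++ a :: l2) (a :: l1 ++ l2))
      by (symmetry; apply Permutation_middle).
    simpl. apply Rplus_le_compat_l, IH.
    intros b Hb. assert (Hb' := Hi b (or_intror Hb)).
    apply in_app_or in Hb'. apply in_or_app.
    destruct Hb' as [|[->|]]; [now left|contradiction|now right].
Qed.

Lemma lsum_exchange {A B} (f : A -> B -> R) l l' :
  lsum (fun a => lsum (f a) l') l = lsum (fun b => lsum (fun a => f a b) l) l'.
Proof.
  induction l as [|a l IH]; simpl.
  - induction l' as [|b l' IH']; simpl; [reflexivity|rewrite <- IH'; ring].
  - rewrite IH, <- lsum_plus. reflexivity.
Qed.

Lemma discriminant_le a b c :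
  0 <= a -> 0 <= c -> (forall t, 0 <= a * t ^ 2 - 2 * b * t + c) -> b ^ 2 <= a * c.
Proof.
  intros Ha Hc H. destruct (Req_dec a 0) as [->|Ha0].
  - destruct (Req_dec b 0) as [->|Hb]; [lra|].
    (* For [a = 0] the quadratic is affine in [t], and this value of [t] makes it equal to -1. *)
    specialize (H ((c + 1) / (2 * b))).
    replace (0 * ((c + 1) / (2 * b)) ^ 2 - 2 * b * ((c + 1) / (2 * b)) + c) with (-1) in H
      by (field; auto). lra.
  - specialize (H (b / a)).
    replace (a * (b / a) ^ 2 - 2 * b * (b / a) + c) with ((a * c - b ^ 2) / a) in H
      by (field; auto).
    assert (0 < a) by lra.
    apply Rmult_le_compat_r with (r := a) in H; [|lra].
    unfold Rdiv in H. rewrite Rmult_assoc, Rinv_l in H by auto. lra.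
Qed.

Lemma lsum_cauchy_schwarz {A} (f g : A -> R) l :
  lsum (fun a => f a * g a) l ^ 2 <= lsum (fun a => f a ^ 2) l * lsum (fun a => g a ^ 2) l.
Proof.
  apply discriminant_le; try (apply lsum_ge0; intros; nra).
  intros t.
  replace (_ + _) with (lsum (fun a => (t * f a - g a) ^ 2) l).
  - apply lsum_ge0; intros; apply pow2_ge_0.
  - induction l as [|a l IH]; simpl; [ring|simpl in IH; rewrite IH; ring].
Qed.

(** Summability of a nonnegative family in a form free of any ordering of the integers. It survives
    injective reindexing, which the convolution estimates need. *)
Definition zbound (a : Z -> R) (B : R) : Prop :=
  forall l, NoDup l -> lsum a l <= B.

Lemma zbound_le a a' B : (forall k, a' k <= a k) -> zbound a B -> zbound a' B.
Proof.
  intros H Ha l Hl. eapply Rle_trans; [|apply Ha, Hl]. apply lsum_le; auto.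
Qed.

Lemma zbound_mono a B B' : B <= B' -> zbound a B -> zbound a B'.
Proof. intros H Ha l Hl. specialize (Ha l Hl). lra. Qed.

Lemma zbound_plus a a' B B' :
  zbound a B -> zbound a' B' -> zbound (fun k => a k + a' k) (B + B').
Proof. intros H H' l Hl. rewrite lsum_plus. specialize (H l Hl). specialize (H' l Hl). lra. Qed.

Lemma zbound_scal c a B : 0 <= c -> zbound a B -> zbound (fun k => c * a k) (c * B).
Proof. intros Hc H l Hl. rewrite lsum_scal. apply Rmult_le_compat_l; auto. Qed.

Lemma zbound_ge0 a B : zbound a B -> 0 <= B.
Proof. intros H. apply (H []). constructor. Qed.

Lemma zbound_term a B k : zbound a B -> a k <= B.
Proof.
  intros H. specialize (H [k]). simpl in H. rewrite Rplus_0_r in H. apply H.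
  constructor; [easy|constructor].
Qed.

(** The window from [-n] to [n - 1], built in the order in which [sob_term] groups [n] with [-n-1].
    It is not symmetric: for positive [n] it contains [-n] but not [n]. *)
Fixpoint zrange (n : nat) : list Z :=
  match n with
  | O => []
  | S m => Z.of_nat m :: (- Z.of_nat (S m))%Z :: zrange m
  end.

Lemma in_zrange n k : In k (zrange n) <-> (- Z.of_nat n <= k < Z.of_nat n)%Z.
Proof.
  induction n as [|n IH]; [simpl; lia|].
  change (zrange (S n)) with (Z.of_nat n :: (- Z.of_nat (S n))%Z :: zrange n).
  simpl In. rewrite IH. lia.
Qed.

Lemma zrange_NoDup n : NoDup (zrange n).
Proof.
  induction n as [|n IH]; [constructor|].
  change (zrange (S n)) with (Z.of_nat n :: (- Z.of_nat (S n))%Z :: zrange n).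
  constructor; [|constructor; [|exact IH]].
  - intros [H|H]; [lia|]. apply in_zrange in H. lia.
  - intros H. apply in_zrange in H. lia.
Qed.

Lemma zrange_exhausts (l : list Z) : exists n, incl l (zrange n).
Proof.
  induction l as [|k l (n & IH)]; [exists O; easy|].
  exists (Nat.max n (S (Z.to_nat (Z.abs k)))).
  intros j [<-|Hj]; apply in_zrange; [lia|]. apply IH, in_zrange in Hj. lia.
Qed.

Definition zpair (a : Z -> R) (n : nat) : R := a (Z.of_nat n) + a (- Z.of_nat (S n))%Z.

Lemma lsum_zrange a n : lsum a (zrange (S n)) = sum_n (zpair a) n.
Proof.
  induction n as [|n IH].
  - rewrite sum_O. unfold zpair; simpl. ring.
  - rewrite sum_Sn, <- IH. unfold plus, zpair; simpl. ring.
Qed.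

Lemma zpair_ge0 a n : (forall k, 0 <= a k) -> 0 <= zpair a n.
Proof. intros H. unfold zpair. apply Rplus_le_le_0_compat; apply H. Qed.

Lemma sum_n_le_Series (b : nat -> R) n :
  (forall n, 0 <= b n) -> ex_series b -> sum_n b n <= Series b.
Proof.
  intros Hb Hs. apply Series_correct in Hs.
  apply (is_lim_seq_incr_compare (sum_n b)); [exact Hs|].
  intros m. rewrite sum_Sn. unfold plus; simpl. specialize (Hb (S m)). lra.
Qed.

Lemma zbound_of_series a :
  (forall k, 0 <= a k) -> ex_series (zpair a) -> zbound a (Series (zpair a)).
Proof.
  intros Ha Hs l Hl. destruct (zrange_exhausts l) as (n & Hn).
  apply Rle_trans with (lsum a (zrange (S n))).
  - apply lsum_incl; auto. intros k Hk. apply Hn, in_zrange in Hk. apply in_zrange. lia.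
  - rewrite lsum_zrange. apply sum_n_le_Series; auto. intros; now apply zpair_ge0.
Qed.

Lemma series_of_zbound a B :
  (forall k, 0 <= a k) -> zbound a B -> ex_series (zpair a) /\ Series (zpair a) <= B.
Proof.
  intros Ha HB.
  assert (Hn : forall n, sum_n (zpair a) n <= B).
  { intros n. rewrite <- lsum_zrange. apply HB, zrange_NoDup. }
  destruct (ex_finite_lim_seq_incr (sum_n (zpair a)) B) as (l & Hl); auto.
  { intros n. rewrite sum_Sn. unfold plus; simpl.
    assert (H := zpair_ge0 a (S n) Ha). lra. }
  split; [now exists l|].
  rewrite (is_series_unique _ l Hl).
  apply (is_lim_seq_le (sum_n (zpair a)) (fun _ => B) l B); auto.
  apply is_lim_seq_const.
Qed.

(** The sum over a large window is within [eps] of the total, and the window followed by [l] is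
    still a list without repetition, so [l] adds at most [eps]. This serves as the Cauchy
    criterion. *)
Lemma zbound_tail a B :
  (forall k, 0 <= a k) -> zbound a B -> forall eps, 0 < eps ->
  exists n0, forall n, (n0 <= n)%nat ->
  forall l, NoDup l -> (forall k, In k l -> ~ In k (zrange n)) -> lsum a l <= eps.
Proof.
  intros Ha HB eps He.
  destruct (series_of_zbound a B Ha HB) as (Hs & _).
  assert (Hb := zbound_of_series a Ha Hs).
  assert (Hl := Series_correct _ Hs).
  change (is_lim_seq (sum_n (zpair a)) (Series (zpair a))) in Hl. apply is_lim_seq_spec in Hl.
  destruct (Hl (mkposreal eps He)) as (n0 & Hn0). simpl in Hn0.
  exists (S n0). intros n Hn l Hd Hdis.
  specialize (Hn0 n0 (Nat.le_refl _)). rewrite <- lsum_zrange in Hn0.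
  assert (H1 : lsum a (zrange (S n0)) <= lsum a (zrange n)).
  { apply lsum_incl; auto; [apply zrange_NoDup|]. intros k Hk.
    apply in_zrange in Hk. apply in_zrange. lia. }
  assert (H2 : lsum a (zrange n ++ l) <= Series (zpair a)).
  { apply Hb. apply NoDup_app; auto; [apply zrange_NoDup|].
    intros k Hk Hk'. exact (Hdis k Hk' Hk). }
  rewrite lsum_app in H2. apply Rabs_def2 in Hn0. lra.
Qed.

(** * Continuous functions and their integrals over a period *)

Definition cont (f : R -> R) : Prop := forall x, continuous f x.

Lemma cont_const c : cont (fun _ => c).
Proof. intros x. apply continuous_const. Qed.

Lemma cont_id : cont (fun x => x).
Proof. intros x. apply continuous_id. Qed.

Lemma cont_plus f g : cont f -> cont g -> cont (fun x => f x + g x).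
Proof. intros Hf Hg x. exact (continuous_plus f g x (Hf x) (Hg x)). Qed.

Lemma cont_opp f : cont f -> cont (fun x => - f x).
Proof. intros Hf x. exact (continuous_opp f x (Hf x)). Qed.

Lemma cont_minus f g : cont f -> cont g -> cont (fun x => f x - g x).
Proof. intros Hf Hg x. exact (continuous_minus f g x (Hf x) (Hg x)). Qed.

Lemma cont_mult f g : cont f -> cont g -> cont (fun x => f x * g x).
Proof. intros Hf Hg x. exact (continuous_mult f g x (Hf x) (Hg x)). Qed.

Lemma cont_comp f g : cont f -> cont g -> cont (fun x => f (g x)).
Proof. intros Hf Hg x. apply (continuous_comp g f x); auto. Qed.

Lemma cont_pow f n : cont f -> cont (fun x => f x ^ n).
Proof.
  intros Hf. induction n as [|n IH]; simpl; [apply cont_const|now apply cont_mult].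
Qed.

Lemma cont_derivable f : (forall x, ex_derive f x) -> cont f.
Proof. intros H x. now apply (ex_derive_continuous f). Qed.

Lemma cont_Rabs f : cont f -> cont (fun x => Rabs (f x)).
Proof. intros Hf. apply (cont_comp Rabs f); auto. intros x. apply continuous_Rabs. Qed.

Lemma cont_inv f : cont f -> (forall x, f x <> 0) -> cont (fun x => / f x).
Proof.
  intros Hf H x. apply (continuous_comp f Rinv); auto.
  apply (ex_derive_continuous Rinv). auto_derive. auto.
Qed.

Lemma cont_lsum {A} (f : A -> R -> R) l :
  (forall a, cont (f a)) -> cont (fun x => lsum (fun a => f a x) l).
Proof.
  intros H. induction l as [|a l IH]; simpl; [apply cont_const|now apply cont_plus].
Qed.

(** * The trigonometric system *)

Definition cs (k : Z) (x : R) : R := cos (2 * PI * IZR k * x).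
Definition sn (k : Z) (x : R) : R := sin (2 * PI * IZR k * x).

Lemma cont_cs k : cont (cs k).
Proof. unfold cs. apply cont_derivable. intros x. auto_derive; auto. Qed.

Lemma cont_sn k : cont (sn k).
Proof. unfold sn. apply cont_derivable. intros x. auto_derive; auto. Qed.

Ltac rring :=
  apply Rminus_diag_uniq; ring.

Ltac cont_step :=
  lazymatch goal with
  | |- cont (fun _ => ?c) => apply (cont_const c)
  | |- cont (fun x => x) => apply cont_id
  | |- cont (fun x => @?f x + @?g x) => apply (cont_plus f g)
  | |- cont (fun x => @?f x - @?g x) => apply (cont_minus f g)
  | |- cont (fun x => - @?f x) => apply (cont_opp f)
  | |- cont (fun x => @?f x * @?g x) => apply (cont_mult f g)
  | |- cont (fun x => @?f x ^ ?n) => apply (cont_pow f n)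
  | |- cont (fun x => lsum (fun i => @?f i x) ?l) =>
      apply cont_lsum; intros
  | |- cont (cs ?k) => apply (cont_cs k)
  | |- cont (sn ?k) => apply (cont_sn k)
  | |- cont (fun x => cs ?k x) => apply (cont_cs k)
  | |- cont (fun x => sn ?k x) => apply (cont_sn k)
  | |- cont _ => assumption
  end.

Ltac cont := repeat cont_step.

Lemma cont_ex_RInt f a b : cont f -> ex_RInt f a b.
Proof. intros H. apply (ex_RInt_continuous f). intros; apply H. Qed.

#[local] Hint Resolve cont_ex_RInt : core.

Lemma RInt_plus_cont f g a b : cont f -> cont g ->
  RInt (fun x => f x + g x) a b = RInt f a b + RInt g a b.
Proof. intros Hf Hg. apply (RInt_plus f g a b); auto. Qed.

Lemma RInt_minus_cont f g a b : cont f -> cont g ->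
  RInt (fun x => f x - g x) a b = RInt f a b - RInt g a b.
Proof. intros Hf Hg. apply (RInt_minus f g a b); auto. Qed.

Lemma RInt_scal_cont f c a b : cont f ->
  RInt (fun x => c * f x) a b = c * RInt f a b.
Proof. intros Hf. apply (RInt_scal f a b c); auto. Qed.

Lemma RInt_const_R c a b : RInt (fun _ => c) a b = (b - a) * c.
Proof. apply (RInt_const (V := R_CompleteNormedModule)). Qed.

Lemma RInt_ext_all (f g : R -> R) a b : (forall x, f x = g x) -> RInt f a b = RInt g a b.
Proof. intros H. apply RInt_ext. intros; apply H. Qed.

Lemma RInt_Chasles_cont f a b c : cont f -> RInt f a b + RInt f b c = RInt f a c.
Proof. intros Hf. apply (RInt_Chasles f a b c); auto. Qed.

Lemma RInt_lsum_cont {A} (f : A -> R -> R) l a b : (forall i, cont (f i)) ->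
  RInt (fun x => lsum (fun i => f i x) l) a b = lsum (fun i => RInt (f i) a b) l.
Proof.
  intros H. induction l as [|i l IH]; simpl.
  - rewrite RInt_const_R. ring.
  - rewrite <- IH. apply RInt_plus_cont; auto. now apply cont_lsum.
Qed.

Lemma RInt_le_cont f g a b : a <= b -> cont f -> cont g ->
  (forall x, a <= x <= b -> f x <= g x) -> RInt f a b <= RInt g a b.
Proof. intros Hab Hf Hg H. apply RInt_le; auto. intros; apply H; lra. Qed.

Lemma RInt_abs_le f M : cont f -> (forall x, 0 <= x <= 1 -> Rabs (f x) <= M) ->
  Rabs (RInt f 0 1) <= M.
Proof.
  intros Hf H. replace M with ((1 - 0) * M) by ring.
  apply abs_RInt_le_const; auto. lra.
Qed.

Lemma RInt_ge_sub f a b m : cont f -> 0 <= a <= b -> b <= 1 ->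
  (forall x, 0 <= x <= 1 -> 0 <= f x) -> (forall x, a <= x <= b -> m <= f x) ->
  m * (b - a) <= RInt f 0 1.
Proof.
  intros Hf Ha Hb H0 Hm.
  rewrite <- (RInt_Chasles_cont f 0 a 1), <- (RInt_Chasles_cont f a b 1) by auto.
  assert (0 <= RInt f 0 a).
  { apply RInt_ge_0; auto; [lra|]. intros; apply H0; lra. }
  assert (0 <= RInt f b 1).
  { apply RInt_ge_0; auto. intros; apply H0; lra. }
  assert (RInt (fun _ => m) a b <= RInt f a b).
  { apply RInt_le_cont; auto; [lra|]. cont. }
  rewrite RInt_const_R in *. lra.
Qed.

Lemma cont_bounded f a b : a <= b -> cont f -> exists M, forall x, a <= x <= b -> Rabs (f x) <= M.
Proof.
  intros Hab Hf.
  destruct (continuity_ab_maj (fun x => Rabs (f x)) a b Hab) as (Mx & HM & _).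
  { intros c _. apply continuity_pt_filterlim. apply (cont_Rabs f Hf). }
  exists (Rabs (f Mx)). auto.
Qed.

Lemma is_derive_primitive f a x : cont f -> is_derive (fun y => RInt f a y) x (f x).
Proof.
  intros Hf. apply (is_derive_RInt f (fun y => RInt f a y) a x); auto.
  apply filter_forall. intros y.
  apply (RInt_correct (V := R_CompleteNormedModule) f a y); auto.
Qed.

Lemma RInt_derive_cont F f a b : (forall x, is_derive F x (f x)) -> cont f ->
  RInt f a b = F b - F a.
Proof.
  intros H Hf. apply is_RInt_unique. apply (is_RInt_derive F f); auto.
Qed.

Lemma RInt_by_parts u v u' v' a b :
  (forall x, is_derive u x (u' x)) -> (forall x, is_derive v x (v' x)) ->
  cont u' -> cont v' ->
  RInt (fun x => u' x * v x) a b = u b * v b - u a * v a - RInt (fun x => u x * v' x) a b.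
Proof.
  intros Hu Hv Cu Cv.
  assert (cu : cont u) by (apply cont_derivable; intros x; now exists (u' x)).
  assert (cv : cont v) by (apply cont_derivable; intros x; now exists (v' x)).
  assert (H := RInt_derive_cont (fun x => u x * v x) (fun x => u' x * v x + u x * v' x) a b).
  rewrite RInt_plus_cont in H by cont. rewrite <- H; [rring| |cont].
  intros x. apply (is_derive_mult u v x (u' x) (v' x)); auto. intros; apply Rmult_comm.
Qed.

(** * Periodic functions *)

Definition periodic (f : R -> R) : Prop := forall x, f (x + 1) = f x.

Lemma periodic_nat f (n : nat) x : periodic f -> f (x + INR n) = f x.
Proof.
  intros H. induction n as [|n IH].
  - simpl. f_equal; ring.
  - rewrite S_INR, <- IH, <- (H (x + INR n)). f_equal; ring.
Qed.

Lemma periodic_int f (k : Z) x : periodic f -> f (x + IZR k) = f x.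
Proof.
  intros H. destruct (Z_le_gt_dec 0 k).
  - rewrite <- (Z2Nat.id k), <- INR_IZR_INZ by auto. now apply periodic_nat.
  - rewrite <- (periodic_nat f (Z.to_nat (- k)) (x + IZR k)) by auto.
    rewrite INR_IZR_INZ, Z2Nat.id, opp_IZR by lia. f_equal; ring.
Qed.

Lemma periodic_reduce f x : periodic f -> exists y, 0 <= y < 1 /\ f y = f x.
Proof.
  intros H. exists (x + IZR (- Int_part x)). split; [|now apply periodic_int].
  rewrite opp_IZR. destruct (base_Int_part x). lra.
Qed.

Lemma periodic_bounded f : cont f -> periodic f -> exists M, forall x, Rabs (f x) <= M.
Proof.
  intros Hc Hp. destruct (cont_bounded f 0 1) as (M & HM); auto; [lra|].
  exists M. intros x. destruct (periodic_reduce f x Hp) as (y & Hy & <-).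
  apply HM; lra.
Qed.

Lemma cos_2kpi (k : Z) x : cos (x + 2 * PI * IZR k) = cos x.
Proof.
  replace (x + 2 * PI * IZR k) with (2 * PI * (x / (2 * PI) + IZR k)) by (field; apply PI_neq0).
  rewrite (periodic_int (fun y => cos (2 * PI * y))).
  - f_equal. field. apply PI_neq0.
  - intros y. replace (2 * PI * (y + 1)) with (2 * PI * y + 2 * INR 1 * PI) by (simpl; ring).
    apply cos_period.
Qed.

Lemma sin_2kpi (k : Z) x : sin (x + 2 * PI * IZR k) = sin x.
Proof.
  replace (x + 2 * PI * IZR k) with (2 * PI * (x / (2 * PI) + IZR k)) by (field; apply PI_neq0).
  rewrite (periodic_int (fun y => sin (2 * PI * y))).
  - f_equal. field. apply PI_neq0.
  - intros y. replace (2 * PI * (y + 1)) with (2 * PI * y + 2 * INR 1 * PI) by (simpl; ring).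
    apply sin_period.
Qed.

Lemma cs_periodic k : periodic (cs k).
Proof.
  intros x. unfold cs. rewrite <- (cos_2kpi k (2 * PI * IZR k * x)). f_equal; ring.
Qed.

Lemma sn_periodic k : periodic (sn k).
Proof.
  intros x. unfold sn. rewrite <- (sin_2kpi k (2 * PI * IZR k * x)). f_equal; ring.
Qed.

Lemma cs_opp k x : cs (- k) x = cs k x.
Proof.
  unfold cs. rewrite opp_IZR, <- cos_neg. f_equal; ring.
Qed.

Lemma sn_opp k x : sn (- k) x = - sn k x.
Proof.
  unfold sn. rewrite opp_IZR, <- sin_neg. f_equal; ring.
Qed.

Lemma cs_plus j k x : cs (j + k) x = cs j x * cs k x - sn j x * sn k x.
Proof. unfold cs, sn. rewrite <- cos_plus, plus_IZR. f_equal; ring. Qed.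

Lemma sn_plus j k x : sn (j + k) x = sn j x * cs k x + cs j x * sn k x.
Proof. unfold cs, sn. rewrite <- sin_plus, plus_IZR. f_equal; ring. Qed.

Lemma cs_minus j k x : cs (j - k) x = cs j x * cs k x + sn j x * sn k x.
Proof. unfold Z.sub. rewrite cs_plus, cs_opp, sn_opp. ring. Qed.

Lemma sn_minus j k x : sn (j - k) x = sn j x * cs k x - cs j x * sn k x.
Proof. unfold Z.sub. rewrite sn_plus, cs_opp, sn_opp. ring. Qed.

Lemma Rabs_cs k x : Rabs (cs k x) <= 1.
Proof. apply Rabs_le. unfold cs. destruct (COS_bound (2 * PI * IZR k * x)). lra. Qed.

Lemma Rabs_sn k x : Rabs (sn k x) <= 1.
Proof. apply Rabs_le. unfold sn. destruct (SIN_bound (2 * PI * IZR k * x)). lra. Qed.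

Lemma cs_0 x : cs 0 x = 1.
Proof. unfold cs. replace (2 * PI * 0 * x) with 0 by ring. apply cos_0. Qed.

Lemma sn_0 x : sn 0 x = 0.
Proof. unfold sn. replace (2 * PI * 0 * x) with 0 by ring. apply sin_0. Qed.

(** * Fourier coefficients *)

Definition fc (f : R -> R) (k : Z) : R := RInt (fun x => f x * cs k x) 0 1.
Definition fs (f : R -> R) (k : Z) : R := RInt (fun x => f x * sn k x) 0 1.

Lemma fc_opp f k : fc f (- k) = fc f k.
Proof. apply RInt_ext_all. intros. now rewrite cs_opp. Qed.

Lemma fs_opp f k : cont f -> fs f (- k) = - fs f k.
Proof.
  intros Hf. unfold fs. rewrite <- Rmult_1_l, <- Ropp_mult_distr_r, Ropp_mult_distr_l.
  rewrite <- RInt_scal_cont by cont.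
  apply RInt_ext_all. intros. rewrite sn_opp. ring.
Qed.

Lemma fc_0 f : fc f 0 = RInt f 0 1.
Proof. apply RInt_ext_all. intros. rewrite cs_0. ring. Qed.

Lemma fs_0 f : fs f 0 = 0.
Proof.
  unfold fs. rewrite (RInt_ext_all _ (fun _ => 0)).
  - rewrite RInt_const_R; rring.
  - intros. rewrite sn_0; ring.
Qed.

Lemma fc_plus f g k : cont f -> cont g -> fc (fun x => f x + g x) k = fc f k + fc g k.
Proof.
  intros. unfold fc. rewrite <- RInt_plus_cont by cont. apply RInt_ext_all. intros; ring.
Qed.

Lemma fs_plus f g k : cont f -> cont g -> fs (fun x => f x + g x) k = fs f k + fs g k.
Proof.
  intros. unfold fs. rewrite <- RInt_plus_cont by cont. apply RInt_ext_all. intros; ring.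
Qed.

Lemma fc_scal f c k : cont f -> fc (fun x => c * f x) k = c * fc f k.
Proof.
  intros. unfold fc. rewrite <- RInt_scal_cont by cont. apply RInt_ext_all. intros; ring.
Qed.

Lemma fs_scal f c k : cont f -> fs (fun x => c * f x) k = c * fs f k.
Proof.
  intros. unfold fs. rewrite <- RInt_scal_cont by cont. apply RInt_ext_all. intros; ring.
Qed.

Lemma fc_minus f g k : cont f -> cont g -> fc (fun x => f x - g x) k = fc f k - fc g k.
Proof.
  intros. unfold fc. rewrite <- RInt_minus_cont by cont. apply RInt_ext_all. intros; ring.
Qed.

Lemma fs_minus f g k : cont f -> cont g -> fs (fun x => f x - g x) k = fs f k - fs g k.
Proof.
  intros. unfold fs. rewrite <- RInt_minus_cont by cont. apply RInt_ext_all. intros; ring.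
Qed.

Lemma fc_lsum {A} (f : A -> R -> R) l k : (forall a, cont (f a)) ->
  fc (fun x => lsum (fun a => f a x) l) k = lsum (fun a => fc (f a) k) l.
Proof.
  intros H. unfold fc. rewrite <- RInt_lsum_cont by (intros; cont; auto).
  apply RInt_ext_all. intros x. induction l as [|a l IH]; simpl; [ring|rewrite <- IH; ring].
Qed.

Lemma fs_lsum {A} (f : A -> R -> R) l k : (forall a, cont (f a)) ->
  fs (fun x => lsum (fun a => f a x) l) k = lsum (fun a => fs (f a) k) l.
Proof.
  intros H. unfold fs. rewrite <- RInt_lsum_cont by (intros; cont; auto).
  apply RInt_ext_all. intros x. induction l as [|a l IH]; simpl; [ring|rewrite <- IH; ring].
Qed.

Lemma fc_abs_le f k M : cont f -> (forall x, 0 <= x <= 1 -> Rabs (f x) <= M) -> Rabs (fc f k) <= M.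
Proof.
  intros Hf H. apply RInt_abs_le; [cont|]. intros x Hx. rewrite Rabs_mult.
  specialize (H x Hx). assert (H1 := Rabs_cs k x). assert (H2 := Rabs_pos (f x)).
  assert (H3 := Rabs_pos (cs k x)). nra.
Qed.

Lemma fs_abs_le f k M : cont f -> (forall x, 0 <= x <= 1 -> Rabs (f x) <= M) -> Rabs (fs f k) <= M.
Proof.
  intros Hf H. apply RInt_abs_le; [cont|]. intros x Hx. rewrite Rabs_mult.
  specialize (H x Hx). assert (H1 := Rabs_sn k x). assert (H2 := Rabs_pos (f x)).
  assert (H3 := Rabs_pos (sn k x)). nra.
Qed.

Lemma is_derive_cs k x : is_derive (cs k) x (- (2 * PI * IZR k) * sn k x).
Proof. unfold cs, sn. auto_derive; auto. ring. Qed.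

Lemma is_derive_sn k x : is_derive (sn k) x ((2 * PI * IZR k) * cs k x).
Proof. unfold cs, sn. auto_derive; auto. ring. Qed.

(** Integration by parts; the boundary terms cancel by periodicity. *)
Lemma fc_derive f f' k : (forall x, is_derive f x (f' x)) -> cont f' -> periodic f ->
  fc f' k = 2 * PI * IZR k * fs f k.
Proof.
  intros Hd Hc Hp. assert (cf : cont f) by (apply cont_derivable; intros x; now exists (f' x)).
  unfold fc. rewrite (RInt_by_parts f (cs k) f' (fun x => - (2 * PI * IZR k) * sn k x)); auto.
  - rewrite <- (cs_periodic k 0), <- (Hp 0), Rplus_0_l.
    unfold fs. rewrite <- RInt_scal_cont by cont.
    rewrite (RInt_ext_all _ (fun x => - (2 * PI * IZR k) * (f x * sn k x))) by (intros; ring).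
    rewrite !RInt_scal_cont by cont. ring.
  - intros; apply is_derive_cs.
  - cont.
Qed.

Lemma fs_derive f f' k : (forall x, is_derive f x (f' x)) -> cont f' -> periodic f ->
  fs f' k = - (2 * PI * IZR k * fc f k).
Proof.
  intros Hd Hc Hp. assert (cf : cont f) by (apply cont_derivable; intros x; now exists (f' x)).
  unfold fs. rewrite (RInt_by_parts f (sn k) f' (fun x => (2 * PI * IZR k) * cs k x)); auto.
  - rewrite <- (sn_periodic k 0), <- (Hp 0), Rplus_0_l.
    unfold fc.
    rewrite (RInt_ext_all _ (fun x => (2 * PI * IZR k) * (f x * cs k x))) by (intros; ring).
    rewrite !RInt_scal_cont by cont. ring.
  - intros; apply is_derive_sn.
  - cont.
Qed.

Lemma RInt_cs k : RInt (cs k) 0 1 = if Z.eq_dec k 0 then 1 else 0.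
Proof.
  destruct (Z.eq_dec k 0) as [->|Hk].
  - rewrite (RInt_ext_all _ (fun _ => 1)) by (intros; apply cs_0). rewrite RInt_const_R; rring.
  - assert (Hk' : 2 * PI * IZR k <> 0).
    { apply Rmult_integral_contrapositive_currified; [|now apply not_0_IZR].
      assert (H := PI_RGT_0). lra. }
    rewrite (RInt_derive_cont (fun x => / (2 * PI * IZR k) * sn k x)); [|
      |apply cont_cs].
    + rewrite <- (sn_periodic k 0), Rplus_0_l. rring.
    + intros x. assert (H := is_derive_sn k x).
      apply (is_derive_scal (sn k) x (/ (2 * PI * IZR k))) in H.
      rewrite <- Rmult_assoc, Rinv_l, Rmult_1_l in H by auto. exact H.
Qed.

Lemma RInt_sn k : RInt (sn k) 0 1 = 0.
Proof.
  destruct (Z.eq_dec k 0) as [->|Hk].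
  - rewrite (RInt_ext_all _ (fun _ => 0)) by (intros; apply sn_0). rewrite RInt_const_R; rring.
  - assert (Hk' : 2 * PI * IZR k <> 0).
    { apply Rmult_integral_contrapositive_currified; [|now apply not_0_IZR].
      assert (H := PI_RGT_0). lra. }
    rewrite (RInt_derive_cont (fun x => - / (2 * PI * IZR k) * cs k x)); [|
      |apply cont_sn].
    + rewrite <- (cs_periodic k 0), Rplus_0_l. rring.
    + intros x. assert (H := is_derive_cs k x).
      apply (is_derive_scal (cs k) x (- / (2 * PI * IZR k))) in H.
      rewrite <- Rmult_assoc, Rmult_opp_opp, Rinv_l, Rmult_1_l in H by auto. exact H.
Qed.

Definition kron (j k : Z) : R := if Z.eq_dec j k then 1 else 0.

Lemma RInt_cs_kron j k : RInt (cs (j - k)) 0 1 = kron j k.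
Proof.
  rewrite RInt_cs. unfold kron. destruct (Z.eq_dec (j - k) 0), (Z.eq_dec j k); auto; lia.
Qed.

Lemma RInt_cs_kron' j k : RInt (cs (j + k)) 0 1 = kron j (- k).
Proof.
  rewrite RInt_cs. unfold kron. destruct (Z.eq_dec (j + k) 0), (Z.eq_dec j (- k)); auto; lia.
Qed.

Lemma fc_cs j k : fc (cs j) k = / 2 * (kron j k + kron j (- k)).
Proof.
  rewrite <- RInt_cs_kron, <- RInt_cs_kron', <- RInt_plus_cont, <- RInt_scal_cont by cont.
  apply RInt_ext_all. intros x. rewrite cs_plus, cs_minus. field.
Qed.

Lemma fs_sn j k : fs (sn j) k = / 2 * (kron j k - kron j (- k)).
Proof.
  rewrite <- RInt_cs_kron, <- RInt_cs_kron', <- RInt_minus_cont, <- RInt_scal_cont by cont.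
  apply RInt_ext_all. intros x. rewrite cs_plus, cs_minus. field.
Qed.

Lemma fs_cs j k : fs (cs j) k = 0.
Proof.
  transitivity (/ 2 * (RInt (sn (j + k)) 0 1 - RInt (sn (j - k)) 0 1)).
  - rewrite <- RInt_minus_cont, <- RInt_scal_cont by cont.
    apply RInt_ext_all. intros x. rewrite sn_plus, sn_minus. field.
  - rewrite !RInt_sn. ring.
Qed.

Lemma fc_sn j k : fc (sn j) k = 0.
Proof.
  transitivity (/ 2 * (RInt (sn (j + k)) 0 1 + RInt (sn (j - k)) 0 1)).
  - rewrite <- RInt_plus_cont, <- RInt_scal_cont by cont.
    apply RInt_ext_all. intros x. rewrite sn_plus, sn_minus. field.
  - rewrite !RInt_sn. ring.
Qed.

(** ** Uniqueness of Fourier coefficients *)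

Definition null_coefs (f : R -> R) : Prop := cont f /\ forall k, fc f k = 0 /\ fs f k = 0.

(** A factor of degree one moves frequencies by at most one, so each coefficient of the product
    combines coefficients of [f] at [k - 1], [k] and [k + 1]. *)
Lemma null_coefs_mult_kernel f a b c : null_coefs f ->
  null_coefs (fun x => f x * (a + b * cs 1 x + c * sn 1 x)).
Proof.
  intros (Hf & H). split; [cont|]. intros k.
  split.
  - transitivity (a * fc f k + b * (/ 2 * (fc f (k + 1) + fc f (k - 1)))
                  + c * (/ 2 * (fs f (k + 1) - fs f (k - 1)))).
    + unfold fc, fs. rewrite <- RInt_plus_cont, <- RInt_minus_cont, <- !RInt_scal_cont,
        <- !RInt_plus_cont by cont.
      apply RInt_ext_all. intros x. rewrite cs_plus, cs_minus, sn_plus, sn_minus. field.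
    + destruct (H k), (H (k + 1)%Z), (H (k - 1)%Z). rewrite H0, H2, H4, H3, H5. ring.
  - transitivity (a * fs f k + b * (/ 2 * (fs f (k + 1) + fs f (k - 1)))
                  + c * (/ 2 * (fc f (k - 1) - fc f (k + 1)))).
    + unfold fc, fs. rewrite <- RInt_plus_cont, <- RInt_minus_cont, <- !RInt_scal_cont,
        <- !RInt_plus_cont by cont.
      apply RInt_ext_all. intros x. rewrite cs_plus, cs_minus, sn_plus, sn_minus. field.
    + destruct (H k), (H (k + 1)%Z), (H (k - 1)%Z). rewrite H1, H2, H4, H3, H5. ring.
Qed.

Lemma null_coefs_mult_kernel_pow f a b c n : null_coefs f ->
  null_coefs (fun x => f x * (a + b * cs 1 x + c * sn 1 x) ^ n).
Proof.
  intros H. induction n as [|n IH].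
  - replace (fun x => _) with f; auto. apply functional_extensionality. intros; simpl; ring.
  - apply (null_coefs_mult_kernel _ a b c) in IH.
    replace (fun x => _) with
      (fun x => f x * (a + b * cs 1 x + c * sn 1 x) ^ n * (a + b * cs 1 x + c * sn 1 x)); auto.
    apply functional_extensionality. intros; simpl; ring.
Qed.

Lemma pow_unbounded k M : 0 < k -> exists n : nat, M < (1 + k) ^ n.
Proof.
  intros Hk. destruct (Pow_x_infinity (1 + k)) with (b := M + 1) as (n & Hn).
  - rewrite Rabs_pos_eq; lra.
  - exists n. specialize (Hn n (le_n _)). rewrite Rabs_pos_eq in Hn; [lra|].
    apply pow_le; lra.
Qed.

(** The hypothesis says that [y] has distance at least [d] from 0 on the circle. Beyond [1/2], the
    reflection of [y] to [1 - y] brings it back to where the cosine decreases. *)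
Lemma cos_le_away d y : 0 < d < / 2 -> d <= Rabs y <= 1 - d ->
  cos (2 * PI * y) <= cos (2 * PI * d).
Proof.
  intros Hd Hy. assert (HP := PI_RGT_0).
  replace (cos (2 * PI * y)) with (cos (2 * PI * Rabs y)).
  2: { unfold Rabs. destruct (Rcase_abs y); auto.
       rewrite <- (cos_neg (2 * PI * y)). f_equal; ring. }
  set (z := Rabs y) in *. destruct (Rle_dec z (/ 2)).
  - apply cos_decr_1; nra.
  - replace (cos (2 * PI * z)) with (cos (2 * PI * (1 - z))).
    + apply cos_decr_1; nra.
    + rewrite <- cos_neg, <- (cos_2kpi 1 (- _)). f_equal. ring.
Qed.

(* Integrating [f] against powers of the trigonometric polynomial
   [1 + cos (2 pi (x - x0)) - cos (2 pi d)], which exceeds 1 only near [x0]. *)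
Lemma null_coefs_interior_le f x0 : null_coefs f -> 0 < x0 < 1 -> f x0 <= 0.
Proof.
  intros Hn Hx. destruct (Rle_dec (f x0) 0) as [|Hpos]; auto. exfalso.
  assert (HP := PI_RGT_0).
  apply Rnot_le_lt in Hpos. destruct (Hn) as (Hf & _).
  assert (Hloc : exists d, 0 < d /\ forall x, Rabs (x - x0) < d -> f x0 / 2 < f x).
  { assert (H := Hf x0). apply continuity_pt_filterlim in H.
    destruct (H (f x0 / 2)) as (d & Hd & H'); [lra|]. exists d. split; auto.
    intros x Hxd. destruct (Req_dec x x0) as [->|Hne]; [lra|].
    specialize (H' x). unfold dist, D_x, no_cond in H'; simpl in H'; unfold R_dist in H'.
    assert (Rabs (f x - f x0) < f x0 / 2) by (apply H'; auto).
    apply Rabs_def2 in H0. lra. }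
  destruct Hloc as (d0 & Hd0 & Hloc).
  (* Within [d] of [x0] the function exceeds [f x0 / 2]; the other bounds keep this neighbourhood
     inside the period and make every remaining point of [0, 1] lie at distance between [d] and
     [1 - d] from [x0]. *)
  set (d := Rmin (d0 / 2) (Rmin (/ 4) (Rmin (x0 / 2) ((1 - x0) / 2)))).
  assert (Hd : 0 < d /\ d <= d0 / 2 /\ d <= / 4 /\ d <= x0 / 2 /\ d <= (1 - x0) / 2).
  { unfold d. repeat split; unfold Rmin; repeat destruct Rle_dec; lra. }
  destruct Hd as (Hd & Hd1 & Hd2 & Hd3 & Hd4). clearbody d.
  set (q := fun x => 1 - cos (2 * PI * d) + cos (2 * PI * x0) * cs 1 x + sin (2 * PI * x0) * sn 1 x).
  assert (Hq : forall x, q x = 1 - cos (2 * PI * d) + cos (2 * PI * (x - x0))).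
  { intros x. unfold q, cs, sn.
    replace (2 * PI * (x - x0)) with (2 * PI * 1 * x - 2 * PI * x0) by ring.
    rewrite cos_minus. ring. }
  assert (Cq : cont q) by (unfold q; cont).
  set (kap := cos (2 * PI * (d / 2)) - cos (2 * PI * d)).
  assert (Hkap : 0 < kap).
  { unfold kap. assert (cos (2 * PI * d) < cos (2 * PI * (d / 2))); [|lra].
    apply cos_decreasing_1; nra. }
  destruct (cont_bounded f 0 1) as (M & HM); auto; [lra|].
  assert (HM0 : 0 <= M).
  { eapply Rle_trans; [apply Rabs_pos|apply (HM 0); lra]. }
  (* With this [n] the contribution of the points within [d / 2] of [x0] exceeds [M], whereas the
     integral of [f q^n + M] equals [M]. *)
  destruct (pow_unbounded kap (M / (f x0 / 2 * d)) Hkap) as (n & Hgt).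
  assert (Hqn := null_coefs_mult_kernel_pow f (1 - cos (2 * PI * d)) (cos (2 * PI * x0))
    (sin (2 * PI * x0)) n Hn).
  destruct Hqn as (Hcq & Hqn). destruct (Hqn 0%Z) as (Hint & _). rewrite fc_0 in Hint.
  change (RInt (fun x => f x * q x ^ n) 0 1 = 0) in Hint.
  change (cont (fun x => f x * q x ^ n)) in Hcq.
  (* Adding [M] makes the integrand nonnegative where [f] may be negative, since [q] is at most 1 in
     absolute value there. Near [x0] one has [q >= 1 + kap]. *)
  assert (Hbig : f x0 / 2 * (1 + kap) ^ n * ((x0 + d / 2) - (x0 - d / 2))
                 <= RInt (fun x => f x * q x ^ n + M) 0 1).
  { apply RInt_ge_sub; [cont|lra|lra| |].
    - intros x Hx1. cbv beta. destruct (Rlt_dec (Rabs (x - x0)) d) as [Hin|Hout].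
      + assert (0 < f x) by (specialize (Hloc x); lra).
        assert (0 <= q x ^ n); [|assert (0 <= f x * q x ^ n) by (apply Rmult_le_pos; lra); lra].
        apply pow_le. rewrite Hq.
        assert (cos (2 * PI * d) <= 1) by apply COS_bound.
        assert (cos (2 * PI * d) <= cos (2 * PI * (x - x0))).
        { replace (cos (2 * PI * (x - x0))) with (cos (2 * PI * Rabs (x - x0))).
          - assert (Ha := Rabs_pos (x - x0)). apply cos_decr_1; nra.
          - unfold Rabs. destruct Rcase_abs; auto.
            rewrite <- (cos_neg (2 * PI * (x - x0))). f_equal; ring. }
        lra.
      + assert (Hqa : Rabs (q x) <= 1).
        { apply Rabs_le. rewrite Hq.
          assert (cos (2 * PI * (x - x0)) <= cos (2 * PI * d)).
          { apply cos_le_away; [lra|]. split; [lra|]. apply Rabs_le; lra. }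
          assert (cos (2 * PI * d) <= 1) by apply COS_bound.
          assert (-1 <= cos (2 * PI * (x - x0))) by apply COS_bound. lra. }
        assert (Rabs (f x * q x ^ n) <= M).
        { rewrite Rabs_mult, <- RPow_abs. specialize (HM x Hx1).
          assert (Rabs (q x) ^ n <= 1).
          { rewrite <- (pow1 n). apply pow_incr. split; [apply Rabs_pos|auto]. }
          assert (0 <= Rabs (q x) ^ n) by (apply pow_le, Rabs_pos).
          assert (H2 := Rabs_pos (f x)). nra. }
        apply Rabs_le_between in H. lra.
    - intros x Hx1. cbv beta.
      assert (Hin : Rabs (x - x0) <= d / 2) by (apply Rabs_le; lra).
      assert (f x0 / 2 < f x) by (apply Hloc; lra).
      assert (1 + kap <= q x).
      { rewrite Hq. unfold kap.
        replace (cos (2 * PI * (x - x0))) with (cos (2 * PI * Rabs (x - x0))).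
        - assert (cos (2 * PI * (d / 2)) <= cos (2 * PI * Rabs (x - x0))); [|lra].
          assert (Ha := Rabs_pos (x - x0)). apply cos_decr_1; nra.
        - unfold Rabs. destruct Rcase_abs; auto.
          rewrite <- (cos_neg (2 * PI * (x - x0))). f_equal; ring. }
      assert ((1 + kap) ^ n <= q x ^ n) by (apply pow_incr; lra).
      assert (0 <= (1 + kap) ^ n) by (apply pow_le; lra).
      assert (f x0 / 2 * (1 + kap) ^ n <= f x * q x ^ n) by (apply Rmult_le_compat; lra).
      lra. }
  rewrite RInt_plus_cont, Hint, RInt_const_R in Hbig by cont.
  apply Rmult_lt_compat_r with (r := f x0 / 2 * d) in Hgt; [|nra].
  unfold Rdiv in Hgt at 1. rewrite Rmult_assoc, Rinv_l in Hgt by nra. lra.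
Qed.

Lemma null_coefs_opp f : null_coefs f -> null_coefs (fun x => - f x).
Proof.
  intros H. apply (null_coefs_mult_kernel _ (-1) 0 0) in H.
  replace (fun x => - f x) with (fun x => f x * (-1 + 0 * cs 1 x + 0 * sn 1 x)); auto.
  apply functional_extensionality. intros; ring.
Qed.

(** The kernel argument treats the interior points of [0, 1]. The endpoint follows by continuity and
    all other points by periodicity. *)
Lemma fourier_unique f : cont f -> periodic f ->
  (forall k, fc f k = 0) -> (forall k, fs f k = 0) -> forall x, f x = 0.
Proof.
  intros Hf Hp Hc Hs.
  assert (Hn : null_coefs f) by (split; auto).
  assert (Hi : forall x, 0 < x < 1 -> f x = 0).
  { intros x Hx. assert (H1 := null_coefs_interior_le f x Hn Hx).
    assert (H2 := null_coefs_interior_le _ x (null_coefs_opp f Hn) Hx). simpl in H2. lra. }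
  assert (H0 : f 0 = 0).
  { destruct (Req_dec (f 0) 0) as [|Hne]; auto. exfalso.
    assert (H := Hf 0). apply continuity_pt_filterlim in H.
    destruct (H (Rabs (f 0))) as (d & Hd & H'); [now apply Rabs_pos_lt|].
    set (x := Rmin (d / 2) (/ 2)).
    assert (Hx : 0 < x /\ x < d /\ x < 1) by (unfold x, Rmin; destruct Rle_dec; lra).
    specialize (H' x). simpl in H'. unfold R_dist, D_x, no_cond in H'.
    rewrite Hi, Rminus_0_l, Rabs_Ropp in H' by lra.
    apply (Rlt_irrefl (Rabs (f 0))), H'. split; [split; [auto|lra]|].
    rewrite Rminus_0_r, Rabs_pos_eq; lra. }
  intros x. destruct (periodic_reduce f x Hp) as (y & Hy & <-).
  destruct (Req_dec y 0) as [->|]; auto. apply Hi; lra.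
Qed.

(** ** Synthesis from summable coefficients *)

Definition trig_sum (c d : Z -> R) (n : nat) (x : R) : R :=
  lsum (fun k => c k * cs k x + d k * sn k x) (zrange n).

Lemma cont_trig_sum c d n : cont (trig_sum c d n).
Proof. unfold trig_sum. cont. Qed.

Lemma lsum_kron v k n : In k (zrange n) -> lsum (fun j => v j * kron j k) (zrange n) = v k.
Proof.
  generalize (zrange_NoDup n). induction (zrange n) as [|a l IH]; [easy|].
  intros Hd [->|Hk]; simpl; inversion_clear Hd.
  - unfold kron at 1. destruct (Z.eq_dec k k); [|easy].
    rewrite (lsum_ext _ (fun _ => 0)).
    + clear. replace (lsum (fun _ => 0) l) with 0; [ring|]. induction l; simpl; lra.
    + intros j Hj. unfold kron. destruct (Z.eq_dec j k); [subst; easy|ring].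
  - rewrite IH by auto. unfold kron. destruct (Z.eq_dec a k); [subst; easy|ring].
Qed.

(** Since [cs] is even in the frequency, the entries at [k] and [-k] feed the same function; only
    the even part of [c] can be recovered. Both frequencies must lie in the asymmetric window. *)
Lemma fc_trig_sum c d n k : In k (zrange n) -> In (- k)%Z (zrange n) ->
  fc (trig_sum c d n) k = / 2 * (c k + c (- k)%Z).
Proof.
  intros Hk Hk'. unfold trig_sum.
  rewrite (fc_lsum (fun k x => c k * cs k x + d k * sn k x)) by (intros; cont).
  rewrite (lsum_ext _ (fun j => / 2 * (c j * kron j k + c j * kron j (- k)))).
  - rewrite lsum_scal, lsum_plus, !lsum_kron by auto. ring.
  - intros j _. rewrite fc_plus, !fc_scal, fc_cs, fc_sn by cont. ring.
Qed.

Lemma fs_trig_sum c d n k : In k (zrange n) -> In (- k)%Z (zrange n) ->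
  fs (trig_sum c d n) k = / 2 * (d k - d (- k)%Z).
Proof.
  intros Hk Hk'. unfold trig_sum.
  rewrite (fs_lsum (fun k x => c k * cs k x + d k * sn k x)) by (intros; cont).
  rewrite (lsum_ext _ (fun j => / 2 * (d j * kron j k + -1 * (d j * kron j (- k))))).
  - rewrite lsum_scal, lsum_plus, lsum_scal, !lsum_kron by auto. ring.
  - intros j _. rewrite fs_plus, !fs_scal, fs_cs, fs_sn by cont. ring.
Qed.

Lemma trig_term_le c d k x : Rabs (c * cs k x + d * sn k x) <= Rabs c + Rabs d.
Proof.
  eapply Rle_trans; [apply Rabs_triang|]. rewrite !Rabs_mult.
  assert (H1 := Rabs_cs k x). assert (H2 := Rabs_sn k x).
  assert (H3 := Rabs_pos c). assert (H4 := Rabs_pos d). nra.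
Qed.

Lemma zrange_split m n : (m <= n)%nat ->
  exists l, zrange n = l ++ zrange m /\ NoDup l /\ forall k, In k l -> ~ In k (zrange m).
Proof.
  intros H. assert (Hd := zrange_NoDup n). induction H as [|n Hmn IH].
  - exists []. repeat split; auto. constructor.
  - destruct IH as (l & Hl & _); [apply zrange_NoDup|].
    exists (Z.of_nat n :: (- Z.of_nat (S n))%Z :: l).
    assert (He : zrange (S n) = (Z.of_nat n :: (- Z.of_nat (S n))%Z :: l) ++ zrange m).
    { simpl zrange. now rewrite Hl. }
    rewrite He in Hd. split; [exact He|]. split.
    + now apply NoDup_app_remove_r in Hd.
    + intros k Hk Hk'. clear He Hl. induction (Z.of_nat n :: (- Z.of_nat (S n))%Z :: l); [easy|].
      inversion_clear Hd. destruct Hk as [->|Hk]; [|auto].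
      apply H. apply in_or_app. now right.
Qed.

Lemma trig_sum_cauchy c d B : zbound (fun k => Rabs (c k) + Rabs (d k)) B ->
  forall eps, 0 < eps -> exists n0, forall m n x, (n0 <= m)%nat -> (m <= n)%nat ->
  Rabs (trig_sum c d n x - trig_sum c d m x) <= eps.
Proof.
  intros HB eps He.
  destruct (zbound_tail (fun k => Rabs (c k) + Rabs (d k)) B) with (eps := eps)
    as (n0 & Hn0); auto.
  { intros. apply Rplus_le_le_0_compat; apply Rabs_pos. }
  exists n0. intros m n x Hm Hmn. destruct (zrange_split m n Hmn) as (l & Hl & Hd & Hdis).
  unfold trig_sum. rewrite Hl, lsum_app.
  match goal with |- Rabs (?a + ?b - ?b) <= _ => replace (a + b - b) with a by ring end.
  eapply Rle_trans; [apply lsum_abs|].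
  apply Rle_trans with (lsum (fun k => Rabs (c k) + Rabs (d k)) l).
  - apply lsum_le. intros; apply trig_term_le.
  - now apply (Hn0 m Hm).
Qed.

Lemma cont_uniform_limit (u : nat -> R -> R) g : (forall n, cont (u n)) ->
  (forall eps, 0 < eps -> exists n, forall x, Rabs (g x - u n x) <= eps) -> cont g.
Proof.
  intros Hu H x. apply continuity_pt_filterlim. intros eps He.
  destruct (H (eps / 4)) as (n & Hn); [lra|].
  assert (Hc := Hu n x). apply continuity_pt_filterlim in Hc.
  destruct (Hc (eps / 4)) as (d & Hd & H'); [lra|].
  exists d. split; auto. intros y Hy. specialize (H' y Hy).
  simpl in *. unfold R_dist in *.
  replace (g y - g x) with ((g y - u n y) + (u n y - u n x) + - (g x - u n x)) by ring.
  eapply Rle_lt_trans; [apply Rabs_triang|]. rewrite Rabs_Ropp.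
  eapply Rle_lt_trans; [apply Rplus_le_compat_r, Rabs_triang|].
  assert (H1 := Hn x). assert (H2 := Hn y). lra.
Qed.

Lemma eq_of_Rabs_le a b : (forall eps, 0 < eps -> Rabs (a - b) <= eps) -> a = b.
Proof.
  intros H. apply Rminus_diag_uniq. destruct (Req_dec (a - b) 0) as [|Hn]; auto.
  apply Rabs_pos_lt in Hn. specialize (H (Rabs (a - b) / 2)). lra.
Qed.

(** Absolute summability gives uniform convergence, which passes continuity and integrals to the
    limit. The coefficients come out symmetrized, as in [fc_trig_sum] and [fs_trig_sum]. *)
Lemma trig_synthesis c d B : zbound (fun k => Rabs (c k) + Rabs (d k)) B ->
  exists g, cont g /\ periodic g /\
    (forall eps, 0 < eps -> exists n0, forall n x, (n0 <= n)%nat ->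
       Rabs (g x - trig_sum c d n x) <= eps) /\
    (forall k, fc g k = / 2 * (c k + c (- k)%Z)) /\
    (forall k, fs g k = / 2 * (d k - d (- k)%Z)).
Proof.
  intros HB. assert (HC := trig_sum_cauchy c d B HB).
  assert (Hlim : forall x, ex_finite_lim_seq (fun n => trig_sum c d n x)).
  { intros x. apply ex_lim_seq_cauchy_corr. intros eps.
    destruct (HC (pos eps / 2)) as (n0 & Hn0); [assert (H := cond_pos eps); lra|].
    exists n0. intros n m Hn Hm. assert (He := cond_pos eps).
    destruct (Nat.le_ge_cases n m).
    - rewrite Rabs_minus_sym. eapply Rle_lt_trans; [apply Hn0; auto|lra].
    - eapply Rle_lt_trans; [apply Hn0; auto|lra]. }
  set (g := fun x => real (Lim_seq (fun n => trig_sum c d n x))).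
  assert (Hg : forall x, is_lim_seq (fun n => trig_sum c d n x) (g x)).
  { intros x. apply Lim_seq_correct'. apply Hlim. }
  assert (HU : forall eps, 0 < eps -> exists n0, forall n x, (n0 <= n)%nat ->
     Rabs (g x - trig_sum c d n x) <= eps).
  { intros eps He. destruct (HC eps He) as (n0 & Hn0). exists n0. intros n x Hn.
    apply (is_lim_seq_le_loc (fun m => Rabs (trig_sum c d m x - trig_sum c d n x))
      (fun _ => eps) (Rabs (g x - trig_sum c d n x)) eps).
    - exists n. intros m Hm. now apply Hn0.
    - apply (is_lim_seq_abs _ (Finite (g x - trig_sum c d n x))).
      apply is_lim_seq_minus'; auto. apply is_lim_seq_const.
    - apply is_lim_seq_const. }
  assert (Cg : cont g).
  { apply (cont_uniform_limit (trig_sum c d)); [apply cont_trig_sum|].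
    intros eps He. destruct (HU eps He) as (n0 & H). exists n0. auto. }
  exists g. split; [auto|]. split; [|split; [auto|split]].
  - intros x. unfold g. f_equal. apply Lim_seq_ext. intros n. unfold trig_sum.
    apply lsum_ext. intros k _. now rewrite cs_periodic, sn_periodic.
  - intros k. apply eq_of_Rabs_le. intros eps He. destruct (HU eps He) as (n0 & Hn0).
    set (n := Nat.max n0 (S (Z.to_nat (Z.abs k)))).
    rewrite <- (fc_trig_sum c d n k) by (apply in_zrange; lia).
    rewrite <- fc_minus by (auto; apply cont_trig_sum).
    apply fc_abs_le; [assert (H := cont_trig_sum c d n); cont|].
    intros x _. apply Hn0. lia.
  - intros k. apply eq_of_Rabs_le. intros eps He. destruct (HU eps He) as (n0 & Hn0).
    set (n := Nat.max n0 (S (Z.to_nat (Z.abs k)))).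
    rewrite <- (fs_trig_sum c d n k) by (apply in_zrange; lia).
    rewrite <- fs_minus by (auto; apply cont_trig_sum).
    apply fs_abs_le; [assert (H := cont_trig_sum c d n); cont|].
    intros x _. apply Hn0. lia.
Qed.

Lemma fourier_ext f g : cont f -> cont g -> periodic f -> periodic g ->
  (forall k, fc f k = fc g k) -> (forall k, fs f k = fs g k) -> forall x, f x = g x.
Proof.
  intros Hf Hg Pf Pg Hc Hs x. apply Rminus_diag_uniq.
  apply (fourier_unique (fun x => f x - g x)).
  - cont.
  - intros y. now rewrite Pf, Pg.
  - intros k. rewrite fc_minus, Hc by auto. ring.
  - intros k. rewrite fs_minus, Hs by auto. ring.
Qed.

(** The coefficients [fc f] are even and [fs f] odd, so symmetrizing leaves them unchanged. The
    synthesized function therefore has the coefficients of [f] and equals [f] by uniqueness. *)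
Lemma fourier_inversion f B : cont f -> periodic f ->
  zbound (fun k => Rabs (fc f k) + Rabs (fs f k)) B ->
  forall eps, 0 < eps -> exists n0, forall n x, (n0 <= n)%nat ->
    Rabs (f x - trig_sum (fc f) (fs f) n x) <= eps.
Proof.
  intros Hf Pf HB. destruct (trig_synthesis _ _ B HB) as (g & Cg & Pg & HU & Hc & Hs).
  assert (E : forall x, f x = g x).
  { apply fourier_ext; auto.
    - intros k. rewrite Hc, fc_opp. field.
    - intros k. rewrite Hs, fs_opp by auto. field. }
  intros eps He. destruct (HU eps He) as (n0 & Hn0). exists n0. intros n x Hn.
  rewrite E. now apply Hn0.
Qed.

Lemma fourier_sup f B : cont f -> periodic f ->
  zbound (fun k => Rabs (fc f k) + Rabs (fs f k)) B -> forall x, Rabs (f x) <= B.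
Proof.
  intros Hf Pf HB x. apply le_epsilon. intros eps He.
  destruct (fourier_inversion f B Hf Pf HB eps He) as (n & Hn).
  specialize (Hn n x (le_n _)).
  replace (f x) with (trig_sum (fc f) (fs f) n x + (f x - trig_sum (fc f) (fs f) n x)) by ring.
  eapply Rle_trans; [apply Rabs_triang|]. apply Rplus_le_compat; auto.
  eapply Rle_trans; [apply lsum_abs|]. eapply Rle_trans; [|apply (HB (zrange n)), zrange_NoDup].
  apply lsum_le. intros; apply trig_term_le.
Qed.

(** The increment of the primitive over one period has derivative zero, and at 0 it is the integral
    over the period. *)
Lemma primitive_periodic f : cont f -> periodic f -> RInt f 0 1 = 0 ->
  periodic (fun x => RInt f 0 x).
Proof.
  intros Cf Pf H0 x. set (G := fun x => RInt f 0 x).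
  assert (dG : forall x, is_derive G x (f x)) by (intros; now apply is_derive_primitive).
  assert (HH : forall y, is_derive (fun x => G (x + 1) - G x) y 0).
  { intros y. replace 0 with (1 * f (y + 1) - f y) by (rewrite Pf; ring).
    apply (is_derive_minus (fun x => G (x + 1)) G); auto.
    apply (is_derive_comp G (fun x => x + 1)); auto. auto_derive; auto. }
  assert (H1 := RInt_derive_cont _ _ 0 x HH (cont_const 0)).
  rewrite RInt_const_R, Rplus_0_l in H1.
  assert (H2 : G 0 = 0) by apply (RInt_point (V := R_CompleteNormedModule)).
  assert (H3 : G 1 = 0) by exact H0. lra.
Qed.

(* Multiplying the coefficients of [f] by [2 pi i k] gives those of a continuous [g];
   [f] and the primitive of [g] then have the same coefficients up to a constant. *)
Lemma derivative_of_summable f B : cont f -> periodic f ->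
  zbound (fun k => Rabs (2 * PI * IZR k * fs f k) + Rabs (2 * PI * IZR k * fc f k)) B ->
  exists g, cont g /\ periodic g /\ forall x, is_derive f x (g x).
Proof.
  intros Hf Pf HB.
  assert (HB' : zbound (fun k => Rabs (2 * PI * IZR k * fs f k)
                                + Rabs (- (2 * PI * IZR k * fc f k))) B).
  { eapply zbound_le; [|exact HB]. intros k. rewrite Rabs_Ropp. apply Rle_refl. }
  destruct (trig_synthesis _ _ B HB') as (g & Cg & Pg & _ & Hc & Hs).
  assert (Hc' : forall k, fc g k = 2 * PI * IZR k * fs f k).
  { intros k. rewrite Hc, fs_opp, opp_IZR by auto. field. }
  assert (Hs' : forall k, fs g k = - (2 * PI * IZR k * fc f k)).
  { intros k. rewrite Hs, fc_opp, opp_IZR by auto. field. }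
  exists g. split; [auto|split; [auto|]].
  set (G := fun x => RInt g 0 x).
  assert (dG : forall x, is_derive G x (g x)) by (intros; now apply is_derive_primitive).
  assert (CG : cont G) by (apply cont_derivable; intros x; now exists (g x)).
  assert (Hg0 : RInt g 0 1 = 0) by (rewrite <- fc_0, Hc'; rring).
  assert (PG : periodic G) by now apply primitive_periodic.
  (* The constant matches the coefficients at frequency 0, the only ones that differentiation does
     not see. *)
  set (c := RInt f 0 1 - RInt G 0 1).
  assert (E : forall x, f x = G x + c).
  { apply fourier_ext; auto; [cont| | |].
    - intros x. now rewrite PG.
    - intros k. rewrite fc_plus by cont.
      rewrite <- (Rmult_1_r c). rewrite fc_scal by cont.
      assert (Hone : fc (fun _ => 1) k = if Z.eq_dec k 0 then 1 else 0).
      { rewrite <- RInt_cs. apply RInt_ext_all. intros; ring. }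
      rewrite Hone. destruct (Z.eq_dec k 0) as [->|Hk].
      + rewrite !fc_0. unfold c. rring.
      + assert (H := fs_derive G g k dG Cg PG). rewrite Hs' in H.
        assert (2 * PI * IZR k <> 0).
        { apply Rmult_integral_contrapositive_currified; [|now apply not_0_IZR].
          assert (HP := PI_RGT_0). lra. }
        assert (fc f k = fc G k); [|lra].
        apply Rmult_eq_reg_l with (2 * PI * IZR k); auto. lra.
    - intros k. rewrite fs_plus by cont.
      rewrite <- (Rmult_1_r c). rewrite fs_scal by cont.
      assert (Hone : fs (fun _ => 1) k = 0).
      { rewrite <- (RInt_sn k). apply RInt_ext_all. intros; ring. }
      rewrite Hone. destruct (Z.eq_dec k 0) as [->|Hk].
      + rewrite !fs_0. ring.
      + assert (H := fc_derive G g k dG Cg PG). rewrite Hc' in H.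
        assert (2 * PI * IZR k <> 0).
        { apply Rmult_integral_contrapositive_currified; [|now apply not_0_IZR].
          assert (HP := PI_RGT_0). lra. }
        assert (fs f k = fs G k); [|lra].
        apply Rmult_eq_reg_l with (2 * PI * IZR k); auto. }
  intros x. apply (is_derive_ext (fun x => G x + c)); [intros; now rewrite E|].
  rewrite <- (Rplus_0_r (g x)). apply (is_derive_plus G (fun _ => c)); auto.
  apply (is_derive_const c).
Qed.

(** ** Bessel's inequality *)

(** The factor 2 joins the equal contributions of [k] and [-k]. Truncation to [zrange n] would keep
    only half of frequency [n], and the remainder would not be orthogonal to it. *)
Definition fourier_partial (f : R -> R) : nat -> R -> R :=
  fix partial n := match n with
  | O => fun x => fc f 0
  | S m => fun x => partial m x +
      2 * (fc f (Z.of_nat n) * cs (Z.of_nat n) x + fs f (Z.of_nat n) * sn (Z.of_nat n) x)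
  end.

Lemma cont_fourier_partial f n : cont (fourier_partial f n).
Proof. induction n as [|n IH]; simpl; cont. Qed.

Lemma fourier_partial_coefs f n k : cont f -> (Z.of_nat n < k)%Z ->
  fc (fourier_partial f n) k = 0 /\ fs (fourier_partial f n) k = 0.
Proof.
  intros Hf. induction n as [|n IH]; intros Hk.
  - split.
    + unfold fc. simpl. rewrite RInt_scal_cont, RInt_cs by cont.
      destruct (Z.eq_dec k 0); [lia|ring].
    + unfold fs. simpl. rewrite RInt_scal_cont, RInt_sn by cont. ring.
  - destruct IH as (H1 & H2); [lia|]. assert (H := cont_fourier_partial f n).
    cbn [fourier_partial].
    rewrite fc_plus, fs_plus, fc_scal, fs_scal, fc_plus, fs_plus, !fc_scal, !fs_scal by cont.
    rewrite H1, H2, fc_cs, fs_cs, fc_sn, fs_sn. unfold kron.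
    destruct (Z.eq_dec (Z.of_nat (S n)) k), (Z.eq_dec (Z.of_nat (S n)) (- k)); try lia.
    split; ring.
Qed.

(** Pythagoras, one frequency at a time: with coefficients [a], [b] the cross term is
    [-4 (a^2 + b^2)] and the square of the new term is [2 (a^2 + b^2)]. The final summand cancels
    the [k = 0] entry of the sum, since frequency 0 is subtracted separately. *)
Lemma fourier_remainder_energy f n : cont f ->
  RInt (fun x => (f x - fourier_partial f n x) ^ 2) 0 1 =
  RInt (fun x => f x ^ 2) 0 1 - fc f 0 ^ 2
  - 2 * sum_f_R0 (fun k => fc f (Z.of_nat k) ^ 2 + fs f (Z.of_nat k) ^ 2) n
  + 2 * fc f 0 ^ 2.
Proof.
  intros Hf. induction n as [|n IH].
  - simpl sum_f_R0. rewrite fs_0.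
    transitivity (RInt (fun x => f x ^ 2) 0 1 + - 2 * fc f 0 * RInt f 0 1
      + RInt (fun _ => fc f 0 ^ 2) 0 1).
    + rewrite <- RInt_scal_cont, <- !RInt_plus_cont by cont.
      apply RInt_ext_all. intros x. simpl. ring.
    + rewrite RInt_const_R, fc_0. simpl. ring.
  - rewrite tech5. set (k := Z.of_nat (S n)). set (r := fun x => f x - fourier_partial f n x).
    assert (H := cont_fourier_partial f n).
    assert (Cr : cont r) by (unfold r; cont).
    destruct (fourier_partial_coefs f n k Hf ltac:(lia)) as (H1 & H2).
    assert (Hrc : fc r k = fc f k) by (unfold r; rewrite fc_minus, H1 by auto; ring).
    assert (Hrs : fs r k = fs f k) by (unfold r; rewrite fs_minus, H2 by auto; ring).
    set (a := fc f k) in *. set (b := fs f k) in *.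
    transitivity (RInt (fun x => r x ^ 2) 0 1 + - 4 * (a * fc r k + b * fs r k)
      + 4 * (a * (a * fc (cs k) k + b * fs (cs k) k)
             + b * (a * fc (sn k) k + b * fs (sn k) k))).
    + unfold fc, fs.
      rewrite <- !(RInt_scal_cont _ a), <- !(RInt_scal_cont _ b) by cont.
      rewrite <- !RInt_plus_cont by cont.
      rewrite <- !(RInt_scal_cont _ a), <- !(RInt_scal_cont _ b) by cont.
      rewrite <- !RInt_plus_cont by cont.
      rewrite <- !RInt_scal_cont by cont. rewrite <- !RInt_plus_cont by cont.
      apply RInt_ext_all. intros x.
      change (fourier_partial f (S n) x)
        with (fourier_partial f n x + 2 * (a * cs k x + b * sn k x)).
      unfold r. ring.
    + unfold r at 1. rewrite IH, Hrc, Hrs, fc_cs, fs_cs, fc_sn, fs_sn. unfold kron.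
      destruct (Z.eq_dec k k); [|easy]. destruct (Z.eq_dec k (- k)); [lia|]. match goal with |- ?x = ?y => change (@eq R x y) end; apply Rminus_diag_uniq; unfold a, b; simpl; field.
Qed.

Lemma bessel f : cont f ->
  zbound (fun k => fc f k ^ 2 + fs f k ^ 2) (2 * RInt (fun x => f x ^ 2) 0 1).
Proof.
  intros Hf l Hl. destruct (zrange_exhausts l) as (n & Hn).
  assert (Hpos : forall k, 0 <= fc f k ^ 2 + fs f k ^ 2).
  { intros; apply Rplus_le_le_0_compat; apply pow2_ge_0. }
  apply Rle_trans with (lsum (fun k => fc f k ^ 2 + fs f k ^ 2) (zrange n)).
  { now apply lsum_incl. }
  set (e := fun k => fc f k ^ 2 + fs f k ^ 2) in *.
  assert (He : forall k, e (- k)%Z = e k).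
  { intros k. unfold e. rewrite fc_opp, fs_opp by auto. ring. }
  (* [e] is even. The window contains both signs of every frequency strictly between 0 and [m], but
     0 and [-m] only once. *)
  assert (Hz : forall m, lsum e (zrange m)
    = 2 * sum_f_R0 (fun k => e (Z.of_nat k)) m - e 0%Z - e (Z.of_nat m)).
  { induction m as [|m IH]; [simpl; ring|].
    change (zrange (S m)) with (Z.of_nat m :: (- Z.of_nat (S m))%Z :: zrange m).
    rewrite !lsum_cons, He, tech5, IH. ring. }
  rewrite Hz. assert (H := fourier_remainder_energy f n Hf).
  change (sum_f_R0 _ n) with (sum_f_R0 (fun k => e (Z.of_nat k)) n) in H.
  assert (H1 : 0 <= RInt (fun x => (f x - fourier_partial f n x) ^ 2) 0 1).
  { assert (H1 := cont_fourier_partial f n).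
    apply RInt_ge_0; [lra|apply cont_ex_RInt; cont|]. intros; apply pow2_ge_0. }
  assert (H2 : 0 <= RInt (fun x => f x ^ 2) 0 1).
  { apply RInt_ge_0; [lra|apply cont_ex_RInt; cont|]. intros; apply pow2_ge_0. }
  assert (H3 := Hpos (Z.of_nat n)). fold (e (Z.of_nat n)) in H3.
  assert (H4 : e 0%Z = fc f 0 ^ 2) by (unfold e; rewrite fs_0; ring).
  lra.
Qed.

(** * Sobolev spaces on the circle *)

Definition amp (f : R -> R) (k : Z) : R := Cmod (fourier f k).

Lemma amp_sqr f k : amp f k ^ 2 = fc f k ^ 2 + fs f k ^ 2.
Proof.
  unfold amp, Cmod. rewrite pow2_sqrt.
  - unfold fourier; simpl. unfold fc, fs, cs, sn. ring.
  - apply Rplus_le_le_0_compat; apply pow2_ge_0.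
Qed.

Lemma amp_ge0 f k : 0 <= amp f k.
Proof. apply Cmod_ge_0. Qed.

Lemma fc_le_amp f k : Rabs (fc f k) <= amp f k.
Proof.
  assert (H := amp_sqr f k). assert (H0 := amp_ge0 f k). assert (H1 := pow2_ge_0 (fs f k)).
  apply Rabs_le. split; nra.
Qed.

Lemma fs_le_amp f k : Rabs (fs f k) <= amp f k.
Proof.
  assert (H := amp_sqr f k). assert (H0 := amp_ge0 f k). assert (H1 := pow2_ge_0 (fc f k)).
  apply Rabs_le. split; nra.
Qed.

Lemma sqr_le_inv a b : 0 <= b -> a ^ 2 <= b ^ 2 -> a <= b.
Proof. intros Hb H. nra. Qed.

Lemma amp_le_sum f k : amp f k <= Rabs (fc f k) + Rabs (fs f k).
Proof.
  assert (H1 := Rabs_pos (fc f k)). assert (H2 := Rabs_pos (fs f k)).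
  apply sqr_le_inv; [lra|]. rewrite amp_sqr, <- (pow2_abs (fc f k)), <- (pow2_abs (fs f k)). nra.
Qed.

Lemma amp_plus f g k : cont f -> cont g -> amp (fun x => f x + g x) k <= amp f k + amp g k.
Proof.
  intros Hf Hg. unfold amp.
  replace (fourier (fun x => f x + g x) k) with (Cplus (fourier f k) (fourier g k)).
  - apply Cmod_triangle.
  - unfold fourier, Cplus; simpl.
    change (fun x => f x * cos (2 * PI * IZR k * x)) with (fun x => f x * cs k x).
    assert (H1 := fc_plus f g k Hf Hg). assert (H2 := fs_plus f g k Hf Hg).
    unfold fc, fs, cs, sn in *. f_equal; lra.
Qed.

Lemma amp_scal c f k : cont f -> amp (fun x => c * f x) k = Rabs c * amp f k.
Proof.
  intros Hf. assert (H1 := amp_ge0 f k). assert (H2 := amp_ge0 (fun x => c * f x) k).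
  assert (H3 := Rabs_pos c).
  assert (H : amp (fun x => c * f x) k ^ 2 = (Rabs c * amp f k) ^ 2).
  { rewrite Rpow_mult_distr, !amp_sqr, fc_scal, fs_scal, pow2_abs by auto. ring. }
  apply Rle_antisym; apply sqr_le_inv; nra.
Qed.

(** Square root of the Sobolev weight. With it [sob_weight] is the square of [hw * amp], the form
    required by Cauchy-Schwarz and Minkowski. *)
Definition hw (r : R) (k : Z) : R := Rpower (1 + IZR k ^ 2) (r / 2).

Lemma one_plus_sqr_pos k : 1 <= 1 + IZR k ^ 2.
Proof. assert (H := pow2_ge_0 (IZR k)). lra. Qed.

Lemma hw_pos r k : 0 < hw r k.
Proof. apply exp_pos. Qed.

Lemma hw_sqr r k : hw r k ^ 2 = Rpower (1 + IZR k ^ 2) r.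
Proof.
  unfold hw. rewrite <- Rsqr_pow2. unfold Rsqr. rewrite <- Rpower_plus. f_equal. field.
Qed.

Lemma hw_plus r t k : hw (r + t) k = hw r k * hw t k.
Proof. unfold hw. rewrite <- Rpower_plus. f_equal. field. Qed.

Lemma hw_opp r k : hw r k * hw (- r) k = 1.
Proof.
  rewrite <- hw_plus, Rplus_opp_r. unfold hw. unfold Rdiv. rewrite Rmult_0_l.
  apply Rpower_O. assert (H := one_plus_sqr_pos k). lra.
Qed.

Lemma hw_mono r t k : r <= t -> hw r k <= hw t k.
Proof.
  intros H. unfold hw. assert (H1 := one_plus_sqr_pos k).
  destruct (Req_dec (IZR k) 0) as [E|E].
  - rewrite E. replace (1 + 0 ^ 2) with 1 by ring. unfold Rpower. rewrite ln_1, !Rmult_0_r. lra.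
  - apply Rle_Rpower; lra.
Qed.

Lemma hw_one_sqr k : hw 1 k ^ 2 = 1 + IZR k ^ 2.
Proof. rewrite hw_sqr. apply Rpower_1. assert (H := one_plus_sqr_pos k). lra. Qed.

Lemma sob_weight_sqr r f k : sob_weight r f k = (hw r k * amp f k) ^ 2.
Proof. unfold sob_weight, amp. rewrite Rpow_mult_distr, hw_sqr. reflexivity. Qed.

Lemma sob_weight_ge0 r f k : 0 <= sob_weight r f k.
Proof. rewrite sob_weight_sqr. apply pow2_ge_0. Qed.

Lemma sob_term_zpair r f : sob_term r f = zpair (sob_weight r f).
Proof. reflexivity. Qed.

Lemma Hs_iff r f : Hs r f <-> cont f /\ periodic f /\ exists B, zbound (sob_weight r f) B.
Proof.
  unfold Hs. split.
  - intros (H1 & H2 & H3). repeat split; auto. eexists. apply zbound_of_series; [|exact H3].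
    apply sob_weight_ge0.
  - intros (H1 & H2 & B & H3). repeat split; auto.
    apply (series_of_zbound _ B); auto. apply sob_weight_ge0.
Qed.

Lemma Hs_cont r f : Hs r f -> cont f.
Proof. now intros (H & _). Qed.

Lemma Hs_periodic r f : Hs r f -> periodic f.
Proof. now intros (_ & H & _). Qed.

Lemma Hs_norm_ge0 r f : 0 <= Hs_norm r f.
Proof. apply sqrt_pos. Qed.

Lemma Hs_norm_zbound r f : Hs r f -> zbound (sob_weight r f) (Hs_norm r f ^ 2).
Proof.
  intros (_ & _ & H). unfold Hs_norm. rewrite pow2_sqrt.
  - apply zbound_of_series; auto. apply sob_weight_ge0.
  - apply Rle_trans with (sum_n (sob_term r f) 0).
    + rewrite sum_O, sob_term_zpair. apply zpair_ge0. apply sob_weight_ge0.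
    + apply sum_n_le_Series; auto. intros. apply zpair_ge0, sob_weight_ge0.
Qed.

Lemma Hs_intro r f B : cont f -> periodic f -> 0 <= B -> zbound (sob_weight r f) (B ^ 2) ->
  Hs r f /\ Hs_norm r f <= B.
Proof.
  intros Hf Hp HB HZ. split; [apply Hs_iff; eauto|].
  unfold Hs_norm. rewrite <- (sqrt_pow2 B) by auto. apply sqrt_le_1_alt.
  apply (series_of_zbound (sob_weight r f)); auto. apply sob_weight_ge0.
Qed.

Lemma Hs_norm_ext r f g : (forall x, f x = g x) -> Hs_norm r f = Hs_norm r g.
Proof. intros H. f_equal. now apply functional_extensionality. Qed.

Lemma lsum_minkowski {A} (x y : A -> R) l X Y : 0 <= X -> 0 <= Y ->
  lsum (fun a => x a ^ 2) l <= X ^ 2 -> lsum (fun a => y a ^ 2) l <= Y ^ 2 ->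
  lsum (fun a => (x a + y a) ^ 2) l <= (X + Y) ^ 2.
Proof.
  intros HX HY H1 H2. assert (H3 := lsum_cauchy_schwarz x y l).
  assert (H4 : lsum (fun a => x a * y a) l <= X * Y).
  { apply sqr_le_inv; [nra|]. eapply Rle_trans; [exact H3|]. rewrite Rpow_mult_distr.
    apply Rmult_le_compat; auto; apply lsum_ge0; intros; apply pow2_ge_0. }
  rewrite (lsum_ext _ (fun a => x a ^ 2 + (2 * (x a * y a) + y a ^ 2))) by (intros; ring).
  rewrite !lsum_plus, lsum_scal. nra.
Qed.

Lemma Hs_plus r f g : Hs r f -> Hs r g ->
  Hs r (fun x => f x + g x) /\ Hs_norm r (fun x => f x + g x) <= Hs_norm r f + Hs_norm r g.
Proof.
  intros Hf Hg. assert (H1 := Hs_norm_zbound r f Hf). assert (H2 := Hs_norm_zbound r g Hg).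
  assert (N1 := Hs_norm_ge0 r f). assert (N2 := Hs_norm_ge0 r g).
  assert (cf := Hs_cont r f Hf). assert (cg := Hs_cont r g Hg).
  apply Hs_intro; [cont| |lra|].
  - intros x. now rewrite (Hs_periodic r f Hf), (Hs_periodic r g Hg).
  - intros l Hl. eapply Rle_trans; [|apply (lsum_minkowski (fun k => hw r k * amp f k)
      (fun k => hw r k * amp g k) l (Hs_norm r f) (Hs_norm r g))]; auto.
    + apply lsum_le. intros k _. rewrite sob_weight_sqr. apply pow_incr.
      assert (H := hw_pos r k). assert (H0 := amp_ge0 (fun x => f x + g x) k).
      assert (H3 := amp_plus f g k cf cg). nra.
    + rewrite (lsum_ext _ (sob_weight r f)) by (intros; now rewrite sob_weight_sqr). auto.
    + rewrite (lsum_ext _ (sob_weight r g)) by (intros; now rewrite sob_weight_sqr). auto.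
Qed.

Lemma Hs_scal_le r c f : Hs r f ->
  Hs r (fun x => c * f x) /\ Hs_norm r (fun x => c * f x) <= Rabs c * Hs_norm r f.
Proof.
  intros Hf. assert (H1 := Hs_norm_zbound r f Hf). assert (N1 := Hs_norm_ge0 r f).
  assert (cf := Hs_cont r f Hf). assert (Hc := Rabs_pos c).
  apply Hs_intro; [cont| |nra|].
  - intros x. now rewrite (Hs_periodic r f Hf).
  - rewrite Rpow_mult_distr.
    apply zbound_le with (fun k => Rabs c ^ 2 * sob_weight r f k).
    + intros k. rewrite !sob_weight_sqr, amp_scal by auto. lra.
    + apply zbound_scal; auto. apply pow2_ge_0.
Qed.

Lemma Hs_scal r c f : Hs r f -> Hs r (fun x => c * f x).
Proof. intros H. now apply Hs_scal_le. Qed.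

Lemma Hs_norm_scal r c f : Hs r f -> Hs_norm r (fun x => c * f x) = Rabs c * Hs_norm r f.
Proof.
  intros Hf. apply Rle_antisym; [now apply Hs_scal_le|].
  destruct (Req_dec c 0) as [->|Hc].
  - rewrite Rabs_R0, Rmult_0_l. apply Hs_norm_ge0.
  - assert (H := proj2 (Hs_scal_le r (/ c) _ (Hs_scal r c f Hf))). cbv beta in H.
    rewrite (Hs_norm_ext r (fun x => / c * (c * f x)) f) in H by (intros; field; auto).
    apply Rmult_le_compat_l with (r := Rabs c) in H; [|apply Rabs_pos].
    rewrite <- Rmult_assoc, <- Rabs_mult, Rinv_r, Rabs_R1, Rmult_1_l in H; auto.
Qed.

Lemma Hs_minus r f g : Hs r f -> Hs r g -> Hs r (fun x => f x - g x).
Proof.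
  intros Hf Hg. assert (H := proj1 (Hs_plus r f _ Hf (Hs_scal r (-1) g Hg))).
  replace (fun x => f x - g x) with (fun x => f x + -1 * g x); auto.
  apply functional_extensionality; intros; ring.
Qed.

Lemma zbound_at_zero v : 0 <= v -> zbound (fun k => if Z.eq_dec k 0 then v else 0) v.
Proof.
  intros Hv l Hl. induction Hl as [|k l Hk Hl IH]; simpl; auto.
  destruct (Z.eq_dec k 0) as [->|]; [|lra].
  rewrite (lsum_ext _ (fun _ => 0)).
  - clear. assert (lsum (fun _ : Z => 0) l = 0) by (induction l; simpl; lra). lra.
  - intros j Hj. destruct (Z.eq_dec j 0); [subst; easy|auto].
Qed.

Lemma fc_const c k : fc (fun _ => c) k = if Z.eq_dec k 0 then c else 0.
Proof.
  unfold fc. rewrite RInt_scal_cont, RInt_cs by cont. destruct (Z.eq_dec k 0); ring.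
Qed.

Lemma fs_const c k : fs (fun _ => c) k = 0.
Proof. unfold fs. rewrite RInt_scal_cont, RInt_sn by cont. ring. Qed.

Lemma hw_0 r : hw r 0 = 1.
Proof.
  unfold hw, Rpower. replace (1 + 0 ^ 2) with 1 by ring. now rewrite ln_1, Rmult_0_r, exp_0.
Qed.

Lemma Hs_const r c : Hs r (fun _ => c) /\ Hs_norm r (fun _ => c) <= Rabs c.
Proof.
  apply Hs_intro; [cont|easy|apply Rabs_pos|].
  eapply zbound_le; [|apply zbound_at_zero, pow2_ge_0].
  intros k. rewrite sob_weight_sqr, Rpow_mult_distr, amp_sqr, fc_const, fs_const.
  destruct (Z.eq_dec k 0) as [->|].
  - rewrite hw_0, pow2_abs. lra.
  - lra.
Qed.

Lemma mean_le_norm r f : Hs r f -> Rabs (RInt f 0 1) <= Hs_norm r f.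
Proof.
  intros Hf. assert (H := zbound_term _ _ 0%Z (Hs_norm_zbound r f Hf)).
  rewrite sob_weight_sqr, hw_0, Rmult_1_l in H.
  rewrite <- fc_0. eapply Rle_trans; [apply fc_le_amp|].
  apply sqr_le_inv; auto. apply Hs_norm_ge0.
Qed.

Lemma Hs_mono r t f : r <= t -> Hs t f -> Hs r f.
Proof.
  intros Hrt Hf. apply Hs_iff. split; [now apply (Hs_cont t)|]. split; [now apply (Hs_periodic t)|].
  exists (Hs_norm t f ^ 2). eapply zbound_le; [|now apply Hs_norm_zbound].
  intros k. rewrite !sob_weight_sqr. apply pow_incr.
  assert (H1 := amp_ge0 f k). assert (H2 := hw_pos r k). assert (H3 := hw_mono r t k Hrt). nra.
Qed.

(** ** Summability of the coefficients *)

(** Discrete integral test: the right-hand sides telescope along [x, x + 1, ...]. The inequality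
    follows from [1 + t <= exp t] and [ln y <= y - 1]. *)
Lemma Rpower_telescope q x : 0 < q -> 0 < x ->
  q * Rpower (x + 1) (- (q + 1)) <= Rpower x (- q) - Rpower (x + 1) (- q).
Proof.
  intros Hq Hx.
  assert (E1 : Rpower (x + 1) (- (q + 1)) = Rpower (x + 1) (- q) * / (x + 1)).
  { replace (- (q + 1)) with (- q + - (1)) by ring.
    rewrite Rpower_plus, (Rpower_Ropp _ 1), Rpower_1 by lra. reflexivity. }
  assert (E2 : Rpower x (- q) = Rpower (x + 1) (- q) * Rpower ((x + 1) / x) q).
  { unfold Rdiv. rewrite <- Rpower_mult_distr by (try apply Rinv_0_lt_compat; lra).
    rewrite <- Rmult_assoc, <- Rpower_plus, Rplus_opp_l, Rpower_O, Rmult_1_l by lra.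
    unfold Rpower. rewrite ln_Rinv by auto. f_equal; ring. }
  rewrite E1, E2.
  assert (H0 : 0 < Rpower (x + 1) (- q)) by apply exp_pos.
  assert (H1 : 1 + q * / (x + 1) <= Rpower ((x + 1) / x) q).
  { unfold Rpower. eapply Rle_trans; [|apply exp_ineq1_le].
    assert (/ (x + 1) <= ln ((x + 1) / x)); [|nra].
    replace ((x + 1) / x) with (/ (x * / (x + 1))) by (field; lra).
    assert (0 < x * / (x + 1)) by (apply Rmult_lt_0_compat; auto; apply Rinv_0_lt_compat; lra).
    rewrite ln_Rinv by auto.
    assert (ln (x * / (x + 1)) <= x * / (x + 1) - 1).
    { assert (HH := exp_ineq1_le (ln (x * / (x + 1)))). rewrite exp_ln in HH by auto. lra. }
    assert (E : / (x + 1) = 1 - x * / (x + 1)) by (field; lra). lra. }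
  nra.
Qed.

Lemma weight_summable r : / 2 < r -> exists W, 0 < W /\ zbound (fun k => hw (- r) k ^ 2) W.
Proof.
  intros Hr. set (q := 2 * r - 1). assert (Hq : 0 < q) by (unfold q; lra).
  (* From [(x + 1)^2 <= 2 (1 + x^2)] the weight is at most [2^r (x + 1)^(-2r)], and [2r = q + 1] is
     the exponent of the telescoping bound, which costs the factor [1/q]. *)
  set (D := Rpower 2 r / q). set (T := fun n : nat => Rpower (INR (S n)) (- q)).
  assert (HD : 0 < D) by (apply Rdiv_lt_0_compat; [apply exp_pos|auto]).
  assert (Hterm : forall n k, IZR k ^ 2 = INR (S n) ^ 2 ->
    hw (- r) k ^ 2 <= D * (T n - T (S n))).
  { intros n k Hk. rewrite hw_sqr, Hk. set (x := INR (S n)).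
    assert (Hx : 1 <= x) by (unfold x; apply (le_INR 1); lia).
    assert (H1 := Rpower_telescope q x Hq ltac:(lra)).
    assert (HT : T n - T (S n) = Rpower x (- q) - Rpower (x + 1) (- q)).
    { unfold T, x. now rewrite (S_INR (S n)). }
    rewrite HT. apply Rle_trans with (D * (q * Rpower (x + 1) (- (q + 1)))).
    - replace (D * (q * Rpower (x + 1) (- (q + 1)))) with (Rpower 2 r * Rpower (x + 1) (- (q + 1)))
        by (unfold D; field; lra).
      replace (- (q + 1)) with (2 * - r) by (unfold q; ring).
      rewrite <- Rpower_mult.
      replace (Rpower (x + 1) 2) with ((x + 1) ^ 2).
      2: { replace 2 with (INR 2) by (simpl; ring). now rewrite Rpower_pow by lra. }
      rewrite (Rpower_Ropp (1 + x ^ 2)), (Rpower_Ropp ((x + 1) ^ 2)).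
      assert (P1 : 0 < Rpower (1 + x ^ 2) r) by apply exp_pos.
      assert (P2 : 0 < Rpower ((x + 1) ^ 2) r) by apply exp_pos.
      apply Rmult_le_reg_l with (Rpower (1 + x ^ 2) r); auto.
      rewrite Rinv_r by lra.
      apply Rmult_le_reg_r with (Rpower ((x + 1) ^ 2) r); auto.
      replace (Rpower (1 + x ^ 2) r * (Rpower 2 r * / Rpower ((x + 1) ^ 2) r)
        * Rpower ((x + 1) ^ 2) r) with (Rpower 2 r * Rpower (1 + x ^ 2) r) by (field; lra).
      rewrite Rmult_1_l, Rpower_mult_distr by nra.
      apply Rle_Rpower_l; [lra|]. nra.
    - apply Rmult_le_compat_l; lra. }
  exists (1 + 2 * D). split; [lra|].
  intros l Hl. destruct (zrange_exhausts l) as (n & Hn).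
  apply Rle_trans with (lsum (fun k => hw (- r) k ^ 2) (zrange n)).
  { apply lsum_incl; auto. intros; apply pow2_ge_0. }
  clear l Hl Hn. assert (HT0 : T O = 1).
  { unfold T. simpl. unfold Rpower. now rewrite ln_1, Rmult_0_r, exp_0. }
  assert (HTp : forall m, 0 < T m) by (intros; apply exp_pos).
  destruct n as [|n]; [simpl; lra|].
  (* The window [zrange (S n)] contains 0, the positive frequencies up to [n] and the negative ones
     down to [-n-1]; each of the two signs telescopes separately. *)
  apply Rle_trans with (1 + D * (1 - T n) + D * (1 - T (S n))).
  2: { assert (H1 := HTp n). assert (H2 := HTp (S n)). nra. }
  induction n as [|n IH].
  - simpl lsum. rewrite hw_0.
    assert (H := Hterm O (-1)%Z ltac:(simpl; ring)). rewrite HT0 in *.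
    change (IZR (- Z.of_nat 1)) with (-1). simpl in *. lra.
  - change (zrange (S (S n))) with (Z.of_nat (S n) :: (- Z.of_nat (S (S n)))%Z :: zrange (S n)).
    rewrite !lsum_cons.
    assert (H1 := Hterm n (Z.of_nat (S n)) ltac:(now rewrite <- INR_IZR_INZ)).
    assert (H2 := Hterm (S n) (- Z.of_nat (S (S n)))%Z
      ltac:(rewrite opp_IZR, <- INR_IZR_INZ; ring)).
    lra.
Qed.

(** Cauchy-Schwarz after inserting [hw (-r) * hw r = 1]: weighted square summability becomes
    absolute summability. This is the core of the Sobolev embedding. *)
Lemma weighted_summable r a W B : zbound (fun k => hw (- r) k ^ 2) W -> 0 < W -> 0 <= B ->
  zbound (fun k => (hw r k * a k) ^ 2) (B ^ 2) -> zbound a (sqrt W * B).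
Proof.
  intros HW HW0 HB Ha l Hl.
  assert (H := lsum_cauchy_schwarz (fun k => hw (- r) k) (fun k => hw r k * a k) l).
  rewrite (lsum_ext _ a) in H.
  2: { intros k _. rewrite <- Rmult_assoc, (Rmult_comm (hw (- r) k)), hw_opp. ring. }
  assert (HS := sqrt_pos W).
  apply sqr_le_inv; [nra|]. eapply Rle_trans; [exact H|].
  rewrite Rpow_mult_distr, pow2_sqrt by lra.
  apply Rmult_le_compat; try (apply lsum_ge0; intros; apply pow2_ge_0); [now apply HW|now apply Ha].
Qed.

Lemma amp_summable r : / 2 < r -> exists c, 0 < c /\ forall f, Hs r f ->
  zbound (amp f) (c * Hs_norm r f).
Proof.
  intros Hr. destruct (weight_summable r Hr) as (W & HW0 & HW).
  exists (sqrt W). split; [now apply sqrt_lt_R0|]. intros f Hf.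
  apply (weighted_summable r); auto; [apply Hs_norm_ge0|].
  eapply zbound_le; [|now apply Hs_norm_zbound]. intros k. rewrite sob_weight_sqr. lra.
Qed.

Lemma zbound_abs_coefs f S : zbound (amp f) S ->
  zbound (fun k => Rabs (fc f k) + Rabs (fs f k)) (2 * S).
Proof.
  intros H. eapply zbound_le; [|apply (zbound_scal 2 (amp f)); [lra|exact H]].
  intros k. assert (H1 := fc_le_amp f k). assert (H2 := fs_le_amp f k). simpl. lra.
Qed.

Lemma sobolev_sup r : / 2 < r -> exists c, 0 < c /\ forall f, Hs r f ->
  forall x, Rabs (f x) <= c * Hs_norm r f.
Proof.
  intros Hr. destruct (amp_summable r Hr) as (c & Hc & H). exists (2 * c). split; [lra|].
  intros f Hf x. rewrite Rmult_assoc.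
  apply fourier_sup; [now apply (Hs_cont r)|now apply (Hs_periodic r)|].
  apply zbound_abs_coefs. auto.
Qed.

Lemma Hs_norm_eq0 r f : / 2 < r -> Hs r f -> Hs_norm r f = 0 -> forall x, f x = 0.
Proof.
  intros Hr Hf H0 x. destruct (sobolev_sup r Hr) as (c & _ & H).
  specialize (H f Hf x). rewrite H0, Rmult_0_r in H.
  apply eq_of_Rabs_le. intros eps He. rewrite Rminus_0_r. lra.
Qed.

(** ** Products *)

(** Cauchy-Schwarz with the weight [x] divided evenly as [sqrt x] between the two factors. *)
Lemma lsum_weighted_jensen {A} (x y : A -> R) l :
  (forall a, 0 <= x a) ->
  lsum (fun a => x a * y a) l ^ 2 <= lsum x l * lsum (fun a => x a * y a ^ 2) l.
Proof.
  intros Hx. assert (H := lsum_cauchy_schwarz (fun a => sqrt (x a)) (fun a => sqrt (x a) * y a) l).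
  rewrite (lsum_ext (fun a => sqrt (x a) * (sqrt (x a) * y a)) (fun a => x a * y a)) in H.
  2: { intros a _. rewrite <- Rmult_assoc, sqrt_sqrt; auto. }
  rewrite (lsum_ext (fun a => sqrt (x a) ^ 2) x) in H.
  2: { intros a _. now apply pow2_sqrt. }
  rewrite (lsum_ext (fun a => (sqrt (x a) * y a) ^ 2) (fun a => x a * y a ^ 2)) in H; auto.
  intros a _. rewrite Rpow_mult_distr, pow2_sqrt; auto.
Qed.

Lemma NoDup_map_inj {A B} (h : A -> B) l :
  (forall a b, h a = h b -> a = b) -> NoDup l -> NoDup (map h l).
Proof. intros H. apply FinFun.Injective_map_NoDup. exact H. Qed.

(* Young's inequality [l^1 * l^2 -> l^2], in the two orders of the factors. *)
Lemma young_l (x y : Z -> R) (h : Z -> Z -> Z) S T l J :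
  (forall k, 0 <= x k) -> zbound x S -> zbound (fun k => y k ^ 2) T ->
  (forall j k k', h k j = h k' j -> k = k') -> NoDup l -> NoDup J ->
  lsum (fun k => lsum (fun j => x j * y (h k j)) J ^ 2) l <= S ^ 2 * T.
Proof.
  intros Hx HS HT Hh Hl HJ. assert (S0 := zbound_ge0 _ _ HS). assert (T0 := zbound_ge0 _ _ HT).
  apply Rle_trans with (lsum (fun k => S * lsum (fun j => x j * y (h k j) ^ 2) J) l).
  { apply lsum_le. intros k _.
    eapply Rle_trans; [apply (lsum_weighted_jensen x (fun j => y (h k j))); auto|].
    apply Rmult_le_compat_r; [|now apply HS].
    apply lsum_ge0. intros. apply Rmult_le_pos; auto. apply pow2_ge_0. }
  rewrite lsum_scal, lsum_exchange.
  rewrite (lsum_ext _ (fun j => x j * lsum (fun k => y (h k j) ^ 2) l))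
    by (intros; apply lsum_scal).
  apply Rle_trans with (S * lsum (fun j => T * x j) J).
  - apply Rmult_le_compat_l; auto. apply lsum_le. intros j _.
    rewrite Rmult_comm. apply Rmult_le_compat_r; auto.
    rewrite <- (lsum_map (fun k => y k ^ 2) (fun k => h k j)). apply HT.
    apply NoDup_map_inj; auto. intros; eapply Hh; eauto.
  - rewrite lsum_scal. specialize (HS J HJ).
    assert (H0 := lsum_ge0 x J Hx).
    replace (S ^ 2 * T) with (S * (T * S)) by ring.
    apply Rmult_le_compat_l; auto. now apply Rmult_le_compat_l.
Qed.

Lemma young_r (x y : Z -> R) (h : Z -> Z -> Z) S T l J :
  (forall k, 0 <= x k) -> zbound x S -> zbound (fun k => y k ^ 2) T ->
  (forall j k k', h k j = h k' j -> k = k') -> (forall k j j', h k j = h k j' -> j = j') ->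
  NoDup l -> NoDup J ->
  lsum (fun k => lsum (fun j => y j * x (h k j)) J ^ 2) l <= S ^ 2 * T.
Proof.
  intros Hx HS HT Hh Hh' Hl HJ. assert (S0 := zbound_ge0 _ _ HS). assert (T0 := zbound_ge0 _ _ HT).
  apply Rle_trans with (lsum (fun k => S * lsum (fun j => x (h k j) * y j ^ 2) J) l).
  { apply lsum_le. intros k _.
    rewrite (lsum_ext _ (fun j => x (h k j) * y j)) by (intros; ring).
    eapply Rle_trans; [apply (lsum_weighted_jensen (fun j => x (h k j)) y); auto|].
    apply Rmult_le_compat_r.
    - apply lsum_ge0. intros. apply Rmult_le_pos; auto. apply pow2_ge_0.
    - rewrite <- (lsum_map x (h k)). apply HS. apply NoDup_map_inj; auto.
      intros; eapply Hh'; eauto. }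
  rewrite lsum_scal, lsum_exchange.
  apply Rle_trans with (S * lsum (fun j => S * y j ^ 2) J).
  - apply Rmult_le_compat_l; auto. apply lsum_le. intros j _.
    rewrite (lsum_ext _ (fun k => y j ^ 2 * x (h k j))) by (intros; ring).
    rewrite lsum_scal, Rmult_comm. apply Rmult_le_compat_r; [apply pow2_ge_0|].
    rewrite <- (lsum_map x (fun k => h k j)). apply HS.
    apply NoDup_map_inj; auto. intros; eapply Hh; eauto.
  - rewrite lsum_scal. replace (S ^ 2 * T) with (S * (S * T)) by ring.
    apply Rmult_le_compat_l; auto. apply Rmult_le_compat_l; auto.
Qed.

(** The square of a sum is at most four times the square of the larger summand. So in a product all
    [r] derivatives can be charged to the factor of larger frequency. *)
Lemma hw_subadd r j k : 0 <= r -> hw r (j + k) <= Rpower 4 (r / 2) * (hw r j + hw r k).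
Proof.
  intros Hr.
  assert (H : forall a b, IZR a ^ 2 <= IZR b ^ 2 -> hw r (a + b) <= Rpower 4 (r / 2) * hw r b).
  { intros a b Hab. unfold hw. rewrite Rpower_mult_distr; [|lra|assert (H := one_plus_sqr_pos b); lra].
    apply Rle_Rpower_l; [lra|]. assert (H := one_plus_sqr_pos (a + b)). split; [lra|].
    rewrite plus_IZR. nra. }
  assert (P := exp_pos (r / 2 * ln 4)). change (exp (r / 2 * ln 4)) with (Rpower 4 (r / 2)) in P.
  assert (H1 := hw_pos r j). assert (H2 := hw_pos r k).
  destruct (Rle_dec (IZR j ^ 2) (IZR k ^ 2)) as [Hjk|Hjk].
  - specialize (H j k Hjk). nra.
  - specialize (H k j ltac:(lra)). rewrite Z.add_comm. nra.
Qed.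

(** Convolution bound in real form: the product-to-sum formulas yield both frequencies [k - j] and
    [k + j]. The first factor is a partial sum, so that only finite sums are exchanged with
    integrals. *)
Lemma coef_product_le (f g : R -> R) n k : cont g ->
  Rabs (fc (fun x => trig_sum (fc f) (fs f) n x * g x) k)
    <= lsum (fun j => amp f j * (amp g (k - j) + amp g (k + j))) (zrange n) /\
  Rabs (fs (fun x => trig_sum (fc f) (fs f) n x * g x) k)
    <= lsum (fun j => amp f j * (amp g (k - j) + amp g (k + j))) (zrange n).
Proof.
  intros Hg.
  assert (Hmix : forall j a b u v, Rabs a <= amp f j -> Rabs b <= amp f j ->
    Rabs u <= / 2 * (amp g (k - j) + amp g (k + j)) ->
    Rabs v <= / 2 * (amp g (k - j) + amp g (k + j)) ->
    Rabs (a * u + b * v) <= amp f j * (amp g (k - j) + amp g (k + j))).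
  { intros j a b u v Ha Hb Hu Hv. eapply Rle_trans; [apply Rabs_triang|].
    rewrite !Rabs_mult.
    assert (A1 := Rabs_pos a). assert (A2 := Rabs_pos b).
    assert (A3 := Rabs_pos u). assert (A4 := Rabs_pos v).
    assert (Rabs a * Rabs u <= amp f j * (/ 2 * (amp g (k - j) + amp g (k + j))))
      by now apply Rmult_le_compat.
    assert (Rabs b * Rabs v <= amp f j * (/ 2 * (amp g (k - j) + amp g (k + j))))
      by now apply Rmult_le_compat.
    lra. }
  assert (Hhalf : forall a b X Y, Rabs a <= X -> Rabs b <= Y ->
    Rabs (/ 2 * (a + b)) <= / 2 * (X + Y) /\ Rabs (/ 2 * (a - b)) <= / 2 * (X + Y)
    /\ Rabs (/ 2 * (b - a)) <= / 2 * (X + Y)).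
  { intros a b X Y HX HY. apply Rabs_le_between in HX. apply Rabs_le_between in HY.
    repeat split; apply Rabs_le; lra. }
  assert (Hterm : forall j,
    fc (fun x => (fc f j * cs j x + fs f j * sn j x) * g x) k
    = fc f j * (/ 2 * (fc g (k - j) + fc g (k + j)))
      + fs f j * (/ 2 * (fs g (k + j) - fs g (k - j)))
    /\ fs (fun x => (fc f j * cs j x + fs f j * sn j x) * g x) k
    = fc f j * (/ 2 * (fs g (k - j) + fs g (k + j)))
      + fs f j * (/ 2 * (fc g (k - j) - fc g (k + j)))).
  { intros j. set (a := fc f j). set (b := fs f j). unfold fc, fs.
    rewrite <- !RInt_plus_cont, <- !RInt_minus_cont, <- !RInt_scal_cont, <- !RInt_plus_cont by cont.
    split; apply RInt_ext_all; intros x; rewrite cs_plus, cs_minus, sn_plus, sn_minus; field. }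
  assert (Hsum : (fun x => trig_sum (fc f) (fs f) n x * g x)
      = (fun x => lsum (fun j => (fc f j * cs j x + fs f j * sn j x) * g x) (zrange n))).
  { apply functional_extensionality; intros x. unfold trig_sum.
    induction (zrange n) as [|a l IH]; simpl; [ring|rewrite <- IH; ring]. }
  split.
  - rewrite Hsum.
    rewrite (fc_lsum (fun j x => (fc f j * cs j x + fs f j * sn j x) * g x)) by (intros; cont).
    eapply Rle_trans; [apply lsum_abs|]. apply lsum_le. intros j _.
    rewrite (proj1 (Hterm j)).
    apply Hmix; [apply fc_le_amp|apply fs_le_amp| |].
    + exact (proj1 (Hhalf _ _ _ _ (fc_le_amp g (k - j)) (fc_le_amp g (k + j)))).
    + exact (proj2 (proj2 (Hhalf _ _ _ _ (fs_le_amp g (k - j)) (fs_le_amp g (k + j))))).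
  - rewrite Hsum.
    rewrite (fs_lsum (fun j x => (fc f j * cs j x + fs f j * sn j x) * g x)) by (intros; cont).
    eapply Rle_trans; [apply lsum_abs|]. apply lsum_le. intros j _.
    rewrite (proj2 (Hterm j)).
    apply Hmix; [apply fc_le_amp|apply fs_le_amp| |].
    + exact (proj1 (Hhalf _ _ _ _ (fs_le_amp g (k - j)) (fs_le_amp g (k + j)))).
    + exact (proj1 (proj2 (Hhalf _ _ _ _ (fc_le_amp g (k - j)) (fc_le_amp g (k + j))))).
Qed.

(** The series of [f] converges uniformly and [g] is bounded, so truncating [f] changes every
    coefficient of the product by at most [eps], with [n0] independent of [k]. *)
Lemma amp_product_le f g S : cont f -> cont g -> periodic f -> periodic g -> zbound (amp f) S ->
  forall eps, 0 < eps -> exists n0, forall n k, (n0 <= n)%nat ->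
  amp (fun x => f x * g x) k <=
    eps + 2 * lsum (fun j => amp f j * (amp g (k - j) + amp g (k + j))) (zrange n).
Proof.
  intros Hf Hg Pf Pg HS eps He.
  destruct (periodic_bounded g Hg Pg) as (M & HM).
  assert (M0 : 0 <= M) by (eapply Rle_trans; [apply Rabs_pos|apply (HM 0)]).
  destruct (fourier_inversion f (2 * S) Hf Pf (zbound_abs_coefs f S HS) (eps / (2 * (M + 1))))
    as (n0 & Hn0); [apply Rdiv_lt_0_compat; lra|].
  exists n0. intros n k Hn.
  assert (Ct := cont_trig_sum (fc f) (fs f) n).
  set (t := trig_sum (fc f) (fs f) n) in *.
  assert (Hd : forall x, 0 <= x <= 1 -> Rabs ((f x - t x) * g x) <= eps / 2).
  { intros x _. rewrite Rabs_mult. replace (eps / 2) with (eps / (2 * (M + 1)) * (M + 1)) by (field; lra).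
    apply Rmult_le_compat; try apply Rabs_pos; [apply Hn0; auto|]. specialize (HM x). lra. }
  destruct (coef_product_le f g n k Hg) as (H1 & H2). fold t in H1, H2.
  assert (Cd : cont (fun x => (f x - t x) * g x)) by cont.
  assert (H3 := fc_abs_le _ k _ Cd Hd). assert (H4 := fs_abs_le _ k _ Cd Hd).
  assert (E1 : fc (fun x => f x * g x) k
    = fc (fun x => (f x - t x) * g x) k + fc (fun x => t x * g x) k).
  { rewrite <- fc_plus by cont. apply RInt_ext_all. intros; ring. }
  assert (E2 : fs (fun x => f x * g x) k
    = fs (fun x => (f x - t x) * g x) k + fs (fun x => t x * g x) k).
  { rewrite <- fs_plus by cont. apply RInt_ext_all. intros; ring. }
  eapply Rle_trans; [apply amp_le_sum|]. rewrite E1, E2.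
  assert (T1 := Rabs_triang (fc (fun x => (f x - t x) * g x) k) (fc (fun x => t x * g x) k)).
  assert (T2 := Rabs_triang (fs (fun x => (f x - t x) * g x) k) (fs (fun x => t x * g x) k)).
  lra.
Qed.

(** Because [J] is chosen before [k], the four sums are convolutions over one fixed index set, as
    Young's inequality requires. In each of them a single factor carries the weight. *)
Lemma hw_amp_product_le r f g S : 0 <= r -> cont f -> cont g -> periodic f -> periodic g ->
  zbound (amp f) S ->
  forall eps, 0 < eps -> exists J, NoDup J /\ forall k,
  hw r k * amp (fun x => f x * g x) k <= eps * hw r k +
    2 * Rpower 4 (r / 2) *
    (lsum (fun j => hw r j * amp f j * amp g (k - j)) J
     + lsum (fun j => amp f j * (hw r (k - j) * amp g (k - j))) J
     + lsum (fun j => hw r j * amp f j * amp g (k + j)) J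
     + lsum (fun j => amp f j * (hw r (k + j) * amp g (k + j))) J).
Proof.
  intros Hr Hf Hg Pf Pg HS eps He.
  destruct (amp_product_le f g S Hf Hg Pf Pg HS eps He) as (n & Hn).
  exists (zrange n). split; [apply zrange_NoDup|]. intros k. specialize (Hn n k (le_n _)).
  assert (Hk := hw_pos r k).
  apply Rle_trans with (hw r k * (eps + 2 * lsum (fun j => amp f j * (amp g (k - j) + amp g (k + j)))
    (zrange n))); [apply Rmult_le_compat_l; lra|].
  set (P := Rpower 4 (r / 2)).
  assert (HP : 0 < P) by apply exp_pos.
  rewrite <- !lsum_plus.
  rewrite Rmult_plus_distr_l, (Rmult_comm _ eps). apply Rplus_le_compat_l.
  rewrite Rmult_assoc. rewrite <- Rmult_assoc, (Rmult_comm (hw r k)), Rmult_assoc.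
  apply Rmult_le_compat_l; [lra|]. rewrite <- !lsum_scal. apply lsum_le. intros j _.
  assert (A := amp_ge0 f j). assert (G1 := amp_ge0 g (k - j)). assert (G2 := amp_ge0 g (k + j)).
  assert (W1 : hw r k <= P * (hw r j + hw r (k - j))).
  { replace k with (j + (k - j))%Z at 1 by ring. now apply hw_subadd. }
  assert (W2 : hw r k <= P * (hw r j + hw r (k + j))).
  { replace k with ((- j) + (k + j))%Z at 1 by ring.
    replace (hw r j) with (hw r (- j)); [now apply hw_subadd|].
    unfold hw. rewrite opp_IZR. do 2 f_equal. ring. }
  assert (B1 : 0 <= amp f j * amp g (k - j)) by now apply Rmult_le_pos.
  assert (B2 : 0 <= amp f j * amp g (k + j)) by now apply Rmult_le_pos.
  apply (Rmult_le_compat_r _ _ _ B1) in W1. apply (Rmult_le_compat_r _ _ _ B2) in W2.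
  lra.
Qed.

Lemma sqr_sum5 a b c d e : (a + b + c + d + e) ^ 2 <= 5 * (a ^ 2 + b ^ 2 + c ^ 2 + d ^ 2 + e ^ 2).
Proof.
  assert (H1 := pow2_ge_0 (a - b)). assert (H2 := pow2_ge_0 (a - c)).
  assert (H3 := pow2_ge_0 (a - d)). assert (H4 := pow2_ge_0 (a - e)).
  assert (H5 := pow2_ge_0 (b - c)). assert (H6 := pow2_ge_0 (b - d)).
  assert (H7 := pow2_ge_0 (b - e)). assert (H8 := pow2_ge_0 (c - d)).
  assert (H9 := pow2_ge_0 (c - e)). assert (H10 := pow2_ge_0 (d - e)). nra.
Qed.

Lemma Hs_mult r : / 2 < r -> exists C, 0 < C /\ forall f g, Hs r f -> Hs r g ->
  Hs r (fun x => f x * g x) /\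
  Hs_norm r (fun x => f x * g x) <= C * Hs_norm r f * Hs_norm r g.
Proof.
  intros Hr. destruct (amp_summable r Hr) as (c & Hc & Hamp).
  set (P := Rpower 4 (r / 2)). assert (HP : 0 < P) by apply exp_pos.
  exists (9 * P * c). split; [repeat apply Rmult_lt_0_compat; lra|].
  intros f g Hf Hg.
  assert (Cf := Hs_cont r f Hf). assert (Cg := Hs_cont r g Hg).
  assert (Pf := Hs_periodic r f Hf). assert (Pg := Hs_periodic r g Hg).
  assert (N1 := Hs_norm_ge0 r f). assert (N2 := Hs_norm_ge0 r g).
  assert (Z1 := Hs_norm_zbound r f Hf). assert (Z2 := Hs_norm_zbound r g Hg).
  assert (S1 := Hamp f Hf). assert (S2 := Hamp g Hg).
  set (nf := Hs_norm r f) in *. set (ng := Hs_norm r g) in *.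
  assert (Z1' : zbound (fun k => (hw r k * amp f k) ^ 2) (nf ^ 2)).
  { eapply zbound_le; [|exact Z1]. intros; rewrite sob_weight_sqr; lra. }
  assert (Z2' : zbound (fun k => (hw r k * amp g k) ^ 2) (ng ^ 2)).
  { eapply zbound_le; [|exact Z2]. intros; rewrite sob_weight_sqr; lra. }
  apply Hs_intro.
  - cont.
  - intros x. now rewrite Pf, Pg.
  - repeat apply Rmult_le_pos; lra.
  - intros l Hl.
    (* [80 = 5 * 4 * 4]: the square of a sum of five terms, the square of [2 P], and four
       convolutions. It is rounded up to the square of 9. *)
    apply Rle_trans with (80 * (P * c * nf * ng) ^ 2).
    2: { assert (H := pow2_ge_0 (P * c * nf * ng)). lra. }
    apply le_epsilon. intros e He.
    set (W := lsum (fun k => hw r k ^ 2) l).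
    assert (HW : 0 <= W) by (apply lsum_ge0; intros; apply pow2_ge_0).
    (* The list [l] is fixed, so [W] is a finite number and the truncation errors on [l] add up to
       at most [e]; [eps <= 1] gives [eps^2 <= eps]. *)
    set (eps := Rmin 1 (e / (5 * W + 1))).
    assert (He1 : 0 < eps /\ eps <= 1 /\ eps <= e / (5 * W + 1)).
    { assert (0 < e / (5 * W + 1)) by (apply Rdiv_lt_0_compat; lra).
      unfold eps, Rmin. destruct Rle_dec; lra. }
    destruct He1 as (He0 & He1 & He2).
    assert (Heps : 5 * (eps ^ 2 * W) <= e).
    { assert (eps * (5 * W + 1) <= e).
      { apply Rmult_le_compat_r with (r := 5 * W + 1) in He2; [|lra].
        unfold Rdiv in He2. rewrite Rmult_assoc, Rinv_l in He2 by lra. lra. }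
      assert (eps ^ 2 <= eps) by nra.
      assert (eps ^ 2 * W <= eps * W) by now apply Rmult_le_compat_r.
      lra. }
    destruct (hw_amp_product_le r f g _ ltac:(lra) Cf Cg Pf Pg S1 eps He0) as (J & HJ & HB).
    fold P in HB.
    set (u1 := fun k => lsum (fun j => hw r j * amp f j * amp g (k - j)) J).
    set (u2 := fun k => lsum (fun j => amp f j * (hw r (k - j) * amp g (k - j))) J).
    set (u3 := fun k => lsum (fun j => hw r j * amp f j * amp g (k + j)) J).
    set (u4 := fun k => lsum (fun j => amp f j * (hw r (k + j) * amp g (k + j))) J).
    assert (U1 : lsum (fun k => u1 k ^ 2) l <= (c * ng) ^ 2 * nf ^ 2).
    { apply (young_r (amp g) (fun j => hw r j * amp f j) (fun k j => (k - j)%Z)); auto;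
        try (intros; lia). apply amp_ge0. }
    assert (U3 : lsum (fun k => u3 k ^ 2) l <= (c * ng) ^ 2 * nf ^ 2).
    { apply (young_r (amp g) (fun j => hw r j * amp f j) (fun k j => (k + j)%Z)); auto;
        try (intros; lia). apply amp_ge0. }
    assert (U2 : lsum (fun k => u2 k ^ 2) l <= (c * nf) ^ 2 * ng ^ 2).
    { apply (young_l (amp f) (fun j => hw r j * amp g j) (fun k j => (k - j)%Z)); auto;
        try (intros; lia). apply amp_ge0. }
    assert (U4 : lsum (fun k => u4 k ^ 2) l <= (c * nf) ^ 2 * ng ^ 2).
    { apply (young_l (amp f) (fun j => hw r j * amp g j) (fun k j => (k + j)%Z)); auto;
        try (intros; lia). apply amp_ge0. }
    apply Rle_trans with (lsum (fun k => 5 * (eps ^ 2 * hw r k ^ 2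
      + (2 * P) ^ 2 * (u1 k ^ 2 + (u2 k ^ 2 + (u3 k ^ 2 + u4 k ^ 2))))) l).
    + apply lsum_le. intros k _. rewrite sob_weight_sqr.
      apply Rle_trans with ((eps * hw r k + 2 * P * u1 k + 2 * P * u2 k + 2 * P * u3 k
        + 2 * P * u4 k) ^ 2).
      * apply pow_incr. split.
        { apply Rmult_le_pos; [left; apply hw_pos|apply amp_ge0]. }
        { specialize (HB k). fold (u1 k) (u2 k) (u3 k) (u4 k) in HB. lra. }
      * eapply Rle_trans; [apply sqr_sum5|]. right. ring.
    + rewrite lsum_scal, lsum_plus, !lsum_scal, !lsum_plus. fold W.
      replace (80 * (P * c * nf * ng) ^ 2)
        with (5 * ((2 * P) ^ 2 * ((c * ng) ^ 2 * nf ^ 2 + ((c * nf) ^ 2 * ng ^ 2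
               + ((c * ng) ^ 2 * nf ^ 2 + (c * nf) ^ 2 * ng ^ 2))))) by ring.
      assert (HPP : 0 <= (2 * P) ^ 2) by apply pow2_ge_0.
      assert ((2 * P) ^ 2 * (lsum (fun k => u1 k ^ 2) l + (lsum (fun k => u2 k ^ 2) l
        + (lsum (fun k => u3 k ^ 2) l + lsum (fun k => u4 k ^ 2) l)))
        <= (2 * P) ^ 2 * ((c * ng) ^ 2 * nf ^ 2 + ((c * nf) ^ 2 * ng ^ 2
               + ((c * ng) ^ 2 * nf ^ 2 + (c * nf) ^ 2 * ng ^ 2)))).
      { apply Rmult_le_compat_l; auto. lra. }
      lra.
Qed.

(** ** Derivatives and primitives *)

Lemma amp_derive f f' k : (forall x, is_derive f x (f' x)) -> cont f' -> periodic f ->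
  amp f' k = 2 * PI * Rabs (IZR k) * amp f k.
Proof.
  intros Hd Hc Hp. assert (HP := PI_RGT_0).
  assert (H : amp f' k ^ 2 = (2 * PI * Rabs (IZR k) * amp f k) ^ 2).
  { rewrite !Rpow_mult_distr, !amp_sqr, pow2_abs, (fc_derive f f'), (fs_derive f f') by auto. ring. }
  assert (H0 := amp_ge0 f' k). assert (H1 := amp_ge0 f k). assert (H2 := Rabs_pos (IZR k)).
  assert (0 <= 2 * PI * Rabs (IZR k) * amp f k) by (apply Rmult_le_pos; [apply Rmult_le_pos; lra|lra]).
  apply Rle_antisym; apply sqr_le_inv; lra.
Qed.

Lemma abs_le_hw_one k : Rabs (IZR k) <= hw 1 k.
Proof.
  apply sqr_le_inv; [left; apply hw_pos|]. rewrite pow2_abs, hw_one_sqr. lra.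
Qed.

(** One derivative is spent on the factor [k] and the remaining [r > 1/2] on absolute summability,
    so the differentiated series converges uniformly. *)
Lemma Hs_derivable r f : / 2 < r -> Hs (r + 1) f ->
  (forall x, is_derive f x (Derive f x)) /\ Hs r (Derive f) /\
  Hs_norm r (Derive f) <= 2 * PI * Hs_norm (r + 1) f.
Proof.
  intros Hr Hf. assert (HP := PI_RGT_0).
  assert (Cf := Hs_cont _ f Hf). assert (Pf := Hs_periodic _ f Hf).
  destruct (weight_summable r Hr) as (W & HW0 & HW).
  assert (Hsum : zbound (fun k => Rabs (IZR k) * amp f k) (sqrt W * Hs_norm (r + 1) f)).
  { apply (weighted_summable r); auto; [apply Hs_norm_ge0|].
    eapply zbound_le; [|now apply Hs_norm_zbound].
    intros k. rewrite sob_weight_sqr, hw_plus.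
    assert (H1 := hw_pos r k). assert (H2 := amp_ge0 f k). assert (H3 := Rabs_pos (IZR k)).
    assert (H4 := abs_le_hw_one k). apply pow_incr. split.
    - repeat apply Rmult_le_pos; lra.
    - rewrite Rmult_assoc. apply Rmult_le_compat_l; [lra|]. apply Rmult_le_compat_r; auto. }
  assert (Hsum' : zbound (fun k => Rabs (2 * PI * IZR k * fs f k) + Rabs (2 * PI * IZR k * fc f k))
    (4 * PI * (sqrt W * Hs_norm (r + 1) f))).
  { eapply zbound_le; [|apply (zbound_scal (4 * PI)); [|exact Hsum]; lra].
    intros k. rewrite !Rabs_mult, (Rabs_pos_eq 2), (Rabs_pos_eq PI) by lra.
    assert (H1 := fc_le_amp f k). assert (H2 := fs_le_amp f k). assert (H3 := Rabs_pos (IZR k)).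
    assert (2 * PI * Rabs (IZR k) * Rabs (fs f k) <= 2 * PI * Rabs (IZR k) * amp f k)
      by (apply Rmult_le_compat_l; auto; apply Rmult_le_pos; lra).
    assert (2 * PI * Rabs (IZR k) * Rabs (fc f k) <= 2 * PI * Rabs (IZR k) * amp f k)
      by (apply Rmult_le_compat_l; auto; apply Rmult_le_pos; lra).
    lra. }
  destruct (derivative_of_summable f _ Cf Pf Hsum') as (g & Cg & Pg & Hd).
  assert (E : Derive f = g).
  { apply functional_extensionality. intros x. now apply is_derive_unique. }
  rewrite E. split; auto.
  apply Hs_intro; auto.
  - assert (N := Hs_norm_ge0 (r + 1) f). nra.
  - rewrite Rpow_mult_distr.
    eapply zbound_le; [|apply zbound_scal; [apply pow2_ge_0|now apply Hs_norm_zbound]].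
    intros k. cbv beta. rewrite !sob_weight_sqr, (amp_derive f g), hw_plus by auto.
    rewrite !Rpow_mult_distr, pow2_abs, hw_one_sqr.
    assert (0 <= hw r k ^ 2 * amp f k ^ 2 * (2 ^ 2 * PI ^ 2)).
    { apply Rmult_le_pos; [apply Rmult_le_pos; apply pow2_ge_0|].
      apply Rmult_le_pos; apply pow2_ge_0. }
    lra.
Qed.

(** For [k <> 0] one has [1 + k^2 <= (2 pi k)^2], so the weight of [f] is controlled by that of
    [f']. Only frequency 0 escapes, and the bound [M] accounts for it. *)
Lemma Hs_of_derivative r f f' : (forall x, is_derive f x (f' x)) -> periodic f -> Hs r f' ->
  Hs (r + 1) f /\
  forall M, (forall x, 0 <= x <= 1 -> Rabs (f x) <= M) ->
    Hs_norm (r + 1) f <= Hs_norm r f' + M.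
Proof.
  intros Hd Hp Hf'. assert (HP := PI_RGT_0). assert (HP2 := PI2_1).
  assert (Cf' := Hs_cont r f' Hf').
  assert (Cf : cont f) by (apply cont_derivable; intros x; now exists (f' x)).
  assert (Hw : forall k, sob_weight (r + 1) f k
    <= sob_weight r f' k + (if Z.eq_dec k 0 then amp f 0 ^ 2 else 0)).
  { intros k. rewrite !sob_weight_sqr. destruct (Z.eq_dec k 0) as [->|Hk].
    - rewrite !hw_0. assert (H := pow2_ge_0 (1 * amp f' 0)). lra.
    - rewrite (amp_derive f f'), hw_plus by auto.
      rewrite !Rpow_mult_distr, pow2_abs, hw_one_sqr.
      assert (1 <= IZR k ^ 2).
      { rewrite <- (pow2_abs (IZR k)), <- abs_IZR. assert (H : 1 <= IZR (Z.abs k)).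
        { apply IZR_le. lia. } nra. }
      assert (1 <= PI ^ 2) by nra.
      assert (0 <= (PI ^ 2 - 1) * IZR k ^ 2) by (apply Rmult_le_pos; lra).
      assert (Hk1 : 1 + IZR k ^ 2 <= 2 ^ 2 * PI ^ 2 * IZR k ^ 2) by lra.
      assert (0 <= hw r k ^ 2 * amp f k ^ 2)
        by (apply Rmult_le_pos; apply pow2_ge_0).
      apply Rmult_le_compat_l with (r := hw r k ^ 2 * amp f k ^ 2) in Hk1; auto.
      lra. }
  assert (Hz : zbound (sob_weight (r + 1) f) (Hs_norm r f' ^ 2 + amp f 0 ^ 2)).
  { eapply zbound_le; [exact Hw|]. apply zbound_plus; [now apply Hs_norm_zbound|].
    apply zbound_at_zero, pow2_ge_0. }
  split; [apply Hs_iff; eauto|].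
  intros M HM. assert (N := Hs_norm_ge0 r f').
  assert (M0 : 0 <= M) by (eapply Rle_trans; [apply Rabs_pos|apply (HM 0); lra]).
  apply Hs_intro; auto; [lra|]. eapply zbound_mono; [|exact Hz].
  rewrite amp_sqr, fs_0, <- (pow2_abs (fc f 0)).
  assert (H1 := fc_abs_le f 0 M Cf HM). assert (H2 := Rabs_pos (fc f 0)). nra.
Qed.

(** The mean is removed so that the primitive is periodic for every periodic [f], which makes the
    operation a linear map into [H^(r+1)]. *)
Definition prim (f : R -> R) (x : R) : R := RInt (fun y => f y - RInt f 0 1) 0 x.

Lemma prim_0 f : prim f 0 = 0.
Proof. apply (RInt_point (V := R_CompleteNormedModule)). Qed.

Lemma is_derive_prim f x : cont f -> is_derive (prim f) x (f x - RInt f 0 1).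
Proof.
  intros Hf. apply (is_derive_primitive (fun y => f y - RInt f 0 1)). cont.
Qed.

Lemma prim_periodic f : cont f -> periodic f -> periodic (prim f).
Proof.
  intros Hf Pf. apply primitive_periodic.
  - cont.
  - intros x. now rewrite Pf.
  - rewrite RInt_minus_cont, RInt_const_R by cont. rring.
Qed.

Lemma Hs_prim r : / 2 < r -> exists C, 0 < C /\ forall f, Hs r f ->
  Hs (r + 1) (prim f) /\ Hs_norm (r + 1) (prim f) <= C * Hs_norm r f.
Proof.
  intros Hr. destruct (sobolev_sup r Hr) as (c & Hc & Hsup).
  (* Removing the mean at most doubles the norm; this is paid once in [H^r] and once in the sup
     bound for the primitive on [0, 1]. *)
  exists (2 + 2 * c). split; [lra|]. intros f Hf.
  assert (Cf := Hs_cont r f Hf). assert (Pf := Hs_periodic r f Hf).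
  set (m := RInt f 0 1).
  assert (Hm : Rabs m <= Hs_norm r f) by now apply mean_le_norm.
  assert (N := Hs_norm_ge0 r f).
  destruct (Hs_const r (- m)) as (K1 & K2). rewrite Rabs_Ropp in K2.
  destruct (Hs_plus r f (fun _ => - m) Hf K1) as (K3 & K4).
  change (Hs r (fun x => f x - m)) in K3.
  change (Hs_norm r (fun x => f x - m) <= Hs_norm r f + Hs_norm r (fun _ => - m)) in K4.
  assert (cN : 0 <= c * Hs_norm r f) by (apply Rmult_le_pos; lra).
  set (g := fun x : R => f x - m) in *.
  destruct (Hs_of_derivative r (prim f) g) as (H1 & H2); auto.
  { intros x. now apply is_derive_prim. }
  { now apply prim_periodic. }
  split; auto. eapply Rle_trans; [apply (H2 (c * (2 * Hs_norm r f)))|lra].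
  intros x Hx. unfold prim. fold m. fold g.
  assert (Cd : cont g) by (unfold g; cont).
  eapply Rle_trans; [apply (abs_RInt_le_const g 0 x (c * (2 * Hs_norm r f)))|].
  - lra.
  - now apply cont_ex_RInt.
  - intros t _. eapply Rle_trans; [now apply Hsup|].
    apply Rmult_le_compat_l; [lra|]. eapply Rle_trans; [exact K4|]. lra.
  - assert (0 <= c * (2 * Hs_norm r f)) by lra.
    rewrite <- (Rmult_1_l (c * _)) at 2. apply Rmult_le_compat_r; lra.
Qed.

(** ** Reciprocals *)

Lemma Hs_one_of_C1 f f' : (forall x, is_derive f x (f' x)) -> cont f' -> periodic f ->
  periodic f' -> Hs 1 f.
Proof.
  intros Hd Cf' Pf Pf'.
  assert (H0 : Hs 0 f').
  { apply Hs_iff. split; [auto|split; [auto|]]. eexists.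
    eapply zbound_le; [|apply (bessel f' Cf')].
    intros k. cbv beta. rewrite sob_weight_sqr, Rpow_mult_distr, amp_sqr, hw_sqr, Rpower_O.
    - lra.
    - assert (H := one_plus_sqr_pos k). lra. }
  replace 1 with (0 + 1) by ring. now apply (Hs_of_derivative 0 f f').
Qed.

(* Bootstrapping on [(1/f)' = - f' / f^2]: each step gains one derivative, up to
   the regularity of [f]; the start is [H^1], from Bessel's inequality. *)
Lemma Hs_inv r f : 3 / 2 < r -> Hs r f -> (forall x, f x <> 0) -> Hs r (fun x => / f x).
Proof.
  intros Hr Hf H0. assert (Cf := Hs_cont r f Hf). assert (Pf := Hs_periodic r f Hf).
  destruct (Hs_derivable (r - 1) f) as (Hd & Hf' & _); [lra| |].
  { now replace (r - 1 + 1) with r by ring. }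
  assert (Cf' := Hs_cont _ _ Hf'). assert (Pf' := Hs_periodic _ _ Hf').
  assert (Ci := cont_inv f Cf H0).
  assert (Pi : periodic (fun x => / f x)) by (intros x; now rewrite Pf).
  assert (Hdi : forall x, is_derive (fun x => / f x) x (-1 * Derive f x * (/ f x * / f x))).
  { intros x. assert (H := is_derive_inv f x _ (Hd x) (H0 x)).
    replace (-1 * Derive f x * (/ f x * / f x)) with (- Derive f x / f x ^ 2) by (field; auto).
    exact H. }
  assert (Hstep : forall n : nat, Hs (Rmin r (1 + INR n)) (fun x => / f x)).
  { induction n as [|n IH].
    - apply Hs_mono with 1; [eapply Rle_trans; [apply Rmin_r|simpl; lra]|].
      apply Hs_one_of_C1 with (1 := Hdi); auto; [cont|].
      intros x. now rewrite Pf, Pf'.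
    (* The regularity of the right-hand side of the differential equation: capped at [r - 1] by [f']
       and at [1 + n] by the induction hypothesis. From [3/2 < r] it exceeds [1/2] at every step, so
       [H^sg] is an algebra. *)
    - set (sg := Rmin (r - 1) (1 + INR n)).
      assert (Hn := pos_INR n).
      assert (Hsg : / 2 < sg) by (unfold sg, Rmin; destruct Rle_dec; lra).
      replace (Rmin r (1 + INR (S n))) with (sg + 1)
        by (unfold sg, Rmin; rewrite S_INR; repeat destruct Rle_dec; lra).
      destruct (Hs_mult sg Hsg) as (C & _ & Hmul).
      assert (Hi : Hs sg (fun x => / f x)).
      { apply Hs_mono with (2 := IH). unfold sg, Rmin; repeat destruct Rle_dec; lra. }
      apply (Hs_of_derivative sg _ _ Hdi Pi).
      apply (Hmul (fun x => -1 * Derive f x) (fun x => / f x * / f x)).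
      + apply Hs_scal. apply Hs_mono with (2 := Hf'). apply Rmin_l.
      + now apply (Hmul (fun x => / f x) (fun x => / f x)). }
  destruct (INR_unbounded r) as (n & Hn). specialize (Hstep n).
  replace (Rmin r (1 + INR n)) with r in Hstep; auto.
  unfold Rmin. destruct Rle_dec; lra.
Qed.

(** ** The norm modulo constants *)

(** Subtracting a constant changes only the coefficient at frequency 0, and subtracting the mean
    makes that one vanish. *)
Lemma Hs_center_norm_le r f c : Hs r f ->
  Hs_norm r (fun x => f x - RInt f 0 1) <= Hs_norm r (fun x => f x - c).
Proof.
  intros Hf. set (m := RInt f 0 1).
  assert (Hc : forall c, Hs r (fun x => f x - c)).
  { intros d. apply Hs_minus; auto. apply (Hs_const r d). }
  assert (Cf := Hs_cont r f Hf).
  apply Hs_intro; [cont|now apply (Hs_periodic r _ (Hc m))|apply Hs_norm_ge0|].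
  eapply zbound_le; [|now apply Hs_norm_zbound].
  intros k. rewrite !sob_weight_sqr, !Rpow_mult_distr.
  apply Rmult_le_compat_l; [apply pow2_ge_0|].
  rewrite !amp_sqr, !fc_minus, !fs_minus, !fc_const, !fs_const by cont.
  destruct (Z.eq_dec k 0) as [->|]; [|lra].
  rewrite !fc_0, fs_0. fold m. assert (H := pow2_ge_0 (m - c)). nra.
Qed.

Lemma Hs_quot_norm_center r f : Hs r f ->
  Hs_quot_norm r f = Hs_norm r (fun x => f x - RInt f 0 1).
Proof.
  intros Hf. unfold Hs_quot_norm.
  rewrite (is_glb_Rbar_unique _ (Finite (Hs_norm r (fun x => f x - RInt f 0 1)))); auto.
  split.
  - intros y (c & ->). simpl. now apply Hs_center_norm_le.
  - intros b Hb. apply Hb. now exists (RInt f 0 1).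
Qed.

(** * Calculus of tensor fields *)

(* The functionals [ev] separate the classes, so that identities modulo [==]
   reduce to identities between real numbers. *)
Record nlaws (F : nspace) : Type := NLaws {
  idx : Type;
  ev : idx -> F -> R;
  ev_eqv : forall u v, u == v <-> forall i, ev i u = ev i v;
  ev_add : forall i u v, ev i (u [+] v) = ev i u + ev i v;
  ev_scal : forall i a u, ev i (a [*] u) = a * ev i u;
  ev_zero : forall i, ev i nzero = 0;
  mem_zero : @nmem F nzero;
  mem_add : forall u v : F, nmem u -> nmem v -> nmem (u [+] v);
  mem_scal : forall a (u : F), nmem u -> nmem (a [*] u);
  mem_eqv : forall u v : F, u == v -> nmem u -> nmem v;
  norm_ge0 : forall u : F, nmem u -> 0 <= nnorm u;
  norm_tri : forall u v : F, nmem u -> nmem v -> nnorm (u [+] v) <= nnorm u + nnorm v;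
  norm_scal : forall a (u : F), nmem u -> nnorm (a [*] u) = Rabs a * nnorm u;
  norm_eqv : forall u v : F, nmem u -> nmem v -> u == v -> nnorm u = nnorm v;
  norm_eq0 : forall u : F, nmem u -> nnorm u = 0 -> u == nzero }.

Arguments idx {F} _.
Arguments ev {F} _ _ _.
Arguments ev_eqv {F} _ _ _.
Arguments ev_add {F} _ _ _ _.
Arguments ev_scal {F} _ _ _ _.
Arguments ev_zero {F} _ _.
Arguments mem_zero {F} _.
Arguments mem_add {F} _ _ _ _ _.
Arguments mem_scal {F} _ _ _ _.
Arguments mem_eqv {F} _ _ _ _ _.
Arguments norm_ge0 {F} _ _ _.
Arguments norm_tri {F} _ _ _ _ _.
Arguments norm_scal {F} _ _ _ _.
Arguments norm_eqv {F} _ _ _ _ _ _.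
Arguments norm_eq0 {F} _ _ _ _.

Ltac ev_expand L :=
  unfold nsub; repeat first [rewrite (ev_add L) | rewrite (ev_scal L) | rewrite (ev_zero L)].

Ltac nring L := apply (ev_eqv L); intros ?i; ev_expand L; ring.

(** Applies the functional [ev L i] to every hypothesis modulo [==], leaving equations between
    reals. *)
Ltac ntrans L i :=
  repeat match goal with
  | H : @neqv _ ?u ?v |- _ =>
      let E := fresh "E" in
      assert (E := proj1 (ev_eqv L u v) H i); clear H; unfold nsub in E;
      repeat first [rewrite (ev_add L) in E | rewrite (ev_scal L) in E | rewrite (ev_zero L) in E]
  end.

Lemma Rabs_m1 : Rabs (-1) = 1.
Proof. rewrite Rabs_left; lra. Qed.

Section NormedSpace.

Context {F : nspace} (L : nlaws F).

Lemma neqv_refl (u : F) : u == u.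
Proof. now apply (ev_eqv L). Qed.

Lemma neqv_sym (u v : F) : u == v -> v == u.
Proof. rewrite !(ev_eqv L). intros H i. now rewrite H. Qed.

Lemma neqv_trans (u v w : F) : u == v -> v == w -> u == w.
Proof. rewrite !(ev_eqv L). intros H H' i. now rewrite H, H'. Qed.

Lemma nadd_eqv (u u' v v' : F) : u == u' -> v == v' -> u [+] v == u' [+] v'.
Proof. rewrite !(ev_eqv L). intros H H' i. rewrite !(ev_add L). now rewrite H, H'. Qed.

Lemma nscal_eqv a (u u' : F) : u == u' -> a [*] u == a [*] u'.
Proof. rewrite !(ev_eqv L). intros H i. rewrite !(ev_scal L). now rewrite H. Qed.

Lemma nsub_eqv (u u' v v' : F) : u == u' -> v == v' -> u [-] v == u' [-] v'.
Proof. intros H H'. apply nadd_eqv; auto. now apply nscal_eqv. Qed.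

Lemma mem_sub (u v : F) : nmem u -> nmem v -> nmem (u [-] v).
Proof. intros. apply (mem_add L); auto. now apply (mem_scal L). Qed.

Lemma norm_sub (u v : F) : nmem u -> nmem v -> nnorm (u [-] v) <= nnorm u + nnorm v.
Proof.
  intros Hu Hv. eapply Rle_trans; [apply (norm_tri L); auto; now apply (mem_scal L)|].
  rewrite (norm_scal L), Rabs_m1 by auto. lra.
Qed.

Lemma norm_le_eqv (u v : F) a : nmem u -> nmem v -> u == v -> nnorm v <= a -> nnorm u <= a.
Proof. intros Hu Hv H Ha. now rewrite (norm_eqv L u v). Qed.

Lemma neqv_of_norm_sub (u v : F) : nmem u -> nmem v ->
  (forall eps, 0 < eps -> nnorm (u [-] v) <= eps) -> u == v.
Proof.
  intros Hu Hv H. assert (H0 : u [-] v == nzero).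
  { apply (norm_eq0 L); [now apply mem_sub|].
    assert (H0 := norm_ge0 L _ (mem_sub u v Hu Hv)).
    destruct (Req_dec (nnorm (u [-] v)) 0) as [|Hn]; auto.
    specialize (H (nnorm (u [-] v) / 2)). lra. }
  apply (ev_eqv L). intros i. ntrans L i. lra.
Qed.

Lemma Forall2_neqv_refl (l : list F) : List.Forall2 neqv l l.
Proof. induction l; constructor; auto. apply neqv_refl. Qed.

Lemma norms_ge0 (l : list F) : List.Forall nmem l -> 0 <= norms l.
Proof.
  induction 1; simpl; [lra|]. apply Rmult_le_pos; auto. now apply (norm_ge0 L).
Qed.

End NormedSpace.

Lemma norms_app {F : nspace} (l l' : list F) : norms (l ++ l') = norms l * norms l'.
Proof. induction l as [|u l IH]; simpl; [ring|rewrite IH; ring]. Qed.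

Lemma norms_perm {F : nspace} (l l' : list F) : Permutation l l' -> norms l = norms l'.
Proof. induction 1; simpl; try congruence. ring. Qed.

Definition Rspace_laws : nlaws Rspace.
Proof.
  refine (NLaws Rspace unit (fun _ u => u) _ _ _ _ _ _ _ _ _ _ _ _ _); simpl; auto.
  - intros u v. split; [auto|]. intros H. apply (H tt).
  - intros. apply Rabs_pos.
  - intros. apply Rabs_triang.
  - intros. apply Rabs_mult.
  - intros; congruence.
  - intros u _ H. destruct (Req_dec u 0); auto. now apply Rabs_no_R0 in H.
Defined.

(** ** Selecting arguments *)

(** A list of positions records which arguments go to which slot, and in what order. Distributing
    arguments between two tensors then becomes a statement about permutations of positions. *)
Definition sel {F : nspace} (s : list nat) (l : list F) : list F :=
  map (fun i => nth i l nzero) s.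

Lemma sel_app {F : nspace} s t (l : list F) : sel (s ++ t) l = sel s l ++ sel t l.
Proof. apply map_app. Qed.

Lemma sel_shift {F : nspace} s (h : F) l : sel (map S s) (h :: l) = sel s l.
Proof. unfold sel. rewrite map_map. reflexivity. Qed.

Lemma sel_seq {F : nspace} (l : list F) : sel (seq 0 (length l)) l = l.
Proof.
  induction l as [|h l IH]; [reflexivity|]. simpl length. simpl seq.
  rewrite <- seq_shift. cbn [sel map]. change (nth 0 (h :: l) nzero) with h.
  f_equal. fold (sel (map S (seq 0 (length l))) (h :: l)). now rewrite sel_shift.
Qed.

Lemma sel_mem {F : nspace} (L : nlaws F) s (l : list F) :
  List.Forall nmem l -> List.Forall nmem (sel s l).
Proof.
  intros H. unfold sel. apply List.Forall_map, List.Forall_forall. intros i _.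
  destruct (Nat.lt_ge_cases i (length l)) as [Hi|Hi].
  - rewrite List.Forall_forall in H. apply H. now apply nth_In.
  - rewrite nth_overflow by auto. apply (mem_zero L).
Qed.

Lemma sel_args {F : nspace} (L : nlaws F) s k (l : list F) : args k l -> args (length s) (sel s l).
Proof.
  intros (_ & H). split; [apply length_map|]. now apply (sel_mem L).
Qed.

Lemma sel_eqv {F : nspace} (L : nlaws F) s (l l' : list F) :
  List.Forall2 neqv l l' -> List.Forall2 neqv (sel s l) (sel s l').
Proof.
  intros H. induction s as [|i s IH]; constructor; auto.
  clear s IH. revert i. induction H as [|u v l l' Huv H IH]; intros [|i]; simpl; auto;
    apply (neqv_refl L).
Qed.

Lemma norms_sel {F : nspace} s k (l : list F) :
  Permutation s (seq 0 k) -> length l = k -> norms (sel s l) = norms l.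
Proof.
  intros H <-. rewrite <- (sel_seq l) at 2. apply norms_perm. now apply Permutation_map.
Qed.

Lemma sel_update {F : nspace} s (l1 l2 : list F) u v :
  ~ In (length l1) s -> sel s (l1 ++ u :: l2) = sel s (l1 ++ v :: l2).
Proof.
  intros H. apply map_ext_in. intros i Hi.
  destruct (Nat.lt_trichotomy i (length l1)) as [Hlt|[->|Hgt]].
  - now rewrite !app_nth1.
  - easy.
  - rewrite !app_nth2 by lia. destruct (i - length l1)%nat eqn:E; [lia|reflexivity].
Qed.

Lemma sel_at {F : nspace} s t (l1 l2 : list F) u :
  sel (s ++ length l1 :: t) (l1 ++ u :: l2)
  = sel s (l1 ++ u :: l2) ++ u :: sel t (l1 ++ u :: l2).
Proof.
  rewrite sel_app. f_equal. cbn [sel map]. f_equal.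
  rewrite app_nth2, Nat.sub_diag; auto.
Qed.

Lemma args_app_inv {F : nspace} k (l1 l2 : list F) u : args k (l1 ++ u :: l2) ->
  List.Forall nmem l1 /\ nmem u /\ List.Forall nmem l2 /\ k = (length l1 + S (length l2))%nat.
Proof.
  intros (H1 & H2). rewrite length_app in H1. simpl in H1.
  apply List.Forall_app in H2. destruct H2 as (H2 & H3). inversion_clear H3. auto.
Qed.

Lemma args_app_intro {F : nspace} k (l1 l2 : list F) u :
  List.Forall nmem l1 -> nmem u -> List.Forall nmem l2 -> k = (length l1 + S (length l2))%nat ->
  args k (l1 ++ u :: l2).
Proof.
  intros H1 Hu H2 ->. split; [rewrite length_app; reflexivity|].
  apply List.Forall_app; split; auto.
Qed.

(** ** Composition of multilinear maps *)

Section Composition.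

Context {E F : nspace} (LE : nlaws E) (LF : nlaws F).

Lemma bounded_multilinear_const k (A : list E -> F) : bounded_multilinear k A ->
  exists C, 0 <= C /\ forall l, args k l -> nnorm (A l) <= C * norms l.
Proof.
  intros (_ & _ & _ & C & H). exists (Rabs C). split; [apply Rabs_pos|].
  intros l Hl. eapply Rle_trans; [now apply H|]. apply Rmult_le_compat_r.
  - apply (norms_ge0 LE). apply Hl.
  - apply Rle_abs.
Qed.

(** Composition in one slot: the value of [B] is inserted between two groups of arguments of [A].
    That [s1 ++ t ++ s2] permutes [seq 0 k] says that each argument is used exactly once. *)
Definition plug (s1 t s2 : list nat) (A : list E -> F) (B : list E -> E) (l : list E) : F :=
  A (sel s1 l ++ B (sel t l) :: sel s2 l).

Lemma norms_plug (s1 t s2 : list nat) k (l : list E) u : Permutation (s1 ++ t ++ s2) (seq 0 k) -> args k l ->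
  forall b, nnorm u <= b * norms (sel t l) ->
  norms (sel s1 l ++ u :: sel s2 l) <= b * norms l.
Proof.
  intros Hp (Hlen & Hl) b Hu. rewrite norms_app.
  rewrite <- (norms_sel _ k l Hp Hlen), !sel_app, !norms_app. cbn [norms fold_right].
  fold (norms (sel s2 l)).
  assert (H1 := norms_ge0 LE _ (sel_mem LE s1 l Hl)).
  assert (H2 := norms_ge0 LE _ (sel_mem LE s2 l Hl)).
  assert (H3 : norms (sel s1 l) * norms (sel s2 l) * nnorm u
    <= norms (sel s1 l) * norms (sel s2 l) * (b * norms (sel t l))).
  { apply Rmult_le_compat_l; auto. now apply Rmult_le_pos. }
  simpl in *. lra.
Qed.

Lemma args_plug (s1 s2 : list nat) k m (l : list E) u : args k l -> nmem u ->
  m = (length s1 + S (length s2))%nat -> args m (sel s1 l ++ u :: sel s2 l).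
Proof.
  intros (Hlen & Hl) Hu ->. apply args_app_intro; auto; try now apply (sel_mem LE).
  unfold sel. now rewrite !length_map.
Qed.

Lemma plug_multilinear s1 t s2 k m j A B :
  m = (length s1 + S (length s2))%nat -> j = length t -> Permutation (s1 ++ t ++ s2) (seq 0 k) ->
  bounded_multilinear m A -> bounded_multilinear j B ->
  bounded_multilinear k (plug s1 t s2 A B).
Proof.
  intros Hm Hj Hp HA HB.
  destruct (bounded_multilinear_const m A HA) as (CA & CA0 & HCA).
  destruct HA as (A1 & A2 & A3 & _).
  assert (HB' : exists C, 0 <= C /\ forall l, args j l -> nnorm (B l) <= C * norms l).
  { destruct HB as (_ & _ & _ & C & H). exists (Rabs C). split; [apply Rabs_pos|].
    intros l Hl. eapply Rle_trans; [now apply H|]. apply Rmult_le_compat_r.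
    - apply (norms_ge0 LE). apply Hl.
    - apply Rle_abs. }
  destruct HB' as (CB & CB0 & HCB). destruct HB as (B1 & B2 & B3 & _).
  assert (Hargs : forall l, args k l -> args m (sel s1 l ++ B (sel t l) :: sel s2 l)).
  { intros l Hl. apply (args_plug s1 s2 k); auto. apply B1. subst j. now apply (sel_args LE t k). }
  split; [|split; [|split]].
  - intros l Hl. apply A1. auto.
  - intros l l' Hl Hl' H. apply A2; auto. apply Forall2_app; [now apply (sel_eqv LE)|].
    constructor; [|now apply (sel_eqv LE)].
    apply B2; try (subst j; now apply (sel_args LE t k)). now apply (sel_eqv LE).
  - intros l1 l2 u v a Hl Hv.
    assert (Hl' := args_app_inv _ _ _ _ Hl). destruct Hl' as (M1 & Mu & M2 & Hk).
    assert (Mw : nmem (a [*] u [+] v)) by (apply (mem_add LE); auto; now apply (mem_scal LE)).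
    assert (Hlv : args k (l1 ++ v :: l2)) by now apply args_app_intro.
    assert (Hlw : args k (l1 ++ (a [*] u [+] v) :: l2)) by now apply args_app_intro.
    assert (Hnd : NoDup (s1 ++ t ++ s2)).
    { apply Permutation_NoDup with (seq 0 k); [now symmetry|apply seq_NoDup]. }
    (* The position of the varied argument occurs in exactly one of [s1], [t], [s2], and the other
       two selections do not see the change. This gives the three cases below. *)
    assert (Hin : In (length l1) (s1 ++ t ++ s2)).
    { apply Permutation_in with (seq 0 k); [now symmetry|]. apply in_seq. lia. }
    assert (Hrest : forall x y, s1 ++ t ++ s2 = x ++ length l1 :: y -> ~ In (length l1) (x ++ y)).
    { intros x y Hxy. rewrite Hxy in Hnd. now apply NoDup_remove_2 in Hnd. }
    unfold plug. apply in_app_or in Hin. destruct Hin as [Hin|Hin].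
    + apply in_split in Hin. destruct Hin as (x & y & ->).
      assert (Hn := Hrest x (y ++ t ++ s2) ltac:(now rewrite <- app_assoc)).
      rewrite !in_app_iff in Hn.
      rewrite !sel_at, <- !app_assoc, <- !app_comm_cons.
      rewrite (sel_update x l1 l2 (a [*] u [+] v) u), (sel_update x l1 l2 v u),
        (sel_update y l1 l2 (a [*] u [+] v) u), (sel_update y l1 l2 v u),
        (sel_update t l1 l2 (a [*] u [+] v) u), (sel_update t l1 l2 v u),
        (sel_update s2 l1 l2 (a [*] u [+] v) u), (sel_update s2 l1 l2 v u) by tauto.
      apply A3; auto. specialize (Hargs _ Hl).
      rewrite sel_at, <- app_assoc, <- app_comm_cons in Hargs. exact Hargs.
    + apply in_app_or in Hin. destruct Hin as [Hin|Hin].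
      * apply in_split in Hin. destruct Hin as (x & y & Ht).
        assert (Hn := Hrest (s1 ++ x) (y ++ s2)
          ltac:(rewrite Ht, <- !app_assoc; reflexivity)).
        rewrite !in_app_iff in Hn.
        rewrite (sel_update s1 l1 l2 (a [*] u [+] v) u), (sel_update s1 l1 l2 v u),
          (sel_update s2 l1 l2 (a [*] u [+] v) u), (sel_update s2 l1 l2 v u) by tauto.
        assert (Btu := sel_args LE t k _ Hl). rewrite <- Hj in Btu.
        assert (Btv := sel_args LE t k _ Hlv). rewrite <- Hj in Btv.
        assert (Btw := sel_args LE t k _ Hlw). rewrite <- Hj in Btw.
        assert (HB : B (sel t (l1 ++ (a [*] u [+] v) :: l2))
          == a [*] B (sel t (l1 ++ u :: l2)) [+] B (sel t (l1 ++ v :: l2))).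
        { rewrite Ht in *. rewrite !sel_at.
          rewrite (sel_update x l1 l2 (a [*] u [+] v) u), (sel_update x l1 l2 v u),
            (sel_update y l1 l2 (a [*] u [+] v) u), (sel_update y l1 l2 v u) by tauto.
          apply B3; auto. rewrite <- sel_at. exact Btu. }
        eapply (neqv_trans LF); [|apply A3].
        -- apply A2.
           ++ apply (args_plug s1 s2 k _ _ _ Hl); auto.
           ++ apply (args_plug s1 s2 k _ _ _ Hl); auto.
              apply (mem_add LE); [apply (mem_scal LE)|]; auto.
           ++ apply Forall2_app; [apply (Forall2_neqv_refl LE)|].
              constructor; auto. apply (Forall2_neqv_refl LE).
        -- apply (args_plug s1 s2 k _ _ _ Hl); auto.
        -- auto.
      * apply in_split in Hin. destruct Hin as (x & y & ->).
        assert (Hn := Hrest (s1 ++ t ++ x) y ltac:(rewrite <- !app_assoc; reflexivity)).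
        rewrite !in_app_iff in Hn.
        rewrite !sel_at, !app_comm_cons, !app_assoc.
        rewrite (sel_update x l1 l2 (a [*] u [+] v) u), (sel_update x l1 l2 v u),
          (sel_update y l1 l2 (a [*] u [+] v) u), (sel_update y l1 l2 v u),
          (sel_update t l1 l2 (a [*] u [+] v) u), (sel_update t l1 l2 v u),
          (sel_update s1 l1 l2 (a [*] u [+] v) u), (sel_update s1 l1 l2 v u) by tauto.
        apply A3; auto. specialize (Hargs _ Hl).
        rewrite sel_at, app_comm_cons, app_assoc in Hargs. exact Hargs.
  - exists (CA * CB). intros l Hl. unfold plug.
    eapply Rle_trans; [apply HCA; auto|]. rewrite Rmult_assoc.
    apply Rmult_le_compat_l; auto. apply (norms_plug s1 t s2 k); auto.
    apply HCB. subst j. now apply (sel_args LE t k).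
Qed.

Lemma multilinear_sub k A l1 l2 (u v : E) : bounded_multilinear k A ->
  args k (l1 ++ u :: l2) -> nmem v ->
  (A (l1 ++ u :: l2) [-] A (l1 ++ v :: l2) : F) == A (l1 ++ (u [-] v) :: l2).
Proof.
  intros (A1 & A2 & A3 & _) Hu Hv.
  destruct (args_app_inv _ _ _ _ Hu) as (M1 & Mu & M2 & Hk).
  assert (Muv : nmem (u [-] v)) by now apply (mem_sub LE).
  assert (H : A (l1 ++ (u [-] v) :: l2)
    == (-1) [*] A (l1 ++ v :: l2) [+] A (l1 ++ u :: l2)).
  { eapply (neqv_trans LF); [|apply A3; auto; now apply args_app_intro].
    apply A2; try apply args_app_intro; auto.
    - apply (mem_add LE); auto. now apply (mem_scal LE).
    - apply Forall2_app; [apply (Forall2_neqv_refl LE)|].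
      constructor; [nring LE|apply (Forall2_neqv_refl LE)]. }
  apply (ev_eqv LF). intros i. ntrans LF i. ev_expand LF. lra.
Qed.

End Composition.

(** ** Tensor fields of class [C^n] *)

(** The domain of the chart at each point contains a ball. It keeps difference quotients inside the
    manifold, where membership of the values is known. *)
Definition open_shifts (M : tmanifold) : Prop :=
  forall p : point M, pmem p -> exists delta, 0 < delta /\
    forall h, nmem h -> nnorm h < delta -> pmem (shift p h).

Definition plug_field {M : tmanifold} {F : nspace} (s1 t s2 : list nat)
    (T : point M -> list (model M) -> F) (S : point M -> list (model M) -> model M)
    (p : point M) : list (model M) -> F :=
  plug s1 t s2 (T p) (S p).

Lemma args_cons {E : nspace} k (h : E) l : nmem h -> args k l -> args (S k) (h :: l).
Proof. intros Hh (H1 & H2). split; simpl; auto. Qed.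

Lemma args_nil {E : nspace} : @args E 0 [].
Proof. split; auto. Qed.

Lemma sel_cons {F : nspace} i s (l : list F) : sel (i :: s) l = nth i l nzero :: sel s l.
Proof. reflexivity. Qed.

Lemma plug_shift_l {E F : nspace} s1 t s2 (A : list E -> F) B h l :
  plug (0%nat :: map S s1) (map S t) (map S s2) A B (h :: l)
  = A (h :: sel s1 l ++ B (sel t l) :: sel s2 l).
Proof. unfold plug. rewrite sel_cons, !sel_shift. reflexivity. Qed.

Lemma plug_shift_r {E F : nspace} s1 t s2 (A : list E -> F) B h l :
  plug (map S s1) (0%nat :: map S t) (map S s2) A B (h :: l)
  = A (sel s1 l ++ B (h :: sel t l) :: sel s2 l).
Proof. unfold plug. rewrite sel_cons, !sel_shift. reflexivity. Qed.

Lemma shift_perm_l s1 t s2 k : Permutation (s1 ++ t ++ s2) (seq 0 k) ->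
  Permutation ((0%nat :: map S s1) ++ map S t ++ map S s2) (seq 0 (S k)).
Proof.
  intros H. simpl. constructor. rewrite <- !map_app, <- seq_shift. now apply Permutation_map.
Qed.

Lemma shift_perm_r s1 t s2 k : Permutation (s1 ++ t ++ s2) (seq 0 k) ->
  Permutation (map S s1 ++ (0%nat :: map S t) ++ map S s2) (seq 0 (S k)).
Proof.
  intros H. simpl. symmetry. rewrite <- Permutation_middle. symmetry. constructor.
  rewrite <- !map_app, <- seq_shift. now apply Permutation_map.
Qed.

Section Fields.

Context {M : tmanifold} {F : nspace} (LM : nlaws (model M)) (LF : nlaws F)
  (OM : open_shifts M).

Implicit Types T : point M -> list (model M) -> F.

Lemma tensor_Cn_field n k T : tensor_Cn M F n k T -> tensor_field M F k T.
Proof. destruct n; intros (H & _); exact H. Qed.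

Lemma tensor_Cn_continuous n k T : tensor_Cn M F n k T -> tensor_continuous M F k T.
Proof. destruct n; intros (_ & H & _); exact H. Qed.

Lemma tensor_Cn_pred n : forall k T, tensor_Cn M F (S n) k T -> tensor_Cn M F n k T.
Proof.
  induction n as [|n IH]; intros k T (H1 & H2 & T' & H3 & H4).
  - split; [auto|split; [auto|exact I]].
  - split; [auto|split; [auto|]]. exists T'. split; auto.
Qed.

Lemma tensor_field_mem k T p l : tensor_field M F k T -> pmem p -> args k l -> nmem (T p l).
Proof. intros (H & _) Hp Hl. now apply (H p Hp). Qed.

Lemma tensor_field_ext k T T2 : tensor_field M F k T ->
  (forall p l, pmem p -> args k l -> T p l == T2 p l) -> tensor_field M F k T2.
Proof.
  intros (H1 & H2) He. split.
  - intros p Hp. destruct (H1 p Hp) as (A1 & A2 & A3 & C & A4). split; [|split; [|split]].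
    + intros l Hl. apply (mem_eqv LF (T p l)); auto.
    + intros l l' Hl Hl' Hll. apply (neqv_trans LF) with (T p l); [apply (neqv_sym LF); auto|].
      apply (neqv_trans LF) with (T p l'); auto.
    + intros l1 l2 u v a Hu Hv.
      destruct (args_app_inv _ _ _ _ Hu) as (M1 & Mu & M2 & Hk).
      assert (Hv' : args k (l1 ++ v :: l2)) by now apply args_app_intro.
      assert (Hw : args k (l1 ++ (a [*] u [+] v) :: l2)).
      { apply args_app_intro; auto. apply (mem_add LM); auto. now apply (mem_scal LM). }
      apply (neqv_trans LF) with (T p (l1 ++ (a [*] u [+] v) :: l2));
        [apply (neqv_sym LF); auto|].
      eapply (neqv_trans LF); [apply A3; auto|].
      apply (nadd_eqv LF); [apply (nscal_eqv LF)|]; auto.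
    + exists C. intros l Hl. rewrite <- (norm_eqv LF (T p l)); auto.
      apply (mem_eqv LF (T p l)); auto.
  - intros p q l Hp Hq Hpq Hl. apply (neqv_trans LF) with (T p l); [apply (neqv_sym LF); auto|].
    apply (neqv_trans LF) with (T q l); auto.
Qed.

Lemma tensor_Cn_ext n k T T2 : tensor_Cn M F n k T ->
  (forall p l, pmem p -> args k l -> T p l == T2 p l) -> tensor_Cn M F n k T2.
Proof.
  intros H He.
  assert (F1 := tensor_Cn_field _ _ _ H). assert (F2 := tensor_field_ext k T T2 F1 He).
  assert (HC : tensor_continuous M F k T2).
  { intros p Hp eps Heps. destruct (tensor_Cn_continuous _ _ _ H p Hp eps Heps) as (d & Hd & Hc).
    exists d. split; auto. intros h Hh Hhd Hph l Hl.
    rewrite <- (norm_eqv LF (T (shift p h) l [-] T p l)); auto;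
      try (apply (mem_sub LF); eapply tensor_field_mem; eauto).
    apply (nsub_eqv LF); auto. }
  destruct n as [|n].
  - split; [auto|split; auto].
  - split; [auto|split; [auto|]]. destruct H as (_ & _ & T' & H3 & H4).
    exists T'. split; auto. intros p Hp eps Heps.
    destruct (H3 p Hp eps Heps) as (d & Hd & Hc).
    exists d. split; auto. intros h Hh Hhd Hph l Hl.
    assert (F3 := tensor_Cn_field _ _ _ H4).
    rewrite <- (norm_eqv LF (T (shift p h) l [-] T p l [-] T' p (h :: l))); auto;
      try (repeat apply (mem_sub LF); eapply tensor_field_mem; eauto; now apply args_cons).
    apply (nsub_eqv LF); [|apply (neqv_refl LF)]. apply (nsub_eqv LF); auto.
Qed.

Lemma tensor_field_lin k T1 T2 a : tensor_field M F k T1 -> tensor_field M F k T2 ->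
  tensor_field M F k (fun p l => T1 p l [+] a [*] T2 p l).
Proof.
  intros H1 H2. split.
  - intros p Hp.
    destruct (bounded_multilinear_const LM k _ (proj1 H1 p Hp)) as (C1 & P1 & B1).
    destruct (bounded_multilinear_const LM k _ (proj1 H2 p Hp)) as (C2 & P2 & B2).
    destruct (proj1 H1 p Hp) as (X1 & X2 & X3 & _).
    destruct (proj1 H2 p Hp) as (Y1 & Y2 & Y3 & _).
    split; [|split; [|split]].
    + intros l Hl. apply (mem_add LF); [|apply (mem_scal LF)]; auto.
    + intros l l' Hl Hl' Hll. apply (nadd_eqv LF); [|apply (nscal_eqv LF)]; auto.
    + intros l1 l2 u v b Hu Hv.
      assert (E1 := X3 l1 l2 u v b Hu Hv). assert (E2 := Y3 l1 l2 u v b Hu Hv).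
      apply (ev_eqv LF). intros i. ntrans LF i. ev_expand LF. rewrite E, E0. ring.
    + exists (C1 + Rabs a * C2). intros l Hl.
      eapply Rle_trans; [apply (norm_tri LF); auto; apply (mem_scal LF); auto|].
      rewrite (norm_scal LF), Rmult_plus_distr_r, Rmult_assoc by auto.
      apply Rplus_le_compat; auto. apply Rmult_le_compat_l; auto. apply Rabs_pos.
  - intros p q l Hp Hq Hpq Hl. apply (nadd_eqv LF); [|apply (nscal_eqv LF)].
    + now apply (proj2 H1).
    + now apply (proj2 H2).
Qed.

Lemma tensor_Cn_lin n : forall k T1 T2 a, tensor_Cn M F n k T1 -> tensor_Cn M F n k T2 ->
  tensor_Cn M F n k (fun p l => T1 p l [+] a [*] T2 p l).
Proof.
  induction n as [|n IH]; intros k T1 T2 a H1 H2;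
    assert (F1 := tensor_Cn_field _ _ _ H1); assert (F2 := tensor_Cn_field _ _ _ H2);
    assert (HC : tensor_continuous M F k (fun p l => T1 p l [+] a [*] T2 p l)).
  1, 3 :
    intros p Hp eps Heps; assert (Ha := Rabs_pos a);
    destruct (tensor_Cn_continuous _ _ _ H1 p Hp (eps / 2)) as (d1 & Hd1 & Hc1); [lra|];
    destruct (tensor_Cn_continuous _ _ _ H2 p Hp (eps / (2 * (Rabs a + 1)))) as (d2 & Hd2 & Hc2);
      [apply Rdiv_lt_0_compat; lra|];
    exists (Rmin d1 d2); split; [now apply Rmin_pos|];
    intros h Hh Hhd Hph l Hl;
    specialize (Hc1 h Hh (Rlt_le_trans _ _ _ Hhd (Rmin_l _ _)) Hph l Hl);
    specialize (Hc2 h Hh (Rlt_le_trans _ _ _ Hhd (Rmin_r _ _)) Hph l Hl);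
    assert (X1 := tensor_field_mem k T1 p l F1 Hp Hl);
    assert (X2 := tensor_field_mem k T2 p l F2 Hp Hl);
    assert (Y1 := tensor_field_mem k T1 _ l F1 Hph Hl);
    assert (Y2 := tensor_field_mem k T2 _ l F2 Hph Hl);
    assert (Z1 := mem_sub LF _ _ Y1 X1); assert (Z2 := mem_sub LF _ _ Y2 X2);
    apply (norm_le_eqv LF _ ((T1 (shift p h) l [-] T1 p l) [+] a [*] (T2 (shift p h) l [-] T2 p l)));
    [ apply (mem_sub LF); apply (mem_add LF); auto; now apply (mem_scal LF)
    | apply (mem_add LF); auto; now apply (mem_scal LF)
    | nring LF
    | eapply Rle_trans; [apply (norm_tri LF); auto; now apply (mem_scal LF)|];
      rewrite (norm_scal LF) by auto;
      assert (HN := norms_ge0 LM l (proj2 Hl));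
      assert (E : Rabs a * (eps / (2 * (Rabs a + 1)) * norms l) <= eps / 2 * norms l);
      [ rewrite <- Rmult_assoc; apply Rmult_le_compat_r; auto;
        replace (eps / 2) with ((Rabs a + 1) * (eps / (2 * (Rabs a + 1)))) by (field; lra);
        apply Rmult_le_compat_r; [left; apply Rdiv_lt_0_compat; lra|lra]
      | apply (Rmult_le_compat_l _ _ _ Ha) in Hc2; lra ] ].
  - split; [now apply tensor_field_lin|split; auto].
  - split; [now apply tensor_field_lin|split; auto].
    destruct H1 as (_ & _ & T1' & D1 & C1). destruct H2 as (_ & _ & T2' & D2 & C2).
    exists (fun p l => T1' p l [+] a [*] T2' p l). split; [|now apply IH].
    assert (F1' := tensor_Cn_field _ _ _ C1). assert (F2' := tensor_Cn_field _ _ _ C2).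
    intros p Hp eps Heps. assert (Ha := Rabs_pos a).
    destruct (D1 p Hp (eps / 2)) as (d1 & Hd1 & Hc1); [lra|].
    destruct (D2 p Hp (eps / (2 * (Rabs a + 1)))) as (d2 & Hd2 & Hc2);
      [apply Rdiv_lt_0_compat; lra|].
    exists (Rmin d1 d2). split; [now apply Rmin_pos|].
    intros h Hh Hhd Hph l Hl.
    specialize (Hc1 h Hh (Rlt_le_trans _ _ _ Hhd (Rmin_l _ _)) Hph l Hl).
    specialize (Hc2 h Hh (Rlt_le_trans _ _ _ Hhd (Rmin_r _ _)) Hph l Hl).
    assert (X1 := tensor_field_mem k T1 p l F1 Hp Hl).
    assert (X2 := tensor_field_mem k T2 p l F2 Hp Hl).
    assert (Y1 := tensor_field_mem k T1 _ l F1 Hph Hl).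
    assert (Y2 := tensor_field_mem k T2 _ l F2 Hph Hl).
    assert (V1 := tensor_field_mem _ T1' p _ F1' Hp (args_cons k h l Hh Hl)).
    assert (V2 := tensor_field_mem _ T2' p _ F2' Hp (args_cons k h l Hh Hl)).
    assert (Z1 := mem_sub LF _ _ (mem_sub LF _ _ Y1 X1) V1).
    assert (Z2 := mem_sub LF _ _ (mem_sub LF _ _ Y2 X2) V2).
    apply (norm_le_eqv LF _ ((T1 (shift p h) l [-] T1 p l [-] T1' p (h :: l))
      [+] a [*] (T2 (shift p h) l [-] T2 p l [-] T2' p (h :: l)))).
    + apply (mem_sub LF); [apply (mem_sub LF)|]; apply (mem_add LF); auto; now apply (mem_scal LF).
    + apply (mem_add LF); auto. now apply (mem_scal LF).
    + nring LF.
    + eapply Rle_trans; [apply (norm_tri LF); auto; now apply (mem_scal LF)|].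
      rewrite (norm_scal LF) by auto.
      assert (HN := norms_ge0 LM l (proj2 Hl)). assert (Hn := norm_ge0 LM h Hh).
      assert (E : Rabs a * (eps / (2 * (Rabs a + 1)) * nnorm h * norms l)
        <= eps / 2 * nnorm h * norms l).
      { rewrite <- !Rmult_assoc. apply Rmult_le_compat_r; auto. apply Rmult_le_compat_r; auto.
        replace (eps / 2) with ((Rabs a + 1) * (eps / (2 * (Rabs a + 1)))) by (field; lra).
        apply Rmult_le_compat_r; [left; apply Rdiv_lt_0_compat; lra|lra]. }
      apply (Rmult_le_compat_l _ _ _ Ha) in Hc2. lra.
Qed.

Lemma tensor_local_bound k T p : tensor_field M F k T -> tensor_continuous M F k T -> pmem p ->
  exists C d, 0 <= C /\ 0 < d /\ forall h, nmem h -> nnorm h < d -> pmem (shift p h) ->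
    forall l, args k l -> nnorm (T (shift p h) l) <= C * norms l.
Proof.
  intros H HC Hp.
  destruct (bounded_multilinear_const LM k _ (proj1 H p Hp)) as (C & C0 & HB).
  destruct (HC p Hp 1 ltac:(lra)) as (d & Hd & Hc).
  exists (C + 1), d. split; [lra|split; auto]. intros h Hh Hhd Hph l Hl.
  assert (X := tensor_field_mem k T p l H Hp Hl).
  assert (Y := tensor_field_mem k T _ l H Hph Hl).
  apply (norm_le_eqv LF _ ((T (shift p h) l [-] T p l) [+] T p l)); auto.
  - apply (mem_add LF); auto. now apply (mem_sub LF).
  - nring LF.
  - eapply Rle_trans; [apply (norm_tri LF); auto; now apply (mem_sub LF)|].
    specialize (Hc h Hh Hhd Hph l Hl). specialize (HB l Hl). lra.
Qed.

End Fields.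

Lemma tensor_continuous_of_derive {M : tmanifold} {F : nspace} (LM : nlaws (model M))
  (LF : nlaws F) k (T T' : point M -> list (model M) -> F) :
  tensor_field M F k T -> tensor_field M F (S k) T' -> is_tensor_derive M F k T T' ->
  tensor_continuous M F k T.
Proof.
  intros HT HT' HD p Hp eps He.
  destruct (bounded_multilinear_const LM (S k) _ (proj1 HT' p Hp)) as (C & C0 & HC).
  destruct (HD p Hp 1) as (d & Hd & H); [lra|].
  exists (Rmin d (eps / (C + 1))). split; [apply Rmin_pos; auto; apply Rdiv_lt_0_compat; lra|].
  intros h Hh Hhd Hph l Hl.
  specialize (H h Hh (Rlt_le_trans _ _ _ Hhd (Rmin_l _ _)) Hph l Hl).
  assert (Ahl := args_cons k h l Hh Hl). specialize (HC _ Ahl).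
  assert (X := tensor_field_mem k T p l HT Hp Hl).
  assert (Y := tensor_field_mem k T _ l HT Hph Hl).
  assert (Z := tensor_field_mem _ T' p _ HT' Hp Ahl).
  assert (V := mem_sub LF _ _ Y X). assert (W := mem_sub LF _ _ V Z).
  apply (norm_le_eqv LF _ ((T (shift p h) l [-] T p l [-] T' p (h :: l)) [+] T' p (h :: l)));
    auto; [now apply (mem_add LF)|nring LF|].
  eapply Rle_trans; [now apply (norm_tri LF)|].
  assert (HN := norms_ge0 LM l (proj2 Hl)).
  apply Rle_trans with ((C + 1) * nnorm h * norms l); [simpl in HC; lra|].
  apply Rmult_le_compat_r; auto.
  assert (Hn : nnorm h < eps / (C + 1)) by (eapply Rlt_le_trans; [exact Hhd|apply Rmin_r]).
  apply (Rmult_lt_compat_l (C + 1)) in Hn; [|lra].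
  replace ((C + 1) * (eps / (C + 1))) with eps in Hn by (field; lra). lra.
Qed.

Section Plug.

Context {M : tmanifold} {F : nspace} (LM : nlaws (model M)) (LF : nlaws F)
  (OM : open_shifts M).

Context (s1 t s2 : list nat) (k m j : nat).
Context (Hm : m = (length s1 + S (length s2))%nat) (Hj : j = length t)
  (Hp : Permutation (s1 ++ t ++ s2) (seq 0 k)).

Context (T : point M -> list (model M) -> F) (Q : point M -> list (model M) -> model M).
Context (FT : tensor_field M F m T) (FQ : tensor_field M (model M) j Q).

Lemma plug_field_field : tensor_field M F k (plug_field s1 t s2 T Q).
Proof.
  split.
  - intros p Hpm. apply (plug_multilinear LM LF s1 t s2 k m j); auto; [apply FT|apply FQ]; auto.
  - intros p q l Hpm Hqm Hpq Hl. unfold plug_field, plug.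
    assert (At := sel_args LM t k l Hl). rewrite <- Hj in At.
    assert (M1 := tensor_field_mem j Q p _ FQ Hpm At).
    assert (M2 := tensor_field_mem j Q q _ FQ Hqm At).
    assert (A1 := args_plug LM s1 s2 k m l _ Hl M1 Hm).
    assert (A2 := args_plug LM s1 s2 k m l _ Hl M2 Hm).
    apply (neqv_trans LF) with (T q (sel s1 l ++ Q p (sel t l) :: sel s2 l)).
    + now apply FT.
    + apply (proj1 FT q Hqm); auto.
      apply Forall2_app; [apply (Forall2_neqv_refl LM)|].
      constructor; [now apply FQ|apply (Forall2_neqv_refl LM)].
Qed.

Lemma plug_field_continuous : tensor_continuous M F m T -> tensor_continuous M (model M) j Q ->
  tensor_continuous M F k (plug_field s1 t s2 T Q).
Proof.
  intros CT CQ p Hpm eps Heps.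
  destruct (tensor_local_bound LM LM j Q p FQ CQ Hpm) as (B & d0 & B0 & Hd0 & HB).
  destruct (bounded_multilinear_const LM m _ (proj1 FT p Hpm)) as (A & A0 & HA).
  destruct (CT p Hpm (eps / (2 * (B + 1)))) as (d1 & Hd1 & Hc1); [apply Rdiv_lt_0_compat; lra|].
  destruct (CQ p Hpm (eps / (2 * (A + 1)))) as (d2 & Hd2 & Hc2); [apply Rdiv_lt_0_compat; lra|].
  exists (Rmin d0 (Rmin d1 d2)). split; [repeat apply Rmin_pos; auto|].
  intros h Hh Hhd Hph l Hl.
  assert (Hh0 : nnorm h < d0) by (eapply Rlt_le_trans; [exact Hhd|apply Rmin_l]).
  assert (Hh1 : nnorm h < d1)
    by (eapply Rlt_le_trans; [exact Hhd|eapply Rle_trans; [apply Rmin_r|apply Rmin_l]]).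
  assert (Hh2 : nnorm h < d2)
    by (eapply Rlt_le_trans; [exact Hhd|eapply Rle_trans; [apply Rmin_r|apply Rmin_r]]).
  set (q := shift p h) in *.
  assert (At := sel_args LM t k l Hl). rewrite <- Hj in At.
  assert (Mp := tensor_field_mem j Q p _ FQ Hpm At).
  assert (Mq := tensor_field_mem j Q q _ FQ Hph At).
  set (yp := Q p (sel t l)) in *. set (yq := Q q (sel t l)) in *.
  assert (Md := mem_sub LM _ _ Mq Mp).
  assert (Ap := args_plug LM s1 s2 k m l yp Hl Mp Hm).
  assert (Aq := args_plug LM s1 s2 k m l yq Hl Mq Hm).
  assert (Ad := args_plug LM s1 s2 k m l (yq [-] yp) Hl Md Hm).
  assert (Tpp := tensor_field_mem m T p _ FT Hpm Ap).
  assert (Tpq := tensor_field_mem m T p _ FT Hpm Aq).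
  assert (Tqq := tensor_field_mem m T q _ FT Hph Aq).
  assert (Tpd := tensor_field_mem m T p _ FT Hpm Ad).
  assert (HN := norms_ge0 LM l (proj2 Hl)).
  unfold plug_field, plug. fold yp yq.
  apply (norm_le_eqv LF _
    ((T q (sel s1 l ++ yq :: sel s2 l) [-] T p (sel s1 l ++ yq :: sel s2 l))
     [+] T p (sel s1 l ++ (yq [-] yp) :: sel s2 l))).
  - now apply (mem_sub LF).
  - apply (mem_add LF); auto. now apply (mem_sub LF).
  - assert (E := multilinear_sub LM LF m (T p) (sel s1 l) (sel s2 l) yq yp
      (proj1 FT p Hpm) Aq Mp).
    apply (ev_eqv LF). intros i. ntrans LF i. ev_expand LF. lra.
  - eapply Rle_trans; [apply (norm_tri LF); auto; now apply (mem_sub LF)|].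
    assert (E1 : nnorm (T q (sel s1 l ++ yq :: sel s2 l) [-] T p (sel s1 l ++ yq :: sel s2 l))
      <= eps / 2 * norms l).
    { eapply Rle_trans; [now apply Hc1|].
      assert (H1 : norms (sel s1 l ++ yq :: sel s2 l) <= B * norms l).
      { apply (norms_plug LM s1 t s2 k); auto. now apply HB. }
      apply (Rmult_le_compat_l (eps / (2 * (B + 1)))) in H1;
        [|left; apply Rdiv_lt_0_compat; lra].
      eapply Rle_trans; [exact H1|]. rewrite <- Rmult_assoc. apply Rmult_le_compat_r; auto.
      replace (eps / 2) with (eps / (2 * (B + 1)) * (B + 1)) by (field; lra).
      apply Rmult_le_compat_l; [left; apply Rdiv_lt_0_compat; lra|lra]. }
    assert (E2 : nnorm (T p (sel s1 l ++ (yq [-] yp) :: sel s2 l)) <= eps / 2 * norms l).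
    { eapply Rle_trans; [now apply HA|].
      assert (H1 : norms (sel s1 l ++ (yq [-] yp) :: sel s2 l)
        <= eps / (2 * (A + 1)) * norms l).
      { apply (norms_plug LM s1 t s2 k); auto. now apply Hc2. }
      apply (Rmult_le_compat_l A) in H1; auto.
      eapply Rle_trans; [exact H1|]. rewrite <- Rmult_assoc. apply Rmult_le_compat_r; auto.
      replace (eps / 2) with ((A + 1) * (eps / (2 * (A + 1)))) by (field; lra).
      apply Rmult_le_compat_r; [left; apply Rdiv_lt_0_compat; lra|lra]. }
    lra.
Qed.

(** Product rule. The direction is the first argument of a derivative, so the old positions move up
    by [S] and position 0 is handed to [T'] or [Q']. The factor [1 [*]] brings the sum into the
    shape of [tensor_Cn_lin]. *)
Lemma plug_field_derive T' Q' :
  tensor_field M F (S m) T' -> tensor_field M (model M) (S j) Q' ->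
  tensor_continuous M (model M) j Q ->
  is_tensor_derive M F m T T' -> is_tensor_derive M (model M) j Q Q' ->
  is_tensor_derive M F k (plug_field s1 t s2 T Q)
    (fun p l => plug_field (0%nat :: map S s1) (map S t) (map S s2) T' Q p l
      [+] 1 [*] plug_field (map S s1) (0%nat :: map S t) (map S s2) T Q' p l).
Proof.
  intros FT' FQ' CQ DT DQ p Hpm eps Heps.
  destruct (tensor_local_bound LM LM j Q p FQ CQ Hpm) as (B & d0 & B0 & Hd0 & HB).
  destruct (bounded_multilinear_const LM m _ (proj1 FT p Hpm)) as (A & A0 & HA).
  destruct (bounded_multilinear_const LM (S m) _ (proj1 FT' p Hpm)) as (A' & A0' & HA').
  destruct (DT p Hpm (eps / (3 * (B + 1)))) as (d1 & Hd1 & Hc1); [apply Rdiv_lt_0_compat; lra|].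
  destruct (DQ p Hpm (eps / (3 * (A + 1)))) as (d2 & Hd2 & Hc2); [apply Rdiv_lt_0_compat; lra|].
  destruct (CQ p Hpm (eps / (3 * (A' + 1)))) as (d3 & Hd3 & Hc3); [apply Rdiv_lt_0_compat; lra|].
  exists (Rmin (Rmin d0 d3) (Rmin d1 d2)). split; [repeat apply Rmin_pos; auto|].
  intros h Hh Hhd Hph l Hl.
  assert (Hdd : nnorm h < d0 /\ nnorm h < d1 /\ nnorm h < d2 /\ nnorm h < d3).
  { revert Hhd. unfold Rmin. repeat destruct Rle_dec; lra. }
  destruct Hdd as (Hh0 & Hh1 & Hh2 & Hh3). clear Hhd.
  set (q := shift p h) in *.
  assert (At := sel_args LM t k l Hl). rewrite <- Hj in At.
  assert (Mp := tensor_field_mem j Q p _ FQ Hpm At).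
  assert (Mq := tensor_field_mem j Q q _ FQ Hph At).
  assert (Mv := tensor_field_mem _ Q' p _ FQ' Hpm (args_cons _ _ _ Hh At)).
  unfold plug_field. rewrite plug_shift_l, plug_shift_r. unfold plug.
  set (yp := Q p (sel t l)) in *. set (yq := Q q (sel t l)) in *.
  set (v := Q' p (h :: sel t l)) in *.
  assert (Md := mem_sub LM _ _ Mq Mp).
  assert (Me := mem_sub LM _ _ Md Mv).
  assert (Ap := args_plug LM s1 s2 k m l yp Hl Mp Hm).
  assert (Aq := args_plug LM s1 s2 k m l yq Hl Mq Hm).
  assert (Av := args_plug LM s1 s2 k m l v Hl Mv Hm).
  assert (Ad := args_plug LM s1 s2 k m l (yq [-] yp) Hl Md Hm).
  assert (Ae := args_plug LM s1 s2 k m l (yq [-] yp [-] v) Hl Me Hm).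
  assert (Bp := args_cons _ _ _ Hh Ap). assert (Bq := args_cons _ _ _ Hh Aq).
  assert (Bd := args_cons _ _ _ Hh Ad).
  assert (Tpp := tensor_field_mem m T p _ FT Hpm Ap).
  assert (Tpq := tensor_field_mem m T p _ FT Hpm Aq).
  assert (Tqq := tensor_field_mem m T q _ FT Hph Aq).
  assert (Tpv := tensor_field_mem m T p _ FT Hpm Av).
  assert (Tpe := tensor_field_mem m T p _ FT Hpm Ae).
  assert (Upp := tensor_field_mem _ T' p _ FT' Hpm Bp).
  assert (Upq := tensor_field_mem _ T' p _ FT' Hpm Bq).
  assert (Upd := tensor_field_mem _ T' p _ FT' Hpm Bd).
  assert (HN := norms_ge0 LM l (proj2 Hl)). assert (Hn := norm_ge0 LM h Hh).
  (* The error has three parts: the remainder of [T] at the moved argument, the derivative of [T]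
     applied to the increment of [Q], and [T] applied to the remainder of [Q]. Each receives a third
     of [eps]. *)
  apply (norm_le_eqv LF _
    ((T q (sel s1 l ++ yq :: sel s2 l) [-] T p (sel s1 l ++ yq :: sel s2 l)
       [-] T' p (h :: sel s1 l ++ yq :: sel s2 l))
     [+] T' p (h :: sel s1 l ++ (yq [-] yp) :: sel s2 l)
     [+] T p (sel s1 l ++ (yq [-] yp [-] v) :: sel s2 l))).
  - apply (mem_sub LF); [now apply (mem_sub LF)|]. apply (mem_add LF); auto.
    now apply (mem_scal LF).
  - apply (mem_add LF); auto. apply (mem_add LF); auto.
    apply (mem_sub LF); auto. now apply (mem_sub LF).
  - assert (E := multilinear_sub LM LF m (T p) (sel s1 l) (sel s2 l) yq yp
      (proj1 FT p Hpm) Aq Mp).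
    assert (E' := multilinear_sub LM LF m (T p) (sel s1 l) (sel s2 l) (yq [-] yp) v
      (proj1 FT p Hpm) Ad Mv).
    assert (E'' := multilinear_sub LM LF (S m) (T' p) (h :: sel s1 l) (sel s2 l) yq yp
      (proj1 FT' p Hpm) Bq Mp).
    rewrite <- !app_comm_cons in E''.
    apply (ev_eqv LF). intros i. ntrans LF i. ev_expand LF. lra.
  - eapply Rle_trans; [apply (norm_tri LF); auto|].
    { apply (mem_add LF); auto. apply (mem_sub LF); auto. now apply (mem_sub LF). }
    eapply Rle_trans; [apply Rplus_le_compat_r, (norm_tri LF); auto|].
    { apply (mem_sub LF); auto. now apply (mem_sub LF). }
    assert (Hpos : 0 <= nnorm h * norms l) by now apply Rmult_le_pos.
    assert (E1 : nnorm (T q (sel s1 l ++ yq :: sel s2 l) [-] T p (sel s1 l ++ yq :: sel s2 l)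
       [-] T' p (h :: sel s1 l ++ yq :: sel s2 l)) <= eps / 3 * (nnorm h * norms l)).
    { eapply Rle_trans; [now apply Hc1|].
      assert (H1 : norms (sel s1 l ++ yq :: sel s2 l) <= B * norms l).
      { apply (norms_plug LM s1 t s2 k); auto. now apply HB. }
      rewrite Rmult_assoc.
      apply Rle_trans with (eps / (3 * (B + 1)) * (nnorm h * (B * norms l))).
      { apply Rmult_le_compat_l; [left; apply Rdiv_lt_0_compat; lra|].
        now apply Rmult_le_compat_l. }
      replace (eps / (3 * (B + 1)) * (nnorm h * (B * norms l)))
        with (eps / (3 * (B + 1)) * B * (nnorm h * norms l)) by ring.
      apply Rmult_le_compat_r; auto.
      replace (eps / 3) with (eps / (3 * (B + 1)) * (B + 1)) by (field; lra).
      apply Rmult_le_compat_l; [left; apply Rdiv_lt_0_compat; lra|lra]. }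
    assert (E2 : nnorm (T' p (h :: sel s1 l ++ (yq [-] yp) :: sel s2 l))
      <= eps / 3 * (nnorm h * norms l)).
    { eapply Rle_trans; [now apply HA'|]. cbn [norms fold_right].
      fold (norms (sel s1 l ++ (yq [-] yp) :: sel s2 l)).
      assert (H1 : norms (sel s1 l ++ (yq [-] yp) :: sel s2 l)
        <= eps / (3 * (A' + 1)) * norms l).
      { apply (norms_plug LM s1 t s2 k); auto. now apply Hc3. }
      apply Rle_trans with (A' * (nnorm h * (eps / (3 * (A' + 1)) * norms l))).
      { apply Rmult_le_compat_l; auto. now apply Rmult_le_compat_l. }
      replace (A' * (nnorm h * (eps / (3 * (A' + 1)) * norms l)))
        with (A' * (eps / (3 * (A' + 1))) * (nnorm h * norms l)) by ring.
      apply Rmult_le_compat_r; auto.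
      replace (eps / 3) with ((A' + 1) * (eps / (3 * (A' + 1)))) by (field; lra).
      apply Rmult_le_compat_r; [left; apply Rdiv_lt_0_compat; lra|lra]. }
    assert (E3 : nnorm (T p (sel s1 l ++ (yq [-] yp [-] v) :: sel s2 l))
      <= eps / 3 * (nnorm h * norms l)).
    { eapply Rle_trans; [now apply HA|].
      assert (H1 : norms (sel s1 l ++ (yq [-] yp [-] v) :: sel s2 l)
        <= eps / (3 * (A + 1)) * nnorm h * norms l).
      { apply (norms_plug LM s1 t s2 k); auto. now apply Hc2. }
      apply (Rmult_le_compat_l A) in H1; auto.
      eapply Rle_trans; [exact H1|].
      replace (A * (eps / (3 * (A + 1)) * nnorm h * norms l))
        with (A * (eps / (3 * (A + 1))) * (nnorm h * norms l)) by ring.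
      apply Rmult_le_compat_r; auto.
      replace (eps / 3) with ((A + 1) * (eps / (3 * (A + 1)))) by (field; lra).
      apply Rmult_le_compat_r; [left; apply Rdiv_lt_0_compat; lra|lra]. }
    lra.
Qed.

End Plug.

(** The derivative of a plug is a sum of two plugs with other position lists, so induction on the
    order closes once the lists and arities are generalized. *)
Lemma plug_field_Cn {M : tmanifold} {F : nspace} (LM : nlaws (model M)) (LF : nlaws F) n :
  forall s1 t s2 k m j (T : point M -> list (model M) -> F)
    (Q : point M -> list (model M) -> model M),
  m = (length s1 + S (length s2))%nat -> j = length t ->
  Permutation (s1 ++ t ++ s2) (seq 0 k) ->
  tensor_Cn M F n m T -> tensor_Cn M (model M) n j Q ->
  tensor_Cn M F n k (plug_field s1 t s2 T Q).
Proof.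
  induction n as [|n IH]; intros s1 t s2 k m j T Q Hm Hj Hp HT HQ;
    assert (FT := tensor_Cn_field _ _ _ HT); assert (FQ := tensor_Cn_field _ _ _ HQ);
    assert (CT := tensor_Cn_continuous _ _ _ HT); assert (CQ := tensor_Cn_continuous _ _ _ HQ);
    (split; [now apply (plug_field_field LM LF s1 t s2 k m j)|
     split; [now apply (plug_field_continuous LM LF s1 t s2 k m j)|]]); [exact I|].
  assert (HT1 := tensor_Cn_pred _ _ _ HT). assert (HQ1 := tensor_Cn_pred _ _ _ HQ).
  destruct HT as (_ & _ & T' & DT & HT'). destruct HQ as (_ & _ & Q' & DQ & HQ').
  assert (FT' := tensor_Cn_field _ _ _ HT'). assert (FQ' := tensor_Cn_field _ _ _ HQ').
  eexists. split.
  { exact (plug_field_derive LM LF s1 t s2 k m j Hm Hj Hp T Q FT FQ T' Q' FT' FQ' CQ DT DQ). }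
  apply (tensor_Cn_lin LM LF).
  - apply (IH _ _ _ _ (S m) j); auto.
    + simpl. rewrite !length_map. lia.
    + now rewrite length_map.
    + now apply shift_perm_l.
  - apply (IH _ _ _ _ m (S j)); auto.
    + now rewrite !length_map.
    + simpl. now rewrite length_map, Hj.
    + now apply shift_perm_r.
Qed.

(** ** Directional derivatives *)

Section Directional.

Context {M : tmanifold} {F : nspace} (LM : nlaws (model M)) (LF : nlaws F)
  (OM : open_shifts M).

Definition valued (Y : point M -> F) : Prop := forall p, pmem p -> nmem (Y p).

Lemma small_step (p : point M) (h : model M) d : pmem p -> nmem h -> 0 < d ->
  exists e, 0 < e /\ forall t, Rabs t < e ->
    nnorm (t [*] h) < d /\ pmem (shift p (t [*] h)).
Proof.
  intros Hp Hh Hd. destruct (OM p Hp) as (d0 & Hd0 & H0).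
  assert (Hn := norm_ge0 LM h Hh).
  exists (Rmin d d0 / (nnorm h + 1)).
  assert (0 < Rmin d d0) by now apply Rmin_pos.
  split; [apply Rdiv_lt_0_compat; lra|]. intros t Ht.
  assert (Hth : nnorm (t [*] h) < Rmin d d0).
  { rewrite (norm_scal LM) by auto. assert (Ha := Rabs_pos t).
    apply Rle_lt_trans with (Rabs t * (nnorm h + 1)); [apply Rmult_le_compat_l; lra|].
    apply Rmult_lt_compat_r with (r := nnorm h + 1) in Ht; [|lra].
    unfold Rdiv in Ht. rewrite Rmult_assoc, Rinv_l in Ht by lra. lra. }
  split; [eapply Rlt_le_trans; [exact Hth|apply Rmin_l]|].
  apply H0; [now apply (mem_scal LM)|]. eapply Rlt_le_trans; [exact Hth|apply Rmin_r].
Qed.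

Lemma dderiv_unique (Y : point M -> F) p h d1 d2 : valued Y -> pmem p -> nmem h ->
  is_dderiv Y p h d1 -> is_dderiv Y p h d2 -> d1 == d2.
Proof.
  intros HY Hp Hh (M1 & H1) (M2 & H2). apply (neqv_of_norm_sub LF); auto. intros eps He.
  destruct (H1 (eps / 2)) as (e1 & He1 & K1); [lra|].
  destruct (H2 (eps / 2)) as (e2 & He2 & K2); [lra|].
  destruct (small_step p h 1 Hp Hh ltac:(lra)) as (e0 & He0 & K0).
  set (t := Rmin e0 (Rmin e1 e2) / 2).
  assert (Ht : 0 < t /\ t < e0 /\ t < e1 /\ t < e2)
    by (unfold t, Rmin; repeat destruct Rle_dec; lra).
  clearbody t. assert (Ha : Rabs t = t) by (apply Rabs_pos_eq; lra).
  specialize (K1 t ltac:(lra) ltac:(lra)). specialize (K2 t ltac:(lra) ltac:(lra)).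
  destruct (K0 t ltac:(lra)) as (_ & Hq).
  set (q := / t [*] (Y (shift p (t [*] h)) [-] Y p)) in *.
  assert (Mq : nmem q).
  { apply (mem_scal LF), (mem_sub LF); apply HY; auto. }
  apply (norm_le_eqv LF _ ((q [-] d2) [-] (q [-] d1))).
  - now apply (mem_sub LF).
  - apply (mem_sub LF); now apply (mem_sub LF).
  - nring LF.
  - eapply Rle_trans; [apply (norm_sub LF); now apply (mem_sub LF)|]. lra.
Qed.

Lemma D_correct (Y : point M -> F) p h d : is_dderiv Y p h d -> is_dderiv Y p h (D Y p h).
Proof. intros H. unfold D. apply epsilon_spec. now exists d. Qed.

(** [D] is an unspecified choice among the limits of difference quotients; their uniqueness modulo
    [==] is what makes it computable. *)
Lemma D_eqv (Y : point M -> F) p h d : valued Y -> pmem p -> nmem h ->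
  is_dderiv Y p h d -> D Y p h == d.
Proof.
  intros HY Hp Hh H. apply (dderiv_unique Y p h); auto. eapply D_correct; eauto.
Qed.

Lemma dderiv_of_tensor_derive (Y : point M -> F) (Y' : point M -> list (model M) -> F) p h :
  valued Y -> tensor_field M F 1 Y' -> is_tensor_derive M F 0 (fun p _ => Y p) Y' ->
  pmem p -> nmem h -> is_dderiv Y p h (Y' p [h]).
Proof.
  intros HY FY' DY Hp Hh. assert (Ah := args_cons 0 h [] Hh args_nil).
  assert (Md := tensor_field_mem _ _ p _ FY' Hp Ah). split; auto.
  intros eps He. assert (Hn := norm_ge0 LM h Hh).
  destruct (DY p Hp (eps / (nnorm h + 1))) as (d & Hd & H); [apply Rdiv_lt_0_compat; lra|].
  destruct (small_step p h d Hp Hh Hd) as (e & He' & K). exists e. split; auto.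
  intros t Ht0 Hte. destruct (K t Hte) as (Hth & Hq).
  assert (Mth := mem_scal LM t h Hh).
  specialize (H (t [*] h) Mth Hth Hq [] args_nil). cbv beta in H.
  change (norms (@nil (model M))) with 1 in H.
  assert (Mp := HY p Hp). assert (Mq := HY _ Hq).
  assert (Ath := args_cons 0 _ [] Mth args_nil).
  assert (Mdt := tensor_field_mem _ _ p _ FY' Hp Ath).
  (* Linearity comes in the combined form [a u + v]. With [u = v = 0] and [a = -1] it sends zero to
     zero, and then [v = 0] gives homogeneity. *)
  assert (E : Y' p [t [*] h] == t [*] Y' p [h]).
  { destruct (proj1 FY' p Hp) as (_ & X2 & X3 & _).
    assert (M0 := mem_zero LM). assert (A0 := args_cons 0 _ [] M0 args_nil).
    assert (A1 : args 1 [t [*] h [+] nzero]).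
    { apply args_cons; [now apply (mem_add LM)|apply args_nil]. }
    assert (A2 : args 1 [(-1) [*] (nzero : model M) [+] nzero]).
    { apply args_cons; [apply (mem_add LM); auto; now apply (mem_scal LM)|apply args_nil]. }
    assert (E1 := X3 [] [] h nzero t Ah M0). assert (E2 := X3 [] [] nzero nzero (-1) A0 M0).
    simpl in E1, E2.
    assert (E3 : Y' p [t [*] h] == Y' p [t [*] h [+] nzero]).
    { apply X2; auto. constructor; [nring LM|constructor]. }
    assert (E4 : Y' p [nzero] == Y' p [-1 [*] nzero [+] nzero]).
    { apply X2; auto. constructor; [nring LM|constructor]. }
    apply (ev_eqv LF). intros i. ntrans LF i. ev_expand LF. lra. }
  rewrite (norm_eqv LF _ (/ t [*] (Y (shift p (t [*] h)) [-] Y p [-] Y' p [t [*] h]))).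
  - rewrite (norm_scal LF) by (apply (mem_sub LF); auto; now apply (mem_sub LF)).
    assert (Ha : 0 < Rabs t) by now apply Rabs_pos_lt.
    rewrite Rabs_inv. rewrite (norm_scal LM) in H by auto.
    apply Rmult_lt_reg_l with (Rabs t); auto.
    rewrite <- Rmult_assoc, Rinv_r, Rmult_1_l by lra.
    eapply Rle_lt_trans; [exact H|].
    replace (eps / (nnorm h + 1) * (Rabs t * nnorm h) * 1)
      with (Rabs t * (eps / (nnorm h + 1) * nnorm h)) by ring.
    apply Rmult_lt_compat_l; auto.
    replace eps with (eps / (nnorm h + 1) * (nnorm h + 1)) at 2 by (field; lra).
    apply Rmult_lt_compat_l; [apply Rdiv_lt_0_compat; lra|lra].
  - apply (mem_sub LF); auto. apply (mem_scal LF). now apply (mem_sub LF).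
  - apply (mem_scal LF), (mem_sub LF); auto. now apply (mem_sub LF).
  - apply (ev_eqv LF). intros i. ntrans LF i. ev_expand LF. rewrite E0. field. auto.
Qed.

Lemma dderiv_add (Y Z : point M -> F) p h d e : valued Y -> valued Z -> pmem p -> nmem h ->
  is_dderiv Y p h d -> is_dderiv Z p h e -> is_dderiv (fun q => Y q [+] Z q) p h (d [+] e).
Proof.
  intros HY HZ Hp Hh (M1 & H1) (M2 & H2). split; [now apply (mem_add LF)|].
  intros eps He.
  destruct (H1 (eps / 2)) as (e1 & He1 & K1); [lra|].
  destruct (H2 (eps / 2)) as (e2 & He2 & K2); [lra|].
  destruct (small_step p h 1 Hp Hh ltac:(lra)) as (e0 & He0 & K0).
  exists (Rmin e0 (Rmin e1 e2)). split; [repeat apply Rmin_pos; auto|]. intros t Ht0 Ht.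
  assert (Ht' : Rabs t < e0 /\ Rabs t < e1 /\ Rabs t < e2).
  { revert Ht. unfold Rmin. repeat destruct Rle_dec; lra. }
  destruct Ht' as (T0 & T1 & T2). destruct (K0 t T0) as (_ & Hq).
  specialize (K1 t Ht0 T1). specialize (K2 t Ht0 T2).
  set (q := shift p (t [*] h)) in *.
  assert (My : nmem (/ t [*] (Y q [-] Y p) [-] d)).
  { apply (mem_sub LF); auto. apply (mem_scal LF), (mem_sub LF); auto. }
  assert (Mz : nmem (/ t [*] (Z q [-] Z p) [-] e)).
  { apply (mem_sub LF); auto. apply (mem_scal LF), (mem_sub LF); auto. }
  rewrite (norm_eqv LF _ ((/ t [*] (Y q [-] Y p) [-] d) [+] (/ t [*] (Z q [-] Z p) [-] e))).
  - eapply Rle_lt_trans; [now apply (norm_tri LF)|]. lra.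
  - apply (mem_sub LF); [|now apply (mem_add LF)].
    apply (mem_scal LF), (mem_sub LF); apply (mem_add LF); auto.
  - now apply (mem_add LF).
  - nring LF.
Qed.

Lemma dderiv_smul (f : point M -> R) (Y : point M -> F) p h c d :
  valued Y -> pmem p -> nmem h ->
  @is_dderiv M Rspace f p h c -> is_dderiv Y p h d ->
  is_dderiv (fun q => f q [*] Y q) p h (c [*] Y p [+] f p [*] d).
Proof.
  intros HY Hp Hh (_ & H1) (M2 & H2). assert (MYp := HY p Hp).
  split; [apply (mem_add LF); now apply (mem_scal LF)|].
  intros eps He. assert (Nd := norm_ge0 LF d M2). assert (Ny := norm_ge0 LF _ MYp).
  assert (Af := Rabs_pos (f p)). assert (Ac := Rabs_pos c).
  destruct (H1 (Rmin 1 (eps / (4 * (nnorm (Y p) + 1))))) as (e1 & He1 & K1).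
  { apply Rmin_pos; [lra|]. apply Rdiv_lt_0_compat; lra. }
  destruct (H2 (eps / (4 * (Rabs (f p) + 1)))) as (e2 & He2 & K2);
    [apply Rdiv_lt_0_compat; lra|].
  destruct (small_step p h 1 Hp Hh ltac:(lra)) as (e0 & He0 & K0).
  set (e3 := Rmin 1 (eps / (4 * (nnorm d + 1))) / (Rabs c + 1)).
  assert (He3 : 0 < e3).
  { apply Rdiv_lt_0_compat; [|lra]. apply Rmin_pos; [lra|]. apply Rdiv_lt_0_compat; lra. }
  exists (Rmin (Rmin e0 e3) (Rmin e1 e2)). split; [repeat apply Rmin_pos; auto|].
  intros t Ht0 Ht.
  assert (Ht' : Rabs t < e0 /\ Rabs t < e1 /\ Rabs t < e2 /\ Rabs t < e3).
  { revert Ht. unfold Rmin. repeat destruct Rle_dec; lra. }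
  destruct Ht' as (T0 & T1 & T2 & T3). destruct (K0 t T0) as (_ & Hq).
  specialize (K1 t Ht0 T1). specialize (K2 t Ht0 T2).
  set (q := shift p (t [*] h)) in *. unfold nsub in K1. simpl in K1.
  set (x := / t * (f q + -1 * f p)) in K1.
  assert (Ex : f q = f p + t * x) by (unfold x; field; auto).
  set (w := / t [*] (Y q [-] Y p) [-] d) in *.
  assert (Mw : nmem w).
  { apply (mem_sub LF); auto. apply (mem_scal LF), (mem_sub LF); auto. }
  assert (Nw := norm_ge0 LF w Mw).
  (* Here [x] is the difference quotient of [f] and [w] the error of the one of [Y]. The error
     splits into [f q w], [(f q - f p) d] and [(x - c) Y p], each at most [eps / 4]. *)
  rewrite (norm_eqv LF _ (f q [*] w [+] ((f q - f p) [*] d [+] (x + -1 * c) [*] Y p))).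
  - eapply Rle_lt_trans; [apply (norm_tri LF);
      [now apply (mem_scal LF)|apply (mem_add LF); now apply (mem_scal LF)]|].
    eapply Rle_lt_trans; [apply Rplus_le_compat_l, (norm_tri LF); now apply (mem_scal LF)|].
    rewrite !(norm_scal LF) by auto.
    assert (Hx : Rabs x <= Rabs c + 1).
    { replace x with (c + (x + -1 * c)) by ring.
      eapply Rle_trans; [apply Rabs_triang|]. apply Rplus_le_compat_l.
      left. eapply Rlt_le_trans; [exact K1|apply Rmin_l]. }
    assert (Hfd : Rabs (f q - f p) <= Rmin 1 (eps / (4 * (nnorm d + 1)))).
    { rewrite Ex. replace (f p + t * x - f p) with (t * x) by ring. rewrite Rabs_mult.
      apply Rle_trans with (e3 * (Rabs c + 1)).
      - apply Rmult_le_compat; try apply Rabs_pos; lra.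
      - unfold e3. right. field. lra. }
    assert (B1 : Rabs (f q) <= Rabs (f p) + 1).
    { replace (f q) with (f p + (f q - f p)) by ring.
      eapply Rle_trans; [apply Rabs_triang|]. apply Rplus_le_compat_l.
      eapply Rle_trans; [exact Hfd|apply Rmin_l]. }
    assert (B2 : Rabs (f q) * nnorm w <= eps / 4).
    { apply Rle_trans with ((Rabs (f p) + 1) * (eps / (4 * (Rabs (f p) + 1)))).
      - apply Rmult_le_compat; auto; try lra. apply Rabs_pos.
      - right. field. lra. }
    assert (B3 : Rabs (f q - f p) * nnorm d <= eps / 4).
    { apply Rle_trans with (eps / (4 * (nnorm d + 1)) * (nnorm d + 1)).
      - apply Rmult_le_compat; auto; try lra; [apply Rabs_pos|].
        eapply Rle_trans; [exact Hfd|apply Rmin_r].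
      - right. field. lra. }
    assert (B4 : Rabs (x + -1 * c) * nnorm (Y p) <= eps / 4).
    { apply Rle_trans with (eps / (4 * (nnorm (Y p) + 1)) * (nnorm (Y p) + 1)).
      - apply Rmult_le_compat; auto; try lra; [apply Rabs_pos|].
        left. eapply Rlt_le_trans; [exact K1|apply Rmin_r].
      - right. field. lra. }
    lra.
  - apply (mem_sub LF); [|apply (mem_add LF); now apply (mem_scal LF)].
    apply (mem_scal LF), (mem_sub LF); apply (mem_scal LF); auto.
  - apply (mem_add LF); [|apply (mem_add LF)]; now apply (mem_scal LF).
  - apply (ev_eqv LF). intros i. unfold w. ev_expand LF. rewrite Ex. field. auto.
Qed.

End Directional.

(** * Derivatives of tensor fields evaluated on vector fields *)

Section Contraction.

Context {M : tmanifold} {F : nspace} (LM : nlaws (model M)) (LF : nlaws F)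
  (OM : open_shifts M).

Lemma vfield_valued (X : point M -> model M) : vfield M X -> valued X.
Proof.
  intros H p Hp. apply (tensor_field_mem 0 (fun p _ => X p) p []); auto.
  - exact (tensor_Cn_field _ _ _ (H O)).
  - apply args_nil.
Qed.

Lemma smooth0_derivative {G : nspace} (Y : point M -> G) : smooth0 M G Y ->
  exists Y', tensor_Cn M G 0 1 Y' /\ is_tensor_derive M G 0 (fun p _ => Y p) Y'.
Proof. intros H. destruct (H 1%nat) as (_ & _ & Y' & H1 & H2). now exists Y'. Qed.

(** Equality is assumed only on the manifold, which is enough since small steps stay there. It moves
    derivatives from expressions to the tensors they represent. *)
Lemma dderiv_ext (Y Z : point M -> F) p h d d' : valued Y -> valued Z -> pmem p -> nmem h ->
  (forall q, pmem q -> Y q == Z q) -> nmem d' -> d == d' ->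
  is_dderiv Y p h d -> is_dderiv Z p h d'.
Proof.
  intros HY HZ Hp Hh HE Md' Hdd (Md & H). split; auto. intros eps He.
  destruct (H eps He) as (e1 & He1 & K1).
  destruct (small_step LM OM p h 1 Hp Hh ltac:(lra)) as (e0 & He0 & K0).
  exists (Rmin e0 e1). split; [now apply Rmin_pos|]. intros t Ht0 Ht.
  destruct (K0 t ltac:(eapply Rlt_le_trans; [exact Ht|apply Rmin_l])) as (_ & Hq).
  specialize (K1 t Ht0 ltac:(eapply Rlt_le_trans; [exact Ht|apply Rmin_r])).
  set (q := shift p (t [*] h)) in *.
  rewrite (norm_eqv LF _ (/ t [*] (Y q [-] Y p) [-] d)); auto.
  - apply (mem_sub LF); auto. apply (mem_scal LF), (mem_sub LF); auto.
  - apply (mem_sub LF); auto. apply (mem_scal LF), (mem_sub LF); auto.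
  - assert (E1 := HE q Hq). assert (E2 := HE p Hp). clear HE.
    apply (ev_eqv LF). intros i. ntrans LF i. ev_expand LF.
    repeat match goal with H : ev LF _ _ = ev LF _ _ |- _ => rewrite H; clear H end. ring.
Qed.

Lemma smooth0_dderiv (Y : point M -> F) p h : smooth0 M F Y -> valued Y -> pmem p -> nmem h ->
  is_dderiv Y p h (D Y p h).
Proof.
  intros H HY Hp Hh. destruct (smooth0_derivative Y H) as (Y' & FY' & DY).
  eapply D_correct. apply (dderiv_of_tensor_derive LM LF OM Y Y'); auto.
  exact (tensor_Cn_field _ _ _ FY').
Qed.

Lemma smooth0_D_eqv (Y : point M -> F) Y' p h : valued Y -> tensor_field M F 1 Y' ->
  is_tensor_derive M F 0 (fun p _ => Y p) Y' -> pmem p -> nmem h -> D Y p h == Y' p [h].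
Proof.
  intros. apply (D_eqv LM LF OM); auto. now apply (dderiv_of_tensor_derive LM LF OM).
Qed.

Lemma D_mem (Y : point M -> F) p h : smooth0 M F Y -> valued Y -> pmem p -> nmem h ->
  nmem (D Y p h).
Proof. intros. now apply smooth0_dderiv. Qed.

Lemma D_lin (Y : point M -> F) p c h h' : smooth0 M F Y -> valued Y -> pmem p ->
  nmem h -> nmem h' -> D Y p (c [*] h [+] h') == c [*] D Y p h [+] D Y p h'.
Proof.
  intros H HY Hp Hh Hh'. destruct (smooth0_derivative Y H) as (Y' & CY' & DY).
  assert (FY' := tensor_Cn_field _ _ _ CY').
  assert (Mw : nmem (c [*] h [+] h')) by (apply (mem_add LM); auto; now apply (mem_scal LM)).
  assert (E1 := smooth0_D_eqv Y Y' p h HY FY' DY Hp Hh).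
  assert (E2 := smooth0_D_eqv Y Y' p h' HY FY' DY Hp Hh').
  assert (E3 := smooth0_D_eqv Y Y' p _ HY FY' DY Hp Mw).
  destruct (proj1 FY' p Hp) as (_ & _ & X3 & _).
  assert (E4 := X3 [] [] h h' c (args_cons 0 h [] Hh args_nil) Hh'). simpl in E4.
  apply (ev_eqv LF). intros i. ntrans LF i. ev_expand LF.
  repeat match goal with H : ev LF _ _ = _ |- _ => rewrite H end. ring.
Qed.

Context (T : point M -> list (model M) -> F) (T' : point M -> list (model M) -> F)
  (Y : point M -> model M) (HY : vfield M Y).

Let MY : valued Y := vfield_valued Y HY.

(** A tensor field evaluated on a vector field is a plug with no argument left, so the product rule
    for plugs applies. *)
Lemma D_apply1 : tensor_field M F 1 T -> tensor_field M F 2 T' -> is_tensor_derive M F 1 T T' ->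
  forall p h, pmem p -> nmem h ->
  is_dderiv (fun q => T q [Y q]) p h (T' p [h; Y p] [+] T p [D Y p h]).
Proof.
  intros FT FT' DT p h Hp Hh.
  destruct (smooth0_derivative Y HY) as (Y' & CY' & DY).
  assert (FY := tensor_Cn_field _ _ _ (HY O)). assert (CY := tensor_Cn_continuous _ _ _ (HY O)).
  assert (FY' := tensor_Cn_field _ _ _ CY').
  assert (A1 : forall q, pmem q -> args 1 [Y q]) by (intros; apply args_cons; auto; apply args_nil).
  assert (DD : D Y p h == Y' p [h]).
  { apply (D_eqv LM LM OM); auto. now apply (dderiv_of_tensor_derive LM LM OM). }
  assert (Ah := args_cons 0 h [] Hh args_nil).
  assert (MY' := tensor_field_mem 1 Y' p _ FY' Hp Ah).
  assert (MD : nmem (D Y p h)) by (apply (mem_eqv LM (Y' p [h])); auto; now apply (neqv_sym LM)).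
  assert (H := plug_field_derive LM LF [] [] [] 0 1 0 eq_refl eq_refl (Permutation_refl _)
    T (fun q _ => Y q) FT FY T' Y' FT' FY' CY DT DY).
  assert (VF : valued (fun q => T q [Y q])).
  { intros q Hq. apply (tensor_field_mem 1 T q); auto. }
  assert (AY : args 2 [h; Y p]) by (apply args_cons; auto).
  assert (AD : args 1 [D Y p h]) by (apply args_cons; auto; apply args_nil).
  assert (AY' : args 1 [Y' p [h]]) by (apply args_cons; auto; apply args_nil).
  apply (dderiv_ext (fun q => T q [Y q]) _ p h (T' p [h; Y p] [+] 1 [*] T p [Y' p [h]])); auto.
  - intros; apply (neqv_refl LF).
  - apply (mem_add LF); [now apply (tensor_field_mem 2 T' p)|now apply (tensor_field_mem 1 T p)].
  - assert (E : T p [D Y p h] == T p [Y' p [h]]).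
    { apply (proj1 FT p Hp); auto. }
    apply (ev_eqv LF). intros i. clear DD. ntrans LF i. ev_expand LF. lra.
  - apply (dderiv_of_tensor_derive LM LF OM (fun q => T q [Y q])
      (fun p l => plug_field (0%nat :: []) [] [] T' (fun q _ => Y q) p l
        [+] 1 [*] plug_field [] (0%nat :: []) [] T Y' p l)); auto.
    apply (tensor_field_lin LM LF).
    + now apply (plug_field_field LM LF [0%nat] [] [] 1 2 0).
    + now apply (plug_field_field LM LF [] [0%nat] [] 1 1 1).
Qed.

Context (Z : point M -> model M) (HZ : vfield M Z).

Let MZ : valued Z := vfield_valued Z HZ.

Lemma D_apply2 : tensor_field M F 2 T -> tensor_field M F 3 T' ->
  is_tensor_derive M F 2 T T' -> forall p h, pmem p -> nmem h ->
  is_dderiv (fun q => T q [Y q; Z q]) p h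
    (T' p [h; Y p; Z p] [+] T p [D Y p h; Z p] [+] T p [Y p; D Z p h]).
Proof.
  intros FT FT' DT p h Hp Hh.
  destruct (smooth0_derivative Y HY) as (Y' & CY' & DY).
  assert (FY := tensor_Cn_field _ _ _ (HY O)). assert (CY := tensor_Cn_continuous _ _ _ (HY O)).
  assert (FY' := tensor_Cn_field _ _ _ CY').
  destruct (smooth0_derivative Z HZ) as (Z' & CZ' & DZ).
  assert (FZ := tensor_Cn_field _ _ _ (HZ O)). assert (CZ := tensor_Cn_continuous _ _ _ (HZ O)).
  assert (FZ' := tensor_Cn_field _ _ _ CZ').
  assert (DD : D Y p h == Y' p [h]).
  { apply (D_eqv LM LM OM); auto. now apply (dderiv_of_tensor_derive LM LM OM). }
  assert (DE : D Z p h == Z' p [h]).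
  { apply (D_eqv LM LM OM); auto. now apply (dderiv_of_tensor_derive LM LM OM). }
  assert (Ah := args_cons 0 h [] Hh args_nil).
  assert (MY' := tensor_field_mem 1 Y' p _ FY' Hp Ah).
  assert (MZ' := tensor_field_mem 1 Z' p _ FZ' Hp Ah).
  assert (MD : nmem (D Y p h)) by (apply (mem_eqv LM (Y' p [h])); auto; now apply (neqv_sym LM)).
  assert (ME : nmem (D Z p h)) by (apply (mem_eqv LM (Z' p [h])); auto; now apply (neqv_sym LM)).
  assert (MYp := MY p Hp). assert (MZp := MZ p Hp).
  assert (A2 : forall u v : model M, nmem u -> nmem v -> args 2 [u; v]).
  { intros. apply args_cons; auto. apply args_cons; auto. apply args_nil. }
  (* The fields are inserted one after the other: [U] has [Y] in the first slot of [T], and its only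
     argument is the second slot. *)
  set (U := plug_field [] [] [0%nat] T (fun q _ => Y q)).
  set (U' := fun p l => plug_field [0%nat] [] [1%nat] T' (fun q _ => Y q) p l
    [+] 1 [*] plug_field [] [0%nat] [1%nat] T Y' p l).
  assert (FU : tensor_field M F 1 U) by now apply (plug_field_field LM LF [] [] [0%nat] 1 2 0).
  assert (FU' : tensor_field M F 2 U').
  { apply (tensor_field_lin LM LF).
    - now apply (plug_field_field LM LF [0%nat] [] [1%nat] 2 3 0).
    - now apply (plug_field_field LM LF [] [0%nat] [1%nat] 2 2 1). }
  assert (DU : is_tensor_derive M F 1 U U').
  { exact (plug_field_derive LM LF [] [] [0%nat] 1 2 0 eq_refl eq_refl (Permutation_refl _)
      T (fun q _ => Y q) FT FY T' Y' FT' FY' CY DT DY). }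
  assert (H := plug_field_derive LM LF [] [] [] 0 1 0 eq_refl eq_refl (Permutation_refl _)
    U (fun q _ => Z q) FU FZ U' Z' FU' FZ' CZ DU DZ).
  assert (VF : valued (fun q => T q [Y q; Z q])).
  { intros q Hq. apply (tensor_field_mem 2 T q); auto. }
  assert (B1 : args 3 [h; Y p; Z p]) by (apply args_cons; auto).
  apply (dderiv_ext (fun q => T q [Y q; Z q]) _ p h
    ((T' p [h; Y p; Z p] [+] 1 [*] T p [Y' p [h]; Z p]) [+] 1 [*] T p [Y p; Z' p [h]])); auto.
  - intros; apply (neqv_refl LF).
  - apply (mem_add LF); [apply (mem_add LF)|].
    + now apply (tensor_field_mem 3 T' p).
    + apply (tensor_field_mem 2 T p); auto.
    + apply (tensor_field_mem 2 T p); auto.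
  - assert (E1 : T p [D Y p h; Z p] == T p [Y' p [h]; Z p]).
    { apply (proj1 FT p Hp); auto. constructor; auto. constructor; auto. apply (neqv_refl LM). }
    assert (E2 : T p [Y p; D Z p h] == T p [Y p; Z' p [h]]).
    { apply (proj1 FT p Hp); auto. constructor; auto. apply (neqv_refl LM). }
    apply (ev_eqv LF). intros i. clear DD DE. ntrans LF i. ev_expand LF. lra.
  - apply (dderiv_of_tensor_derive LM LF OM (fun q => T q [Y q; Z q])
      (fun p l => plug_field (0%nat :: []) [] [] U' (fun q _ => Z q) p l
        [+] 1 [*] plug_field [] (0%nat :: []) [] U Z' p l)); auto.
    apply (tensor_field_lin LM LF).
    + now apply (plug_field_field LM LF [0%nat] [] [] 1 2 0).
    + now apply (plug_field_field LM LF [] [0%nat] [] 1 1 1).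
Qed.

End Contraction.

Lemma apply1_Cn {M : tmanifold} {F : nspace} (LM : nlaws (model M)) (LF : nlaws F) n
  (T : point M -> list (model M) -> F) (Y : point M -> model M) :
  tensor_Cn M F n 1 T -> tensor_Cn M (model M) n 0 (fun p _ => Y p) ->
  tensor_Cn M F n 0 (fun p _ => T p [Y p]).
Proof.
  intros HT HY. exact (plug_field_Cn LM LF n [] [] [] 0 1 0 T (fun q _ => Y q) eq_refl eq_refl
    (Permutation_refl _) HT HY).
Qed.

Lemma apply2_Cn {M : tmanifold} {F : nspace} (LM : nlaws (model M)) (LF : nlaws F) n
  (T : point M -> list (model M) -> F) (Y Z : point M -> model M) :
  tensor_Cn M F n 2 T -> tensor_Cn M (model M) n 0 (fun p _ => Y p) ->
  tensor_Cn M (model M) n 0 (fun p _ => Z p) ->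
  tensor_Cn M F n 0 (fun p _ => T p [Y p; Z p]).
Proof.
  intros HT HY HZ.
  assert (HU := plug_field_Cn LM LF n [] [] [0%nat] 1 2 0 T (fun q _ => Y q) eq_refl eq_refl
    (Permutation_refl _) HT HY).
  exact (plug_field_Cn LM LF n [] [] [] 0 1 0 _ (fun q _ => Z q) eq_refl eq_refl
    (Permutation_refl _) HU HZ).
Qed.

(** * The manifold [K^s] *)

Lemma Hs_ext r f g : (forall x, f x = g x) -> Hs r f -> Hs r g.
Proof. intros H. replace g with f; auto. now apply functional_extensionality. Qed.

Lemma Hs_center r f : Hs r f -> Hs r (fun x => f x - RInt f 0 1).
Proof. intros Hf. apply Hs_minus; auto. apply (Hs_const r (RInt f 0 1)). Qed.

Lemma Hs_quot_norm_ge0 r f : Hs r f -> 0 <= Hs_quot_norm r f.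
Proof. intros Hf. rewrite Hs_quot_norm_center by auto. apply Hs_norm_ge0. Qed.

Lemma Hs_quot_norm_plus r f g : Hs r f -> Hs r g ->
  Hs_quot_norm r (fun x => f x + g x) <= Hs_quot_norm r f + Hs_quot_norm r g.
Proof.
  intros Hf Hg. rewrite !Hs_quot_norm_center by (auto; now apply Hs_plus).
  eapply Rle_trans; [|apply Hs_plus; now apply Hs_center].
  right. apply Hs_norm_ext. intros x.
  rewrite RInt_plus_cont by (now apply (Hs_cont r)). ring.
Qed.

Lemma Hs_quot_norm_scal r c f : Hs r f ->
  Hs_quot_norm r (fun x => c * f x) = Rabs c * Hs_quot_norm r f.
Proof.
  intros Hf. rewrite !Hs_quot_norm_center by (auto; now apply Hs_scal).
  rewrite <- Hs_norm_scal by now apply Hs_center.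
  apply Hs_norm_ext. intros x. rewrite RInt_scal_cont by (now apply (Hs_cont r)). ring.
Qed.

Lemma center_shift r f g c x : Hs r g -> (forall y, f y = g y + c) ->
  f x - RInt f 0 1 = g x - RInt g 0 1.
Proof.
  intros Hg H. rewrite (RInt_ext_all f (fun y => g y + c)) by exact H.
  rewrite RInt_plus_cont, RInt_const_R, H by (try apply cont_const; now apply (Hs_cont r)).
  ring.
Qed.

(** Point evaluations for the first component; for the second, differences from the value at 0,
    which are blind to the additive constant. *)
Definition Kmodel_ev (s : R) (i : bool * R) (u : Kmodel s) : R :=
  if fst i then fst u (snd i) else snd u (snd i) - snd u 0.

Definition Kmodel_laws (s : R) (hs : 5 / 2 < s) : nlaws (Kmodel s).
Proof.
  refine (NLaws (Kmodel s) (bool * R) (Kmodel_ev s) _ _ _ _ _ _ _ _ _ _ _ _ _).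
  - intros u v. split.
    + intros (H1 & c & H2) (b & x). unfold Kmodel_ev; simpl. destruct b; auto.
      rewrite !H2. ring.
    + intros H. split.
      * intros x. apply (H (true, x)).
      * exists (snd u 0 - snd v 0). intros x. assert (E := H (false, x)).
        unfold Kmodel_ev in E; simpl in E. lra.
  - intros ([|] & x) u v; unfold Kmodel_ev; simpl; ring.
  - intros ([|] & x) a u; unfold Kmodel_ev; simpl; ring.
  - intros ([|] & x); unfold Kmodel_ev; simpl; ring.
  - simpl. split; [apply Hs_const|split; [reflexivity|apply Hs_const]].
  - intros u v (U1 & U2 & U3) (V1 & V2 & V3). simpl.
    split; [now apply Hs_plus|split; [rewrite U2, V2; ring|now apply Hs_plus]].
  - intros a u (U1 & U2 & U3). simpl.
    split; [now apply Hs_scal|split; [rewrite U2; ring|now apply Hs_scal]].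
  - intros u v (H1 & c & H2) (U1 & U2 & U3). split; [|split].
    + now apply (Hs_ext _ (fst u)).
    + rewrite <- H1. exact U2.
    + apply (Hs_ext _ (fun x => snd u x - c)); [intros; rewrite H2; ring|].
      apply Hs_minus; auto. apply (Hs_const (s - 1) c).
  - intros u (U1 & U2 & U3). simpl. apply Rplus_le_le_0_compat; [apply Hs_norm_ge0|].
    now apply Hs_quot_norm_ge0.
  - intros u v (U1 & U2 & U3) (V1 & V2 & V3). simpl.
    assert (H1 := proj2 (Hs_plus _ _ _ U1 V1)). assert (H2 := Hs_quot_norm_plus _ _ _ U3 V3). lra.
  - intros a u (U1 & U2 & U3). simpl.
    rewrite Hs_norm_scal, Hs_quot_norm_scal by auto. ring.
  - intros u v (U1 & U2 & U3) (V1 & V2 & V3) (H1 & c & H2). simpl. f_equal.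
    + now apply Hs_norm_ext.
    + rewrite !Hs_quot_norm_center by auto. apply Hs_norm_ext. intros x.
      now apply (center_shift (s - 1) _ _ c).
  - intros u (U1 & U2 & U3) H. simpl in H.
    assert (N1 := Hs_norm_ge0 s (fst u)). assert (N2 := Hs_quot_norm_ge0 _ _ U3).
    split.
    + apply (Hs_norm_eq0 s); auto; lra.
    + exists (RInt (snd u) 0 1). intros x.
      assert (E : snd u x - RInt (snd u) 0 1 = 0).
      { apply (Hs_norm_eq0 (s - 1) (fun x => snd u x - RInt (snd u) 0 1)); [lra| |].
        - now apply Hs_center.
        - rewrite <- Hs_quot_norm_center by auto. lra. }
      simpl. lra.
Defined.

Section Manifold.

Context (s : R) (hs : 5 / 2 < s).

Notation N := (Hs_norm (s - 1)).
Notation A := (Hs (s - 1)).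

Lemma fst_derivable (u : Kmodel s) : nmem u ->
  (forall x, is_derive (fst u) x (Derive (fst u) x)) /\ A (Derive (fst u)) /\
  N (Derive (fst u)) <= 2 * PI * nnorm u.
Proof.
  intros (U1 & U2 & U3). destruct (Hs_derivable (s - 1) (fst u)) as (H1 & H2 & H3); [lra| |].
  { now replace (s - 1 + 1) with s by ring. }
  split; [auto|split; [auto|]]. eapply Rle_trans; [exact H3|].
  replace (s - 1 + 1) with s by ring. assert (HP := PI_RGT_0).
  apply Rmult_le_compat_l; [lra|]. simpl. assert (H := Hs_quot_norm_ge0 _ _ U3). lra.
Qed.

Lemma snd_center (u : Kmodel s) : nmem u ->
  A (fun x => snd u x - RInt (snd u) 0 1) /\
  N (fun x => snd u x - RInt (snd u) 0 1) <= nnorm u.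
Proof.
  intros (U1 & U2 & U3). split; [now apply Hs_center|].
  simpl. rewrite <- Hs_quot_norm_center by auto. assert (H := Hs_norm_ge0 s (fst u)). lra.
Qed.

Lemma phi_derivable (p : point (K s)) : pmem p ->
  (forall x, is_derive (fst p) x (Derive (fst p) x)) /\ A (Derive (fst p)) /\
  (forall x, 0 < Derive (fst p) x).
Proof.
  intros (P1 & P2 & P3 & _).
  destruct (Hs_derivable (s - 1) (fun x => fst p x - x)) as (H1 & H2 & _); [lra| |].
  { now replace (s - 1 + 1) with s by ring. }
  assert (Hd : forall x, is_derive (fst p) x (Derive (fun y => fst p y - y) x + 1)).
  { intros x. apply (is_derive_ext (fun x => (fst p x - x) + x)); [intros; simpl; ring|].
    apply (is_derive_plus (fun x => fst p x - x) (fun x => x)); auto.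
    apply (is_derive_id (K := R_AbsRing) x). }
  assert (E : forall x, Derive (fst p) x = Derive (fun y => fst p y - y) x + 1).
  { intros x. now apply is_derive_unique. }
  split; [|split].
  - intros x. rewrite E. apply Hd.
  - apply (Hs_ext _ (fun x => Derive (fun y => fst p y - y) x + 1)); [auto|].
    apply Hs_plus; auto. apply (Hs_const (s - 1) 1).
  - intros x. rewrite E. specialize (P2 x). lra.
Qed.

Lemma rho_mem (p : point (K s)) : pmem p -> A (fun x => / Derive (fst p) x).
Proof.
  intros Hp. destruct (phi_derivable p Hp) as (_ & H1 & H2). apply Hs_inv; auto; [lra|].
  intros x. specialize (H2 x). lra.
Qed.

Lemma phi_total (p : point (K s)) : pmem p -> RInt (Derive (fst p)) 0 1 = 1.
Proof.
  intros Hp. destruct (phi_derivable p Hp) as (H1 & H2 & _).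
  rewrite (RInt_derive_cont (fst p)); auto; [|now apply (Hs_cont (s - 1))].
  destruct Hp as (P1 & _ & P3 & _). assert (Hper := Hs_periodic _ _ P1 0).
  rewrite Rplus_0_l in Hper. lra.
Qed.

Lemma Derive_shift (p : point (K s)) (u : model (K s)) x : pmem p -> nmem u ->
  Derive (fst (shift p u)) x = Derive (fst p) x + Derive (fst u) x.
Proof.
  intros Hp Hu. apply is_derive_unique.
  apply (is_derive_plus (fst p) (fst u)); [now apply phi_derivable|now apply fst_derivable].
Qed.

(** By periodicity [phi_x] has a positive minimum [m], and the sup norm of [h_x] is at most
    [c * 2 pi] times the norm of [h]. Below the radius [m / (c * 2 pi)] the derivative thus stays
    positive. *)
Lemma K_open_shifts : open_shifts (K s).
Proof.
  intros p Hp. destruct (phi_derivable p Hp) as (D1 & D2 & D3).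
  destruct (sobolev_sup (s - 1)) as (c & Hc & Hsup); [lra|].
  destruct (continuity_ab_min (Derive (fst p)) 0 1) as (x0 & Hmin & _); [lra| |].
  { intros y _. apply continuity_pt_filterlim. apply (Hs_cont _ _ D2). }
  set (m := Derive (fst p) x0) in *. assert (Hm : 0 < m) by apply D3.
  assert (Hmin' : forall x, m <= Derive (fst p) x).
  { intros x. destruct (periodic_reduce (Derive (fst p)) x (Hs_periodic _ _ D2)) as (y & Hy & <-).
    apply Hmin; lra. }
  assert (HP := PI_RGT_0). assert (HcP : 0 < c * (2 * PI)) by (apply Rmult_lt_0_compat; lra).
  exists (m / (c * (2 * PI))). split; [now apply Rdiv_lt_0_compat|].
  intros h Hh Hn. assert (Hh' := Hh). destruct Hh' as (H1 & H2 & H3).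
  assert (Hp' := Hp). destruct Hp' as (P1 & P2 & P3 & n & P4).
  destruct (fst_derivable h Hh) as (E1 & E2 & E3).
  split; [|split; [|split]]; simpl.
  - apply (Hs_ext _ (fun x => (fst p x - x) + fst h x)); [intros; ring|]. now apply Hs_plus.
  - intros x.
    assert (Hd : is_derive (fun y => fst p y + fst h y - y) x
      (Derive (fst p) x + Derive (fst h) x - 1)).
    { apply (is_derive_minus (fun y => fst p y + fst h y) (fun y => y)).
      - apply (is_derive_plus (fst p) (fst h)); auto.
      - apply (is_derive_id (K := R_AbsRing) x). }
    eapply Rlt_le_trans; [|right; symmetry; apply is_derive_unique; exact Hd].
    assert (Hb : Rabs (Derive (fst h) x) < m).
    { eapply Rle_lt_trans; [now apply Hsup|].
      apply Rle_lt_trans with (c * (2 * PI) * nnorm h).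
      - rewrite Rmult_assoc. apply Rmult_le_compat_l; [lra|exact E3].
      - apply Rmult_lt_compat_r with (r := c * (2 * PI)) in Hn; auto.
        unfold Rdiv in Hn. rewrite Rmult_assoc, Rinv_l in Hn by lra. lra. }
    apply Rabs_def2 in Hb. specialize (Hmin' x). lra.
  - rewrite P3, H2. ring.
  - exists n. apply (Hs_ext _ (fun x => (snd p x - 4 * PI * IZR n * x) + snd h x));
      [intros; ring|]. now apply Hs_plus.
Qed.

(** [Hs_inv] gives membership without a bound. The bound comes from the resolvent identity
    [g = rho - rho h_x g]: for small [h] the last term has at most half the norm of [g] and is
    absorbed on the left, whence the factor 2. *)
Lemma rho_local_bound (p : point (K s)) : pmem p -> exists C d, 0 <= C /\ 0 < d /\
  forall h : model (K s), nmem h -> nnorm h < d -> pmem (shift p h) ->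
    N (fun x => / Derive (fst (shift p h)) x) <= C.
Proof.
  intros Hp. destruct (Hs_mult (s - 1)) as (C & HC & Hmul); [lra|].
  destruct (phi_derivable p Hp) as (_ & _ & D3). assert (Hr := rho_mem p Hp).
  set (n0 := N (fun x => / Derive (fst p) x)). assert (N0 : 0 <= n0) by apply Hs_norm_ge0.
  assert (HP := PI_RGT_0). set (B := C * C * (n0 + 1) * (2 * PI)).
  assert (HB : 0 < B) by (unfold B; apply Rmult_lt_0_compat; [apply Rmult_lt_0_compat; [apply Rmult_lt_0_compat|]|]; lra).
  exists (2 * n0), (/ (2 * B)). split; [lra|]. split; [apply Rinv_0_lt_compat; lra|].
  intros h Hh Hn Hph. destruct (fst_derivable h Hh) as (E1 & E2 & E3).
  assert (Hq := rho_mem _ Hph). destruct (phi_derivable _ Hph) as (_ & _ & D3').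
  set (g := fun x => / Derive (fst (shift p h)) x) in *.
  assert (Eg : forall x, g x = / Derive (fst p) x
    + -1 * ((/ Derive (fst p) x * Derive (fst h) x) * g x)).
  { intros x. unfold g. rewrite Derive_shift by auto.
    specialize (D3 x). specialize (D3' x). rewrite Derive_shift in D3' by auto. field. lra. }
  destruct (Hmul _ _ Hr E2) as (M1 & M2). destruct (Hmul _ _ M1 Hq) as (M3 & M4).
  fold n0 in M2. assert (Ng : 0 <= N g) by apply Hs_norm_ge0.
  assert (K1 : N g <= n0 + N (fun x => (/ Derive (fst p) x * Derive (fst h) x) * g x)).
  { rewrite (Hs_norm_ext _ _ _ Eg). eapply Rle_trans.
    - apply (Hs_plus _ (fun x => / Derive (fst p) x)); auto. now apply Hs_scal.
    - rewrite Hs_norm_scal, Rabs_m1 by auto. fold n0. lra. }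
  assert (K2 : C * N (fun x => / Derive (fst p) x * Derive (fst h) x) <= / 2).
  { apply Rle_trans with (C * (C * (n0 + 1) * (2 * PI * nnorm h))).
    - apply Rmult_le_compat_l; [lra|]. eapply Rle_trans; [exact M2|].
      apply Rmult_le_compat; auto.
      + apply Rmult_le_pos; lra.
      + apply Hs_norm_ge0.
      + apply Rmult_le_compat_l; lra.
    - replace (C * (C * (n0 + 1) * (2 * PI * nnorm h))) with (B * nnorm h) by (unfold B; ring).
      apply (Rmult_lt_compat_l B), Rlt_le in Hn; auto.
      replace (/ 2) with (B * / (2 * B)) by (field; lra). exact Hn. }
  assert (K3 : C * N (fun x => / Derive (fst p) x * Derive (fst h) x) * N g <= / 2 * N g)
    by now apply Rmult_le_compat_r.
  lra.
Qed.

End Manifold.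

(** * Polynomial tensor fields on [K^s] *)

(* For the [i]-th argument [U], [Dx i] stands for [U_1x] and [Sn i] for [U_2] minus
   its mean, a representative whose norm is that of the class [[U_2]]. *)
Inductive expr : Type :=
| Cst (c : R) | Phi | Rho | Dx (i : nat) | Sn (i : nat)
| Add (a b : expr) | Mul (a b : expr) | Int (a : expr).

Definition pairs : Type := ((R -> R) * (R -> R))%type.

Fixpoint eval (p : pairs) (env : nat -> pairs) (e : expr) : R -> R :=
  match e with
  | Cst c => fun _ => c
  | Phi => Derive (fst p)
  | Rho => fun x => / Derive (fst p) x
  | Dx i => Derive (fst (env i))
  | Sn i => fun x => snd (env i) x - RInt (snd (env i)) 0 1
  | Add a b => fun x => eval p env a x + eval p env b x
  | Mul a b => fun x => eval p env a x * eval p env b x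
  | Int a => fun _ => RInt (eval p env a) 0 1
  end.

Definition ncons (h : pairs) (env : nat -> pairs) (i : nat) : pairs :=
  match i with O => h | S j => env j end.

Fixpoint lift_expr (e : expr) : expr :=
  match e with
  | Dx i => Dx (S i)
  | Sn i => Sn (S i)
  | Add a b => Add (lift_expr a) (lift_expr b)
  | Mul a b => Mul (lift_expr a) (lift_expr b)
  | Int a => Int (lift_expr a)
  | _ => e
  end.

(** Formal derivative in the base point. The direction becomes argument 0 and the others move up, as
    [is_tensor_derive] expects. [Sn] is constant in the point because its mean is unweighted; for
    [pi] itself this would fail. *)
Fixpoint dexpr (e : expr) : expr :=
  match e with
  | Phi => Dx 0
  | Rho => Mul (Cst (-1)) (Mul (Mul Rho Rho) (Dx 0))
  | Add a b => Add (dexpr a) (dexpr b)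
  | Mul a b => Add (Mul (dexpr a) (lift_expr b)) (Mul (lift_expr a) (dexpr b))
  | Int a => Int (dexpr a)
  | _ => Cst 0
  end.

(* [linear_in l e]: [e] is linear in each of the arguments listed in [l], and
   does not depend on the others. *)
Inductive linear_in : list nat -> expr -> Prop :=
| lin_zero l : linear_in l (Cst 0)
| lin_cst c : linear_in [] (Cst c)
| lin_phi : linear_in [] Phi
| lin_rho : linear_in [] Rho
| lin_dx i : linear_in [i] (Dx i)
| lin_sn i : linear_in [i] (Sn i)
| lin_add l a b : linear_in l a -> linear_in l b -> linear_in l (Add a b)
| lin_mul l1 l2 l a b : linear_in l1 a -> linear_in l2 b -> Permutation (l1 ++ l2) l ->
    linear_in l (Mul a b)
| lin_int l a : linear_in l a -> linear_in l (Int a).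

Lemma linear_in_lift l e : linear_in l e -> linear_in (map S l) (lift_expr e).
Proof.
  induction 1; simpl; try constructor; auto.
  econstructor; eauto. rewrite <- map_app. now apply Permutation_map.
Qed.

(** For the leaves with zero derivative, [lin_zero] is used with an arbitrary list: zero counts as
    linear in all arguments, including the direction. *)
Lemma linear_in_dexpr l e : linear_in l e -> linear_in (0%nat :: map S l) (dexpr e).
Proof.
  induction 1; simpl; try (constructor; auto; fail).
  - apply (lin_mul [] [0%nat]); [constructor| |auto].
    apply (lin_mul [] [0%nat]); [|constructor|auto].
    apply (lin_mul [] []); constructor.
  - assert (HP : Permutation (map S l1 ++ map S l2) (map S l))
      by (rewrite <- map_app; now apply Permutation_map).
    constructor.
    + eapply lin_mul; [eassumption|apply linear_in_lift; eassumption|].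
      simpl. now constructor.
    + eapply lin_mul; [apply linear_in_lift; eassumption|eassumption|].
      rewrite <- Permutation_middle. now constructor.
Qed.

Lemma eval_lift p h env e : eval p (ncons h env) (lift_expr e) = eval p env e.
Proof. induction e; simpl; rewrite ?IHe, ?IHe1, ?IHe2; reflexivity. Qed.

(** * Bounds and expansions of expressions *)

Section Expressions.

Context (s : R) (hs : 5 / 2 < s).

Notation N := (Hs_norm (s - 1)).
Notation A := (Hs (s - 1)).
Let LM : nlaws (model (K s)) := Kmodel_laws s hs.

Definition mem_env (env : nat -> model (K s)) : Prop := forall i, nmem (env i).

Lemma mem_ncons (h : model (K s)) env : nmem h -> mem_env env -> mem_env (ncons h env).
Proof. intros Hh He [|i]; [exact Hh|exact (He i)]. Qed.

Lemma eval_mem (p : point (K s)) env e : pmem p -> mem_env env -> A (eval p env e).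
Proof.
  intros Hp He. destruct (Hs_mult (s - 1)) as (C & _ & Hmul); [lra|].
  induction e; simpl.
  - apply Hs_const.
  - now apply phi_derivable.
  - now apply rho_mem.
  - now apply fst_derivable.
  - now apply (snd_center s).
  - now apply Hs_plus.
  - now apply (Hmul (eval p env e1) (eval p env e2)).
  - apply (Hs_const (s - 1)).
Qed.

Lemma eval_cont (p : point (K s)) env e : pmem p -> mem_env env -> cont (eval p env e).
Proof. intros. apply (Hs_cont (s - 1)). now apply eval_mem. Qed.

Definition env_norm (env : nat -> model (K s)) (l : list nat) : R := norms (map env l).

Lemma env_norm_ge0 env l : mem_env env -> 0 <= env_norm env l.
Proof.
  intros He. apply (norms_ge0 LM). apply List.Forall_map, List.Forall_forall. intros; apply He.
Qed.

Lemma env_norm_app env l l' : env_norm env (l ++ l') = env_norm env l * env_norm env l'.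
Proof. unfold env_norm. rewrite map_app. apply norms_app. Qed.

Lemma env_norm_perm env l l' : Permutation l l' -> env_norm env l = env_norm env l'.
Proof. intros H. apply norms_perm. now apply Permutation_map. Qed.

Lemma env_norm_ncons (h : model (K s)) env l :
  env_norm (ncons h env) (0%nat :: map S l) = nnorm h * env_norm env l.
Proof. unfold env_norm. simpl. now rewrite map_map. Qed.

Lemma eval_bound (p : point (K s)) l e : linear_in l e -> pmem p ->
  exists C, 0 <= C /\ forall env, mem_env env -> N (eval p env e) <= C * env_norm env l.
Proof.
  intros Hl Hp. destruct (Hs_mult (s - 1)) as (Cm & Cm0 & Hmul); [lra|].
  assert (HP := PI_RGT_0).
  induction Hl as [l|c| | |i|i|l a b Ha IHa Hb IHb|l1 l2 l a b Ha IHa Hb IHb Hperm|l a Ha IHa].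
  - exists 0. split; [lra|]. intros env He. simpl.
    eapply Rle_trans; [apply Hs_const|]. rewrite Rabs_R0. lra.
  - exists (Rabs c). split; [apply Rabs_pos|]. intros env He. unfold env_norm; simpl.
    rewrite Rmult_1_r. apply Hs_const.
  - exists (N (Derive (fst p))). split; [apply Hs_norm_ge0|]. intros env He.
    unfold env_norm; simpl. lra.
  - exists (N (fun x => / Derive (fst p) x)). split; [apply Hs_norm_ge0|]. intros env He.
    unfold env_norm; simpl. lra.
  - exists (2 * PI). split; [lra|]. intros env He. unfold env_norm.
    cbn [eval map norms fold_right].
    rewrite Rmult_1_r. now apply fst_derivable.
  - exists 1. split; [lra|]. intros env He. unfold env_norm.
    cbn [eval map norms fold_right].
    rewrite Rmult_1_r, Rmult_1_l. now apply (snd_center s).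
  - destruct IHa as (Ca & Ca0 & HCa). destruct IHb as (Cb & Cb0 & HCb).
    exists (Ca + Cb). split; [lra|]. intros env He. simpl.
    eapply Rle_trans; [apply Hs_plus; now apply eval_mem|].
    specialize (HCa env He). specialize (HCb env He). lra.
  - destruct IHa as (Ca & Ca0 & HCa). destruct IHb as (Cb & Cb0 & HCb).
    exists (Cm * (Ca * Cb)). split; [apply Rmult_le_pos; [lra|now apply Rmult_le_pos]|].
    intros env He. simpl.
    eapply Rle_trans; [apply (Hmul (eval p env a) (eval p env b)); now apply eval_mem|].
    specialize (HCa env He). specialize (HCb env He).
    rewrite <- (env_norm_perm env _ _ Hperm), env_norm_app.
    assert (N1 := Hs_norm_ge0 (s - 1) (eval p env a)).
    assert (N2 := Hs_norm_ge0 (s - 1) (eval p env b)).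
    replace (Cm * (Ca * Cb) * (env_norm env l1 * env_norm env l2))
      with (Cm * ((Ca * env_norm env l1) * (Cb * env_norm env l2))) by ring.
    rewrite Rmult_assoc. apply Rmult_le_compat_l; [lra|]. now apply Rmult_le_compat.
  - destruct IHa as (Ca & Ca0 & HCa). exists Ca. split; auto. intros env He. simpl.
    eapply Rle_trans; [apply Hs_const|].
    eapply Rle_trans; [apply (mean_le_norm (s - 1)); now apply eval_mem|]. auto.
Qed.

Definition eval_remainder (p q : pairs) (h : pairs) (env : nat -> pairs) (e : expr) (x : R) : R :=
  eval q env e x - eval p env e x - eval p (ncons h env) (dexpr e) x.

Lemma eval_remainder_mem (p : point (K s)) (h : model (K s)) env e :
  pmem p -> pmem (shift p h) -> nmem h -> mem_env env ->
  A (eval_remainder p (shift p h) h env e).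
Proof.
  intros Hp Hq Hh He. unfold eval_remainder.
  assert (He' := mem_ncons h env Hh He).
  apply (Hs_minus _ (fun x => eval (shift p h) env e x - eval p env e x));
    [apply Hs_minus|]; now apply eval_mem.
Qed.

(** An estimate of order [j] in [h], uniform in the other arguments. The radius is at most 1 so that
    higher powers of the norm are dominated by lower ones. *)
Definition near_bound (p : point (K s)) (l : list nat) (j : nat)
    (E : model (K s) -> (nat -> model (K s)) -> R -> R) : Prop :=
  exists C d, 0 <= C /\ 0 < d <= 1 /\ forall h env, nmem h -> nnorm h < d ->
    pmem (shift p h) -> mem_env env ->
    N (E h env) <= C * nnorm h ^ j * env_norm env l.

(** The derivative term is itself of first order by [eval_bound]. The estimate is needed for
    products, whose remainder involves the increments of the factors. *)
Lemma near_bound_difference (p : point (K s)) l e : linear_in l e -> pmem p ->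
  near_bound p l 2 (fun h env => eval_remainder p (shift p h) h env e) ->
  near_bound p l 1 (fun h env x => eval (shift p h) env e x - eval p env e x).
Proof.
  intros Hl Hp (C & d & C0 & Hd & HB).
  destruct (eval_bound p _ _ (linear_in_dexpr l e Hl) Hp) as (C1 & C10 & HC1).
  exists (C + C1), d. split; [lra|split; auto]. intros h env Hh Hn Hq He.
  assert (He' := mem_ncons h env Hh He).
  specialize (HB h env Hh Hn Hq He). specialize (HC1 _ He').
  rewrite env_norm_ncons in HC1.
  assert (R1 := eval_remainder_mem p h env e Hp Hq Hh He).
  rewrite (Hs_norm_ext _ _ (fun x => eval_remainder p (shift p h) h env e x
    + eval p (ncons h env) (dexpr e) x)) by (intros; unfold eval_remainder; ring).
  eapply Rle_trans; [apply Hs_plus; auto; now apply eval_mem|].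
  assert (Nh := norm_ge0 LM h Hh). assert (Ne := env_norm_ge0 env l He).
  assert (C * nnorm h ^ 2 * env_norm env l <= C * nnorm h * env_norm env l).
  { apply Rmult_le_compat_r; auto. apply Rmult_le_compat_l; auto.
    simpl in *. rewrite Rmult_1_r. rewrite <- (Rmult_1_r (_ + _)) at 3.
    apply Rmult_le_compat_l; auto. lra. }
  simpl in *. lra.
Qed.

Lemma near_bound_eval (p : point (K s)) l e : linear_in l e -> pmem p ->
  near_bound p l 1 (fun h env x => eval (shift p h) env e x - eval p env e x) ->
  near_bound p l 0 (fun h env => eval (shift p h) env e).
Proof.
  intros Hl Hp (C & d & C0 & Hd & HB).
  destruct (eval_bound p _ _ Hl Hp) as (C1 & C10 & HC1).
  exists (C + C1), d. split; [lra|split; auto]. intros h env Hh Hn Hq He.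
  specialize (HB h env Hh Hn Hq He). specialize (HC1 _ He).
  rewrite (Hs_norm_ext _ _ (fun x => (eval (shift p h) env e x - eval p env e x)
    + eval p env e x)) by (intros; ring).
  eapply Rle_trans; [apply Hs_plus; [apply Hs_minus|]; now apply eval_mem|].
  assert (Nh := norm_ge0 LM h Hh). assert (Ne := env_norm_ge0 env l He).
  assert (C * nnorm h ^ 1 * env_norm env l <= C * 1 * env_norm env l).
  { apply Rmult_le_compat_r; auto. apply Rmult_le_compat_l; auto. simpl in *. lra. }
  simpl in *. lra.
Qed.

(** A quadratic remainder is preserved by sums, products and integrals. Among the leaves only [Rho]
    is nonlinear in the base point; for the others the remainder is zero. *)
Lemma near_bound_remainder (p : point (K s)) l e : linear_in l e -> pmem p ->
  near_bound p l 2 (fun h env => eval_remainder p (shift p h) h env e).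
Proof.
  intros Hl Hp. destruct (Hs_mult (s - 1)) as (Cm & Cm0 & Hmul); [lra|].
  assert (HP := PI_RGT_0).
  assert (Hzero : forall l e, (forall h env x, nmem h -> pmem (shift p h) -> mem_env env ->
      eval_remainder p (shift p h) h env e x = 0) ->
    near_bound p l 2 (fun h env => eval_remainder p (shift p h) h env e)).
  { intros l0 e0 H. exists 0, 1. split; [lra|split; [lra|]]. intros h env Hh _ Hq He.
    rewrite (Hs_norm_ext _ _ (fun _ => 0)) by (intros; now apply H).
    eapply Rle_trans; [apply Hs_const|]. rewrite Rabs_R0. lra. }
  induction Hl as [l|c| | |i|i|l a b Ha IHa Hb IHb|l1 l2 l a b Ha IHa Hb IHb Hperm|l a Ha IHa].
  - apply Hzero. intros. unfold eval_remainder; simpl; ring.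
  - apply Hzero. intros. unfold eval_remainder; simpl; ring.
  - apply Hzero. intros h env x Hh Hq He. unfold eval_remainder; cbn [eval dexpr ncons].
    rewrite (Derive_shift s hs) by auto. ring.
  - destruct (rho_local_bound s hs p Hp) as (C & d & C0 & Hd & HB).
    set (n0 := N (fun x => / Derive (fst p) x)).
    assert (N0 : 0 <= n0) by apply Hs_norm_ge0.
    set (B := Cm * (Cm * n0 * n0) * (Cm * (Cm * (2 * PI) * (2 * PI)) * C)).
    exists B, (Rmin 1 d).
    assert (B0 : 0 <= B).
    { unfold B. apply Rmult_le_pos.
      - apply Rmult_le_pos; [lra|]. apply Rmult_le_pos; auto. apply Rmult_le_pos; lra.
      - apply Rmult_le_pos; auto. apply Rmult_le_pos; [lra|].
        apply Rmult_le_pos; [|lra]. apply Rmult_le_pos; lra. }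
    split; auto. split; [split; [apply Rmin_pos; lra|apply Rmin_l]|].
    intros h env Hh Hn Hq He.
    assert (Hn' : nnorm h < d) by (eapply Rlt_le_trans; [exact Hn|apply Rmin_r]).
    specialize (HB h Hh Hn' Hq).
    destruct (fst_derivable s hs h Hh) as (_ & D2 & D3).
    destruct (phi_derivable s hs p Hp) as (_ & _ & P3).
    destruct (phi_derivable s hs _ Hq) as (_ & _ & Q3).
    assert (Rp := rho_mem s hs p Hp). assert (Rq := rho_mem s hs _ Hq).
    set (dh := Derive (fst h)) in *. set (rp := fun x => / Derive (fst p) x) in *.
    set (rq := fun x => / Derive (fst (shift p h)) x) in *.
    (* With [a] for [phi_x] and [h] for [h_x]: [1/(a+h) - 1/a + h/a^2 = h^2 / (a^2 (a+h))]. The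
       factor [1/(a+h)] is bounded by [rho_local_bound]. *)
    rewrite (Hs_norm_ext _ _ (fun x => (rp x * rp x) * ((dh x * dh x) * rq x))).
    2: { intros x. unfold eval_remainder, rp, rq, dh. cbn [eval dexpr ncons].
         specialize (Q3 x). rewrite (Derive_shift s hs) in * by auto. specialize (P3 x).
         field. lra. }
    destruct (Hmul _ _ Rp Rp) as (X1 & X2). destruct (Hmul _ _ D2 D2) as (Y1 & Y2).
    destruct (Hmul _ _ Y1 Rq) as (Z1 & Z2). destruct (Hmul _ _ X1 Z1) as (W1 & W2).
    fold n0 in X2. unfold env_norm. cbn [map norms fold_right]. rewrite Rmult_1_r.
    assert (Nh := norm_ge0 LM h Hh).
    assert (Nd := Hs_norm_ge0 (s - 1) dh).
    eapply Rle_trans; [exact W2|].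
    replace (B * nnorm h ^ 2) with (Cm * (Cm * n0 * n0)
      * (Cm * (Cm * (2 * PI * nnorm h) * (2 * PI * nnorm h)) * C)) by (unfold B; ring).
    apply Rmult_le_compat; try apply Hs_norm_ge0.
    { apply Rmult_le_pos; [lra|apply Hs_norm_ge0]. }
    { apply Rmult_le_compat_l; [lra|exact X2]. }
    eapply Rle_trans; [exact Z2|].
    apply Rmult_le_compat; auto; try apply Hs_norm_ge0.
    { apply Rmult_le_pos; [lra|apply Hs_norm_ge0]. }
    apply Rmult_le_compat_l; [lra|]. eapply Rle_trans; [exact Y2|].
    apply Rmult_le_compat; auto; [apply Rmult_le_pos; lra|]. apply Rmult_le_compat_l; auto; lra.
  - apply Hzero. intros. unfold eval_remainder; simpl; ring.
  - apply Hzero. intros. unfold eval_remainder; simpl; ring.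
  - destruct IHa as (Ca & da & Ca0 & Hda & HBa). destruct IHb as (Cb & db & Cb0 & Hdb & HBb).
    exists (Ca + Cb), (Rmin da db). split; [lra|].
    split; [split; [apply Rmin_pos; lra|eapply Rle_trans; [apply Rmin_l|lra]]|].
    intros h env Hh Hn Hq He.
    specialize (HBa h env Hh ltac:(eapply Rlt_le_trans; [exact Hn|apply Rmin_l]) Hq He).
    specialize (HBb h env Hh ltac:(eapply Rlt_le_trans; [exact Hn|apply Rmin_r]) Hq He).
    rewrite (Hs_norm_ext _ _ (fun x => eval_remainder p (shift p h) h env a x
      + eval_remainder p (shift p h) h env b x))
      by (intros; unfold eval_remainder; simpl; ring).
    eapply Rle_trans; [apply Hs_plus; now apply eval_remainder_mem|]. lra.
  - assert (La := near_bound_difference p l1 a Ha Hp IHa).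
    assert (Lb := near_bound_difference p l2 b Hb Hp IHb).
    assert (Eb := near_bound_eval p l2 b Hb Hp Lb).
    destruct (eval_bound p _ _ Ha Hp) as (Ba & Ba0 & HBa).
    destruct (eval_bound p _ _ (linear_in_dexpr l1 a Ha) Hp) as (Bd & Bd0 & HBd).
    destruct IHa as (Ra & d1 & Ra0 & Hd1 & HRa). destruct IHb as (Rb & d2 & Rb0 & Hd2 & HRb).
    destruct Lb as (Lb & d3 & Lb0 & Hd3 & HLb). destruct Eb as (Eb & d4 & Eb0 & Hd4 & HEb).
    exists (Cm * (Ra * Eb) + Cm * (Bd * Lb) + Cm * (Ba * Rb)),
      (Rmin (Rmin d1 d2) (Rmin d3 d4)).
    split.
    { assert (0 <= Cm * (Ra * Eb)) by (apply Rmult_le_pos; [lra|now apply Rmult_le_pos]).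
      assert (0 <= Cm * (Bd * Lb)) by (apply Rmult_le_pos; [lra|now apply Rmult_le_pos]).
      assert (0 <= Cm * (Ba * Rb)) by (apply Rmult_le_pos; [lra|now apply Rmult_le_pos]).
      lra. }
    split; [unfold Rmin; repeat destruct Rle_dec; lra|].
    intros h env Hh Hn Hq He.
    assert (Hn' : nnorm h < d1 /\ nnorm h < d2 /\ nnorm h < d3 /\ nnorm h < d4).
    { revert Hn. unfold Rmin. repeat destruct Rle_dec; lra. }
    destruct Hn' as (Hn1 & Hn2 & Hn3 & Hn4). clear Hn.
    assert (He' := mem_ncons h env Hh He).
    specialize (HRa h env Hh Hn1 Hq He). specialize (HRb h env Hh Hn2 Hq He).
    specialize (HLb h env Hh Hn3 Hq He). specialize (HEb h env Hh Hn4 Hq He).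
    specialize (HBa env He). specialize (HBd _ He'). rewrite env_norm_ncons in HBd.
    set (q := shift p h) in *.
    set (ra := eval_remainder p q h env a) in *. set (rb := eval_remainder p q h env b) in *.
    set (eb := eval q env b) in *. set (lb := fun x => eb x - eval p env b x) in *.
    set (da := eval p (ncons h env) (dexpr a)) in *. set (ea := eval p env a) in *.
    assert (Mra : A ra) by now apply eval_remainder_mem.
    assert (Mrb : A rb) by now apply eval_remainder_mem.
    assert (Meb : A eb) by now apply eval_mem.
    assert (Mlb : A lb) by (apply Hs_minus; auto; now apply eval_mem).
    assert (Mda : A da) by now apply eval_mem.
    assert (Mea : A ea) by now apply eval_mem.
    (* Remainder of a product: remainder of the first factor times the new second factor, derivative
       of the first times increment of the second, and old first factor times remainder of the
       second. The orders in [h] are 2+0, 1+1 and 0+2. *)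
    rewrite (Hs_norm_ext _ _ (fun x => (ra x * eb x + da x * lb x) + ea x * rb x)).
    2: { intros x. unfold ra, rb, lb, eb, ea, da, eval_remainder. simpl.
         rewrite !eval_lift. ring. }
    destruct (Hmul _ _ Mra Meb) as (X1 & X2). destruct (Hmul _ _ Mda Mlb) as (Y1 & Y2).
    destruct (Hmul _ _ Mea Mrb) as (Z1 & Z2). destruct (Hs_plus _ _ _ X1 Y1) as (V1 & V2).
    destruct (Hs_plus _ _ _ V1 Z1) as (_ & W2).
    rewrite <- (env_norm_perm env _ _ Hperm), env_norm_app.
    assert (Nh := norm_ge0 LM h Hh).
    set (n1 := env_norm env l1) in *. set (n2 := env_norm env l2) in *. set (nh := nnorm h) in *.
    assert (X3 : Cm * N ra * N eb <= Cm * (Ra * Eb) * nh ^ 2 * (n1 * n2)).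
    { replace (Cm * (Ra * Eb) * nh ^ 2 * (n1 * n2))
        with (Cm * ((Ra * nh ^ 2 * n1) * (Eb * nh ^ 0 * n2))) by (simpl; ring).
      rewrite Rmult_assoc. apply Rmult_le_compat_l; [lra|].
      apply Rmult_le_compat; auto; apply Hs_norm_ge0. }
    assert (Y3 : Cm * N da * N lb <= Cm * (Bd * Lb) * nh ^ 2 * (n1 * n2)).
    { replace (Cm * (Bd * Lb) * nh ^ 2 * (n1 * n2))
        with (Cm * ((Bd * (nh * n1)) * (Lb * nh ^ 1 * n2))) by (simpl; ring).
      rewrite Rmult_assoc. apply Rmult_le_compat_l; [lra|].
      apply Rmult_le_compat; auto; apply Hs_norm_ge0. }
    assert (Z3 : Cm * N ea * N rb <= Cm * (Ba * Rb) * nh ^ 2 * (n1 * n2)).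
    { replace (Cm * (Ba * Rb) * nh ^ 2 * (n1 * n2))
        with (Cm * ((Ba * n1) * (Rb * nh ^ 2 * n2))) by (simpl; ring).
      rewrite Rmult_assoc. apply Rmult_le_compat_l; [lra|].
      apply Rmult_le_compat; auto; apply Hs_norm_ge0. }
    lra.
  - destruct IHa as (Ca & da & Ca0 & Hda & HBa). exists Ca, da. split; [auto|split; [auto|]].
    intros h env Hh Hn Hq He. specialize (HBa h env Hh Hn Hq He).
    assert (He' := mem_ncons h env Hh He).
    eapply Rle_trans; [|exact HBa].
    rewrite (Hs_norm_ext _ _ (fun _ => RInt (eval_remainder p (shift p h) h env a) 0 1)).
    + eapply Rle_trans; [apply Hs_const|]. apply (mean_le_norm (s - 1)).
      now apply eval_remainder_mem.
    + intros x. unfold eval_remainder. cbn [eval dexpr].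
      assert (C1 := eval_cont _ _ a Hq He). assert (C2 := eval_cont _ _ a Hp He).
      assert (C3 := eval_cont _ _ (dexpr a) Hp He').
      rewrite (RInt_minus_cont (fun x => eval (shift p h) env a x - eval p env a x)),
        RInt_minus_cont by cont. reflexivity.
Qed.

End Expressions.

(** * Multilinearity of expressions and the tensor fields they define *)

Section Multilinearity.

Context (s : R) (hs : 5 / 2 < s).

Notation N := (Hs_norm (s - 1)).
Notation A := (Hs (s - 1)).
Let LM : nlaws (model (K s)) := Kmodel_laws s hs.

Lemma eval_independent (p : point (K s)) l e i (env env' : nat -> model (K s)) :
  linear_in l e -> ~ In i l -> (forall j, j <> i -> env j = env' j) ->
  eval p env e = eval p env' e.
Proof.
  intros Hl Hi He.
  induction Hl as [l|c| | |j|j|l a b Ha IHa Hb IHb|l1 l2 l a b Ha IHa Hb IHb Hperm|l a Ha IHa];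
    simpl; auto.
  - rewrite He; auto. intros ->. apply Hi. now left.
  - rewrite He; auto. intros ->. apply Hi. now left.
  - now rewrite IHa, IHb.
  - assert (Hi' : ~ In i (l1 ++ l2)).
    { intros H. apply Hi. eapply Permutation_in; eauto. }
    rewrite in_app_iff in Hi'. rewrite IHa, IHb; tauto.
  - now rewrite IHa.
Qed.

Lemma eval_linear (p : point (K s)) l e i (eu ev ew : nat -> model (K s)) c :
  pmem p -> linear_in l e -> NoDup l -> In i l -> mem_env s eu -> mem_env s ev -> mem_env s ew ->
  (forall j, j <> i -> eu j = ew j) -> (forall j, j <> i -> ev j = ew j) ->
  ew i = c [*] eu i [+] ev i ->
  forall x, eval p ew e x = c * eval p eu e x + eval p ev e x.
Proof.
  intros Hp Hl Hnd Hi Mu Mv Mw Hu Hv Hw.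
  induction Hl as [l|d| | |j|j|l a b Ha IHa Hb IHb|l1 l2 l a b Ha IHa Hb IHb Hperm|l a Ha IHa];
    intros x; simpl in Hi; try easy.
  - simpl. ring.
  - destruct Hi as [->|[]]. simpl. rewrite Hw.
    destruct (fst_derivable s hs _ (Mu i)) as (D1 & _).
    destruct (fst_derivable s hs _ (Mv i)) as (D2 & _).
    apply is_derive_unique.
    apply (is_derive_plus (fun x => c * fst (eu i) x) (fst (ev i))); auto.
    apply (is_derive_scal (fst (eu i)) x c _ (D1 x)).
  - destruct Hi as [->|[]]. simpl. rewrite Hw. simpl.
    destruct (Mu i) as (_ & _ & U3). destruct (Mv i) as (_ & _ & V3).
    apply Hs_cont in U3. apply Hs_cont in V3.
    rewrite (RInt_plus_cont (fun x => c * snd (eu i) x)), RInt_scal_cont by cont. ring.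
  - simpl. rewrite IHa, IHb by auto. ring.
  - assert (Hnd' : NoDup (l1 ++ l2)) by (eapply Permutation_NoDup; [symmetry|]; eauto).
    assert (Hi' : In i (l1 ++ l2)) by (eapply Permutation_in; [symmetry|]; eauto).
    (* The factors share no argument, so the product depends on the varied one through exactly one
       of them. *)
    assert (Hor : forall y, In y l1 -> ~ In y l2).
    { clear - Hnd'. induction l1 as [|z l1 IH]; simpl in *; [easy|].
      inversion_clear Hnd'. intros y [<-|Hy] H1.
      - apply H. apply in_or_app. now right.
      - now apply (IH H0 y). }
    simpl. apply in_app_or in Hi'. destruct Hi' as [Hi'|Hi'].
    + rewrite IHa by (auto; now apply NoDup_app_remove_r in Hnd').
      rewrite (eval_independent p l2 b i eu ew), (eval_independent p l2 b i ev ew); auto. ring.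
    + assert (Hi1 : ~ In i l1) by (intros H; now apply (Hor i)).
      rewrite IHb by (auto; now apply NoDup_app_remove_l in Hnd').
      rewrite (eval_independent p l1 a i eu ew), (eval_independent p l1 a i ev ew); auto. ring.
  - simpl. rewrite (RInt_ext_all _ (fun x => c * eval p eu a x + eval p ev a x)) by auto.
    assert (C1 := eval_cont s hs p eu a Hp Mu). assert (C2 := eval_cont s hs p ev a Hp Mv).
    rewrite (RInt_plus_cont (fun x => c * eval p eu a x)), RInt_scal_cont by cont. reflexivity.
Qed.

Lemma eval_eqv (p q : point (K s)) (env env' : nat -> model (K s)) e :
  mem_env s env' -> (forall x, fst p x = fst q x) -> (forall i, env i == env' i) ->
  eval p env e = eval q env' e.
Proof.
  intros He Hpq H. assert (Ep : fst p = fst q) by now apply functional_extensionality.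
  induction e; simpl; rewrite ?Ep, ?IHe, ?IHe1, ?IHe2; auto.
  - destruct (H i) as (H1 & _). apply functional_extensionality in H1. now rewrite H1.
  - destruct (H i) as (_ & c & H2). apply functional_extensionality. intros x.
    apply (center_shift (s - 1) _ _ c); auto. apply He.
Qed.

Definition env_of (l : list (model (K s))) (i : nat) : model (K s) := nth i l nzero.

Lemma env_of_mem k l : args k l -> mem_env s (env_of l).
Proof.
  intros (_ & H) i. unfold env_of. destruct (Nat.lt_ge_cases i (length l)).
  - rewrite List.Forall_forall in H. apply H. now apply nth_In.
  - rewrite nth_overflow by auto. apply (mem_zero LM).
Qed.

Lemma env_of_cons h l : env_of (h :: l) = ncons h (env_of l).
Proof. apply functional_extensionality. now intros [|i]. Qed.

Lemma env_of_norm k l : args k l -> env_norm s (env_of l) (seq 0 k) = norms l.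
Proof. intros (<- & _). unfold env_norm. f_equal. apply sel_seq. Qed.

Lemma env_of_at (l1 l2 : list (model (K s))) u : env_of (l1 ++ u :: l2) (length l1) = u.
Proof. unfold env_of. rewrite app_nth2, Nat.sub_diag; auto. Qed.

Lemma env_of_off (l1 l2 : list (model (K s))) u v j : j <> length l1 ->
  env_of (l1 ++ u :: l2) j = env_of (l1 ++ v :: l2) j.
Proof.
  intros H. unfold env_of. destruct (Nat.lt_ge_cases j (length l1)).
  - now rewrite !app_nth1.
  - rewrite !app_nth2 by auto. destruct (j - length l1)%nat eqn:E; [lia|reflexivity].
Qed.

Lemma env_of_eqv (l l' : list (model (K s))) : List.Forall2 neqv l l' ->
  forall i, env_of l i == env_of l' i.
Proof.
  intros H. unfold env_of. induction H as [|u v l l' Huv H IH]; intros [|i]; simpl nth; auto;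
    apply (neqv_refl LM).
Qed.

(** ** Tensor fields read off from a pair of expressions *)

(** A bounded linear map from pairs of functions in [H^(s-1)], by which estimates on expressions
    become estimates on tensors. Scalar tensors use the integral over the circle; tangent vectors
    use the primitive and the class modulo constants. *)
Record readout (F : nspace) : Type := Readout {
  rd : (R -> R) -> (R -> R) -> F;
  rd_mem : forall f g, A f -> A g -> nmem (rd f g);
  rd_lin : forall c f f' g g', A f -> A f' -> A g -> A g' ->
    rd (fun x => c * f x + f' x) (fun x => c * g x + g' x) == c [*] rd f g [+] rd f' g';
  rd_bound : exists C, 0 <= C /\ forall f g, A f -> A g -> nnorm (rd f g) <= C * (N f + N g) }.

Arguments rd {F} _ _ _.

Context {F : nspace} (LF : nlaws F) (rho : readout F).

Definition expr_tensor (e1 e2 : expr) (p : point (K s)) (l : list (model (K s))) : F :=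
  rd rho (eval p (env_of l) e1) (eval p (env_of l) e2).

Lemma rd_sub f f' g g' : A f -> A f' -> A g -> A g' ->
  rd rho f g [-] rd rho f' g' == rd rho (fun x => f x - f' x) (fun x => g x - g' x).
Proof.
  intros Hf Hf' Hg Hg'. assert (H := rd_lin _ rho (-1) f' f g' g Hf' Hf Hg' Hg).
  replace (fun x => -1 * f' x + f x) with (fun x => f x - f' x) in H
    by (apply functional_extensionality; intros; ring).
  replace (fun x => -1 * g' x + g x) with (fun x => g x - g' x) in H
    by (apply functional_extensionality; intros; ring).
  apply (ev_eqv LF). intros i. ntrans LF i. ev_expand LF. lra.
Qed.

Lemma expr_tensor_field k e1 e2 :
  linear_in (seq 0 k) e1 -> linear_in (seq 0 k) e2 ->
  tensor_field (K s) F k (expr_tensor e1 e2).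
Proof.
  intros L1 L2. split.
  - intros p Hp. split; [|split; [|split]].
    + intros l Hl. apply rd_mem; apply (eval_mem s hs); auto; eapply env_of_mem; eauto.
    + intros l l' Hl Hl' H. unfold expr_tensor.
      assert (M' := env_of_mem _ _ Hl').
      rewrite (eval_eqv p p (env_of l) (env_of l') e1), (eval_eqv p p (env_of l) (env_of l') e2);
        auto; try now apply env_of_eqv. apply (neqv_refl LF).
    + intros l1 l2 u v c Hu Hv.
      destruct (args_app_inv _ _ _ _ Hu) as (M1 & Mu & M2 & Hk).
      assert (Av : args k (l1 ++ v :: l2)) by now apply args_app_intro.
      assert (Aw : args k (l1 ++ (c [*] u [+] v) :: l2)).
      { apply args_app_intro; auto. apply (mem_add LM); auto. now apply (mem_scal LM). }
      assert (Eu := env_of_mem _ _ Hu). assert (Ev := env_of_mem _ _ Av).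
      assert (Ew := env_of_mem _ _ Aw).
      assert (HE : forall e, linear_in (seq 0 k) e ->
        eval p (env_of (l1 ++ (c [*] u [+] v) :: l2)) e
        = (fun x => c * eval p (env_of (l1 ++ u :: l2)) e x
                    + eval p (env_of (l1 ++ v :: l2)) e x)).
      { intros e He. apply functional_extensionality. intros x.
        apply (eval_linear p (seq 0 k) e (length l1)); auto.
        - apply seq_NoDup.
        - apply in_seq. lia.
        - intros; now apply env_of_off.
        - intros; now apply env_of_off.
        - rewrite !env_of_at. reflexivity. }
      unfold expr_tensor. rewrite !HE by auto.
      apply rd_lin; now apply (eval_mem s hs).
    + destruct (rd_bound _ rho) as (C & C0 & HC).
      destruct (eval_bound s hs p _ _ L1 Hp) as (B1 & B10 & HB1).
      destruct (eval_bound s hs p _ _ L2 Hp) as (B2 & B20 & HB2).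
      exists (C * (B1 + B2)). intros l Hl. assert (Me := env_of_mem _ _ Hl).
      eapply Rle_trans; [apply HC; now apply (eval_mem s hs)|].
      specialize (HB1 _ Me). specialize (HB2 _ Me).
      rewrite (env_of_norm k l Hl) in *. rewrite Rmult_assoc. apply Rmult_le_compat_l; auto. lra.
  - intros p q l Hp Hq (Hpq & _) Hl. unfold expr_tensor.
    assert (M := env_of_mem _ _ Hl).
    rewrite (eval_eqv p q (env_of l) (env_of l) e1), (eval_eqv p q (env_of l) (env_of l) e2); auto;
      try (intros; apply (neqv_refl LM)). apply (neqv_refl LF).
Qed.

Lemma expr_tensor_derive k e1 e2 :
  linear_in (seq 0 k) e1 -> linear_in (seq 0 k) e2 ->
  is_tensor_derive (K s) F k (expr_tensor e1 e2) (expr_tensor (dexpr e1) (dexpr e2)).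
Proof.
  intros L1 L2 p Hp eps Heps. destruct (rd_bound _ rho) as (C & C0 & HC).
  destruct (near_bound_remainder s hs p _ _ L1 Hp) as (B1 & d1 & B10 & Hd1 & HB1).
  destruct (near_bound_remainder s hs p _ _ L2 Hp) as (B2 & d2 & B20 & Hd2 & HB2).
  set (B := C * (B1 + B2) + 1).
  assert (HB : 0 < B) by (unfold B; assert (0 <= C * (B1 + B2)) by (apply Rmult_le_pos; lra); lra).
  exists (Rmin (eps / B) (Rmin d1 d2)).
  split; [repeat apply Rmin_pos; try lra; now apply Rdiv_lt_0_compat|].
  intros h Hh Hn Hq l Hl.
  assert (Hn' : nnorm h < eps / B /\ nnorm h < d1 /\ nnorm h < d2).
  { revert Hn. unfold Rmin. repeat destruct Rle_dec; lra. }
  destruct Hn' as (Hn0 & Hn1 & Hn2). clear Hn.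
  assert (Me := env_of_mem _ _ Hl). assert (Me' := mem_ncons s h _ Hh Me).
  specialize (HB1 h _ Hh Hn1 Hq Me). specialize (HB2 h _ Hh Hn2 Hq Me).
  rewrite (env_of_norm k l Hl) in *. unfold expr_tensor. rewrite env_of_cons.
  assert (X1 := eval_mem s hs _ _ e1 Hp Me). assert (X2 := eval_mem s hs _ _ e2 Hp Me).
  assert (Y1 := eval_mem s hs _ _ e1 Hq Me). assert (Y2 := eval_mem s hs _ _ e2 Hq Me).
  assert (Z1 := eval_mem s hs _ _ (dexpr e1) Hp Me').
  assert (Z2 := eval_mem s hs _ _ (dexpr e2) Hp Me').
  assert (R1 := eval_remainder_mem s hs p h _ e1 Hp Hq Hh Me).
  assert (R2 := eval_remainder_mem s hs p h _ e2 Hp Hq Hh Me).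
  assert (HN := norms_ge0 LM l (proj2 Hl)). assert (Nh := norm_ge0 LM h Hh).
  apply (norm_le_eqv LF _ (rd rho (eval_remainder p (shift p h) h (env_of l) e1)
    (eval_remainder p (shift p h) h (env_of l) e2))).
  - apply (mem_sub LF); [apply (mem_sub LF)|]; now apply rd_mem.
  - now apply rd_mem.
  - eapply (neqv_trans LF).
    + apply (nsub_eqv LF); [now apply rd_sub|apply (neqv_refl LF)].
    + apply rd_sub; auto; now apply Hs_minus.
  - eapply Rle_trans; [now apply HC|].
    apply Rle_trans with (B * nnorm h * nnorm h * norms l).
    + assert (C * (N (eval_remainder p (shift p h) h (env_of l) e1)
        + N (eval_remainder p (shift p h) h (env_of l) e2))
        <= C * (B1 * nnorm h ^ 2 * norms l + B2 * nnorm h ^ 2 * norms l))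
        by (apply Rmult_le_compat_l; auto; lra).
      assert (0 <= nnorm h * nnorm h * norms l)
        by (apply Rmult_le_pos; auto; now apply Rmult_le_pos).
      unfold B. simpl in *. lra.
    + apply Rmult_le_compat_r; auto. apply Rmult_le_compat_r; auto.
      apply (Rmult_lt_compat_l B) in Hn0; auto.
      replace (B * (eps / B)) with eps in Hn0 by (field; lra). lra.
Qed.

Lemma linear_in_dexpr_seq k e : linear_in (seq 0 k) e -> linear_in (seq 0 (S k)) (dexpr e).
Proof. intros H. simpl. rewrite <- seq_shift. now apply linear_in_dexpr. Qed.

Lemma expr_tensor_continuous k e1 e2 :
  linear_in (seq 0 k) e1 -> linear_in (seq 0 k) e2 ->
  tensor_continuous (K s) F k (expr_tensor e1 e2).
Proof.
  intros L1 L2.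
  apply (tensor_continuous_of_derive LM LF k _ (expr_tensor (dexpr e1) (dexpr e2))).
  - now apply expr_tensor_field.
  - apply expr_tensor_field; now apply linear_in_dexpr_seq.
  - now apply expr_tensor_derive.
Qed.

(** Expressions linear in their arguments are closed under [dexpr], so the first-order estimate
    gives every order by induction. *)
Lemma expr_tensor_Cn n : forall k e1 e2,
  linear_in (seq 0 k) e1 -> linear_in (seq 0 k) e2 ->
  tensor_Cn (K s) F n k (expr_tensor e1 e2).
Proof.
  induction n as [|n IH]; intros k e1 e2 L1 L2;
    (split; [now apply expr_tensor_field|split; [now apply expr_tensor_continuous|]]); [exact I|].
  exists (expr_tensor (dexpr e1) (dexpr e2)). split; [now apply expr_tensor_derive|].
  apply IH; now apply linear_in_dexpr_seq.
Qed.

End Multilinearity.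

Arguments rd {s F} _ _ _.

(** * The inverse of a circle diffeomorphism *)

Section Inverse.

Context (phi dphi : R -> R) (Hd : forall x, is_derive phi x (dphi x)) (Cd : cont dphi)
  (Pp : periodic (fun x => phi x - x)) (m : R) (Hm : 0 < m) (Hmin : forall x, m <= dphi x).

Let Cphi : cont phi.
Proof. apply cont_derivable. intros x. now exists (dphi x). Qed.

Lemma phi_increment x y : x <= y -> m * (y - x) <= phi y - phi x.
Proof.
  intros Hxy. rewrite <- (RInt_derive_cont phi dphi) by auto.
  apply Rle_trans with (RInt (fun _ => m) x y).
  - rewrite RInt_const_R. lra.
  - apply RInt_le_cont; auto. apply cont_const.
Qed.

(** Gives injectivity, and shows that the inverse is Lipschitz with constant [1/m]. *)
Lemma phi_expanding x y : m * Rabs (x - y) <= Rabs (phi x - phi y).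
Proof.
  destruct (Rle_dec x y) as [H|H].
  - assert (H1 := phi_increment x y H). assert (0 <= m * (y - x)) by (apply Rmult_le_pos; lra).
    rewrite Rabs_minus_sym, (Rabs_minus_sym (phi x)), !Rabs_pos_eq; lra.
  - assert (H1 := phi_increment y x ltac:(lra)).
    assert (0 <= m * (x - y)) by (apply Rmult_le_pos; lra).
    rewrite !Rabs_pos_eq; lra.
Qed.

(** [phi - id] is periodic, hence bounded by some [B]; the values of [phi] at [y - B] and [y + B]
    therefore enclose [y]. *)
Lemma phi_surjective y : exists x, phi x = y.
Proof.
  destruct (periodic_bounded (fun x => phi x - x)) as (B & HB); auto.
  { assert (C := cont_id). cont. }
  assert (B0 : 0 <= B) by (eapply Rle_trans; [apply Rabs_pos|apply (HB 0)]).
  assert (H1 := HB (y - B)). assert (H2 := HB (y + B)).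
  apply Rabs_le_between in H1. apply Rabs_le_between in H2.
  destruct (IVT_gen phi (y - B) (y + B) y) as (x & _ & Hx).
  - intros x. apply continuity_pt_filterlim. apply Cphi.
  - rewrite Rmin_left, Rmax_right; lra.
  - now exists x.
Qed.

Lemma phi_inverse_r y : phi (inverse phi y) = y.
Proof. unfold inverse. apply epsilon_spec. apply phi_surjective. Qed.

Lemma phi_inverse_l x : inverse phi (phi x) = x.
Proof.
  assert (H := phi_expanding (inverse phi (phi x)) x).
  rewrite phi_inverse_r, Rminus_diag, Rabs_R0 in H.
  assert (H0 := Rabs_pos (inverse phi (phi x) - x)).
  assert (Rabs (inverse phi (phi x) - x) <= 0) by nra.
  apply Rminus_diag_uniq. apply Rabs_eq_0. lra.
Qed.

Lemma is_derive_inverse y : is_derive (inverse phi) y (/ dphi (inverse phi y)).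
Proof.
  apply is_derive_Reals. intros eps He.
  set (x0 := inverse phi y). set (c := dphi x0).
  assert (Hc : m <= c) by apply Hmin.
  assert (H := Hd x0). apply is_derive_Reals in H. fold c in H.
  (* With [q = h / k] the difference quotient of [phi], the error for the inverse is
     [(c - q) / (q c)], and [q c >= m c]. *)
  assert (He' : 0 < eps * (m * c)) by (apply Rmult_lt_0_compat; auto; apply Rmult_lt_0_compat; lra).
  destruct (H _ He') as (d & Hq).
  assert (Hd0 := cond_pos d).
  (* By expansion an increment [h] of the value moves the preimage by at most [|h| / m], hence by
     less than [d]. *)
  exists (mkposreal (m * d) (Rmult_lt_0_compat _ _ Hm Hd0)). simpl. intros h Hh Hhd.
  set (x := inverse phi (y + h)).
  assert (Hx : phi x - phi x0 = h).
  { unfold x, x0. rewrite !phi_inverse_r. ring. }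
  assert (Hexp := phi_expanding x x0). rewrite Hx in Hexp.
  set (k := x - x0) in *.
  assert (Hk0 : k <> 0).
  { intros E. apply Hh. rewrite <- Hx. replace x with x0 by (unfold k in E; lra). ring. }
  assert (Hkd : Rabs k < d).
  { apply Rmult_lt_reg_l with m; auto. lra. }
  specialize (Hq k Hk0 Hkd). replace (x0 + k) with x in Hq by (unfold k; ring).
  rewrite Hx in Hq.
  assert (Hqm : m <= h / k).
  { destruct (Rle_dec 0 k) as [Hk|Hk].
    - assert (H1 := phi_increment x0 x ltac:(unfold k in Hk; lra)). rewrite Hx in H1. fold k in H1.
      apply Rmult_le_reg_r with k; [lra|]. unfold Rdiv. rewrite Rmult_assoc, Rinv_l; lra.
    - assert (H1 := phi_increment x x0 ltac:(unfold k in Hk; lra)).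
      replace (x0 - x) with (- k) in H1 by (unfold k; ring).
      replace (phi x0 - phi x) with (- h) in H1 by lra.
      apply Rmult_le_reg_r with (- k); [lra|]. replace (h / k * - k) with (- h) by (field; auto).
      lra. }
  set (q := h / k) in *.
  replace (k / h - / c) with ((c - q) / (q * c)).
  2: { unfold q. field. repeat split; auto; lra. }
  unfold Rdiv. rewrite Rabs_mult, Rabs_inv.
  assert (Hqc : m * c <= q * c) by (apply Rmult_le_compat_r; lra).
  assert (Hmc : 0 < m * c) by (apply Rmult_lt_0_compat; lra).
  rewrite (Rabs_pos_eq (q * c)) by lra.
  apply Rmult_lt_reg_r with (q * c); [lra|].
  rewrite Rmult_assoc, Rinv_l, Rmult_1_r by lra. rewrite Rabs_minus_sym.
  eapply Rlt_le_trans; [exact Hq|]. apply Rmult_le_compat_l; lra.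
Qed.

Lemma RInt_inverse (H : R -> R) x : cont H -> phi 0 = 0 ->
  RInt (fun y => H (inverse phi y)) 0 (phi x) = RInt (fun t => H t * dphi t) 0 x.
Proof.
  intros CH H0.
  assert (Ci : cont (inverse phi)).
  { apply cont_derivable. intros y. eexists. apply is_derive_inverse. }
  assert (E := RInt_comp (V := R_CompleteNormedModule) (fun y => H (inverse phi y)) phi dphi 0 x).
  rewrite H0 in E. rewrite <- E.
  - apply RInt_ext_all. intros t. rewrite phi_inverse_l. apply Rmult_comm.
  - intros t _. apply (cont_comp H (inverse phi)); auto.
  - intros t _. split; auto.
Qed.

End Inverse.

(** * Coordinates on the tangent spaces *)

Section Coordinates.

Context (s : R) (hs : 5 / 2 < s).

Notation N := (Hs_norm (s - 1)).
Notation A := (Hs (s - 1)).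
Let LM : nlaws (model (K s)) := Kmodel_laws s hs.

Lemma prim_ext f g : (forall x, f x = g x) -> prim f = prim g.
Proof. intros H. now apply functional_extensionality in H as ->. Qed.

Lemma Derive_prim f x : cont f -> Derive (prim f) x = f x - RInt f 0 1.
Proof. intros. now apply is_derive_unique, is_derive_prim. Qed.

Lemma prim_of_derivative F f : (forall x, is_derive F x (f x)) -> cont f -> F 0 = 0 -> F 1 = 0 ->
  forall x, prim f x = F x.
Proof.
  intros Hd Cf F0 F1 x. unfold prim.
  rewrite (RInt_derive_cont F f 0 1), F0, F1 by auto.
  rewrite (RInt_ext_all _ f) by (intros; ring). rewrite (RInt_derive_cont F) by auto.
  rewrite F0. rring.
Qed.

Definition model_readout : readout s (Kmodel s).
Proof.
  refine (Readout s (Kmodel s) (fun f g => (prim f, g)) _ _ _).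
  - intros f g Hf Hg. destruct (Hs_prim (s - 1)) as (C & _ & HC); [lra|].
    split; [|split; [apply prim_0|auto]]. simpl.
    replace s with (s - 1 + 1) by ring. now apply HC.
  - intros c f f' g g' Hf Hf' _ _. split; simpl.
    + intros x. apply Hs_cont in Hf. apply Hs_cont in Hf'. unfold prim.
      rewrite (RInt_plus_cont (fun x => c * f x)), RInt_scal_cont by cont.
      set (m := RInt f 0 1). set (m' := RInt f' 0 1).
      rewrite <- RInt_scal_cont, <- RInt_plus_cont by cont.
      apply RInt_ext_all. intros; ring.
    + exists 0. intros; ring.
  - destruct (Hs_prim (s - 1)) as (C & C0 & HC); [lra|]. exists (C + 1). split; [lra|].
    intros f g Hf Hg. simpl. destruct (HC f Hf) as (_ & H).
    replace (s - 1 + 1) with s in H by ring.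
    rewrite Hs_quot_norm_center by auto.
    assert (H1 := Hs_center_norm_le (s - 1) g 0 Hg).
    rewrite (Hs_norm_ext _ (fun x => g x - 0) g) in H1 by (intros; ring).
    assert (N1 := Hs_norm_ge0 (s - 1) f). assert (N2 := Hs_norm_ge0 (s - 1) g).
    assert (0 <= C * N g) by (apply Rmult_le_pos; lra). lra.
Defined.

Definition real_readout : readout s Rspace.
Proof.
  refine (Readout s Rspace (fun f _ => RInt f 0 1) _ _ _).
  - intros; exact I.
  - intros c f f' g g' Hf Hf' _ _. apply Hs_cont in Hf. apply Hs_cont in Hf'. simpl.
    rewrite (RInt_plus_cont (fun x => c * f x)), RInt_scal_cont by cont. reflexivity.
  - exists 1. split; [lra|]. intros f g Hf Hg. simpl.
    assert (H := mean_le_norm (s - 1) f Hf). assert (H0 := Hs_norm_ge0 (s - 1) g). lra.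
Defined.

Definition coord_dx (u : model (K s)) : R -> R := Derive (fst u).
Definition coord_pi (p : point (K s)) (u : model (K s)) : R -> R := piphi (fst p) (snd u).
Definition phi_dx (p : point (K s)) : R -> R := Derive (fst p).

Lemma dphi_mem p : pmem p -> A (phi_dx p).
Proof. intros Hp. now apply phi_derivable. Qed.

Lemma dphi_pos (p : point (K s)) x : pmem p -> 0 < phi_dx p x.
Proof. intros Hp. now apply (phi_derivable s hs p Hp). Qed.

Lemma cont_dphi p : pmem p -> cont (phi_dx p).
Proof. intros Hp. apply (Hs_cont (s - 1)). now apply dphi_mem. Qed.

Lemma rho_cont (p : point (K s)) : pmem p -> cont (fun x => / phi_dx p x).
Proof. intros Hp. apply (Hs_cont (s - 1)). now apply (rho_mem s hs). Qed.

Lemma du_mem (u : model (K s)) : nmem u -> A (coord_dx u).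
Proof. intros Hu. now apply (fst_derivable s hs). Qed.

Lemma du_cont (u : model (K s)) : nmem u -> cont (coord_dx u).
Proof. intros Hu. apply (Hs_cont (s - 1)). now apply du_mem. Qed.

Lemma snd_cont (u : model (K s)) : nmem u -> cont (snd u).
Proof. intros (_ & _ & H). now apply (Hs_cont (s - 1)). Qed.

Lemma fst_at_1 (u : model (K s)) : nmem u -> fst u 1 = 0.
Proof.
  intros (H1 & H2 & _). assert (H := Hs_periodic _ _ H1 0). rewrite Rplus_0_l in H. lra.
Qed.

Lemma du_total (u : model (K s)) : nmem u -> RInt (coord_dx u) 0 1 = 0.
Proof.
  intros Hu. rewrite (RInt_derive_cont (fst u)).
  - rewrite fst_at_1 by auto. destruct Hu as (_ & -> & _). rring.
  - intros x. now apply (fst_derivable s hs).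
  - now apply du_cont.
Qed.

Lemma pu_mem (p : point (K s)) (u : model (K s)) : nmem u -> A (coord_pi p u).
Proof.
  intros (_ & _ & H). apply Hs_minus; auto. apply (Hs_const (s - 1)).
Qed.

Lemma pu_cont p u : nmem u -> cont (coord_pi p u).
Proof. intros Hu. apply (Hs_cont (s - 1)). now apply pu_mem. Qed.

Lemma pu_total (p : point (K s)) (u : model (K s)) : pmem p -> nmem u ->
  RInt (fun x => coord_pi p u x * phi_dx p x) 0 1 = 0.
Proof.
  intros Hp Hu. unfold coord_pi, piphi. fold (phi_dx p).
  set (c := RInt (fun y => snd u y * phi_dx p y) 0 1).
  assert (C1 := snd_cont u Hu). assert (C2 := cont_dphi p Hp).
  rewrite (RInt_ext_all _ (fun x => snd u x * phi_dx p x - c * phi_dx p x)) by (intros; ring).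
  rewrite RInt_minus_cont, RInt_scal_cont by cont.
  unfold phi_dx at 2. rewrite (phi_total s hs p Hp). unfold c. rring.
Qed.

Lemma prim_du (u : model (K s)) x : nmem u -> prim (coord_dx u) x = fst u x.
Proof.
  intros Hu. apply prim_of_derivative.
  - intros y. now apply (fst_derivable s hs).
  - now apply du_cont.
  - apply Hu.
  - now apply fst_at_1.
Qed.

Lemma coord_eqv (p : point (K s)) (u v : model (K s)) : nmem u -> nmem v ->
  (forall x, coord_dx u x = coord_dx v x) -> (forall x, coord_pi p u x = coord_pi p v x) -> u == v.
Proof.
  intros Hu Hv H1 H2. split.
  - intros x. now rewrite <- (prim_du u), <- (prim_du v), (prim_ext _ _ H1).
  - exists (RInt (fun y => snd u y * Derive (fst p) y) 0 1
           - RInt (fun y => snd v y * Derive (fst p) y) 0 1).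
    intros x. specialize (H2 x). unfold coord_pi, piphi in H2. lra.
Qed.

Lemma du_eqv (u v : model (K s)) x : u == v -> coord_dx u x = coord_dx v x.
Proof.
  intros (H & _). unfold coord_dx. apply functional_extensionality in H. now rewrite H.
Qed.

Lemma pu_eqv (p : point (K s)) (u v : model (K s)) x : pmem p -> nmem v -> u == v ->
  coord_pi p u x = coord_pi p v x.
Proof.
  intros Hp Hv (_ & c & H). unfold coord_pi, piphi. fold (phi_dx p).
  assert (C1 := snd_cont v Hv). assert (C2 := cont_dphi p Hp).
  rewrite (RInt_ext_all _ (fun y => snd v y * phi_dx p y + c * phi_dx p y))
    by (intros; rewrite H; ring).
  rewrite RInt_plus_cont, RInt_scal_cont, H by cont.
  unfold phi_dx at 2. rewrite (phi_total s hs p Hp). ring.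
Qed.

Lemma du_lin c (u v : model (K s)) x : nmem u -> nmem v ->
  coord_dx (c [*] u [+] v) x = c * coord_dx u x + coord_dx v x.
Proof.
  intros Hu Hv. destruct (fst_derivable s hs u Hu) as (D1 & _).
  destruct (fst_derivable s hs v Hv) as (D2 & _). apply is_derive_unique.
  apply (is_derive_plus (fun x => c * fst u x) (fst v)); auto.
  apply (is_derive_scal (fst u) x c _ (D1 x)).
Qed.

Lemma pu_lin (p : point (K s)) c (u v : model (K s)) x : pmem p -> nmem u -> nmem v ->
  coord_pi p (c [*] u [+] v) x = c * coord_pi p u x + coord_pi p v x.
Proof.
  intros Hp Hu Hv. unfold coord_pi, piphi. fold (phi_dx p). simpl.
  assert (C1 := snd_cont u Hu). assert (C2 := snd_cont v Hv). assert (C3 := cont_dphi p Hp).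
  rewrite (RInt_ext_all _ (fun y => c * (snd u y * phi_dx p y) + snd v y * phi_dx p y))
    by (intros; ring).
  rewrite RInt_plus_cont, RInt_scal_cont by cont. ring.
Qed.

Lemma du_readout f g x : A f -> A g -> coord_dx (rd model_readout f g) x = f x - RInt f 0 1.
Proof. intros Hf Hg. apply Derive_prim. now apply (Hs_cont (s - 1)). Qed.

Lemma pu_readout p f g x :
  coord_pi p (rd model_readout f g) x = g x - RInt (fun y => g y * phi_dx p y) 0 1.
Proof. reflexivity. Qed.

Lemma A_mult f g : A f -> A g -> A (fun x => f x * g x).
Proof.
  intros Hf Hg. destruct (Hs_mult (s - 1)) as (C & _ & H); [lra|]. now apply H.
Qed.

(** ** The tensors in coordinates *)

Lemma metric_coord (p : point (K s)) (u v : model (K s)) :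
  K_metric s p u v = / 4 * RInt (fun x =>
    coord_dx u x * coord_dx v x * / phi_dx p x + coord_pi p u x * coord_pi p v x * phi_dx p x) 0 1.
Proof. reflexivity. Qed.

Lemma J_eq (p : point (K s)) (u : model (K s)) : pmem p -> nmem u ->
  K_J s p u = rd model_readout (fun x => - (coord_pi p u x * phi_dx p x)) (fun x => coord_dx u x * / phi_dx p x).
Proof.
  intros Hp Hu. unfold K_J, model_readout; simpl. f_equal.
  apply functional_extensionality. intros x. fold (phi_dx p).
  assert (C1 := pu_cont p u Hu). assert (C2 := cont_dphi p Hp).
  assert (E : forall a b, RInt (fun x => - (coord_pi p u x * phi_dx p x)) a b
    = - RInt (fun x => coord_pi p u x * phi_dx p x) a b).
  { intros a b. rewrite (RInt_ext_all _ (fun x => -1 * (coord_pi p u x * phi_dx p x)))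
      by (intros; ring). rewrite RInt_scal_cont by cont. rring. }
  unfold prim. rewrite E, pu_total by auto.
  rewrite (RInt_ext_all (fun y => - (coord_pi p u y * phi_dx p y) - - 0)
    (fun y => - (coord_pi p u y * phi_dx p y))) by (intros; ring).
  rewrite E. reflexivity.
Qed.

Lemma J_mem (p : point (K s)) (u : model (K s)) : pmem p -> nmem u -> nmem (K_J s p u).
Proof.
  intros Hp Hu. rewrite J_eq by auto. apply (rd_mem s (Kmodel s) model_readout).
  - apply (Hs_ext _ (fun x => -1 * (coord_pi p u x * phi_dx p x))); [intros; ring|].
    apply Hs_scal, A_mult; [now apply pu_mem|now apply dphi_mem].
  - apply A_mult; [now apply du_mem|now apply (rho_mem s hs)].
Qed.

Lemma du_J (p : point (K s)) (u : model (K s)) x : pmem p -> nmem u ->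
  coord_dx (K_J s p u) x = - (coord_pi p u x * phi_dx p x).
Proof.
  intros Hp Hu. rewrite J_eq by auto.
  assert (C1 := pu_cont p u Hu). assert (C2 := cont_dphi p Hp).
  assert (H : A (fun x => - (coord_pi p u x * phi_dx p x))).
  { apply (Hs_ext _ (fun x => -1 * (coord_pi p u x * phi_dx p x))); [intros; ring|].
    apply Hs_scal, A_mult; [now apply pu_mem|now apply dphi_mem]. }
  rewrite du_readout; auto.
  - rewrite (RInt_ext_all _ (fun x => -1 * (coord_pi p u x * phi_dx p x))) by (intros; ring).
    rewrite RInt_scal_cont, pu_total by (auto; cont). ring.
  - apply A_mult; [now apply du_mem|now apply (rho_mem s hs)].
Qed.

Lemma pu_J (p : point (K s)) (u : model (K s)) x : pmem p -> nmem u ->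
  coord_pi p (K_J s p u) x = coord_dx u x * / phi_dx p x.
Proof.
  intros Hp Hu. rewrite J_eq, pu_readout by auto.
  rewrite (RInt_ext_all _ (coord_dx u)).
  - rewrite du_total by auto. ring.
  - intros y. assert (H := dphi_pos p y Hp). field. lra.
Qed.

(** Four times the integrand of the metric. It is also [phi_x] times the pull-back by [phi] of the
    function to which the connection at the identity applies [Ainv] after differentiation. *)
Definition gam_density (p : point (K s)) (u v : model (K s)) (x : R) : R :=
  coord_dx u x * coord_dx v x * / phi_dx p x + coord_pi p u x * coord_pi p v x * phi_dx p x.

Definition gam_first (p : point (K s)) (u v : model (K s)) (x : R) : R :=
  / 2 * (gam_density p u v x - RInt (gam_density p u v) 0 1 * phi_dx p x).

Definition gam_second (p : point (K s)) (u v : model (K s)) (x : R) : R :=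
  - / 2 * ((coord_dx u x * coord_pi p v x + coord_dx v x * coord_pi p u x) * / phi_dx p x).

Lemma gam_density_mem p u v : pmem p -> nmem u -> nmem v -> A (gam_density p u v).
Proof.
  intros Hp Hu Hv.
  assert (M1 := du_mem u Hu). assert (M2 := du_mem v Hv). assert (M3 := pu_mem p u Hu).
  assert (M4 := pu_mem p v Hv). assert (M5 := dphi_mem p Hp). assert (M6 := rho_mem s hs p Hp).
  apply Hs_plus.
  - apply (A_mult (fun x => coord_dx u x * coord_dx v x)); auto. now apply A_mult.
  - apply (A_mult (fun x => coord_pi p u x * coord_pi p v x)); auto. now apply A_mult.
Qed.

Lemma gam_first_mem p u v : pmem p -> nmem u -> nmem v -> A (gam_first p u v).
Proof.
  intros Hp Hu Hv. apply Hs_scal.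
  apply (Hs_minus _ (gam_density p u v)); [now apply gam_density_mem|].
  apply Hs_scal. now apply dphi_mem.
Qed.

Lemma gam_second_mem p u v : pmem p -> nmem u -> nmem v -> A (gam_second p u v).
Proof.
  intros Hp Hu Hv.
  assert (M1 := du_mem u Hu). assert (M2 := du_mem v Hv). assert (M3 := pu_mem p u Hu).
  assert (M4 := pu_mem p v Hv). assert (M6 := rho_mem s hs p Hp).
  apply Hs_scal. apply (A_mult (fun x => coord_dx u x * coord_pi p v x + coord_dx v x * coord_pi p u x)); auto.
  apply Hs_plus; now apply A_mult.
Qed.

Lemma gam_first_total p u v : pmem p -> nmem u -> nmem v -> RInt (gam_first p u v) 0 1 = 0.
Proof.
  intros Hp Hu Hv. unfold gam_first. set (c := RInt (gam_density p u v) 0 1).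
  assert (C1 : cont (gam_density p u v)) by (apply (Hs_cont (s - 1)); now apply gam_density_mem).
  assert (C2 := cont_dphi p Hp).
  rewrite RInt_scal_cont, RInt_minus_cont, RInt_scal_cont by cont.
  unfold phi_dx. rewrite (phi_total s hs p Hp). unfold c. rring.
Qed.

Lemma dphi_min (p : point (K s)) : pmem p -> exists m, 0 < m /\ forall x, m <= phi_dx p x.
Proof.
  intros Hp. destruct (continuity_ab_min (phi_dx p) 0 1) as (x0 & Hmin & _); [lra| |].
  { intros y _. apply continuity_pt_filterlim. apply (cont_dphi p Hp). }
  exists (phi_dx p x0). split; [now apply dphi_pos|].
  intros x. destruct (periodic_reduce (phi_dx p) x (Hs_periodic _ _ (dphi_mem p Hp))) as (y & Hy & <-).
  apply Hmin; lra.
Qed.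

(** One of the two integrations undoes the derivative and the contributions of [F 0] cancel, so the
    formula involves only integrals of [F]. This is why no derivative is lost in the connection. *)
Lemma Ainv_derivative F F' x : (forall y, is_derive F y (F' y)) -> cont F' ->
  Ainv (Derive F) x = - RInt F 0 x + x * RInt F 0 1.
Proof.
  intros Hd CF'. assert (CF : cont F) by (apply cont_derivable; intros y; now exists (F' y)).
  assert (E : forall y, RInt (Derive F) 0 y = F y - F 0).
  { intros y. rewrite (RInt_ext_all _ F') by (intros; now apply is_derive_unique).
    now apply RInt_derive_cont. }
  unfold Ainv. rewrite !(RInt_ext_all (fun y => RInt (Derive F) 0 y) (fun y => F y - F 0)) by auto.
  rewrite !RInt_minus_cont, !RInt_const_R by cont. ring.
Qed.

(* Substituting [y = phi x] in the integrals turns the composition with the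
   inverse diffeomorphism into algebraic operations. *)
Lemma Gamma_eq (p : point (K s)) (u v : model (K s)) : pmem p -> nmem u -> nmem v ->
  K_Gamma s p u v = rd model_readout (gam_first p u v) (gam_second p u v).
Proof.
  intros Hp Hu Hv. destruct (dphi_min p Hp) as (m & Hm & Hmin).
  destruct (phi_derivable s hs p Hp) as (Dp & _ & _). change (Derive (fst p)) with (phi_dx p) in Dp.
  assert (Cd := cont_dphi p Hp).
  assert (Pp : periodic (fun x => fst p x - x)) by (destruct Hp as (P1 & _); now apply (Hs_periodic s)).
  assert (P0 : fst p 0 = 0) by apply Hp.
  assert (P1 : fst p 1 = 1) by (assert (H := Pp 0); rewrite Rplus_0_l in H; lra).
  set (phi := fst p) in *. set (psi := inverse phi).
  assert (Dpsi : forall y, is_derive psi y (/ phi_dx p (psi y))).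
  { intros y. now apply (is_derive_inverse phi (phi_dx p) Dp Cd Pp m). }
  assert (Cpsi : cont psi) by (apply cont_derivable; intros y; eexists; apply Dpsi).
  assert (psiK : forall x, psi (phi x) = x).
  { intros x. now apply (phi_inverse_l phi (phi_dx p) Dp Cd Pp m). }
  assert (Hint : forall (f : R -> R) x, cont f ->
    RInt (fun y => f (psi y)) 0 (phi x) = RInt (fun t => f t * phi_dx p t) 0 x).
  { intros f x Cf. now apply (RInt_inverse phi (phi_dx p) Dp Cd Pp m). }
  assert (Hint1 : forall (f : R -> R), cont f ->
    RInt (fun y => f (psi y)) 0 1 = RInt (fun t => f t * phi_dx p t) 0 1).
  { intros f Cf. rewrite <- P1 at 1. now apply Hint. }
  assert (HD : forall w : model (K s), nmem w -> forall y,
    Derive (fun x => fst w (psi x)) y = coord_dx w (psi y) * / phi_dx p (psi y)).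
  { intros w Hw y. apply is_derive_unique. rewrite Rmult_comm.
    apply (is_derive_comp (fst w) psi); auto. now apply (fst_derivable s hs). }
  assert (HP : forall w : model (K s), nmem w -> forall y,
    piphi (fun x => x) (fun x => snd w (psi x)) y = coord_pi p w (psi y)).
  { intros w Hw y. unfold piphi, coord_pi, piphi. f_equal.
    rewrite (RInt_ext_all _ (fun y => snd w (psi y))).
    - rewrite Hint1; auto. now apply snd_cont.
    - intros t. rewrite Derive_id. ring. }
  (* Composed with [psi], this is the function differentiated inside [Ainv] in the formula at the
     identity. *)
  set (H := fun x => coord_dx u x * / phi_dx p x * (coord_dx v x * / phi_dx p x) + coord_pi p u x * coord_pi p v x).
  assert (MH : A H).
  { apply Hs_plus; [|apply A_mult; now apply pu_mem].
    apply (A_mult (fun x => coord_dx u x * / phi_dx p x) (fun x => coord_dx v x * / phi_dx p x));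
      apply A_mult; try (now apply (rho_mem s hs)); now apply du_mem. }
  assert (CH : cont H) by now apply (Hs_cont (s - 1)).
  (* [H] lies in [H^(s-1)], and [s - 2 > 1/2] makes its derivative continuous. *)
  destruct (Hs_derivable (s - 2) H) as (DH & MH' & _); [lra| |].
  { now replace (s - 2 + 1) with (s - 1) by ring. }
  assert (CH' : cont (Derive H)) by now apply (Hs_cont (s - 2)).
  assert (EF : (fun y => Derive (fun x => fst u (psi x)) y * Derive (fun x => fst v (psi x)) y
      + piphi (fun x => x) (fun x => snd u (psi x)) y
        * piphi (fun x => x) (fun x => snd v (psi x)) y) = (fun y => H (psi y))).
  { apply functional_extensionality. intros y. rewrite !HD, !HP by auto. reflexivity. }
  assert (EHg : forall x, H x * phi_dx p x = gam_density p u v x).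
  { intros x. unfold H, gam_density. assert (Hx := dphi_pos p x Hp). field. lra. }
  assert (Cg : cont (gam_density p u v)) by (apply (Hs_cont (s - 1)); now apply gam_density_mem).
  unfold K_Gamma, K_Gamma_id, right_comp, model_readout. cbn [rd fst snd]. fold phi. fold psi.
  f_equal; apply functional_extensionality; intros x.
  - rewrite EF.
    rewrite (Ainv_derivative (fun y => H (psi y)) (fun y => / phi_dx p (psi y) * Derive H (psi y))).
    + rewrite Hint, Hint1 by auto.
      rewrite !(RInt_ext_all _ _ _ _ EHg).
      unfold prim. rewrite gam_first_total by auto.
      unfold gam_first. set (c := RInt (gam_density p u v) 0 1).
      rewrite (RInt_ext_all (fun y => / 2 * (gam_density p u v y - c * phi_dx p y) - 0)
        (fun y => / 2 * (gam_density p u v y - c * phi_dx p y))) by (intros; ring).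
      rewrite RInt_scal_cont, RInt_minus_cont, RInt_scal_cont by cont.
      rewrite (RInt_derive_cont phi (phi_dx p)), P0 by auto. ring.
    + intros y. apply (is_derive_comp H psi); auto.
    + assert (Crho := rho_cont p Hp).
      apply cont_mult; [apply (cont_comp (fun x => / phi_dx p x) psi)|apply (cont_comp (Derive H) psi)];
        auto.
  - rewrite !HD, !HP, !psiK by auto. unfold gam_second. ring.
Qed.

Lemma Gamma_mem p u v : pmem p -> nmem u -> nmem v -> nmem (K_Gamma s p u v).
Proof.
  intros. rewrite Gamma_eq by auto. apply (rd_mem s (Kmodel s) model_readout).
  - now apply gam_first_mem.
  - now apply gam_second_mem.
Qed.

Lemma du_Gamma (p : point (K s)) (u v : model (K s)) x : pmem p -> nmem u -> nmem v ->
  coord_dx (K_Gamma s p u v) x = gam_first p u v x.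
Proof.
  intros. rewrite Gamma_eq, du_readout, gam_first_total; auto; [ring| |].
  - now apply gam_first_mem.
  - now apply gam_second_mem.
Qed.

Lemma gam_second_total p u v : pmem p ->
  RInt (fun x => gam_second p u v x * phi_dx p x) 0 1
  = RInt (fun x => - / 2 * (coord_dx u x * coord_pi p v x + coord_dx v x * coord_pi p u x)) 0 1.
Proof.
  intros Hp. apply RInt_ext_all. intros x. unfold gam_second.
  assert (Hx := dphi_pos p x Hp). field. lra.
Qed.

Lemma pu_Gamma (p : point (K s)) (u v : model (K s)) x : pmem p -> nmem u -> nmem v ->
  coord_pi p (K_Gamma s p u v) x = gam_second p u v x
    - RInt (fun x => - / 2 * (coord_dx u x * coord_pi p v x + coord_dx v x * coord_pi p u x)) 0 1.
Proof.
  intros. rewrite Gamma_eq, pu_readout by auto. now rewrite gam_second_total.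
Qed.

(** Symmetry in the two arguments is torsion freeness of the connection, on which closedness and
    integrability rest. *)
Lemma Gamma_sym (p : point (K s)) (u v : model (K s)) : pmem p -> nmem u -> nmem v ->
  K_Gamma s p u v = K_Gamma s p v u.
Proof.
  intros. rewrite !Gamma_eq by auto.
  assert (E : gam_density p u v = gam_density p v u).
  { apply functional_extensionality. intros x. unfold gam_density. ring. }
  f_equal; apply functional_extensionality; intros x.
  - unfold gam_first. now rewrite E.
  - unfold gam_second. ring.
Qed.

End Coordinates.

(** * The tensors as polynomial expressions *)

(** [pi] is unchanged when a constant is added to [U_2], since [phi_x] has integral 1. It may
    therefore be computed from the centered representative, whose norm is that of the class. *)
Definition pi_expr (i : nat) : expr :=
  Add (Sn i) (Mul (Cst (-1)) (Int (Mul (Sn i) Phi))).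

Definition density_expr : expr :=
  Add (Mul (Mul (Dx 0) (Dx 1)) Rho) (Mul (Mul (pi_expr 0) (pi_expr 1)) Phi).

Definition metric_expr : expr := Mul (Cst (/ 4)) density_expr.

Definition J_expr1 : expr := Mul (Cst (-1)) (Mul (pi_expr 0) Phi).
Definition J_expr2 : expr := Mul (Dx 0) Rho.

Definition Gamma_expr1 : expr :=
  Mul (Cst (/ 2)) (Add density_expr (Mul (Cst (-1)) (Mul (Int density_expr) Phi))).
Definition Gamma_expr2 : expr :=
  Mul (Cst (- / 2)) (Mul (Add (Mul (Dx 0) (pi_expr 1)) (Mul (Dx 1) (pi_expr 0))) Rho).

(** The derivative of the second component lies only in [H^(s-2)], outside the expressions.
    Integration by parts moves it to the first component. *)
Definition omega_expr : expr :=
  Mul (Cst (/ 4)) (Add (Mul (Cst (-1)) (Mul (Sn 0) (Dx 1))) (Mul (Sn 1) (Dx 0))).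

Ltac solve_perm := simpl; first [apply Permutation_refl | apply perm_swap].

Ltac solve_linear :=
  lazymatch goal with
  | |- linear_in _ (Cst _) => apply lin_cst
  | |- linear_in _ Phi => apply lin_phi
  | |- linear_in _ Rho => apply lin_rho
  | |- linear_in _ (Dx _) => apply lin_dx
  | |- linear_in _ (Sn _) => apply lin_sn
  | |- linear_in _ (Add _ _) => apply lin_add; [solve_linear|solve_linear]
  | |- linear_in _ (Mul _ _) => eapply lin_mul; [solve_linear|solve_linear|solve_perm]
  | |- linear_in _ (Int _) => apply lin_int; solve_linear
  end.

Lemma linear_metric : linear_in (seq 0 2) metric_expr.
Proof. unfold metric_expr, density_expr, pi_expr. solve_linear. Qed.

Lemma linear_J1 : linear_in (seq 0 1) J_expr1.
Proof. unfold J_expr1, pi_expr. solve_linear. Qed.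

Lemma linear_J2 : linear_in (seq 0 1) J_expr2.
Proof. unfold J_expr2. solve_linear. Qed.

Lemma linear_Gamma1 : linear_in (seq 0 2) Gamma_expr1.
Proof. unfold Gamma_expr1, density_expr, pi_expr. solve_linear. Qed.

Lemma linear_Gamma2 : linear_in (seq 0 2) Gamma_expr2.
Proof. unfold Gamma_expr2, pi_expr. solve_linear. Qed.

Lemma linear_omega : linear_in (seq 0 2) omega_expr.
Proof. unfold omega_expr. solve_linear. Qed.

(** For the parallelism of the metric: the integrand does not vanish pointwise, but it is a
    combination, with nonlocal constants as coefficients, of functions of integral zero. *)
Lemma RInt_null_combination F n1 n2 n3 n4 c1 c2 c3 c4 :
  cont n1 -> cont n2 -> cont n3 -> cont n4 ->
  RInt n1 0 1 = 0 -> RInt n2 0 1 = 0 -> RInt n3 0 1 = 0 -> RInt n4 0 1 = 0 ->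
  (forall x, F x = c1 * n1 x + c2 * n2 x + c3 * n3 x + c4 * n4 x) -> RInt F 0 1 = 0.
Proof.
  intros C1 C2 C3 C4 H1 H2 H3 H4 E. rewrite (RInt_ext_all _ _ _ _ E).
  rewrite !RInt_plus_cont, !RInt_scal_cont, H1, H2, H3, H4 by cont. rring.
Qed.

Section Kahler.

Context (s : R) (hs : 5 / 2 < s).

Notation N := (Hs_norm (s - 1)).
Notation A := (Hs (s - 1)).
Let LM : nlaws (model (K s)) := Kmodel_laws s hs.
Let OM : open_shifts (K s) := K_open_shifts s hs.
Let MR : readout s (Kmodel s) := model_readout s hs.
Let RR : readout s Rspace := real_readout s.

Notation du := (coord_dx s).
Notation pu := (coord_pi s).
Notation dphi := (phi_dx s).
Notation gm := (K_metric s).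
Notation om := (K_omega s).
Notation J := (K_J s).
Notation Gam := (K_Gamma s).

Lemma eval_pi (p : point (K s)) env i x : pmem p -> mem_env s env ->
  eval p env (pi_expr i) x = pu p (env i) x.
Proof.
  intros Hp He. cbn [pi_expr eval]. unfold coord_pi, piphi. fold (dphi p).
  set (m := RInt (snd (env i)) 0 1).
  assert (C1 := snd_cont s (env i) (He i)). assert (C2 := cont_dphi s hs p Hp).
  rewrite (RInt_ext_all (fun y => (snd (env i) y - m) * dphi p y)
    (fun y => snd (env i) y * dphi p y - m * dphi p y)) by (intros; ring).
  rewrite RInt_minus_cont, RInt_scal_cont by cont.
  replace (RInt (dphi p) 0 1) with 1 by (symmetry; apply (phi_total s hs p Hp)). ring.
Qed.

Lemma eval_density (p : point (K s)) env x : pmem p -> mem_env s env ->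
  eval p env density_expr x = gam_density s p (env 0%nat) (env 1%nat) x.
Proof.
  intros Hp He. cbn [density_expr eval]. rewrite !eval_pi by auto. reflexivity.
Qed.

Lemma RInt_eval_density (p : point (K s)) env : pmem p -> mem_env s env ->
  RInt (eval p env density_expr) 0 1 = RInt (gam_density s p (env 0%nat) (env 1%nat)) 0 1.
Proof. intros. apply RInt_ext_all. intros. now apply eval_density. Qed.

(* The projection [pi] depends on the base point only through its constant
   [int U_2 phi_x], whose derivative is [int U_2 h_x = int pi (U_2) h_x]. *)
Lemma eval_dpi (p : point (K s)) (h : model (K s)) env i x :
  pmem p -> nmem h -> mem_env s env ->
  eval p (ncons h env) (dexpr (pi_expr i)) x = - RInt (fun y => pu p (env i) y * du h y) 0 1.
Proof.
  intros Hp Hh He. cbn [pi_expr dexpr lift_expr eval ncons].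
  set (m := RInt (snd (env i)) 0 1).
  assert (C1 := snd_cont s (env i) (He i)). assert (C2 := cont_dphi s hs p Hp).
  assert (C3 := du_cont s hs h Hh). assert (Z3 := du_total s hs h Hh).
  change (Derive (fst h)) with (du h).
  rewrite (RInt_ext_all (fun y => 0 * Derive (fst p) y + (snd (env i) y - m) * du h y)
    (fun y => snd (env i) y * du h y - m * du h y)) by (intros; ring).
  unfold coord_pi, piphi. set (k := RInt (fun y => snd (env i) y * Derive (fst p) y) 0 1).
  rewrite (RInt_ext_all (fun y => (snd (env i) y - k) * du h y)
    (fun y => snd (env i) y * du h y - k * du h y)) by (intros; ring).
  rewrite !RInt_minus_cont, !RInt_scal_cont, Z3 by cont. ring.
Qed.

Lemma metric_tensor (p : point (K s)) l : pmem p -> args 2 l ->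
  expr_tensor s RR metric_expr metric_expr p l = gm p (nth 0 l nzero) (nth 1 l nzero).
Proof.
  intros Hp Hl. assert (He := env_of_mem s hs 2 l Hl).
  unfold expr_tensor, RR, real_readout. cbn [rd].
  assert (Cd : cont (gam_density s p (nth 0 l nzero) (nth 1 l nzero))).
  { apply (Hs_cont (s - 1)). apply (gam_density_mem s hs); auto; apply (He _). }
  transitivity (/ 4 * RInt (gam_density s p (nth 0 l nzero) (nth 1 l nzero)) 0 1); [|reflexivity].
  rewrite <- RInt_scal_cont by exact Cd. apply RInt_ext_all. intros x.
  cbn [metric_expr eval]. now rewrite eval_density.
Qed.

Lemma J_tensor (p : point (K s)) l : pmem p -> args 1 l ->
  expr_tensor s MR J_expr1 J_expr2 p l = J p (nth 0 l nzero).
Proof.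
  intros Hp Hl. assert (He := env_of_mem s hs 1 l Hl).
  rewrite (J_eq s hs) by (auto; apply (He 0%nat)). unfold expr_tensor.
  f_equal; apply functional_extensionality; intros x.
  cbn [J_expr1 eval]. rewrite eval_pi by auto. change (Derive (fst p)) with (dphi p).
  change (env_of s l 0) with (nth 0 l nzero). ring.
Qed.

Lemma Gamma_tensor (p : point (K s)) l : pmem p -> args 2 l ->
  expr_tensor s MR Gamma_expr1 Gamma_expr2 p l = Gam p (nth 0 l nzero) (nth 1 l nzero).
Proof.
  intros Hp Hl. assert (He := env_of_mem s hs 2 l Hl).
  rewrite (Gamma_eq s hs) by (auto; apply (He _)). unfold expr_tensor.
  f_equal; apply functional_extensionality; intros x.
  - cbn [Gamma_expr1 eval]. rewrite eval_density, RInt_eval_density by auto.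
    unfold gam_first. change (Derive (fst p)) with (dphi p).
    change (env_of s l 0) with (nth 0 l nzero). change (env_of s l 1) with (nth 1 l nzero). ring.
  - cbn [Gamma_expr2 eval]. rewrite !eval_pi by auto. reflexivity.
Qed.

(** By parts, the boundary terms vanishing because the first components are zero at 0 and 1. *)
Lemma omega_coord (p : point (K s)) (u v : model (K s)) : nmem u -> nmem v ->
  om p u v = / 4 * (RInt (fun x => snd v x * du u x) 0 1 - RInt (fun x => snd u x * du v x) 0 1).
Proof.
  intros Hu Hv.
  assert (Hder : forall w : model (K s), nmem w ->
    (forall x, is_derive (snd w) x (Derive (snd w) x)) /\ cont (Derive (snd w))).
  { intros w (_ & _ & Hw). destruct (Hs_derivable (s - 2) (snd w)) as (H1 & H2 & _); [lra| |].
    - now replace (s - 2 + 1) with (s - 1) by ring.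
    - split; auto. now apply (Hs_cont (s - 2)). }
  destruct (Hder u Hu) as (Du & Cu'). destruct (Hder v Hv) as (Dv & Cv').
  destruct (fst_derivable s hs u Hu) as (Fu & _). destruct (fst_derivable s hs v Hv) as (Fv & _).
  assert (Cu := du_cont s hs u Hu). assert (Cv := du_cont s hs v Hv).
  assert (Cfu : cont (fst u)) by (apply cont_derivable; intros x; eexists; apply Fu).
  assert (Cfv : cont (fst v)) by (apply cont_derivable; intros x; eexists; apply Fv).
  assert (E1 := RInt_by_parts (snd u) (fst v) _ _ 0 1 Du Fv Cu' Cv).
  assert (E2 := RInt_by_parts (snd v) (fst u) _ _ 0 1 Dv Fu Cv' Cu).
  unfold K_omega. rewrite RInt_minus_cont, E1, E2 by cont.
  rewrite !(fst_at_1 s) by auto. destruct Hu as (_ & -> & _). destruct Hv as (_ & -> & _).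
  unfold coord_dx. ring.
Qed.

Lemma omega_tensor (p : point (K s)) l : pmem p -> args 2 l ->
  expr_tensor s RR omega_expr omega_expr p l = om p (nth 0 l nzero) (nth 1 l nzero).
Proof.
  intros Hp Hl. assert (He := env_of_mem s hs 2 l Hl).
  unfold expr_tensor, RR, real_readout. cbn [rd].
  rewrite omega_coord by apply (He _). unfold omega_expr.
  set (u := nth 0 l nzero). set (v := nth 1 l nzero).
  change (env_of s l) with (fun i => nth i l nzero) in *.
  assert (Hu : nmem u) by apply (He 0%nat). assert (Hv : nmem v) by apply (He 1%nat).
  set (a := RInt (snd u) 0 1). set (b := RInt (snd v) 0 1).
  assert (C1 := snd_cont s u Hu). assert (C2 := snd_cont s v Hv).
  assert (C3 := du_cont s hs u Hu). assert (C4 := du_cont s hs v Hv).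
  rewrite (RInt_ext_all _ (fun x => / 4 * ((snd v x * du u x - b * du u x)
    - (snd u x * du v x - a * du v x)))).
  - rewrite RInt_scal_cont, !RInt_minus_cont, !RInt_scal_cont, !(du_total s hs) by (auto; cont).
    rring.
  - intros x. cbn [eval]. fold u v. fold a b. unfold coord_dx. ring.
Qed.

Lemma metric_Cn n : tensor_Cn (K s) Rspace n 2
  (fun p l => gm p (nth 0 l nzero) (nth 1 l nzero)).
Proof.
  apply (tensor_Cn_ext LM Rspace_laws n 2 (expr_tensor s RR metric_expr metric_expr)).
  - apply (expr_tensor_Cn s hs Rspace_laws); apply linear_metric.
  - intros p l Hp Hl. now apply metric_tensor.
Qed.

Lemma omega_Cn n : tensor_Cn (K s) Rspace n 2
  (fun p l => om p (nth 0 l nzero) (nth 1 l nzero)).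
Proof.
  apply (tensor_Cn_ext LM Rspace_laws n 2 (expr_tensor s RR omega_expr omega_expr)).
  - apply (expr_tensor_Cn s hs Rspace_laws); apply linear_omega.
  - intros p l Hp Hl. now apply omega_tensor.
Qed.

Lemma J_Cn n : tensor_Cn (K s) (model (K s)) n 1 (fun p l => J p (nth 0 l nzero)).
Proof.
  apply (tensor_Cn_ext LM LM n 1 (expr_tensor s MR J_expr1 J_expr2)).
  - apply (expr_tensor_Cn s hs LM); [apply linear_J1|apply linear_J2].
  - intros p l Hp Hl. rewrite J_tensor by auto. apply (neqv_refl LM).
Qed.

Lemma Gamma_Cn n : tensor_Cn (K s) (model (K s)) n 2
  (fun p l => Gam p (nth 0 l nzero) (nth 1 l nzero)).
Proof.
  apply (tensor_Cn_ext LM LM n 2 (expr_tensor s MR Gamma_expr1 Gamma_expr2)).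
  - apply (expr_tensor_Cn s hs LM); [apply linear_Gamma1|apply linear_Gamma2].
  - intros p l Hp Hl. rewrite Gamma_tensor by auto. apply (neqv_refl LM).
Qed.

(** ** Pointwise identities *)

Lemma du_sub (u v : model (K s)) x : nmem u -> nmem v -> du (u [-] v) x = du u x - du v x.
Proof.
  intros Hu Hv. rewrite (du_eqv s (u [-] v) ((-1) [*] v [+] u)) by nring LM.
  rewrite (du_lin s hs) by auto. ring.
Qed.

Lemma pu_sub (p : point (K s)) (u v : model (K s)) x : pmem p -> nmem u -> nmem v ->
  pu p (u [-] v) x = pu p u x - pu p v x.
Proof.
  intros Hp Hu Hv. rewrite (pu_eqv s hs p (u [-] v) ((-1) [*] v [+] u)); auto.
  - rewrite (pu_lin s hs) by auto. ring.
  - apply (mem_add LM); auto. now apply (mem_scal LM).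
  - nring LM.
Qed.

Lemma du_zero x : du nzero x = 0.
Proof. exact (Derive_const 0 x). Qed.

Lemma pu_zero (p : point (K s)) x : pu p nzero x = 0.
Proof.
  unfold coord_pi, piphi. simpl. rewrite (RInt_ext_all _ (fun _ => 0)) by (intros; ring).
  rewrite RInt_const_R. ring.
Qed.

Lemma J_square (p : point (K s)) (u : model (K s)) : pmem p -> nmem u ->
  J p (J p u) == (-1) [*] u.
Proof.
  intros Hp Hu. assert (HJ := J_mem s hs p u Hp Hu). assert (HJJ := J_mem s hs p _ Hp HJ).
  assert (Hz := mem_zero LM). assert (E : (-1) [*] u == (-1) [*] u [+] nzero) by nring LM.
  assert (M1 : nmem ((-1) [*] u [+] nzero)) by (apply (mem_add LM); auto; now apply (mem_scal LM)).
  apply (neqv_trans LM) with ((-1) [*] u [+] nzero); [|now apply (neqv_sym LM)].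
  apply (coord_eqv s hs p); auto; intros x; assert (Hx := dphi_pos s hs p x Hp).
  - rewrite (du_J s hs), (pu_J s hs), (du_lin s hs), du_zero by auto. field. lra.
  - rewrite (pu_J s hs), (du_J s hs), (pu_lin s hs), pu_zero by auto. field. lra.
Qed.

Lemma J_eqv (p : point (K s)) (u v : model (K s)) : pmem p -> nmem u -> nmem v -> u == v ->
  J p u == J p v.
Proof.
  intros Hp Hu Hv H. apply (coord_eqv s hs p); try now apply (J_mem s hs).
  - intros x. rewrite !(du_J s hs) by auto. now rewrite (pu_eqv s hs p u v).
  - intros x. rewrite !(pu_J s hs) by auto. now rewrite (du_eqv s u v).
Qed.

Lemma J_sub (p : point (K s)) (u v : model (K s)) : pmem p -> nmem u -> nmem v ->
  J p (u [-] v) == J p u [-] J p v.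
Proof.
  intros Hp Hu Hv. assert (HJu := J_mem s hs p u Hp Hu). assert (HJv := J_mem s hs p v Hp Hv).
  assert (M := mem_sub LM u v Hu Hv).
  apply (coord_eqv s hs p); [now apply (J_mem s hs)|now apply (mem_sub LM)| |].
  - intros x. rewrite du_sub, !(du_J s hs), pu_sub by auto. ring.
  - intros x. rewrite pu_sub, !(pu_J s hs), du_sub by auto. ring.
Qed.

Lemma metric_J (p : point (K s)) (u v : model (K s)) : pmem p -> nmem u -> nmem v ->
  gm p u v = gm p (J p u) (J p v).
Proof.
  intros Hp Hu Hv. rewrite !(metric_coord s). f_equal. apply RInt_ext_all. intros x.
  rewrite !(du_J s hs), !(pu_J s hs) by auto. assert (Hx := dphi_pos s hs p x Hp). field. lra.
Qed.

Lemma metric_sym (p : point (K s)) (u v : model (K s)) : gm p u v = gm p v u.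
Proof.
  rewrite !(metric_coord s). f_equal. apply RInt_ext_all. intros x. ring.
Qed.

Lemma metric_cont (p : point (K s)) (u v : model (K s)) : pmem p -> nmem u -> nmem v ->
  cont (fun x => du u x * du v x * / dphi p x + pu p u x * pu p v x * dphi p x).
Proof.
  intros. apply (Hs_cont (s - 1)). now apply (gam_density_mem s hs).
Qed.

Lemma metric_sub_l (p : point (K s)) (u v w : model (K s)) : pmem p ->
  nmem u -> nmem v -> nmem w -> gm p (u [-] v) w = gm p u w - gm p v w.
Proof.
  intros Hp Hu Hv Hw. rewrite !(metric_coord s), <- Rmult_minus_distr_l,
    <- RInt_minus_cont by now apply metric_cont.
  f_equal. apply RInt_ext_all. intros x. rewrite du_sub, pu_sub by auto. ring.
Qed.

Lemma metric_eqv_l (p : point (K s)) (u v w : model (K s)) : pmem p ->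
  nmem u -> nmem v -> u == v -> gm p u w = gm p v w.
Proof.
  intros Hp Hu Hv H. rewrite !(metric_coord s). f_equal. apply RInt_ext_all. intros x.
  now rewrite (du_eqv s u v), (pu_eqv s hs p u v).
Qed.

Lemma RInt_nonneg_zero f : cont f -> (forall x, 0 <= f x) -> RInt f 0 1 = 0 ->
  forall x, 0 < x < 1 -> f x = 0.
Proof.
  intros Cf Hf H x Hx. destruct (Req_dec (f x) 0) as [|Hn]; auto. exfalso.
  assert (Hpos : 0 < f x) by (specialize (Hf x); lra).
  assert (Hc := Cf x). apply continuity_pt_filterlim in Hc.
  destruct (Hc (f x / 2)) as (d & Hd & Hc'); [lra|].
  set (e := Rmin (d / 2) (Rmin (x / 2) ((1 - x) / 2))).
  assert (He : 0 < e /\ e <= d / 2 /\ e <= x / 2 /\ e <= (1 - x) / 2).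
  { unfold e. repeat split; unfold Rmin; repeat destruct Rle_dec; lra. }
  assert (HI := RInt_ge_sub f (x - e) (x + e) (f x / 2) Cf ltac:(lra) ltac:(lra)
    ltac:(intros; apply Hf)).
  assert (0 < f x / 2 * (x + e - (x - e))) by (apply Rmult_lt_0_compat; lra).
  assert (forall y, x - e <= y <= x + e -> f x / 2 <= f y).
  { intros y Hy. destruct (Req_dec y x) as [->|Hyx]; [lra|].
    specialize (Hc' y). simpl in Hc'. unfold R_dist, D_x, no_cond in Hc'.
    assert (Rabs (f y - f x) < f x / 2).
    { apply Hc'. split; [split; auto|]. apply Rle_lt_trans with e; [apply Rabs_le; lra|lra]. }
    apply Rabs_def2 in H1. lra. }
  specialize (HI H1). lra.
Qed.

Lemma periodic_zero f : cont f -> periodic f -> (forall x, 0 < x < 1 -> f x = 0) ->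
  forall x, f x = 0.
Proof.
  intros Cf Pf H.
  assert (H0 : f 0 = 0).
  { apply eq_of_Rabs_le. intros eps He. rewrite Rminus_0_r.
    assert (Hc := Cf 0). apply continuity_pt_filterlim in Hc.
    destruct (Hc eps He) as (d & Hd & Hc').
    set (y := Rmin (d / 2) (/ 2)).
    assert (Hy : 0 < y /\ y < d /\ y < 1) by (unfold y, Rmin; destruct Rle_dec; lra).
    specialize (Hc' y). simpl in Hc'. unfold R_dist, D_x, no_cond in Hc'.
    rewrite (H y), Rminus_0_l, Rabs_Ropp in Hc' by lra. left. apply Hc'.
    split; [split; auto; lra|]. rewrite Rminus_0_r, Rabs_pos_eq; lra. }
  intros x. destruct (periodic_reduce f x Pf) as (y & Hy & <-).
  destruct (Req_dec y 0) as [->|]; auto. apply H; lra.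
Qed.

(** A continuous nonnegative periodic integrand with integral zero vanishes everywhere; both of its
    summands are nonnegative, and [phi_x > 0] then forces both coordinates to be zero. *)
Lemma metric_pos (p : point (K s)) (u : model (K s)) : pmem p -> nmem u -> ~ u == nzero ->
  0 < gm p u u.
Proof.
  intros Hp Hu Hn.
  set (f := fun x => du u x * du u x * / dphi p x + pu p u x * pu p u x * dphi p x).
  assert (Cf : cont f) by now apply metric_cont.
  assert (P1 : forall x, 0 <= du u x * du u x * / dphi p x).
  { intros x. apply Rmult_le_pos; [nra|]. left. apply Rinv_0_lt_compat. now apply (dphi_pos s hs). }
  assert (P2 : forall x, 0 <= pu p u x * pu p u x * dphi p x).
  { intros x. apply Rmult_le_pos; [nra|]. left. now apply (dphi_pos s hs). }
  assert (Hf : forall x, 0 <= f x).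
  { intros x. specialize (P1 x). specialize (P2 x). unfold f. lra. }
  assert (H0 : 0 <= RInt f 0 1).
  { apply RInt_ge_0; [lra|now apply cont_ex_RInt|]. intros; apply Hf. }
  rewrite (metric_coord s). fold f.
  destruct (Req_dec (RInt f 0 1) 0) as [Hz|Hz]; [exfalso|lra].
  apply Hn.
  assert (Pf : periodic f).
  { intros x. unfold f. now rewrite (Hs_periodic _ _ (du_mem s hs u Hu)),
      (Hs_periodic _ _ (pu_mem s p u Hu)), (Hs_periodic _ _ (dphi_mem s hs p Hp)). }
  assert (Hzero := periodic_zero f Cf Pf (RInt_nonneg_zero f Cf Hf Hz)).
  apply (coord_eqv s hs p); auto; [apply (mem_zero LM)| |].
  - intros x. rewrite du_zero. specialize (Hzero x). specialize (P1 x). specialize (P2 x). unfold f in Hzero.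
    assert (E : du u x * du u x * / dphi p x = 0) by lra.
    apply Rmult_integral in E. destruct E as [E|E]; [nra|].
    assert (Hx := Rinv_0_lt_compat _ (dphi_pos s hs p x Hp)). lra.
  - intros x. rewrite pu_zero. specialize (Hzero x). specialize (P1 x). specialize (P2 x). unfold f in Hzero.
    assert (E : pu p u x * pu p u x * dphi p x = 0) by lra.
    apply Rmult_integral in E. destruct E as [E|E]; [nra|].
    assert (Hx := dphi_pos s hs p x Hp). lra.
Qed.

(** After inserting [J] the powers of [phi_x] cancel. The weighted means subtracted by [pi] only
    multiply [u_1x] and [v_1x], whose integrals vanish. *)
Lemma omega_metric (p : point (K s)) (u v : model (K s)) : pmem p -> nmem u -> nmem v ->
  om p u v = gm p (J p u) v.
Proof.
  intros Hp Hu Hv. rewrite omega_coord, (metric_coord s) by auto. f_equal.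
  assert (C1 := snd_cont s u Hu). assert (C2 := snd_cont s v Hv).
  assert (C3 := du_cont s hs u Hu). assert (C4 := du_cont s hs v Hv).
  assert (Z1 := du_total s hs u Hu). assert (Z2 := du_total s hs v Hv).
  set (a := RInt (fun y => snd u y * dphi p y) 0 1).
  set (b := RInt (fun y => snd v y * dphi p y) 0 1).
  rewrite (RInt_ext_all (fun x => du (J p u) x * du v x * / dphi p x
      + pu p (J p u) x * pu p v x * dphi p x)
    (fun x => (snd v x * du u x - b * du u x) - (snd u x * du v x - a * du v x))).
  - rewrite !RInt_minus_cont, !RInt_scal_cont, Z1, Z2 by cont. ring.
  - intros x. rewrite (du_J s hs), (pu_J s hs) by auto. unfold coord_pi, piphi.
    fold (dphi p). fold a b. assert (Hx := dphi_pos s hs p x Hp). field. lra.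
Qed.

Lemma omega_antisym (p : point (K s)) (u v : model (K s)) : nmem u -> nmem v ->
  om p u v = - om p v u.
Proof. intros. rewrite !omega_coord by auto. ring. Qed.

Lemma metric_derivative (p : point (K s)) (x y z : model (K s)) :
  pmem p -> nmem x -> nmem y -> nmem z ->
  expr_tensor s RR (dexpr metric_expr) (dexpr metric_expr) p [x; y; z]
  = - (gm p (Gam p y x) z + gm p y (Gam p z x)).
Proof.
  intros Hp Hx Hy Hz.
  assert (Hl : args 2 [y; z]) by (repeat (apply args_cons; auto); apply args_nil).
  assert (He := env_of_mem s hs 2 _ Hl). assert (He' := mem_ncons s x _ Hx He).
  unfold expr_tensor, RR, real_readout. cbn [rd]. rewrite env_of_cons.
  assert (M1 := Gamma_mem s hs p y x Hp Hy Hx). assert (M2 := Gamma_mem s hs p z x Hp Hz Hx).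
  rewrite !(metric_coord s).
  apply Rplus_opp_r_uniq.
  rewrite <- Rmult_plus_distr_l, <- RInt_plus_cont, <- RInt_scal_cont,
    <- RInt_plus_cont; try now apply metric_cont.
  2: { apply cont_mult; [apply cont_const|]. apply cont_plus; now apply metric_cont. }
  2: { apply (eval_cont s hs); auto. }
  2: { apply cont_plus; now apply metric_cont. }
  set (cy := RInt (fun t => pu p y t * du x t) 0 1).
  set (cz := RInt (fun t => pu p z t * du x t) 0 1).
  set (c1 := RInt (gam_density s p y x) 0 1). set (c2 := RInt (gam_density s p z x) 0 1).
  set (k1 := RInt (fun t => - / 2 * (du y t * pu p x t + du x t * pu p y t)) 0 1).
  set (k2 := RInt (fun t => - / 2 * (du z t * pu p x t + du x t * pu p z t)) 0 1).
  (* All local terms cancel. There remain the constants [c1], [c2] from the first component of the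
     connection, [k1], [k2] from the second, and [cy], [cz] from the derivative of [pi]; each
     multiplies a function of integral zero. *)
  apply (RInt_null_combination _ (du y) (du z) (fun t => pu p y t * dphi p t)
    (fun t => pu p z t * dphi p t) (- / 8 * c2) (- / 8 * c1) (- / 4 * (cz + k2))
    (- / 4 * (cy + k1))).
  - now apply (du_cont s hs).
  - now apply (du_cont s hs).
  - apply cont_mult; [now apply (pu_cont s)|now apply (cont_dphi s hs)].
  - apply cont_mult; [now apply (pu_cont s)|now apply (cont_dphi s hs)].
  - now apply (du_total s hs).
  - now apply (du_total s hs).
  - now apply (pu_total s hs).
  - now apply (pu_total s hs).
  - intros t. rewrite !(du_Gamma s hs), !(pu_Gamma s hs) by auto. fold k1 k2.
    unfold gam_first. fold c1 c2. unfold gam_second, gam_density.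
    unfold metric_expr, density_expr. cbn [dexpr lift_expr eval ncons].
    rewrite !eval_lift, !eval_dpi, !eval_pi by auto.
    change (env_of s [y; z] 0) with y. change (env_of s [y; z] 1) with z. fold cy cz.
    assert (Ht := dphi_pos s hs p t Hp). unfold coord_dx, phi_dx in *. field. lra.
Qed.

Lemma J_derivative (p : point (K s)) (x y : model (K s)) : pmem p -> nmem x -> nmem y ->
  expr_tensor s MR (dexpr J_expr1) (dexpr J_expr2) p [x; y]
  == Gam p (J p y) x [-] J p (Gam p y x).
Proof.
  intros Hp Hx Hy.
  assert (Hl : args 1 [y]) by (repeat (apply args_cons; auto); apply args_nil).
  assert (He := env_of_mem s hs 1 _ Hl). assert (He' := mem_ncons s x _ Hx He).
  assert (HJ := J_mem s hs p y Hp Hy).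
  assert (M1 := Gamma_mem s hs p _ x Hp HJ Hx). assert (M2 := Gamma_mem s hs p y x Hp Hy Hx).
  assert (M3 := J_mem s hs p _ Hp M2).
  unfold expr_tensor. rewrite env_of_cons.
  set (f := eval p (ncons x (env_of s [y])) (dexpr J_expr1)).
  set (g := eval p (ncons x (env_of s [y])) (dexpr J_expr2)).
  assert (Af : A f) by now apply (eval_mem s hs).
  assert (Ag : A g) by now apply (eval_mem s hs).
  (* Every nonlocal term on either side is a combination of these four integrals. Once the integrals
     are rewritten in them, the two sides agree pointwise. *)
  set (i1 := RInt (fun t => pu p y t * du x t) 0 1).
  set (i2 := RInt (fun t => du y t * pu p x t) 0 1).
  set (i3 := RInt (fun t => du x t * du y t * / dphi p t) 0 1).
  set (i4 := RInt (fun t => pu p x t * pu p y t * dphi p t) 0 1).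
  assert (Ef : forall t, f t = i1 * dphi p t - pu p y t * du x t).
  { intros t. unfold f, J_expr1. cbn [dexpr lift_expr eval ncons].
    rewrite !eval_lift, !eval_dpi, !eval_pi by auto.
    change (env_of s [y] 0) with y. fold i1. unfold coord_dx, phi_dx. ring. }
  assert (Eg : forall t, g t = - (du x t * du y t * / dphi p t * / dphi p t)).
  { intros t. unfold g, J_expr2. cbn [dexpr lift_expr eval ncons].
    change (env_of s [y] 0) with y. unfold coord_dx, phi_dx. ring. }
  assert (C1 := du_cont s hs x Hx). assert (C2 := du_cont s hs y Hy).
  assert (C3 := pu_cont s p x Hx). assert (C4 := pu_cont s p y Hy).
  assert (C5 := cont_dphi s hs p Hp). assert (C6 := rho_cont s hs p Hp).
  assert (Ptot : RInt (dphi p) 0 1 = 1) by apply (phi_total s hs p Hp).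
  assert (If : RInt f 0 1 = 0).
  { rewrite (RInt_ext_all _ _ _ _ Ef), RInt_minus_cont, RInt_scal_cont, Ptot by cont.
    unfold i1. rring. }
  assert (Ig : RInt (fun t => g t * dphi p t) 0 1 = - i3).
  { rewrite (RInt_ext_all _ (fun t => -1 * (du x t * du y t * / dphi p t))).
    - rewrite RInt_scal_cont by cont. unfold i3. rring.
    - intros t. rewrite Eg. assert (Ht := dphi_pos s hs p t Hp). field. lra. }
  assert (I1 : RInt (gam_density s p (J p y) x) 0 1 = i2 - i1).
  { unfold i1, i2. rewrite <- RInt_minus_cont by cont. apply RInt_ext_all. intros t.
    unfold gam_density. rewrite (du_J s hs), (pu_J s hs) by auto.
    assert (Ht := dphi_pos s hs p t Hp). field. lra. }
  assert (I2 : RInt (fun t => - / 2 * (du y t * pu p x t + du x t * pu p y t)) 0 1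
    = - / 2 * (i2 + i1)).
  { unfold i1, i2. rewrite <- RInt_plus_cont, <- RInt_scal_cont by cont.
    apply RInt_ext_all. intros; ring. }
  assert (I3 : RInt (fun t => - / 2 * (du (J p y) t * pu p x t + du x t * pu p (J p y) t)) 0 1
    = - / 2 * (i3 - i4)).
  { unfold i3, i4. rewrite <- RInt_minus_cont, <- RInt_scal_cont by cont.
    apply RInt_ext_all. intros t. rewrite (du_J s hs), (pu_J s hs) by auto. ring. }
  assert (I4 : RInt (gam_density s p y x) 0 1 = i3 + i4).
  { unfold i3, i4. rewrite <- RInt_plus_cont by cont.
    apply RInt_ext_all. intros t. unfold gam_density. ring. }
  apply (coord_eqv s hs p).
  - now apply (rd_mem s (Kmodel s) MR).
  - now apply (mem_sub LM).
  - intros t. unfold MR. rewrite (du_readout s hs), If, Ef by auto.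
    rewrite du_sub, (du_Gamma s hs), (du_J s hs p (Gam p y x)), (pu_Gamma s hs) by auto.
    unfold gam_first. rewrite I1, I2. unfold gam_density, gam_second.
    rewrite (du_J s hs), (pu_J s hs) by auto.
    assert (Ht := dphi_pos s hs p t Hp). field. lra.
  - intros t. unfold MR. rewrite (pu_readout s hs), Ig, Eg.
    rewrite pu_sub, (pu_Gamma s hs), (pu_J s hs p (Gam p y x)), (du_Gamma s hs) by auto.
    rewrite I3. unfold gam_first. rewrite I4. unfold gam_density, gam_second.
    rewrite (du_J s hs), (pu_J s hs) by auto.
    assert (Ht := dphi_pos s hs p t Hp). field. lra.
Qed.

End Kahler.

(** * The Kähler structure on vector fields *)

Section Structure.

Context (s : R) (hs : 5 / 2 < s).

Let LM : nlaws (model (K s)) := Kmodel_laws s hs.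
Let OM : open_shifts (K s) := K_open_shifts s hs.
Let MR : readout s (Kmodel s) := model_readout s hs.
Let RR : readout s Rspace := real_readout s.

Notation gm := (K_metric s).
Notation om := (K_omega s).
Notation J := (K_J s).
Notation Gam := (K_Gamma s).
Notation nabla := (covariant (M := K s) Gam).

Lemma K_smooth_metric : smooth_metric (K s) gm.
Proof.
  split; [|split].
  - intros n. apply (metric_Cn s hs).
  - intros p u v _ _ _. apply (metric_sym s).
  - intros p u Hp Hu Hn. now apply (metric_pos s hs).
Qed.

Lemma K_complex_structure : complex_structure (K s) J.
Proof.
  split.
  - intros n. apply (J_Cn s hs).
  - intros p u Hp Hu. now apply (J_square s hs).
Qed.

Lemma vfield_mem (X : point (K s) -> model (K s)) p : vfield (K s) X -> pmem p -> nmem (X p).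
Proof. intros HX Hp. now apply (vfield_valued X HX). Qed.

Lemma D_vfield_mem (Y : point (K s) -> model (K s)) p h : vfield (K s) Y -> pmem p -> nmem h ->
  nmem (D Y p h).
Proof. intros HY Hp Hh. apply (D_mem LM LM OM); auto. now apply vfield_valued. Qed.

Lemma covariant_mem (X Y : point (K s) -> model (K s)) p : vfield (K s) X -> vfield (K s) Y ->
  pmem p -> nmem (nabla X Y p).
Proof.
  intros HX HY Hp. assert (HXp := vfield_mem X p HX Hp). assert (HYp := vfield_mem Y p HY Hp).
  apply (mem_sub LM); [now apply D_vfield_mem|now apply (Gamma_mem s hs)].
Qed.

Lemma vfield_J (Y : point (K s) -> model (K s)) : vfield (K s) Y -> vfield (K s) (fun q => J q (Y q)).
Proof.
  intros HY n. exact (apply1_Cn LM LM n (fun p l => J p (nth 0 l nzero)) Y (J_Cn s hs n) (HY n)).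
Qed.

(** One order of [Y] is spent on its derivative field [Y'], a tensor to which [D Y] is equivalent at
    each point of the manifold; the rest is composition of tensors. *)
Lemma vfield_covariant (X Y : point (K s) -> model (K s)) :
  vfield (K s) X -> vfield (K s) Y -> vfield (K s) (nabla X Y).
Proof.
  intros HX HY n. destruct (HY (S n)) as (_ & _ & Y' & DY & CY').
  assert (FY' := tensor_Cn_field _ _ _ CY').
  assert (C1 := apply1_Cn LM LM n Y' X CY' (HX n)).
  assert (C2 := apply2_Cn LM LM n _ Y X (Gamma_Cn s hs n) (HY n) (HX n)). simpl in C2.
  apply (tensor_Cn_ext LM LM n 0 _ _ (tensor_Cn_lin LM LM n 0 _ _ (-1) C1 C2)).
  intros p l Hp _. apply (nsub_eqv LM); [|apply (neqv_refl LM)].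
  apply (neqv_sym LM). apply (smooth0_D_eqv LM LM OM); auto.
  - now apply vfield_valued.
  - now apply vfield_mem.
Qed.

(** Product rule; the first two terms are the derivative of the tensor [J] in the base point. Since
    [J] agrees with its expression only at points of the manifold, the rule is transferred through
    [dderiv_ext]. *)
Lemma D_J (Y : point (K s) -> model (K s)) p h : vfield (K s) Y -> pmem p -> nmem h ->
  D (fun q => J q (Y q)) p h == Gam p (J p (Y p)) h [-] J p (Gam p (Y p) h) [+] J p (D Y p h).
Proof.
  intros HY Hp Hh. assert (HYp := vfield_mem Y p HY Hp).
  assert (HD := D_vfield_mem Y p h HY Hp Hh).
  assert (VJ := vfield_valued _ (vfield_J Y HY)).
  assert (H := D_apply1 LM LM OM (expr_tensor s MR J_expr1 J_expr2)
    (expr_tensor s MR (dexpr J_expr1) (dexpr J_expr2)) Y HY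
    (expr_tensor_field s hs LM MR 1 _ _ linear_J1 linear_J2)
    (expr_tensor_field s hs LM MR 2 _ _ (linear_in_dexpr_seq _ _ linear_J1)
      (linear_in_dexpr_seq _ _ linear_J2))
    (expr_tensor_derive s hs LM MR 1 _ _ linear_J1 linear_J2) p h Hp Hh).
  assert (A1 : forall u : model (K s), nmem u -> args 1 [u])
    by (intros; apply args_cons; auto; apply args_nil).
  assert (E1 : forall q, pmem q -> expr_tensor s MR J_expr1 J_expr2 q [Y q] = J q (Y q)).
  { intros q Hq. apply (J_tensor s hs q [Y q]); auto. apply A1. now apply vfield_mem. }
  assert (E2 : expr_tensor s MR J_expr1 J_expr2 p [D Y p h] = J p (D Y p h)).
  { apply (J_tensor s hs p [D Y p h]); auto. }
  rewrite E2 in H.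
  apply (neqv_trans LM)
    with (expr_tensor s MR (dexpr J_expr1) (dexpr J_expr2) p [h; Y p] [+] J p (D Y p h)).
  - apply (D_eqv LM LM OM); auto.
    refine (dderiv_ext LM LM OM (fun q => expr_tensor s MR J_expr1 J_expr2 q [Y q])
      (fun q => J q (Y q)) p h _ _ _ VJ Hp Hh _ (proj1 H) (neqv_refl LM _) H).
    + intros q Hq. rewrite E1 by auto. now apply VJ.
    + intros q Hq. rewrite E1 by auto. apply (neqv_refl LM).
  - apply (nadd_eqv LM); [|apply (neqv_refl LM)]. now apply (J_derivative s hs).
Qed.

(** Stated as a limit instead of a value of [deriv], so that it can be carried over to [om] by way
    of the field [J Y]. *)
Lemma dderiv_metric (Y Z : point (K s) -> model (K s)) p h : vfield (K s) Y -> vfield (K s) Z ->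
  pmem p -> nmem h ->
  @is_dderiv (K s) Rspace (fun q => gm q (Y q) (Z q)) p h
    (gm p (D Y p h [-] Gam p (Y p) h) (Z p) + gm p (Y p) (D Z p h [-] Gam p (Z p) h)).
Proof.
  intros HY HZ Hp Hh. assert (HYp := vfield_mem Y p HY Hp). assert (HZp := vfield_mem Z p HZ Hp).
  assert (HDY := D_vfield_mem Y p h HY Hp Hh). assert (HDZ := D_vfield_mem Z p h HZ Hp Hh).
  assert (H := D_apply2 LM Rspace_laws OM (expr_tensor s RR metric_expr metric_expr)
    (expr_tensor s RR (dexpr metric_expr) (dexpr metric_expr)) Y HY Z HZ
    (expr_tensor_field s hs Rspace_laws RR 2 _ _ linear_metric linear_metric)
    (expr_tensor_field s hs Rspace_laws RR 3 _ _ (linear_in_dexpr_seq _ _ linear_metric)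
      (linear_in_dexpr_seq _ _ linear_metric))
    (expr_tensor_derive s hs Rspace_laws RR 2 _ _ linear_metric linear_metric) p h Hp Hh).
  assert (E : forall q (u v : model (K s)), pmem q -> nmem u -> nmem v ->
    expr_tensor s RR metric_expr metric_expr q [u; v] = gm q u v).
  { intros q u v Hq Hu Hv. apply (metric_tensor s hs q [u; v]); auto.
    repeat (apply args_cons; auto). apply args_nil. }
  refine (dderiv_ext LM Rspace_laws OM
    (fun q => expr_tensor s RR metric_expr metric_expr q [Y q; Z q])
    (fun q => gm q (Y q) (Z q)) p h _ _ (fun _ _ => I) (fun _ _ => I) Hp Hh _ I _ H).
  - intros q Hq. exact (E q _ _ Hq (vfield_mem Y q HY Hq) (vfield_mem Z q HZ Hq)).
  - change (expr_tensor s RR (dexpr metric_expr) (dexpr metric_expr) p [h; Y p; Z p]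
      + expr_tensor s RR metric_expr metric_expr p [D Y p h; Z p]
      + expr_tensor s RR metric_expr metric_expr p [Y p; D Z p h]
      = gm p (D Y p h [-] Gam p (Y p) h) (Z p) + gm p (Y p) (D Z p h [-] Gam p (Z p) h)).
    rewrite (metric_derivative s hs), !E by auto.
    assert (M1 := Gamma_mem s hs p _ _ Hp HYp Hh). assert (M2 := Gamma_mem s hs p _ _ Hp HZp Hh).
    rewrite (metric_sub_l s hs), (metric_sym s p (Y p) (D Z p h [-] Gam p (Z p) h)),
      (metric_sub_l s hs), (metric_sym s p (Y p) (Gam p (Z p) h)),
      (metric_sym s p (Y p) (D Z p h)) by auto. ring.
Qed.

Lemma deriv_of_dderiv (f : point (K s) -> R) (X : point (K s) -> model (K s)) p d :
  pmem p -> nmem (X p) -> @is_dderiv (K s) Rspace f p (X p) d -> deriv X f p = d.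
Proof.
  intros Hp Hx H. apply (D_eqv LM Rspace_laws OM f p (X p) d); auto. intros q _. exact I.
Qed.

Lemma K_parallel_metric : parallel2 (K s) Gam gm.
Proof.
  intros X Y Z HX HY HZ p Hp. assert (HXp := vfield_mem X p HX Hp).
  apply deriv_of_dderiv; auto. now apply dderiv_metric.
Qed.

Lemma K_parallel_J : parallel11 (K s) Gam J.
Proof.
  intros X Y HX HY p Hp. assert (HXp := vfield_mem X p HX Hp). assert (HYp := vfield_mem Y p HY Hp).
  assert (HD := D_vfield_mem Y p _ HY Hp HXp). assert (M1 := Gamma_mem s hs p _ _ Hp HYp HXp).
  unfold covariant.
  assert (E1 := D_J Y p (X p) HY Hp HXp). assert (E2 := J_sub s hs p _ _ Hp HD M1).
  apply (ev_eqv LM). intros i. ntrans LM i. ev_expand LM. lra.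
Qed.

(** The metric rule applied to [J Y] and [Z]; by [D_J] the covariant derivative of [J Y] is [J] of
    the one of [Y]. *)
Lemma dderiv_omega (Y Z : point (K s) -> model (K s)) p h : vfield (K s) Y -> vfield (K s) Z ->
  pmem p -> nmem h ->
  @is_dderiv (K s) Rspace (fun q => om q (Y q) (Z q)) p h
    (om p (D Y p h [-] Gam p (Y p) h) (Z p) + om p (Y p) (D Z p h [-] Gam p (Z p) h)).
Proof.
  intros HY HZ Hp Hh. assert (HYp := vfield_mem Y p HY Hp). assert (HZp := vfield_mem Z p HZ Hp).
  assert (HDY := D_vfield_mem Y p h HY Hp Hh). assert (HDZ := D_vfield_mem Z p h HZ Hp Hh).
  assert (HJ := J_mem s hs p _ Hp HYp).
  assert (M1 := Gamma_mem s hs p _ _ Hp HYp Hh). assert (M2 := Gamma_mem s hs p _ _ Hp HZp Hh).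
  assert (M3 := Gamma_mem s hs p _ _ Hp HJ Hh).
  assert (M4 := mem_sub LM _ _ HDY M1). assert (M5 := mem_sub LM _ _ HDZ M2).
  assert (HDJ := D_vfield_mem _ p h (vfield_J Y HY) Hp Hh).
  assert (H := dderiv_metric (fun q => J q (Y q)) Z p h (vfield_J Y HY) HZ Hp Hh).
  refine (dderiv_ext LM Rspace_laws OM (fun q => gm q (J q (Y q)) (Z q))
    (fun q => om q (Y q) (Z q)) p h _ _ (fun _ _ => I) (fun _ _ => I) Hp Hh _ I _ H).
  - intros q Hq. symmetry.
    exact (omega_metric s hs q _ _ Hq (vfield_mem Y q HY Hq) (vfield_mem Z q HZ Hq)).
  - rewrite !(omega_metric s hs) by auto.
    change (gm p (D (fun q => J q (Y q)) p h [-] Gam p (J p (Y p)) h) (Z p)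
      + gm p (J p (Y p)) (D Z p h [-] Gam p (Z p) h)
      = gm p (J p (D Y p h [-] Gam p (Y p) h)) (Z p)
      + gm p (J p (Y p)) (D Z p h [-] Gam p (Z p) h)).
    apply (f_equal (fun a => a + _)), (metric_eqv_l s hs p _ _ (Z p) Hp).
    + now apply (mem_sub LM).
    + now apply (J_mem s hs).
    + assert (E1 := D_J Y p h HY Hp Hh). assert (E2 := J_sub s hs p _ _ Hp HDY M1).
      apply (ev_eqv LM). intros i. ntrans LM i. ev_expand LM. lra.
Qed.

Lemma K_parallel_omega : parallel2 (K s) Gam om.
Proof.
  intros X Y Z HX HY HZ p Hp. assert (HXp := vfield_mem X p HX Hp).
  apply deriv_of_dderiv; auto. now apply dderiv_omega.
Qed.

Lemma omega_sub_l (p : point (K s)) (u v w : model (K s)) : pmem p ->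
  nmem u -> nmem v -> nmem w -> om p (u [-] v) w = om p u w - om p v w.
Proof.
  intros Hp Hu Hv Hw.
  assert (HJu := J_mem s hs p u Hp Hu). assert (HJv := J_mem s hs p v Hp Hv).
  assert (M := mem_sub LM _ _ Hu Hv).
  rewrite !(omega_metric s hs), <- (metric_sub_l s hs) by auto.
  apply (metric_eqv_l s hs); auto.
  - now apply (J_mem s hs).
  - now apply (mem_sub LM).
  - now apply (J_sub s hs).
Qed.

Lemma bracket_mem (X Y : point (K s) -> model (K s)) p : vfield (K s) X -> vfield (K s) Y ->
  pmem p -> nmem (bracket X Y p).
Proof.
  intros HX HY Hp. apply (mem_sub LM); apply D_vfield_mem; auto; now apply vfield_mem.
Qed.

Lemma omega_eqv_l (p : point (K s)) (u v w : model (K s)) : pmem p ->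
  nmem u -> nmem v -> nmem w -> u == v -> om p u w = om p v w.
Proof.
  intros Hp Hu Hv Hw H. rewrite !(omega_metric s hs) by auto.
  apply (metric_eqv_l s hs); auto; try now apply (J_mem s hs). now apply (J_eqv s hs).
Qed.

(* [nabla] is torsion free, so [d omega] is the cyclic sum of [nabla omega]. *)
Lemma omega_bracket (X Y : point (K s) -> model (K s)) p w : vfield (K s) X -> vfield (K s) Y ->
  pmem p -> nmem w -> om p (bracket X Y p) w = om p (nabla X Y p) w - om p (nabla Y X p) w.
Proof.
  intros HX HY Hp Hw. assert (HXp := vfield_mem X p HX Hp). assert (HYp := vfield_mem Y p HY Hp).
  assert (M1 := covariant_mem X Y p HX HY Hp). assert (M2 := covariant_mem Y X p HY HX Hp).
  rewrite <- omega_sub_l by auto. apply omega_eqv_l; auto.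
  - now apply bracket_mem.
  - now apply (mem_sub LM).
  - unfold bracket, covariant. rewrite (Gamma_sym s hs p (X p) (Y p)) by auto. nring LM.
Qed.

Lemma K_symplectic : symplectic_form (K s) om.
Proof.
  split; [|split].
  - split; [intros n; apply (omega_Cn s hs)|].
    intros p u v _ Hu Hv. now apply (omega_antisym s hs).
  - intros p u Hp Hu H. destruct (classic (u == nzero)) as [|Hn]; auto. exfalso.
    assert (Hpos := metric_pos s hs p u Hp Hu Hn).
    (* The test vector is [J u]: [om u (J u) = g (J u) (J u) = g u u]. *)
    assert (HJ := J_mem s hs p u Hp Hu).
    specialize (H _ HJ). rewrite (omega_metric s hs), <- (metric_J s hs) in H by auto. lra.
  - intros X Y Z HX HY HZ p Hp.
    assert (HXp := vfield_mem X p HX Hp). assert (HYp := vfield_mem Y p HY Hp).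
    assert (HZp := vfield_mem Z p HZ Hp).
    (* The six terms from the derivatives cancel the six from the brackets, once the arguments are
       exchanged in three of them. *)
    rewrite (K_parallel_omega X Y Z), (K_parallel_omega Y Z X), (K_parallel_omega Z X Y) by auto.
    rewrite !omega_bracket by auto.
    rewrite (omega_antisym s hs p (Y p) (nabla X Z p)), (omega_antisym s hs p (Z p) (nabla Y X p)),
      (omega_antisym s hs p (X p) (nabla Z Y p)) by (auto; now apply covariant_mem). ring.
Qed.

(** Each derivative of [J X] or [J Y] expands by [D_J]. The terms with derivatives of [X] and [Y]
    cancel by [J^2 = -I], those with the connection by its symmetry. *)
Lemma K_integrable : integrable (K s) J.
Proof.
  intros X Y HX HY p Hp.
  assert (HXp := vfield_mem X p HX Hp). assert (HYp := vfield_mem Y p HY Hp).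
  set (x := X p) in *. set (y := Y p) in *.
  assert (Jx := J_mem s hs p x Hp HXp). assert (Jy := J_mem s hs p y Hp HYp).
  assert (Dm : forall Z h, vfield (K s) Z -> nmem h -> nmem (D Z p h))
    by (intros; now apply D_vfield_mem).
  assert (Gm : forall u v : model (K s), nmem u -> nmem v -> nmem (Gam p u v))
    by (intros; now apply (Gamma_mem s hs)).
  assert (Jm : forall u : model (K s), nmem u -> nmem (J p u)) by (intros; now apply (J_mem s hs)).
  assert (HJX := vfield_J X HX). assert (HJY := vfield_J Y HY).
  (* [J] applied to both sides of [D_J], with [J^2 = -I] absorbing the double applications. *)
  assert (JD : forall Z h, vfield (K s) Z -> nmem h -> J p (D (fun q => J q (Z q)) p h)
    == J p (Gam p (J p (Z p)) h) [+] Gam p (Z p) h [-] D Z p h).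
  { intros Z h HZ Hh. assert (HZp := vfield_mem Z p HZ Hp).
    assert (M1 := Gm _ _ (Jm _ HZp) Hh). assert (M2 := Gm _ _ HZp Hh). assert (M3 := Dm Z h HZ Hh).
    assert (M4 := mem_sub LM _ _ M2 M3).
    apply (neqv_trans LM)
      with (J p (Gam p (J p (Z p)) h [-] J p (Gam p (Z p) h [-] D Z p h))).
    - refine (J_eqv s hs p _ _ Hp (Dm _ h (vfield_J Z HZ) Hh) (mem_sub LM _ _ M1 (Jm _ M4)) _).
      assert (E1 := D_J Z p h HZ Hp Hh). assert (E2 := J_sub s hs p _ _ Hp M2 M3).
      apply (ev_eqv LM). intros i. ntrans LM i. ev_expand LM. lra.
    - assert (E1 := J_sub s hs p _ _ Hp M1 (Jm _ M4)). assert (E2 := J_square s hs p _ Hp M4).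
      apply (ev_eqv LM). intros i. ntrans LM i. ev_expand LM. lra. }
  assert (D1 := D_J Y p (J p x) HY Hp Jx). assert (D2 := D_J X p (J p y) HX Hp Jy).
  assert (J1 := JD X y HX HYp). assert (J2 := JD Y x HY HXp). clear JD.
  assert (S1 := J_sub s hs p _ _ Hp (Dm Y (J p x) HY Jx) (Dm _ y HJX HYp)).
  assert (S2 := J_sub s hs p _ _ Hp (Dm _ x HJY HXp) (Dm X (J p y) HX Jy)).
  unfold nijenhuis, bracket. fold x y in D1, D2, J1, J2, S1, S2 |- *.
  (* The arguments are put in one common order, so that terms to be cancelled become identical and
     linear arithmetic can finish. *)
  rewrite (Gamma_sym s hs p (J p y) (J p x)), (Gamma_sym s hs p y (J p x)) in D1 by auto.
  rewrite (Gamma_sym s hs p x (J p y)) in D2 by auto.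
  rewrite (Gamma_sym s hs p x y) in J1 by auto.
  apply (ev_eqv LM). intros i. ntrans LM i. ev_expand LM. lra.
Qed.

(** Read off from the tensor field property; linearity in the first slot, needed for the Leibniz
    rule, follows from it by [Gamma_sym]. *)
Lemma Gamma_lin_r (p : point (K s)) (u v w : model (K s)) c : pmem p ->
  nmem u -> nmem v -> nmem w ->
  Gam p u (c [*] v [+] w) == c [*] Gam p u v [+] Gam p u w.
Proof.
  intros Hp Hu Hv Hw.
  destruct (proj1 (tensor_Cn_field _ _ _ (Gamma_Cn s hs O)) p Hp) as (_ & _ & H & _).
  apply (H [u] [] v w c); auto. repeat (apply args_cons; auto). apply args_nil.
Qed.

Lemma K_smooth_connection : smooth_connection (K s) Gam.
Proof.
  split; [|split; [|split]].
  - intros n. apply (Gamma_Cn s hs).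
  - apply vfield_covariant.
  - intros f X X' Y Hf HX HX' HY p Hp.
    assert (Mx := vfield_mem X p HX Hp). assert (Mx' := vfield_mem X' p HX' Hp).
    assert (My := vfield_mem Y p HY Hp). unfold covariant.
    assert (E1 := D_lin LM LM OM Y p (f p) (X p) (X' p) HY (vfield_valued Y HY) Hp Mx Mx').
    assert (E2 := Gamma_lin_r p (Y p) (X p) (X' p) (f p) Hp My Mx Mx').
    apply (ev_eqv LM). intros i. ntrans LM i. ev_expand LM.
    repeat match goal with H : ev LM _ _ = _ |- _ => rewrite H; clear H end. ring.
  - intros f X Y Y' Hf HX HY HY' p Hp.
    assert (Mx := vfield_mem X p HX Hp). assert (My' := vfield_mem Y' p HY' Hp).
    assert (My := vfield_mem Y p HY Hp). unfold covariant.
    assert (VY := vfield_valued Y HY). assert (VY' := vfield_valued Y' HY').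
    assert (Vf : @valued (K s) Rspace f) by (intros q _; exact I).
    assert (Df := smooth0_dderiv LM Rspace_laws OM f p (X p) Hf Vf Hp Mx).
    assert (DY := smooth0_dderiv LM LM OM Y p (X p) HY VY Hp Mx).
    assert (DY' := smooth0_dderiv LM LM OM Y' p (X p) HY' VY' Hp Mx).
    assert (VfY : @valued (K s) (model (K s)) (fun q => f q [*] Y q))
      by (intros q Hq; apply (mem_scal LM); auto).
    assert (E1 : D (fun q => f q [*] Y q [+] Y' q) p (X p)
      == deriv X f p [*] Y p [+] f p [*] D Y p (X p) [+] D Y' p (X p)).
    { apply (D_eqv LM LM OM); auto.
      - intros q Hq. apply (mem_add LM); auto.
      - apply (dderiv_add LM LM OM (fun q => f q [*] Y q)); auto.
        now apply (dderiv_smul LM LM OM). }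
    assert (Mw : nmem (f p [*] Y p [+] Y' p)) by (apply (mem_add LM); auto; now apply (mem_scal LM)).
    assert (E2 := Gamma_lin_r p (X p) (Y p) (Y' p) (f p) Hp Mx My My').
    rewrite (Gamma_sym s hs p (X p) (f p [*] Y p [+] Y' p)), (Gamma_sym s hs p (X p) (Y p)),
      (Gamma_sym s hs p (X p) (Y' p)) in E2 by auto.
    apply (ev_eqv LM). intros i. ntrans LM i. ev_expand LM.
    repeat match goal with H : ev LM _ _ = _ |- _ => rewrite H; clear H end. ring.
Qed.

End Structure.

Theorem theorem6p1 (s : R) (hs : 5 / 2 < s) :
  kahler_manifold (K s) (K_metric s) (K_omega s) (K_J s) /\
  (* (a) *)
  (smooth_metric (K s) (K_metric s) /\
   smooth_connection (K s) (K_Gamma s) /\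
   parallel2 (K s) (K_Gamma s) (K_metric s)) /\
  (* (b) *)
  (symplectic_form (K s) (K_omega s) /\
   parallel2 (K s) (K_Gamma s) (K_omega s)) /\
  (* (c) *)
  (complex_structure (K s) (K_J s) /\
   parallel11 (K s) (K_Gamma s) (K_J s)) /\
  (* (d) *)
  (forall (p : point (K s)) (U V : model (K s)),
     pmem p -> nmem U -> nmem V ->
     K_omega s p U V = K_metric s p (K_J s p U) V) /\
  (* (e) *)
  (forall (p : point (K s)) (U V : model (K s)),
     pmem p -> nmem U -> nmem V ->
     K_metric s p U V = K_metric s p (K_J s p U) (K_J s p V)) /\
  (* (f) *)
  (forall X Y : point (K s) -> model (K s),
     vfield (K s) X -> vfield (K s) Y ->
     forall p : point (K s), pmem p ->
     nijenhuis (K_J s) X Y p == nzero).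
Proof.
  assert (Hg := K_smooth_metric s hs). assert (Hc := K_complex_structure s hs).
  assert (Hi := K_integrable s hs). assert (Ho := K_symplectic s hs).
  assert (Hh := metric_J s hs). assert (Hf := omega_metric s hs).
  split; [repeat (split; [assumption|]); assumption|].
  split; [split; [auto|split; [now apply K_smooth_connection|now apply K_parallel_metric]]|].
  split; [split; [auto|now apply K_parallel_omega]|].
  split; [split; [auto|now apply K_parallel_J]|].
  split; [exact Hf|]. split; [exact Hh|exact Hi].
Qed.
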